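(* Let $2<q<\infty$ and let $\Pi\cong[-\pi,\pi)^2$ be the two-dimensional torus. Then there exists a constant $C>0$ such that for every $f\in L^2(\Pi)\cap L^q(\Pi)$ with $\int_\Pi f=0$ there exists $F\in L^\infty(\Pi;\mathbb{R}^2)\cap H^1(\Pi;\mathbb{R}^2)\cap W^{1,q}(\Pi;\mathbb{R}^2)$ such that (1) $\operatorname{div}F=f$; (2) $\|F\|_{L^\infty}\le C\|f\|_{L^2}$; (3) $\|F\|_{H^1}\le C\|f\|_{L^2}$; (4) $\|F\|_{W^{1,q}}\le C\|f\|_{L^q}$.
   Context: Functions on $\Pi$ are $2\pi$-periodic in each variable; $f$ is real-valued. *)

(* Defs.v *)
From HB Require Import structures.
From mathcomp Require Import all_boot all_order all_algebra.
From mathcomp Require Import all_classical all_reals all_analysis.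
Set Implicit Arguments. Unset Strict Implicit. Unset Printing Implicit Defensive.
Import Order.TTheory GRing.Theory Num.Theory.
Import numFieldNormedType.Exports.
Local Open Scope classical_set_scope.
Local Open Scope ring_scope.

Section Torus.
Variable R : realType.

Definition Pi : set (R * R) := `[- pi, pi[%classic `*` `[- pi, pi[%classic.

Definition leb2 := ((@lebesgue_measure R) \x (@lebesgue_measure R))%E.

Definition periodic2 (f : R * R -> R) : Prop :=
  forall x y, f (x + 2 * pi, y) = f (x, y) /\ f (x, y + 2 * pi) = f (x, y).

Definition e1 : R * R := (1, 0).
Definition e2 : R * R := (0, 1).
Definition edir (b : bool) : R * R := if b then e2 else e1.

Fixpoint iterD (s : seq bool) (phi : R * R -> R) : R * R -> R :=
  match s with
  | [::] => phi
  | b :: s' => 'D_(edir b) (iterD s' phi)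
  end.

Definition smooth2 (phi : R * R -> R) : Prop :=
  forall s : seq bool, continuous (iterD s phi) /\
    forall (b : bool) (x : R * R), derivable (iterD s phi) x (edir b).

Definition test_fun (phi : R * R -> R) : Prop := smooth2 phi /\ periodic2 phi.

Definition inLp (p : R) (f : R * R -> R) : Prop :=
  measurable_fun Pi f /\ (\int[leb2]_(x in Pi) (`|f x| `^ p)%:E < +oo)%E.

Definition Lpnorm (p : R) (f : R * R -> R) : R :=
  (fine (\int[leb2]_(x in Pi) (`|f x| `^ p)%:E)) `^ p^-1.

Definition weak_deriv (b : bool) (F G : R * R -> R) : Prop :=
  forall phi, test_fun phi ->
    (\int[leb2]_(x in Pi) (F x * 'D_(edir b) phi x)%:E
      = - \int[leb2]_(x in Pi) (G x * phi x)%:E)%E.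

(** Euclidean norm of the vector field (F1, F2) and Frobenius norm of its
    Jacobian (G i j = d_j F_i). *)
Definition vnorm (F1 F2 : R * R -> R) : R * R -> R :=
  fun x => Num.sqrt (F1 x ^+ 2 + F2 x ^+ 2).
Definition mnorm (G11 G12 G21 G22 : R * R -> R) : R * R -> R :=
  fun x => Num.sqrt (G11 x ^+ 2 + G12 x ^+ 2 + G21 x ^+ 2 + G22 x ^+ 2).

Definition W1pnorm (p : R) (F1 F2 G11 G12 G21 G22 : R * R -> R) : R :=
  (Lpnorm p (vnorm F1 F2) `^ p + Lpnorm p (mnorm G11 G12 G21 G22) `^ p) `^ p^-1.

End Torus.

(* Main.v *)
(** The data f is a sum of trigonometric polynomials f_n of mean zero whose L^2
    and L^q norms decay geometrically, so it suffices to solve div F = f for a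
    trigonometric polynomial f with constants independent of f, and to sum.

    For trigonometric polynomials, Bourgain and Brezis' L^oo /\ H^1 solution Z is
    obtained by minimising the Dirichlet energy plus a high power of the values
    on a fine grid. In the Euler-Lagrange equations the multiplier mu satisfies
    k_b mu(k) = |k|^2 z_b(k) + (an L^1 function)^(k), and a kernel that is a sum
    over dyadic scales j of products of two bumps, bounded by
    min(2^j s, 2^-j / s) and hence summable to a bounded function, turns this
    into an l^2 bound for mu, that is, into the a priori estimate.

    To reach W^(1,q), Z is averaged over squares of side h and the average is
    corrected by F0 - A F0, where F0 = grad Laplacian^-1 f. The gradient of F0 is
    bounded in L^q by M. Riesz's argument for even exponents and Marcinkiewicz
    interpolation; Morrey's inequality bounds F0 - A F0 uniformly, and h is chosen
    so that both estimates match. *)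

Require Import Defs.
From HB Require Import structures.
From mathcomp Require Import all_boot all_order all_algebra.
From mathcomp Require Import all_classical all_reals all_analysis.
From mathcomp Require Import measurable_realfun.
From mathcomp Require Import complex.
From mathcomp Require Import ring lra zify.
Import Order.TTheory GRing.Theory Num.Theory.
Import numFieldNormedType.Exports.
Local Open Scope classical_set_scope.
Local Open Scope ring_scope.
Set Implicit Arguments.
Unset Strict Implicit.
Unset Printing Implicit Defensive.

(** * Integration over the torus *)

(** [F0] alone is not enough: in two dimensions a gradient in L^2 just misses an L^oo bound, and
    W^(1,q) bounds [F0] only through the L^q norm of f. The bounded field Z, in turn, has its
    gradient controlled in L^2 only. Averaging over squares commutes with the divergence, so A Z +
    F0 - A F0 still has divergence f, and for side h one has |grad (A Z)| <= C |f|_2 / h pointwise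
    and |F0 - A F0| <= C h^(1-2/q) |f|_q. The latter is at most C |f|_2 when h^(1-2/q) is of the
    order of |f|_2 / |f|_q. Interpolating the former between L^oo and L^2 then gives h^(-(1-2/q))
    |f|_2 for the L^q norm of grad (A Z), which is of the order of |f|_q. Z depends nonlinearly on
    f, so general data cannot be reached by continuity of a solution operator; a geometrically
    decaying decomposition of f needs only the bounds and the linearity of the divergence. With
    trigonometric polynomials and a finite grid the minimisation is finite-dimensional: minimiser
    and multiplier come from compactness and linear algebra, and the estimates do not depend on the
    dimension. *)

Section TorusIntegral.
Variable R : realType.
Implicit Types (f g : R * R -> R) (p r : R).

Local Notation mu := (@lebesgue_measure R).
Local Notation leb2 := (@leb2 R).

Lemma measurable_Pi : measurable (@Pi R).
Proof. by apply: measurableX; exact: measurable_itv. Qed.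

Lemma leb2_Pi : leb2 (@Pi R) = ((2 * pi) ^+ 2)%:E.
Proof.
rewrite /leb2 /Pi product_measure1E; [|exact: measurable_itv|exact: measurable_itv].
rewrite [X in (X * X)%E]lebesgue_measure_itv /= lte_fin.
have -> : (- pi < (pi : R)) by have := pi_gt0 R; lra.
by rewrite -EFinD -EFinM; congr (_ %:E); ring.
Qed.

Lemma leb2_Pi_fin : (leb2 (@Pi R) < +oo)%E.
Proof. by rewrite leb2_Pi ltry. Qed.

(** Working class up to the passage to general data: on the torus its members are integrable to
    every power, so that [Iint] is linear and monotone on it without further side conditions. *)
Definition bmeas f := measurable_fun setT f /\ exists B : R, forall x, `|f x| <= B.

Lemma bmeas_cst c : bmeas (fun=> c).
Proof. by split; [exact: measurable_cst|exists `|c|]. Qed.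

Lemma bmeasD f g : bmeas f -> bmeas g -> bmeas (fun x => f x + g x).
Proof.
move=> [mf [B fB]] [mg [B' gB]]; split; first exact: measurable_funD.
by exists (B + B') => x; rewrite (le_trans (ler_normD _ _))// lerD.
Qed.

Lemma bmeasM f g : bmeas f -> bmeas g -> bmeas (fun x => f x * g x).
Proof.
move=> [mf [B fB]] [mg [B' gB]]; split; first exact: measurable_funM.
by exists (B * B') => x; rewrite normrM ler_pM.
Qed.

Lemma bmeasZ c f : bmeas f -> bmeas (fun x => c * f x).
Proof. exact: bmeasM (bmeas_cst c). Qed.

Lemma bmeasN f : bmeas f -> bmeas (fun x => - f x).
Proof.
by move=> /(bmeasZ (-1)) h; rewrite (_ : (fun x => _) = (fun x => -1 * f x)) //; apply/funext => x; rewrite mulN1r.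
Qed.

Lemma bmeasB f g : bmeas f -> bmeas g -> bmeas (fun x => f x - g x).
Proof. by move=> hf /bmeasN hg; exact: bmeasD. Qed.

Lemma bmeasX n f : bmeas f -> bmeas (fun x => f x ^+ n).
Proof.
move=> hf; elim: n => [|n IH]; first exact: bmeas_cst.
rewrite (_ : (fun x => _) = (fun x => f x * f x ^+ n)); first exact: bmeasM.
by apply/funext => x; rewrite exprS.
Qed.

Lemma bmeas_norm f : bmeas f -> bmeas (fun x => `|f x|).
Proof.
move=> [mf [B fB]]; split; first by apply: measurableT_comp => //; exact: normr_measurable.
by exists B => x; rewrite normr_id.
Qed.

Lemma bmeas_powR r f : 0 <= r -> bmeas f -> bmeas (fun x => `|f x| `^ r).
Proof.
move=> r0 [mf [B fB]]; split.
  apply: (measurableT_comp (measurable_powR r)).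
  by apply: measurableT_comp => //; exact: normr_measurable.
exists (B `^ r) => x; rewrite ger0_norm ?powR_ge0//.
have B0 : 0 <= B by exact: le_trans (fB x).
by apply: ge0_ler_powR; rewrite ?nnegrE.
Qed.

Lemma bmeas_sum (I : Type) (s : seq I) (F : I -> R * R -> R) :
  (forall i, bmeas (F i)) -> bmeas (fun x => \sum_(i <- s) F i x).
Proof.
move=> hF; elim: s => [|i s IH].
  by rewrite (_ : (fun x => _) = (fun=> 0)); [exact: bmeas_cst|apply/funext => x; rewrite big_nil].
rewrite (_ : (fun x => _) = (fun x => F i x + \sum_(j <- s) F j x)); first exact: bmeasD.
by apply/funext => x; rewrite big_cons.
Qed.

Lemma bmeas_indic (E : set (R * R)) : measurable E -> bmeas (\1_E : R * R -> R).
Proof.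
move=> mE; split; first exact: measurable_indic.
by exists 1 => x; rewrite indicE; case: (_ \in _); rewrite /= ?normr1 ?normr0.
Qed.

Lemma bmeas_comp (phi : R * R -> R * R) f :
  measurable_fun setT phi -> bmeas f -> bmeas (f \o phi).
Proof.
by move=> mphi [mf [B fB]]; split; [exact: measurableT_comp|exists B => x /=].
Qed.

Lemma bmeas_bound f : bmeas f -> exists2 B, 0 < B & forall x, `|f x| <= B.
Proof.
move=> [_ [B fB]]; exists (B + 1); last by move=> x; rewrite (le_trans (fB x))// lerDl.
by have := le_trans (normr_ge0 _) (fB (0, 0)); lra.
Qed.

Lemma bmeas_integrable f : bmeas f -> leb2.-integrable (@Pi R) (EFin \o f).
Proof.
move=> [mf [B fB]]; apply: measurable_bounded_integrable.
- exact: measurable_Pi.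
- exact: leb2_Pi_fin.
- exact: measurable_funS mf.
- exists B; split; first by rewrite num_real.
  by move=> M BM x _ /=; rewrite (le_trans (fB x))// ltW.
Qed.

Definition Iint f : R := \int[leb2]_(x in @Pi R) f x.

Lemma Iint_EFin f : bmeas f -> (\int[leb2]_(x in @Pi R) (f x)%:E = (Iint f)%:E)%E.
Proof.
move=> hf; rewrite /Iint /Rintegral fineK//.
by apply: integrable_fin_num; [exact: measurable_Pi|exact: bmeas_integrable].
Qed.

Lemma eq_Iint f g : f =1 g -> Iint f = Iint g.
Proof. by move=> /funext ->. Qed.

Lemma IintD f g : bmeas f -> bmeas g -> Iint (fun x => f x + g x) = Iint f + Iint g.
Proof.
by move=> hf hg; rewrite /Iint RintegralD//;
  [exact: measurable_Pi|exact: bmeas_integrable|exact: bmeas_integrable].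
Qed.

Lemma IintZ c f : bmeas f -> Iint (fun x => c * f x) = c * Iint f.
Proof.
by move=> hf; rewrite /Iint RintegralZl//; [exact: measurable_Pi|exact: bmeas_integrable].
Qed.

Lemma IintN f : bmeas f -> Iint (fun x => - f x) = - Iint f.
Proof.
move=> hf; rewrite -mulN1r -IintZ//; apply: eq_Iint => x; by rewrite mulN1r.
Qed.

Lemma IintB f g : bmeas f -> bmeas g -> Iint (fun x => f x - g x) = Iint f - Iint g.
Proof. by move=> hf hg; rewrite IintD ?IintN//; exact: bmeasN. Qed.

Lemma Iint_cst c : Iint (fun=> c) = c * (2 * pi) ^+ 2.
Proof. rewrite /Iint Rintegral_cst; last exact: measurable_Pi.
by congr (_ * _); exact: (congr1 fine leb2_Pi). Qed.

Lemma Iint_ge0 f : (forall x, 0 <= f x) -> 0 <= Iint f.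
Proof. by move=> f0; apply: Rintegral_ge0. Qed.

Lemma Iint_le f g : bmeas f -> bmeas g -> (forall x, f x <= g x) -> Iint f <= Iint g.
Proof.
by move=> hf hg fg; apply: le_Rintegral => //;
  [exact: measurable_Pi|exact: bmeas_integrable|exact: bmeas_integrable].
Qed.

Lemma Iint_sum (I : Type) (s : seq I) (F : I -> R * R -> R) :
  (forall i, bmeas (F i)) ->
  Iint (fun x => \sum_(i <- s) F i x) = \sum_(i <- s) Iint (F i).
Proof.
move=> hF; elim: s => [|i s IH].
  by rewrite big_nil -[RHS](mul0r ((2 * pi) ^+ 2)) -Iint_cst; apply: eq_Iint => x; rewrite big_nil.
rewrite big_cons -IH -IintD//; last exact: bmeas_sum.
by apply: eq_Iint => x; rewrite big_cons.
Qed.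

Local Notation mR := (measurableTypeR R).

Definition shift1 (a : R) : mR -> mR := fun x => x + a.

Definition shift2 (a : R * R) : mR * mR -> mR * mR := fun x => (x.1 + a.1, x.2 + a.2).

Lemma measurable_shift1 a : measurable_fun setT (shift1 a).
Proof. exact: measurable_funD. Qed.

Lemma measurable_shift2 a : measurable_fun setT (shift2 a).
Proof.
apply: measurable_fun_pair.
- exact: (measurableT_comp (measurable_shift1 a.1) measurable_fst).
- exact: (measurableT_comp (measurable_shift1 a.2) measurable_snd).
Qed.

HB.instance Definition _ a := isMeasurableFun.Build _ _ _ _ (shift1 a) (measurable_shift1 a).
HB.instance Definition _ a := isMeasurableFun.Build _ _ _ _ (shift2 a) (measurable_shift2 a).

(** The image measure agrees with Lebesgue measure on half-open intervals, which determine it; the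
    planar version below uses rectangles in the same way. *)
Lemma lebesgue_measure_shift (a : R) (A : set R) : measurable A ->
  mu (shift1 a @^-1` A) = mu A.
Proof.
move=> mA; rewrite -[LHS]/(pushforward mu (shift1 a) A).
symmetry; apply: (@lebesgue_measure_unique _ (pushforward mu (shift1 a))) => // X [[u v] _ <-] /=.
rewrite /pushforward.
have -> : shift1 a @^-1` `]u, v]%classic = `]u - a, v - a]%classic.
  by apply/seteqP; split => x /=; rewrite /shift1 !in_itv /= => /andP[h1 h2]; apply/andP; split; lra.
rewrite !lebesgue_measure_itv /= !lte_fin ltrD2r; case: ifPn => // _.
by rewrite -!EFinB; congr (_ %:E); ring.
Qed.

Lemma leb2_shift a (A : set (R * R)) : measurable A ->
  leb2 (shift2 a @^-1` A) = leb2 A.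
Proof.
move=> mA; rewrite -[LHS]/(pushforward (mu \x mu)%E (shift2 a) A).
symmetry; apply: (@product_measure_unique _ _ _ _ _ _ _ (pushforward (mu \x mu)%E (shift2 a))) => // X Y mX mY.
transitivity ((mu \x mu)%E ((shift1 a.1 @^-1` X) `*` (shift1 a.2 @^-1` Y))); first by [].
rewrite product_measure1E; last 2 first.
- by rewrite -[X in measurable X]setTI; exact: measurable_shift1.
- by rewrite -[X in measurable X]setTI; exact: measurable_shift1.
by congr (_ * _)%E; exact: lebesgue_measure_shift.
Qed.

Lemma integral_shift2 a (D : set (mR * mR)) (f : mR * mR -> R) :
  measurable D -> measurable_fun setT f -> (forall x, 0 <= f x) ->
  (\int[(mu \x mu)%E]_(x in shift2 a @^-1` D) (f (shift2 a x))%:E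
   = \int[(mu \x mu)%E]_(x in D) (f x)%:E)%E.
Proof.
move=> mD mf f0.
have h := @ge0_integral_pushforward _ _ _ _ _ _ (measurable_shift2 a) (mu \x mu)%E D (EFin \o f) mD.
rewrite /= in h; rewrite -[LHS]h.
- by apply: eq_measure_integral => A mA _; exact: leb2_shift.
- have mfD : measurable_fun D f := @measurable_funTS _ _ _ _ D f mf.
  exact: (measurableT_comp (@EFin_measurable _ _) mfD).
- by move=> x _; rewrite lee_fin.
Qed.

Lemma periodic2_int f : periodic2 f -> forall (m n : int) x y,
  f (x + 2 * pi * m%:~R, y + 2 * pi * n%:~R) = f (x, y).
Proof.
move=> hf.
have h1 n x y : f (x + 2 * pi * n%:R, y) = f (x, y).
  elim: n => [|n IH]; first by rewrite mulr0 addr0.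
  by rewrite -[n.+1]addn1 natrD mulrDr mulr1 addrA (hf _ _).1.
have h2 n x y : f (x, y + 2 * pi * n%:R) = f (x, y).
  elim: n => [|n IH]; first by rewrite mulr0 addr0.
  by rewrite -[n.+1]addn1 natrD mulrDr mulr1 addrA (hf _ _).2.
have h1' (m : int) x y : f (x + 2 * pi * m%:~R, y) = f (x, y).
  case: m => n; first exact: h1.
  by rewrite NegzE mulrNz mulrN -[in RHS](subrK (2 * pi * n.+1%:R) x) h1.
have h2' (m : int) x y : f (x, y + 2 * pi * m%:~R) = f (x, y).
  case: m => n; first exact: h2.
  by rewrite NegzE mulrNz mulrN -[in RHS](subrK (2 * pi * n.+1%:R) y) h2.
by move=> m n x y; rewrite h1' h2'.
Qed.

Lemma mod2pi (s : R) : exists n : int, 0 <= s + 2 * pi * n%:~R < 2 * pi.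
Proof.
have p0 : 0 < 2 * pi :> R by have := pi_gt0 R; lra.
exists (- Num.floor (s / (2 * pi))).
have /andP[h1 h2] := floor_itv (s / (2 * pi)).
rewrite mulrNz mulrN.
rewrite ler_pdivlMr// in h1; rewrite ltr_pdivrMr// intrD in h2.
rewrite mulrC -[X in _ - X]mulrC in h1 h2 *.
by apply/andP; split; lra.
Qed.

(** The boolean picks the axis, so that one argument covers both coordinates. *)
Definition rect2 (b : bool) (I J : set R) : set (R * R) := if b then J `*` I else I `*` J.
Definition pitv : set R := `[- pi, pi[%classic.
Definition axis2 (b : bool) (s : R) : R * R := if b then (0, s) else (s, 0).

Lemma measurable_rect2 b I J : measurable I -> measurable J ->
  measurable (rect2 b I J : set (mR * mR)).
Proof. by case: b => mI mJ; apply: measurableX. Qed.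

Lemma rect2_shift b (u v s : R) J :
  shift2 (axis2 b s) @^-1` (rect2 b `[u + s, v + s[%classic J) = rect2 b `[u, v[%classic J.
Proof.
apply/seteqP; case: b; split => -[x y] /=; rewrite /shift2 /= !in_itv /= !addr0;
  rewrite ?lerD2r ?ltrD2r //.
Qed.

Lemma rect2U b (u v w : R) J : u <= v <= w ->
  rect2 b `[u, w[%classic J = rect2 b `[u, v[%classic J `|` rect2 b `[v, w[%classic J.
Proof.
move=> /andP[uv vw]; apply/seteqP; case: b; split => -[x y] /=; rewrite !in_itv /=.
- by move=> [Jx /andP[h1 h2]]; case: (ltP y v) => h; [left|right]; split => //; apply/andP.
- by move=> [] [Jx /andP[h1 h2]]; split => //; apply/andP; split; lra.
- by move=> [/andP[h1 h2] Jx]; case: (ltP x v) => h; [left|right]; split => //; apply/andP.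
- by move=> [] [/andP[h1 h2] Jx]; split => //; apply/andP; split; lra.
Qed.

Lemma rect2_disj b (u v w : R) J :
  [disjoint rect2 b `[u, v[%classic J & rect2 b `[v, w[%classic J].
Proof.
apply/disj_setPS => -[x y]; case: b => /=; rewrite !in_itv /=.
- by move=> [[_ /andP[_ h1]] [_ /andP[h2 _]]]; lra.
- by move=> [[/andP[_ h1] _] [/andP[h2 _] _]]; lra.
Qed.

Lemma periodic2_axis f b : periodic2 f -> forall x, f (shift2 (axis2 b (2 * pi)) x) = f x.
Proof. by move=> hf [x y]; rewrite /shift2 /=; case: b; rewrite /= addr0; case: (hf x y). Qed.

(** The translated strip is cut at [pi]; by periodicity the overhang [[pi, pi + s[] is carried back
    by one period and fills the gap [[- pi, - pi + s[]. *)
Lemma integral_axis_shift b (s : R) (f : mR * mR -> R) (J : set R) :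
  measurable J -> measurable_fun setT f ->
  (forall x, 0 <= f x) -> periodic2 f -> 0 <= s < 2 * pi ->
  (\int[(mu \x mu)%E]_(x in rect2 b pitv J) (f (shift2 (axis2 b s) x))%:E
   = \int[(mu \x mu)%E]_(x in rect2 b pitv J) (f x)%:E)%E.
Proof.
move=> mJ mf f0 pf /andP[s0 s1].
have mI (u v : R) : measurable (`[u, v[%classic : set R) by exact: measurable_itv.
have mE (D : set (mR * mR)) : measurable_fun D (fun x => (f x)%:E).
  have mfD : measurable_fun D f := @measurable_funTS _ _ _ _ D f mf.
  exact: (measurableT_comp (@EFin_measurable _ _) mfD).
rewrite /pitv -[in LHS](@rect2_shift b (- pi) pi s) integral_shift2//; last exact: measurable_rect2.
rewrite (@rect2U b (- pi + s) pi (pi + s)); last by apply/andP; split; lra.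
rewrite (@rect2U b (- pi) (- pi + s) pi); last by apply/andP; split; lra.
have f0' (D : set (mR * mR)) : forall x, D x -> (0 <= (f x)%:E)%E by move=> x _; rewrite lee_fin.
rewrite !ge0_integral_setU //; try exact: measurable_rect2; try exact: rect2_disj; try exact: f0'.
rewrite addeC; congr (_ + _)%E.
have -> : rect2 b `[pi, pi + s[%classic J = rect2 b `[- pi + 2 * pi, - pi + s + 2 * pi[%classic J.
  have -> : - pi + 2 * pi = pi :> R by ring.
  by have -> : - pi + s + 2 * pi = pi + s :> R by ring.
rewrite -[LHS](@integral_shift2 (axis2 b (2 * pi)) _ f _ mf f0); last exact: measurable_rect2.
rewrite rect2_shift; apply: eq_integral => x _.
by rewrite periodic2_axis.
Qed.

Lemma periodic2_shift f a : periodic2 f -> periodic2 (f \o shift2 a).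
Proof.
move=> hf x y; rewrite /shift2 /=; split.
- by rewrite addrAC (hf _ _).1.
- by rewrite addrAC (hf _ _).2.
Qed.

Lemma bmeas_shift f a : bmeas f -> bmeas (f \o shift2 a).
Proof. by apply: bmeas_comp; exact: measurable_shift2. Qed.

Lemma Iint_axis_shift f b s : bmeas f -> periodic2 f -> Iint (f \o shift2 (axis2 b s)) = Iint f.
Proof.
move=> hf pf.
wlog s01 : s / 0 <= s < 2 * pi.
  move=> H; have [n hn] := mod2pi s; rewrite -(H _ hn); apply: eq_Iint => -[x y] /=.
  rewrite /shift2 /=; case: b {H}; rewrite /= !addr0.
  - by rewrite addrA -[in RHS](addr0 x) -{1}(mulr0 (2 * pi)) -(periodic2_int pf 0 n).
  - by rewrite addrA -[in RHS](addr0 y) -{1}(mulr0 (2 * pi)) -(periodic2_int pf n 0).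
(* Adding a bound of [f] makes it nonnegative, as the change of variables requires; the constant
   cancels on both sides. *)
wlog f0 : f hf pf / forall x, 0 <= f x.
  move=> H; have [B B0 fB] := bmeas_bound hf.
  have hg : bmeas (fun x => f x + B) by apply: bmeasD => //; exact: bmeas_cst.
  have := H (fun x => f x + B) hg; rewrite /comp.
  rewrite (IintD hf (bmeas_cst B)).
  rewrite (@IintD (f \o shift2 (axis2 b s)) (fun=> B)); last 2 first.
  - exact: bmeas_shift.
  - exact: bmeas_cst.
  move=> h; apply: (addIr (Iint (fun=> B))); apply: h.
  - by move=> x y; rewrite (pf x y).1 (pf x y).2.
  - by move=> x; have := fB x; rewrite ler_norml => /andP[]; lra.
have mI : measurable (`[- pi, pi[%classic : set R) by exact: measurable_itv.
have := @integral_axis_shift b s f _ mI hf.1 f0 pf s01.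
have -> : rect2 b `[- pi, pi[%classic `[- pi, pi[%classic = @Pi R by case: b.
move=> h; rewrite /Iint /Rintegral; congr fine; exact: h.
Qed.

Lemma Iint_shift f a : bmeas f -> periodic2 f -> Iint (f \o shift2 a) = Iint f.
Proof.
move=> hf pf; rewrite -(@Iint_axis_shift f false a.1)//.
rewrite -(@Iint_axis_shift (f \o shift2 (axis2 false a.1)) true a.2).
- by apply: eq_Iint => x; rewrite /= /shift2 /= !addr0.
- exact: bmeas_shift.
- exact: periodic2_shift.
Qed.

End TorusIntegral.

(** * Trigonometric polynomials *)

Section TrigPoly.
Variable R : realType.
Local Notation C := R[i].
Local Notation Re := (@complex.Re R).
Local Notation Im := (@complex.Im R).
Implicit Types (z w : C) (k : int * int) (x y : R * R).

Lemma cplx_eq z w : Re z = Re w -> Im z = Im w -> z = w.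
Proof. by case: z w => a b [c d] /= -> ->. Qed.

Lemma ReD z w : Re (z + w) = Re z + Re w. Proof. by case: z w => a b [c d]. Qed.
Lemma ImD z w : Im (z + w) = Im z + Im w. Proof. by case: z w => a b [c d]. Qed.
Lemma ReN z : Re (- z) = - Re z. Proof. by case: z. Qed.
Lemma ImN z : Im (- z) = - Im z. Proof. by case: z. Qed.
Lemma ReM z w : Re (z * w) = Re z * Re w - Im z * Im w. Proof. by case: z w => a b [c d]. Qed.
Lemma ImM z w : Im (z * w) = Re z * Im w + Im z * Re w. Proof. by case: z w => a b [c d]. Qed.

Lemma Re_sum (I : Type) (s : seq I) (P : pred I) (F : I -> C) :
  Re (\sum_(i <- s | P i) F i) = \sum_(i <- s | P i) Re (F i).
Proof. exact: (big_morph Re ReD erefl). Qed.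

Lemma Im_sum (I : Type) (s : seq I) (P : pred I) (F : I -> C) :
  Im (\sum_(i <- s | P i) F i) = \sum_(i <- s | P i) Im (F i).
Proof. exact: (big_morph Im ImD erefl). Qed.

Definition sqmod z : R := Re z ^+ 2 + Im z ^+ 2.

Lemma sqmodM z w : sqmod (z * w) = sqmod z * sqmod w.
Proof. by rewrite /sqmod ReM ImM; ring. Qed.

Lemma sqmod_ge0 z : 0 <= sqmod z.
Proof. by rewrite addr_ge0// sqr_ge0. Qed.

Definition cexpi (t : R) : C := (cos t +i* sin t)%C.

Lemma cexpi0 : cexpi 0 = 1.
Proof. by rewrite /cexpi cos0 sin0. Qed.

Lemma cexpiD s t : cexpi (s + t) = cexpi s * cexpi t.
Proof.
apply: cplx_eq; rewrite ?ReM ?ImM /= ?cosD ?sinD //; ring.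
Qed.

Lemma cexpiN t : cexpi (- t) = conjc (cexpi t).
Proof. by rewrite /cexpi cosN sinN. Qed.

Lemma cexpi_2pi (n : int) : cexpi (2 * pi * n%:~R) = 1.
Proof.
have h (m : nat) : cexpi (2 * pi * m%:R) = 1.
  elim: m => [|m IH]; first by rewrite mulr0 cexpi0.
  rewrite -[m.+1]addn1 natrD mulrDr mulr1 cexpiD IH mul1r /cexpi.
  by have -> : 2 * pi = (pi : R) *+ 2; [rewrite mulr_natl|rewrite cos2pi sin2pi].
case: n => n; first exact: h.
by rewrite NegzE mulrNz mulrN cexpiN h conjc1.
Qed.

Definition phase k x : R := k.1%:~R * x.1 + k.2%:~R * x.2.

Lemma phaseD k k' x : phase (k + k') x = phase k x + phase k' x.
Proof. by rewrite /phase /= !intrD; ring. Qed.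

Lemma phaseN k x : phase (- k) x = - phase k x.
Proof. by rewrite /phase /= !mulrNz; ring. Qed.

Lemma phase_shift k a x : phase k (shift2 a x) = phase k a + phase k x.
Proof. by rewrite /phase /shift2 /=; ring. Qed.

(* A list of coefficient-frequency pairs (repetitions allowed), read as the real
   part [tev] of the corresponding complex trigonometric sum. *)
Definition tpoly := seq (C * (int * int)).
Implicit Types (L : tpoly) (M : int * int -> C).

Definition tval L x : C := \sum_(t <- L) t.1 * cexpi (phase t.2 x).
Definition tev L x : R := Re (tval L x).
(** Fourier multiplier with symbol [M], acting on the list. It descends to the real functions
    [tev L] when [M (- k)] is the conjugate of [M k]; the constant symbol - i of [Im_tval] is not of
    this kind. *)
Definition tmult M L : tpoly := [seq (M t.2 * t.1, t.2) | t <- L].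
Definition tprod L L' : tpoly := [seq (t.1 * u.1, t.2 + u.2) | t <- L, u <- L'].
Definition tconj L : tpoly := [seq (conjc t.1, - t.2) | t <- L].

Lemma tvalE L x : tval L x = (tev L x +i* Im (tval L x))%C.
Proof. by apply: cplx_eq. Qed.

Lemma tval_nil x : tval [::] x = 0.
Proof. by rewrite /tval big_nil. Qed.

Lemma tval_cons t L x : tval (t :: L) x = t.1 * cexpi (phase t.2 x) + tval L x.
Proof. by rewrite /tval big_cons. Qed.

Lemma tval_cat L L' x : tval (L ++ L') x = tval L x + tval L' x.
Proof. by rewrite /tval big_cat. Qed.

Lemma tev_cat L L' x : tev (L ++ L') x = tev L x + tev L' x.
Proof. by rewrite /tev tval_cat ReD. Qed.

Lemma tev_nil x : tev [::] x = 0.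
Proof. by rewrite /tev tval_nil. Qed.

Lemma tmult_cat M L L' : tmult M (L ++ L') = tmult M L ++ tmult M L'.
Proof. exact: map_cat. Qed.

Lemma tmult_comp M M' L : tmult M (tmult M' L) = tmult (fun k => M k * M' k) L.
Proof. by rewrite /tmult -map_comp; apply: eq_map => t /=; rewrite mulrA. Qed.

Lemma eq_tmult M M' L : {in map snd L, M =1 M'} -> tmult M L = tmult M' L.
Proof. by move=> h; apply/eq_in_map => t tL; rewrite h//; apply: map_f. Qed.

Lemma tmult_keys M L : map snd (tmult M L) = map snd L.
Proof. by rewrite -map_comp. Qed.

Lemma tval_tmult M L x : tval (tmult M L) x = \sum_(t <- L) M t.2 * t.1 * cexpi (phase t.2 x).
Proof. by rewrite /tval big_map. Qed.

Lemma tval_scale z L x : tval (tmult (fun=> z) L) x = z * tval L x.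
Proof. by rewrite tval_tmult /tval big_distrr /=; apply: eq_bigr => t _; rewrite mulrA. Qed.

Lemma tev_scale (c : R) L x : tev (tmult (fun=> c%:C%C) L) x = c * tev L x.
Proof. by rewrite /tev tval_scale ReM /= mul0r subr0. Qed.

Lemma tev_opp L x : tev (tmult (fun=> -1) L) x = - tev L x.
Proof. by rewrite /tev tval_scale mulN1r ReN. Qed.

Lemma tval_multD M M' L x :
  tval (tmult (fun k => M k + M' k) L) x = tval (tmult M L) x + tval (tmult M' L) x.
Proof. by rewrite !tval_tmult -big_split /=; apply: eq_bigr => t _; rewrite !mulrDl. Qed.

Lemma Im_tval L x : Im (tval L x) = tev (tmult (fun=> - 'i%C) L) x.
Proof. by rewrite /tev tval_scale ReM ReN ImN /=; ring. Qed.

Lemma tval_prod L L' x : tval (tprod L L') x = tval L x * tval L' x.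
Proof.
rewrite /tval big_allpairs_dep big_distrl /=; apply: eq_bigr => t _.
rewrite big_distrr /=; apply: eq_bigr => u _; rewrite phaseD cexpiD; ring.
Qed.

Lemma tval_conj L x : tval (tconj L) x = conjc (tval L x).
Proof.
rewrite /tval big_map rmorph_sum /=; apply: eq_bigr => t _.
by rewrite phaseN cexpiN rmorphM.
Qed.

Lemma tval_shift L a x : tval L (shift2 a x) = tval (tmult (fun k => cexpi (phase k a)) L) x.
Proof.
rewrite tval_tmult; apply: eq_bigr => t _; rewrite phase_shift cexpiD; ring.
Qed.

Lemma tev_shift L a x : tev L (shift2 a x) = tev (tmult (fun k => cexpi (phase k a)) L) x.
Proof. by rewrite /tev tval_shift. Qed.

Lemma tev_periodic L : periodic2 (tev L).
Proof.
move=> x y.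
have h a : (forall k, cexpi (phase k a) = 1) -> tev L (shift2 a (x, y)) = tev L (x, y).
  move=> ha; rewrite tev_shift (@eq_tmult _ (fun=> 1)); last by move=> k _.
  by rewrite -[1]/(1%:C%C) tev_scale mul1r.
split.
- have -> : (x + 2 * pi, y) = shift2 (2 * pi, 0) (x, y) by rewrite /shift2 /= addr0.
  by apply: h => k; rewrite /phase /= mulr0 addr0 mulrC cexpi_2pi.
- have -> : (x, y + 2 * pi) = shift2 (0, 2 * pi) (x, y) by rewrite /shift2 /= addr0.
  by apply: h => k; rewrite /phase /= mulr0 add0r mulrC cexpi_2pi.
Qed.

Lemma measurable_phase k : measurable_fun setT (phase k).
Proof.
apply: measurable_funD; apply: measurable_funM => //; exact: measurable_cst.
Qed.

Lemma tev_bmeas L : bmeas (tev L).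
Proof.
rewrite (_ : tev L = fun x => \sum_(t <- L) (Re t.1 * cos (phase t.2 x) - Im t.1 * sin (phase t.2 x))).
  apply: bmeas_sum => t; apply: bmeasB; apply: bmeasZ; split.
  - by apply: measurableT_comp; [exact: continuous_measurable_fun (@continuous_cos R)|exact: measurable_phase].
  - by exists 1 => x; rewrite ler_norml cos_geN1 cos_le1.
  - by apply: measurableT_comp; [exact: continuous_measurable_fun (@continuous_sin R)|exact: measurable_phase].
  - by exists 1 => x; rewrite ler_norml sin_geN1 sin_le1.
by apply/funext => x; rewrite /tev Re_sum; apply: eq_bigr => t _; rewrite ReM.
Qed.

(** For [k != 0], translation by a vector [a] with [phase k a = pi] changes the sign of the
    character, while the integral is translation invariant. *)
Lemma Iint_char z k : Iint (tev [:: (z, k)]) = if k == 0 then (2 * pi) ^+ 2 * Re z else 0.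
Proof.
case: eqP => [->|/eqP k0].
  rewrite (@eq_Iint _ _ (fun=> Re z)); first by rewrite Iint_cst mulrC.
  by move=> x; rewrite /tev /tval big_seq1 /phase /= !mul0r addr0 cexpi0 mulr1.
have [a ha] : exists a : R * R, phase k a = pi.
  case: k k0 => k1 k2; rewrite -pair_eqE /= negb_and => /orP[h|h].
  - by exists (pi / k1%:~R, 0); rewrite /phase /= mulr0 addr0 mulrC divfK// intr_eq0.
  - by exists (0, pi / k2%:~R); rewrite /phase /= mulr0 add0r mulrC divfK// intr_eq0.
have := @Iint_shift _ (tev [:: (z, k)]) a (tev_bmeas _) (tev_periodic _).
rewrite (@eq_Iint _ _ (fun x => - tev [:: (z, k)] x)); last first.
  move=> x /=; rewrite tev_shift -tev_opp /tmult /= ha.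
  by have -> : cexpi pi = -1; first by rewrite /cexpi cospi sinpi; apply: cplx_eq => //=; rewrite oppr0.
rewrite IintN; last exact: tev_bmeas.
lra.
Qed.

Lemma Iint_tev L : Iint (tev L) = (2 * pi) ^+ 2 * \sum_(t <- L | t.2 == 0) Re t.1.
Proof.
elim: L => [|t L IH].
  by rewrite big_nil mulr0 (@eq_Iint _ _ (fun=> 0)) ?Iint_cst ?mul0r// => x; rewrite tev_nil.
rewrite big_cons (@eq_Iint _ _ (fun x => tev [:: t] x + tev L x)); last by move=> x; rewrite -tev_cat.
rewrite IintD ?IH; try exact: tev_bmeas.
case: t => z k; rewrite Iint_char /=; case: ifP => _; ring.
Qed.

Lemma Iint_tev0 L : 0 \notin map snd L -> Iint (tev L) = 0.
Proof.
move=> h; rewrite Iint_tev big_seq_cond big1 ?mulr0// => t /andP[tL /eqP t0].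
by move/negP: h; case; apply/mapP; exists t.
Qed.

Lemma uniq_map_injl (T U : eqType) (f : T -> U) (s : seq T) : uniq (map f s) ->
  {in s &, injective f}.
Proof.
elim: s => [//|t s IH] /= /andP[ht us] u v; rewrite !inE => /orP[/eqP->|us'] /orP[/eqP->|vs] // e.
- by case/negP: ht; rewrite e map_f.
- by case/negP: ht; rewrite -e map_f.
- exact: IH.
Qed.

(* Parseval: only the diagonal terms of |tval L|^2 have frequency zero. *)
Lemma Iint_sqmod L : uniq (map snd L) ->
  Iint (fun x => sqmod (tval L x)) = (2 * pi) ^+ 2 * \sum_(t <- L) sqmod t.1.
Proof.
move=> uL; rewrite (@eq_Iint _ _ (tev (tprod L (tconj L)))); last first.
  by move=> x; rewrite /tev tval_prod tval_conj ReM /sqmod; case: (tval L x) => a b /=; ring.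
rewrite Iint_tev; congr (_ * _).
rewrite big_mkcond /tprod big_allpairs_dep /= big_seq [RHS]big_seq; apply: eq_bigr => t tL.
rewrite big_map /= (bigD1_seq t) //=; last exact: map_uniq uL.
rewrite subrr eqxx ReM.
have -> : \sum_(i <- L | i != t) (if t.2 - i.2 == 0 then Re (t.1 * conjc i.1) else 0) = 0.
  rewrite big_seq_cond big1// => u /andP[uLL ut]; case: ifP => //.
  by rewrite subr_eq0 => /eqP e; case/negP: ut; apply/eqP; exact: (uniq_map_injl uL).
rewrite addr0 /sqmod; case: t.1 => a b /=; ring.
Qed.

End TrigPoly.

(** * Double Riesz transforms on L^2m *)

Section PowR.
Variable R : realType.
Implicit Types a b s t r : R.

(** The tangent-line inequality for t^r at s is Young's inequality for t and s^(r-1) with exponents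
    r and r/(r-1). The convexity arguments for real exponents rest on it. *)
Lemma powR_tangent r s t : 1 <= r -> 0 <= s -> 0 <= t ->
  s `^ r + r * s `^ (r - 1) * (t - s) <= t `^ r.
Proof.
move=> r1 s0 t0.
have sr : s * s `^ (r - 1) = s `^ r by apply: mulr_powRB1 => //; lra.
have [->|rn1] := eqVneq r 1.
  by rewrite subrr powRr0 !powRr1//; lra.
have r1' : 0 < r - 1 by rewrite subr_gt0 lt_def rn1.
have rn0 : r != 0 by lra.
have := @conjugate_powR R t (s `^ (r - 1)) r (r / (r - 1)) t0 (powR_ge0 _ _).
rewrite -powRrM.
have -> : (r - 1) * (r / (r - 1)) = r by rewrite mulrCA divff ?mulr1//; lra.
move=> h; have rpos : 0 < r by lra.
have {}h : t * s `^ (r - 1) <= t `^ r / r + s `^ r * ((r - 1) / r).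
  rewrite -[(r - 1) / r]invf_div; apply: h => //; first by rewrite divr_gt0.
  by rewrite invf_div; field.
have : r * (t * s `^ (r - 1)) <= r * (t `^ r / r + s `^ r * ((r - 1) / r)).
  by rewrite ler_pM2l.
have -> : r * (t `^ r / r + s `^ r * ((r - 1) / r)) = t `^ r + s `^ r * (r - 1) by field.
have -> : r * s `^ (r - 1) * (t - s) = r * (t * s `^ (r - 1)) - r * s `^ r by rewrite -sr; ring.
lra.
Qed.

(** The tangent-line inequality at the mean [s], summed. Total weight at most one is enough because
    the power vanishes at 0; this appears as the nonnegative term [(r - 1) * (1 - V)]. *)
Lemma powR_jensen (I : Type) (W : seq I) (w u : I -> R) r :
  1 <= r -> (forall i, 0 <= w i) -> \sum_(i <- W) w i <= 1 ->
  `|\sum_(i <- W) w i * u i| `^ r <= \sum_(i <- W) w i * `|u i| `^ r.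
Proof.
move=> r1 w0 W1; set s := \sum_(i <- W) w i * `|u i|.
have s0 : 0 <= s by apply: sumr_ge0 => i _; rewrite mulr_ge0.
apply: (@le_trans _ _ (s `^ r)).
  apply: ge0_ler_powR; rewrite ?nnegrE//; first by lra.
  apply: le_trans (ler_norm_sum _ _ _) _; apply: ler_sum => i _.
  by rewrite normrM (ger0_norm (w0 i)).
have sr : s * s `^ (r - 1) = s `^ r by apply: mulr_powRB1 => //; lra.
apply: (@le_trans _ _ (\sum_(i <- W) w i * (s `^ r + r * s `^ (r - 1) * (`|u i| - s)))); last first.
  by apply: ler_sum => i _; apply: ler_wpM2l => //; exact: powR_tangent.
set V := \sum_(i <- W) w i.
have -> : \sum_(i <- W) w i * (s `^ r + r * s `^ (r - 1) * (`|u i| - s)) =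
   V * s `^ r + r * s `^ (r - 1) * (s - V * s).
  rewrite /s /V !mulr_suml -sumrB mulr_sumr -big_split /=; apply: eq_bigr => i _; ring.
have -> : V * s `^ r + r * s `^ (r - 1) * (s - V * s) = s `^ r * (V + r * (1 - V)).
  by rewrite -sr; ring.
rewrite -[leLHS]mulr1; apply: ler_wpM2l; first exact: powR_ge0.
have : 0 <= (r - 1) * (1 - V) by rewrite mulr_ge0 ?subr_ge0.
lra.
Qed.

(** Estimates are carried out on integrals of r-th powers, without taking roots; this crude
    inequality stands in for Minkowski's. *)
Lemma powR_normD r a b : 0 <= r -> `|a + b| `^ r <= 2 `^ r * (`|a| `^ r + `|b| `^ r).
Proof.
move=> r0.
have h c : `|c| `^ r * 2 `^ r = (2 * `|c|) `^ r by rewrite mulrC -powRM.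
have [ab|ba] := leP `|a| `|b|.
- apply: (@le_trans _ _ ((2 * `|b|) `^ r)).
    apply: ge0_ler_powR; rewrite ?nnegrE ?mulr_ge0//.
    by rewrite (le_trans (ler_normD _ _))//; lra.
  by rewrite -h mulrC ler_wpM2l ?powR_ge0// lerDr powR_ge0.
- apply: (@le_trans _ _ ((2 * `|a|) `^ r)).
    apply: ge0_ler_powR; rewrite ?nnegrE ?mulr_ge0//.
    by rewrite (le_trans (ler_normD _ _))//; lra.
  by rewrite -h mulrC ler_wpM2l ?powR_ge0// lerDl powR_ge0.
Qed.

Lemma powR_sqr a : `|a| `^ 2 = a ^+ 2.
Proof. by rewrite -[2]/(2%:R) powR_mulrn// real_normK// num_real. Qed.

Lemma powR_even m a : `|a| `^ (2 * m)%:R = a ^+ (2 * m).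
Proof. by rewrite powR_mulrn// exprM real_normK ?num_real// -exprM. Qed.

Lemma sorted_le_last x a (s : seq R) : sorted <=%R s -> x \in s -> x <= last a s.
Proof.
elim: s a => [//|b s IH] a /= pb; rewrite inE => /orP[/eqP->|xs].
  have := mem_last b s; rewrite inE => /orP[/eqP->//|h].
  exact: (allP (order_path_min le_trans pb)).
by apply: IH => //; exact: path_sorted pb.
Qed.

(** The weights are the gaps between consecutive values of the sorted list, starting from 0, and the
    levels are the midpoints of the gaps. Hence no level is a value of the list, and frequencies
    will never lie on the boundary of a sector. *)
Lemma layer_cake (s : seq R) : (forall x, x \in s -> 0 <= x <= 1) ->
  exists W : seq (R * R), [/\ \sum_(t <- W) t.1 <= 1,
    forall t : R * R, t \in W -> [/\ 0 <= t.1, 0 < t.2 < 1 & t.2 \notin s] &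
    forall x, x \in s -> x = \sum_(t <- W) t.1 * (t.2 < x)%R%:R].
Proof.
move=> hs.
suff H (s' : seq R) : sorted <=%R s' -> (forall x, x \in s' -> 0 <= x <= 1) ->
    exists W : seq (R * R), [/\ \sum_(t <- W) t.1 = last 0 s',
    forall t : R * R, t \in W -> [/\ 0 <= t.1, 0 < t.2 < last 0 s' & t.2 \notin s'] &
    forall x, x \in s' -> x = \sum_(t <- W) t.1 * (t.2 < x)%R%:R].
  have [||W [h1 h2 h3]] := H (sort <=%R s).
  - by apply: sort_sorted; exact: le_total.
  - by move=> x; rewrite mem_sort; exact: hs.
  have l01 : 0 <= last 0 (sort <=%R s) <= 1.
    have := mem_last 0 (sort <=%R s); rewrite inE => /orP[/eqP->|]; first by rewrite lexx ler01.
    by rewrite mem_sort; exact: hs.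
  exists W; split.
  - by rewrite h1; case/andP: l01.
  - move=> t tW; have [t0 /andP[t1 t2] t3] := h2 t tW; split => //.
      by rewrite t1 (lt_le_trans t2)//; case/andP: l01.
    by rewrite -(mem_sort <=%R).
  - by move=> x xs; apply: h3; rewrite mem_sort.
elim/last_ind: s' => [_ _|s' y IH srt h01].
  by exists [::]; split => //; rewrite ?big_nil.
have srt' : sorted <=%R s' by apply: (subseq_sorted le_trans _ srt); exact: subseq_rcons.
have h01' x : x \in s' -> 0 <= x <= 1 by move=> xs; apply: h01; rewrite mem_rcons inE xs orbT.
have [W [h1 h2 h3]] := IH srt' h01'.
have y01 : 0 <= y <= 1 by apply: h01; rewrite mem_rcons inE eqxx.
have lmax x : x \in s' -> x <= last 0 s' by exact: sorted_le_last.
have ly : last 0 s' <= y.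
  have := mem_last 0 s'; rewrite inE => /orP[/eqP->|h]; first by case/andP: y01.
  rewrite -[leRHS](last_rcons 0 s' y); apply: sorted_le_last => //.
  by rewrite mem_rcons inE h orbT.
rewrite last_rcons.
have [yl|yl] := eqVneq y (last 0 s').
  exists W; split; rewrite ?yl//.
    move=> t tW; have [t0 t1 t2] := h2 t tW; split => //.
    rewrite mem_rcons inE negb_or t2 andbT; apply/eqP => e.
    by case/andP: t1; rewrite e ltxx.
  move=> x; rewrite mem_rcons inE => /orP[/eqP ->|]; last exact: h3.
  rewrite -{1}h1; rewrite big_seq [RHS]big_seq; apply: eq_bigr => t tW.
  by have [_ /andP[_ ->] _] := h2 t tW; rewrite mulr1.
have {yl}yl : last 0 s' < y by rewrite lt_def yl.
have l0 : 0 <= last 0 s'.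
  have := mem_last 0 s'; rewrite inE => /orP[/eqP->//|/h01'/andP[]//].
exists ((y - last 0 s', (y + last 0 s') / 2) :: W); split.
- by rewrite big_cons h1 /=; ring.
- move=> t; rewrite inE => /orP[/eqP -> /=|tW].
    split; [lra|apply/andP; split; lra|].
    rewrite mem_rcons inE negb_or; apply/andP; split; first by apply/eqP; lra.
    by apply/negP => /lmax; lra.
  have [t0 /andP[t1 t2] t3] := h2 t tW; split => //.
    by rewrite t1 (lt_trans t2).
  rewrite mem_rcons inE negb_or t3 andbT; apply/eqP => e; move: t2; rewrite e; lra.
- move=> x; rewrite mem_rcons inE big_cons /= => /orP[/eqP ->|xs].
    have -> : (y + last 0 s') / 2 < y by lra.
    rewrite (_ : \sum_(t <- W) _ = last 0 s'); first by rewrite mulr1; ring.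
    rewrite -{1}h1 big_seq [RHS]big_seq; apply: eq_bigr => t tW.
    by have [_ /andP[_ t2] _] := h2 t tW; rewrite (lt_trans t2 yl) mulr1.
  rewrite -h3//; have := lmax x xs => xl.
  have -> : ((y + last 0 s') / 2 < x) = false by apply/negbTE; rewrite -leNgt; lra.
  by rewrite mulr0 add0r.
Qed.

End PowR.

(** * Conjugate functions and double Riesz transforms at even exponents *)

Section Riesz.
Variable R : realType.
Local Notation C := R[i].
Local Notation Re := (@complex.Re R).
Local Notation Im := (@complex.Im R).
Local Notation tpoly := (tpoly R).
Implicit Types (L : tpoly) (M : int * int -> C) (v : int * int -> R) (r : R).

(** The r-th power of the norm, without the root. *)
Definition Lp r (f : R * R -> R) : R := Iint (fun x => `|f x| `^ r).

Lemma Lp_ge0 r f : 0 <= Lp r f.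
Proof. by apply: Iint_ge0 => x; exact: powR_ge0. Qed.

Lemma ltr_normc_Re (z : C) : `|Re z| <= Normc.normc z.
Proof.
case: z => a b /=; rewrite -sqrtr_sqr ler_wsqrtr// lerDl; exact: sqr_ge0.
Qed.

Lemma normcX (z : C) n : Normc.normc (z ^+ n) = Normc.normc z ^+ n.
Proof.
elim: n => [|n IH]; first by rewrite !expr0 Normc.normc1.
by rewrite !exprS Normc.normcM IH.
Qed.

Lemma normc_ge0 (z : C) : 0 <= Normc.normc z.
Proof. by case: z => a b; exact: sqrtr_ge0. Qed.

Lemma expr_perturb (s e : R) (w : C) n : 0 <= s -> 0 <= e <= 1 ->
  Normc.normc (w - s%:C%C) <= e * s ->
  Normc.normc (w ^+ n - (s ^+ n)%:C%C) <= (2 ^+ n - 1) * e * s ^+ n.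
Proof.
move=> s0 /andP[e0 e1] h; elim: n => [|n IH].
  by rewrite !expr0 subrr Normc.normc0 subrr !mul0r.
have nw : Normc.normc w <= 2 * s.
  have -> : w = (w - s%:C%C) + s%:C%C by rewrite subrK.
  apply: le_trans (le_normcD _ _) _.
  have -> : Normc.normc s%:C%C = s by rewrite /= expr0n addr0 sqrtr_sqr ger0_norm.
  have : e * s <= 1 * s by apply: ler_wpM2r.
  lra.
have -> : w ^+ n.+1 - (s ^+ n.+1)%:C%C = w * (w ^+ n - (s ^+ n)%:C%C) + (w - s%:C%C) * (s ^+ n)%:C%C.
  by rewrite !exprS rmorphM /=; ring.
apply: le_trans (le_normcD _ _) _; rewrite !Normc.normcM.
have -> : Normc.normc (s ^+ n)%:C%C = s ^+ n by rewrite /= expr0n addr0 sqrtr_sqr ger0_norm ?exprn_ge0.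
apply: (@le_trans _ _ (2 * s * ((2 ^+ n - 1) * e * s ^+ n) + e * s * s ^+ n)).
  apply: lerD; first by apply: ler_pM => //; exact: normc_ge0.
  by apply: ler_wpM2r => //; exact: exprn_ge0.
by rewrite !exprS le_eqVlt; apply/orP; left; apply/eqP; ring.
Qed.

(* M. Riesz's trick: for f = Re g with g analytic and of mean zero, the last term
   integrates to zero, which bounds Im g by f in L^(2m). *)
Lemma riesz_pointwise m : exists2 K : R, 0 <= K & forall x y : R,
  y ^+ (2 * m) <= K * x ^+ (2 * m) + 2 * ((-1) ^+ m * Re ((x +i* y)%C ^+ (2 * m))).
Proof.
(* The relative error of [w ^+ m] against [y ^+ (2 * m)] will be at most 2^m e = 1/2, which the
   factor 2 in the statement absorbs. *)
pose e : R := (2 ^+ m.+1)^-1.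
have p2 n : 1 <= 2 ^+ n :> R by rewrite exprn_ege1// ler1n.
have e0 : 0 < e by rewrite invr_gt0 (lt_le_trans ltr01).
have e1 : e <= 1 by rewrite invf_le1 ?(lt_le_trans ltr01).
have em : 2 ^+ m * e = 2^-1 by rewrite /e exprS; field; apply/eqP => h; have := p2 m; rewrite h ler10.
(* In the cone |x| <= d |y| the distance from [w] to y^2 is at most x^2 + 2 |x y| <= 3 d y^2 = e
   y^2. Outside the cone y is dominated by x. *)
pose d := e / 3.
have d0 : 0 < d by rewrite divr_gt0.
exists (d^-1 ^+ (2 * m) + 2 * (1 + d^-1 ^+ 2) ^+ m).
  by rewrite addr_ge0// ?mulr_ge0 ?exprn_ge0// ?invr_ge0 ?ltW// addr_gt0// exprn_gt0// invr_gt0.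
move=> x y.
(* The sign makes [w] close to the positive number y^2 when x is small, and [w ^+ m] carries the
   factor (-1)^m of the statement. *)
pose w : C := - (x +i* y)%C ^+ 2.
have wE : (-1) ^+ m * Re ((x +i* y)%C ^+ (2 * m)) = Re (w ^+ m).
  have -> : w ^+ m = (-1) ^+ m * (x +i* y)%C ^+ (2 * m) by rewrite [LHS]exprNn exprM.
  rewrite -signr_odd -[in RHS]signr_odd; case: (odd m) => /=.
    by rewrite !expr1 !mulN1r ReN.
  by rewrite !expr0 !mul1r.
rewrite wE.
have wv : w = ((y ^+ 2 - x ^+ 2) -i* (2 * x * y))%C.
  by rewrite /w expr2; apply: cplx_eq; rewrite ?ReN ?ImN ?ReM ?ImM /=; ring.
have [xy|xy] := leP `|x| (d * `|y|).
- have s0 : 0 <= y ^+ 2 by exact: sqr_ge0.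
  have hw : Normc.normc (w - (y ^+ 2)%:C%C) <= e * y ^+ 2.
    have -> : w - (y ^+ 2)%:C%C = (- x ^+ 2)%:C%C + (0 -i* (2 * x * y))%C.
      by rewrite wv; apply: cplx_eq; rewrite ?ReD ?ImD ?ReN ?ImN /=; ring.
    apply: le_trans (le_normcD _ _) _.
    rewrite /= !expr0n /= addr0 add0r !sqrtr_sqr !normrN normrX !normrM (ger0_norm (_ : 0 <= 2))//.
    have x0 := normr_ge0 x; have y0 := normr_ge0 y.
    have -> : y ^+ 2 = `|y| ^+ 2 by rewrite real_normK ?num_real.
    have h1 : `|x| ^+ 2 <= (d * `|y|) * (1 * `|y|).
      rewrite expr2; apply: ler_pM => //; apply: le_trans xy _; apply: ler_wpM2r => //.
      by rewrite /d; lra.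
    have h2 : `|x| * `|y| <= d * `|y| * `|y| by apply: ler_wpM2r.
    have -> : e * `|y| ^+ 2 = 3 * (d * `|y| * `|y|) by rewrite /d; field.
    by move: h1 h2; rewrite mul1r -mulrA; lra.
  have := @expr_perturb (y ^+ 2) e w m s0 _ hw; rewrite (ltW e0) e1 => /(_ isT) hp.
  have hr := le_trans (ltr_normc_Re _) hp.
  have {hr} : `|Re (w ^+ m) - y ^+ 2 ^+ m| <= 2^-1 * y ^+ 2 ^+ m.
    rewrite ReD ReN /= in hr; apply: le_trans hr _; rewrite -em.
    apply: ler_wpM2r; first by rewrite exprn_ge0.
    by apply: ler_wpM2r; [exact: ltW|lra].
  rewrite ler_norml -!exprM => /andP[h _].
  have : 0 <= (d^-1 ^+ (2 * m) + 2 * (1 + d^-1 ^+ 2) ^+ m) * x ^+ (2 * m).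
    rewrite mulr_ge0//; last by rewrite exprM exprn_ge0// sqr_ge0.
    by rewrite addr_ge0// ?mulr_ge0 ?exprn_ge0// ?invr_ge0 ?ltW// addr_gt0// exprn_gt0// invr_gt0.
  lra.
- have hy : `|y| <= d^-1 * `|x| by rewrite ler_pdivlMl// ltW.
  have y2 : y ^+ 2 <= d^-1 ^+ 2 * x ^+ 2.
    rewrite -(real_normK (num_real y)) -(real_normK (num_real x)) -exprMn.
    by rewrite ler_pXn2r// nnegrE// mulr_ge0// invr_ge0 ltW.
  have h1 : y ^+ (2 * m) <= d^-1 ^+ (2 * m) * x ^+ (2 * m).
    rewrite !exprM -exprMn; apply: lerXn2r => //; rewrite nnegrE; first exact: sqr_ge0.
    by apply: mulr_ge0; exact: sqr_ge0.
  have nw : Normc.normc w = x ^+ 2 + y ^+ 2.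
    rewrite wv /=.
    have -> : (y ^+ 2 - x ^+ 2) ^+ 2 + (- (2 * x * y)) ^+ 2 = (x ^+ 2 + y ^+ 2) ^+ 2 by ring.
    by rewrite sqrtr_sqr ger0_norm// addr_ge0 ?sqr_ge0.
  have h2 : `|Re (w ^+ m)| <= (1 + d^-1 ^+ 2) ^+ m * x ^+ (2 * m).
    apply: le_trans (ltr_normc_Re _) _; rewrite normcX nw exprM -exprMn.
    apply: lerXn2r; rewrite ?nnegrE.
    - by apply: addr_ge0; exact: sqr_ge0.
    - by apply: mulr_ge0; [apply: addr_ge0 => //; exact: sqr_ge0|exact: sqr_ge0].
    - by rewrite mulrDl mul1r lerD2l.
  move: h2; rewrite ler_norml => /andP[h2 _].
  rewrite mulrDl; lra.
Qed.

Definition tpow L n : tpoly := iter n (tprod L) [:: (1, 0)].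

Lemma tval_pow L n x : tval (tpow L n) x = tval L x ^+ n.
Proof.
elim: n => [|n IH]; last by rewrite /= tval_prod IH exprS.
by rewrite /= tval_cons tval_nil addr0 /phase /= !mul0r addr0 cexpi0 mulr1.
Qed.

(** Linear forms on the frequency lattice. The half-plane [0 < v k] plays the role of the positive
    integers: a sum with frequencies there is the analogue of an analytic function of mean zero. *)
Definition additive2 v := forall k k', v (k + k') = v k + v k'.

Lemma additive2_0 v : additive2 v -> v 0 = 0.
Proof. by move=> h; apply: (addrI (v 0)); rewrite -h !addr0. Qed.

Lemma additive2_N v (k : int * int) : additive2 v -> v (- k) = - v k.
Proof. by move=> h; apply/eqP; rewrite -addr_eq0 -h addNr additive2_0. Qed.

Lemma tpow_keys v L n : additive2 v -> (forall k, k \in map snd L -> 0 < v k) ->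
  forall k, k \in map snd (tpow L n) -> if n == 0%N then v k = 0 else 0 < v k.
Proof.
move=> av hL; elim: n => [|n IH] k /=.
  by rewrite inE => /eqP ->; exact: additive2_0.
move=> /mapP[_ /allpairsP[[t u] /= [tL uL ->]] ->] /=.
rewrite av ltr_pwDl//; first by apply: hL; apply: map_f.
by have := IH u.2 (map_f _ uL); case: eqP => _ => [->|/ltW].
Qed.

(** Sums of frequencies on which [v] is positive keep [v] positive, so frequency 0 does not occur in
    the power. *)
Lemma Iint_tpow v L n : additive2 v -> (forall k, k \in map snd L -> 0 < v k) ->
  (0 < n)%N -> Iint (fun x => Re (tval L x ^+ n)) = 0.
Proof.
move=> av hL n0; rewrite (@eq_Iint _ _ (tev (tpow L n))); last by move=> x; rewrite /tev tval_pow.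
apply: Iint_tev0; apply/negP => /(tpow_keys av hL).
by rewrite gtn_eqF// additive2_0// ltxx.
Qed.

(** Conjugating a term preserves its real part, so [tev L] is also the real part of a sum with
    frequencies in the half-plane where [v] is nonnegative. The imaginary part of that sum is the
    Hilbert transform in the direction [v], whose symbol is - i times the sign of [v] where [v] does
    not vanish. *)
Definition orient v (t : C * (int * int)) := if v t.2 < 0 then (conjc t.1, - t.2) else t.
Definition hilbert v (k : int * int) : C := if v k < 0 then 'i%C else - 'i%C.

Lemma tev_orient v L x : tev (map (orient v) L) x = tev L x.
Proof.
rewrite /tev !Re_sum big_map; apply: eq_bigr => t _; rewrite /orient.
case: ifP => // _; rewrite /= phaseN cexpiN -rmorphM /=.
by case: (_ * _).
Qed.

Lemma tev_hilbert v L x : tev (tmult (hilbert v) L) x = Im (tval (map (orient v) L) x).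
Proof.
rewrite /tev !Re_sum Im_sum !big_map; apply: eq_bigr => t _; rewrite /orient /hilbert /=.
case: ifP => _ /=; rewrite -mulrA; last by rewrite ReM ReN ImN /=; ring.
rewrite phaseN cexpiN -rmorphM ReM; set z := t.1 * _.
by case: z => a b /=; ring.
Qed.

(** The pointwise inequality is integrated along the oriented sum, where the term Re (z^(2m)) has
    mean zero. The constant does not depend on the direction [v], which later allows averaging over
    sectors. *)
Theorem riesz m : (0 < m)%N -> exists2 K : R, 0 <= K & forall v L, additive2 v ->
  (forall k, k \in map snd L -> v k != 0) ->
  Lp (2 * m)%:R (tev (tmult (hilbert v) L)) <= K * Lp (2 * m)%:R (tev L).
Proof.
move=> m0; have [K K0 hK] := riesz_pointwise m; exists K => // v L av hv.
pose G := map (orient v) L.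
have Gpos k : k \in map snd G -> 0 < v k.
  move=> /mapP[_ /mapP[t tL ->] ->]; have := hv t.2 (map_f _ tL).
  rewrite /orient; case: (ltP (v t.2) 0) => h h0; first by change (0 < v (- t.2)); rewrite additive2_N// oppr_gt0.
  by rewrite lt_def h0.
rewrite /Lp.
rewrite (@eq_Iint _ (fun x => `|tev (tmult (hilbert v) L) x| `^ (2 * m)%:R)
  (fun x => Im (tval G x) ^+ (2 * m))); last by move=> x; rewrite powR_even tev_hilbert.
rewrite (@eq_Iint _ (fun x => `|tev L x| `^ (2 * m)%:R) (fun x => tev G x ^+ (2 * m))); last first.
  by move=> x; rewrite powR_even tev_orient.
have bI : bmeas (fun x => Im (tval G x) ^+ (2 * m)).
  rewrite (_ : (fun x => _) = (fun x => tev (tmult (fun=> - 'i%C) G) x ^+ (2 * m))).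
    by apply: bmeasX; exact: tev_bmeas.
  by apply/funext => x; rewrite Im_tval.
have bR : bmeas (fun x => tev G x ^+ (2 * m)) by apply: bmeasX; exact: tev_bmeas.
have bP : bmeas (fun x => Re (tval G x ^+ (2 * m))).
  rewrite (_ : (fun x => _) = tev (tpow G (2 * m))); first exact: tev_bmeas.
  by apply/funext => x; rewrite /tev tval_pow.
have := @Iint_le R _ (fun x => K * tev G x ^+ (2 * m) +
  2 * ((-1) ^+ m * Re (tval G x ^+ (2 * m)))) bI.
rewrite IintD; last 2 first.
- exact: bmeasZ.
- by apply: bmeasZ; apply: bmeasZ.
rewrite !IintZ//; last by apply: bmeasZ.
rewrite (Iint_tpow av Gpos) ?muln_gt0// !mulr0 addr0; apply.
- by apply: bmeasD; [exact: bmeasZ|apply: bmeasZ; apply: bmeasZ].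
- by move=> x; have := hK (tev G x) (Im (tval G x)); rewrite -tvalE.
Qed.

Lemma LpD r (f g : R * R -> R) : 0 <= r -> bmeas f -> bmeas g ->
  Lp r (fun x => f x + g x) <= 2 `^ r * (Lp r f + Lp r g).
Proof.
move=> r0 hf hg; rewrite /Lp -IintD; try exact: bmeas_powR.
rewrite -IintZ; last by apply: bmeasD; exact: bmeas_powR.
apply: Iint_le; first by apply: bmeas_powR => //; exact: bmeasD.
  by apply: bmeasZ; apply: bmeasD; exact: bmeas_powR.
by move=> x; exact: powR_normD.
Qed.

Lemma LpZ r c (f : R * R -> R) : 0 <= r -> bmeas f ->
  Lp r (fun x => c * f x) = `|c| `^ r * Lp r f.
Proof.
move=> r0 hf; rewrite /Lp -IintZ; last exact: bmeas_powR.
by apply: eq_Iint => x; rewrite normrM powRM.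
Qed.

Lemma eq_Lp r (f g : R * R -> R) : f =1 g -> Lp r f = Lp r g.
Proof. by move=> /funext ->. Qed.

Lemma real_complexM (x y : R) : (x * y)%:C%C = x%:C%C * y%:C%C.
Proof. exact: rmorphM. Qed.

Lemma hilbert_hilbert v w (k : int * int) : v k != 0 -> w k != 0 ->
  hilbert v k * hilbert w k = (1 - 2 * (0 < v k * w k)%R%:R)%:C%C.
Proof.
rewrite /hilbert; case: (ltgtP (v k) 0) => // hv _; case: (ltgtP (w k) 0) => // hw _.
- by rewrite nmulr_rgt0// hw; apply: cplx_eq => /=; ring.
- by rewrite nmulr_rgt0// ltNge (ltW hw); apply: cplx_eq => /=; ring.
- by rewrite pmulr_rgt0// ltNge (ltW hw); apply: cplx_eq => /=; ring.
- by rewrite pmulr_rgt0// hw; apply: cplx_eq => /=; ring.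
Qed.

Lemma tev_mult_sum (I : Type) (W : seq I) (c : I -> R) (g : I -> int * int -> R) L x :
  tev (tmult (fun k => (\sum_(t <- W) c t * g t k)%:C%C) L) x =
  \sum_(t <- W) c t * tev (tmult (fun k => (g t k)%:C%C) L) x.
Proof.
elim: W => [|t W IH].
  rewrite big_nil (@eq_tmult _ _ (fun=> 0%:C%C)); last by move=> k _; rewrite big_nil.
  by rewrite tev_scale mul0r.
rewrite big_cons -IH -tev_scale tmult_comp /tev -ReD -tval_multD.
congr Re; congr tval; apply: eq_tmult => k _.
by rewrite big_cons -real_complexM -rmorphD.
Qed.

Section QuadraticMultiplier.
Variable m : nat.
Hypothesis m0 : (0 < m)%N.
Let r : R := (2 * m)%:R.

Let r1 : 1 <= r. Proof. by rewrite ler1n muln_gt0. Qed.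
Let r0 : 0 <= r. Proof. exact: le_trans r1. Qed.

(* The product of two Hilbert transforms is a sign multiplier, so half-planes cut
   out the sector {s < b^2 / (a^2 + b^2)}. *)
Lemma sector_mult : exists2 K : R, 0 <= K & forall (a b : int * int -> R) L (s : R),
  additive2 a -> additive2 b -> 0 < s < 1 ->
  (forall k, k \in map snd L -> a k ^+ 2 + b k ^+ 2 != 0) ->
  (forall k, k \in map snd L -> s != b k ^+ 2 / (a k ^+ 2 + b k ^+ 2)) ->
  Lp r (tev (tmult (fun k => (s < b k ^+ 2 / (a k ^+ 2 + b k ^+ 2))%R%:R%:C%C) L)) <= K * Lp r (tev L).
Proof.
have [K K0 hK] := riesz m0.
exists (1 + K * K) => [|a b L s aa ab /andP[s0 s1] hL hs]; first by rewrite addr_ge0 ?mulr_ge0.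
(* The product [v k * w k] is (1 - s) b^2 - s a^2, positive exactly in the sector s < b^2 / (a^2 +
   b^2). *)
pose v k := Num.sqrt (1 - s) * b k - Num.sqrt s * a k.
pose w k := Num.sqrt (1 - s) * b k + Num.sqrt s * a k.
have av : additive2 v by move=> k k'; rewrite /v aa ab; ring.
have aw : additive2 w by move=> k k'; rewrite /w aa ab; ring.
have q0 k : k \in map snd L -> 0 < a k ^+ 2 + b k ^+ 2.
  by move=> kL; rewrite lt_def hL//= addr_ge0 ?sqr_ge0.
have vw k : k \in map snd L -> v k * w k = (a k ^+ 2 + b k ^+ 2) * (b k ^+ 2 / (a k ^+ 2 + b k ^+ 2) - s).
  move=> kL; have := q0 k kL; rewrite lt_def => /andP[qn _].
  transitivity (Num.sqrt (1 - s) ^+ 2 * b k ^+ 2 - Num.sqrt s ^+ 2 * a k ^+ 2); first by rewrite /v /w; ring.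
  rewrite !sqr_sqrtr; [by field|lra|lra].
have vw0 k : k \in map snd L -> v k * w k != 0.
  by move=> kL; rewrite vw// mulf_neq0 ?hL// subr_eq0 eq_sym hs.
have v0 k : k \in map snd L -> v k != 0 by move=> /vw0; rewrite mulf_eq0 negb_or => /andP[].
have w0 k : k \in map snd L -> w k != 0 by move=> /vw0; rewrite mulf_eq0 negb_or => /andP[].
pose H := tmult (hilbert v) (tmult (hilbert w) L).
have E x : tev (tmult (fun k => (s < b k ^+ 2 / (a k ^+ 2 + b k ^+ 2))%R%:R%:C%C) L) x =
    2^-1 * tev L x + (- 2^-1) * tev H x.
  transitivity (tev (tmult (fun k => (2^-1 : R)%:C%C + (- 2^-1 : R)%:C%C * (hilbert v k * hilbert w k)) L) x).
    congr tev; apply: eq_tmult => k kL.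
    rewrite hilbert_hilbert ?v0 ?w0// vw// pmulr_rgt0 ?q0// subr_gt0.
    by rewrite -real_complexM -rmorphD; congr real_complex_def; case: (s < _) => /=; field.
  rewrite /tev tval_multD ReD; congr (_ + _); first exact: tev_scale.
  rewrite -[RHS]tev_scale /H !tmult_comp; congr Re; congr tval; apply: eq_tmult => k _.
  by rewrite mulrA.
rewrite (eq_Lp _ E).
have h2 : (2^-1 : R) `^ r * 2 `^ r = 1 by rewrite -powRM// mulVf// powR1.
apply: le_trans (LpD r0 (bmeasZ _ (tev_bmeas _)) (bmeasZ _ (tev_bmeas _))) _.
rewrite !LpZ ?normrN//; try exact: tev_bmeas.
rewrite (ger0_norm (_ : 0 <= 2^-1)) ?invr_ge0// -mulrDr mulrA [2 `^ r * _]mulrC h2 mul1r mulrDl mul1r lerD2l.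
have wH := hK w L aw w0.
have vH := hK v (tmult (hilbert w) L) av.
rewrite tmult_keys in vH; apply: le_trans (vH v0) _.
by rewrite -mulrA ler_wpM2l.
Qed.

(* The symbol is an average of sector indicators over the levels s. *)
Lemma quad_mult : exists2 K : R, 0 <= K & forall (a b : int * int -> R) L,
  additive2 a -> additive2 b ->
  (forall k, k \in map snd L -> a k ^+ 2 + b k ^+ 2 != 0) ->
  Lp r (tev (tmult (fun k => (b k ^+ 2 / (a k ^+ 2 + b k ^+ 2))%:C%C) L)) <= K * Lp r (tev L).
Proof.
have [K K0 hK] := sector_mult; exists K => // a b L aa ab hL.
pose phi k := b k ^+ 2 / (a k ^+ 2 + b k ^+ 2).
have [W [W1 hW eW]] : exists W : seq (R * R), [/\ \sum_(t <- W) t.1 <= 1,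
    forall t : R * R, t \in W -> [/\ 0 <= t.1, 0 < t.2 < 1 & t.2 \notin map phi (map snd L)] &
    forall x, x \in map phi (map snd L) -> x = \sum_(t <- W) t.1 * (t.2 < x)%R%:R].
  apply: layer_cake => _ /mapP[k kL ->]; rewrite /phi.
  have q0 : 0 < a k ^+ 2 + b k ^+ 2 by rewrite lt_def hL//= addr_ge0 ?sqr_ge0.
  by rewrite divr_ge0 ?sqr_ge0 ?(ltW q0)//= ler_pdivrMr// mul1r lerDr sqr_ge0.
(* The absolute value makes the weight nonnegative for every [t], also outside [W], as [powR_jensen]
   requires; on [W] it changes nothing. *)
pose w (t : R * R) := `|t.1|.
have wE t : t \in W -> w t = t.1 by move=> /hW[h _ _]; rewrite /w ger0_norm.
have bs : \sum_(t <- W) w t <= 1.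
  by rewrite (eq_big_seq (fun t => t.1)).
pose u (t : R * R) := tev (tmult (fun k => (t.2 < phi k)%R%:R%:C%C : C) L).
have E x : tev (tmult (fun k => (phi k)%:C%C) L) x = \sum_(t <- W) w t * u t x.
  rewrite /u -tev_mult_sum; congr tev; apply: eq_tmult => k kL.
  rewrite {1}(eW (phi k)) ?map_f//; congr real_complex_def; apply: eq_big_seq => t tW.
  by rewrite wE.
rewrite (eq_Lp _ E).
have bu t : bmeas (fun x => w t * `|u t x| `^ r).
  by apply: bmeasZ; apply: bmeas_powR => //; exact: tev_bmeas.
apply: (@le_trans _ _ (Iint (fun x => \sum_(t <- W) w t * `|u t x| `^ r))).
  apply: Iint_le.
  - by apply: bmeas_powR => //; apply: bmeas_sum => t; apply: bmeasZ; exact: tev_bmeas.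
  - exact: bmeas_sum.
  - by move=> x; apply: powR_jensen => // t; exact: normr_ge0.
rewrite Iint_sum//.
apply: (@le_trans _ _ (\sum_(t <- W) w t * (K * Lp r (tev L)))).
  rewrite big_seq [leRHS]big_seq; apply: ler_sum => t tW.
  rewrite IintZ; last by apply: bmeas_powR => //; exact: tev_bmeas.
  apply: ler_wpM2l; first exact: normr_ge0.
  have [t0 t1 t2] := hW t tW.
  apply: hK => // k kL; apply: contraNneq t2 => ->.
  by apply/mapP; exists k.
rewrite -mulr_suml -[leRHS]mul1r; apply: ler_wpM2r => //.
by rewrite mulr_ge0 ?Lp_ge0.
Qed.

Definition frequency (b : bool) (k : int * int) : R := (if b then k.2 else k.1)%:~R.
Definition frequency_sqr (k : int * int) : R := frequency false k ^+ 2 + frequency true k ^+ 2.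
(* Symbol of the double Riesz transform d_b d_b' Laplacian^-1. *)
Definition riesz2 (b b' : bool) (k : int * int) : R := frequency b k * frequency b' k / frequency_sqr k.

Lemma freqD b : additive2 (frequency b).
Proof. by move=> k k'; rewrite /frequency -intrD; case: b. Qed.

Lemma freq2_neq0 k : k != 0 -> frequency_sqr k != 0.
Proof.
case: k => k1 k2; rewrite -pair_eqE /= negb_and /frequency_sqr /frequency /= => h.
by rewrite paddr_eq0 ?sqr_ge0// !sqrf_eq0 !intr_eq0 negb_and.
Qed.

Theorem riesz2_bound : exists2 K : R, 0 <= K & forall b b' L, 0 \notin map snd L ->
  Lp r (tev (tmult (fun k => (riesz2 b b' k)%:C%C) L)) <= K * Lp r (tev L).
Proof.
have [K K0 hK] := quad_mult.
exists (2 `^ r * (K + 1)) => [|b b' L L0]; first by rewrite mulr_ge0 ?powR_ge0 ?addr_ge0.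
have kn0 k : k \in map snd L -> frequency_sqr k != 0.
  by move=> kL; apply: freq2_neq0; apply: contraNneq L0 => <-.
have r12 : 1 <= 2 `^ r :> R by rewrite -[leLHS](powRr0 2); apply: ler_powR => //; rewrite ler1n.
have diag c : Lp r (tev (tmult (fun k => (riesz2 c c k)%:C%C) L)) <= 2 `^ r * (K + 1) * Lp r (tev L).
  apply: (@le_trans _ _ (K * Lp r (tev L))); last first.
    apply: ler_wpM2r; first exact: Lp_ge0.
    by apply: (@le_trans _ _ (1 * (K + 1))); [lra|apply: ler_wpM2r => //; lra].
  have e k : frequency (~~ c) k ^+ 2 + frequency c k ^+ 2 = frequency_sqr k by rewrite /frequency_sqr; case: c => //=; rewrite addrC.
  have hk k : k \in map snd L -> frequency (~~ c) k ^+ 2 + frequency c k ^+ 2 != 0 by move=> kL; rewrite e kn0.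
  have := hK (frequency (~~ c)) (frequency c) L (@freqD _) (@freqD _) hk.
  rewrite (@eq_tmult _ _ (fun k => (riesz2 c c k)%:C%C)) // => k _.
  by rewrite e /riesz2 expr2.
have offdiag : Lp r (tev (tmult (fun k => (riesz2 false true k)%:C%C) L)) <= 2 `^ r * (K + 1) * Lp r (tev L).
  (* Polarisation: with A = k1 - k2 and B = k1 + k2, the symbol B^2 / (A^2 + B^2) is 1/2 + k1 k2 /
     |k|^2. *)
  pose A k := frequency false k - frequency true k; pose B k := frequency false k + frequency true k.
  have AD : additive2 A by move=> k k'; rewrite /A !freqD; ring.
  have BD : additive2 B by move=> k k'; rewrite /B !freqD; ring.
  have AB k : A k ^+ 2 + B k ^+ 2 = 2 * frequency_sqr k by rewrite /A /B /frequency_sqr; ring.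
  have kAB k : k \in map snd L -> A k ^+ 2 + B k ^+ 2 != 0.
    by move=> kL; rewrite AB mulf_neq0 ?kn0.
  pose G := tmult (fun k => (B k ^+ 2 / (A k ^+ 2 + B k ^+ 2))%:C%C) L.
  have E x : tev (tmult (fun k => (riesz2 false true k)%:C%C) L) x = tev G x + (- 2^-1) * tev L x.
    rewrite -tev_scale /tev -ReD -tval_multD; congr Re; congr tval; apply: eq_tmult => k kL.
    rewrite -rmorphD; congr real_complex_def; rewrite AB /riesz2 /B.
    by have := kn0 k kL; rewrite /frequency_sqr => h; field.
  rewrite (eq_Lp _ E); apply: le_trans (LpD r0 (tev_bmeas _) (bmeasZ _ (tev_bmeas _))) _.
  rewrite -mulrA; apply: ler_wpM2l; first exact: powR_ge0.
  rewrite mulrDl; apply: lerD; first exact: hK AD BD kAB.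
  rewrite (LpZ _ r0 (tev_bmeas _)).
  apply: ler_wpM2r; first exact: Lp_ge0.
  rewrite normrN ger0_norm ?invr_ge0//.
  have : (2^-1 : R) `^ r <= 1 `^ r by apply: ge0_ler_powR => //; rewrite ?nnegrE ?invr_ge0//; lra.
  by rewrite powR1.
have sym : riesz2 true false = riesz2 false true.
  by apply/funext => k; rewrite /riesz2 [frequency true k * _]mulrC.
by case: b; case: b'; [exact: diag|rewrite sym; exact: offdiag|exact: offdiag|exact: diag].
Qed.

End QuadraticMultiplier.
End Riesz.

(** * The Bourgain-Brezis estimate for trigonometric polynomials *)

Section Kernel.
Variable R : realType.

Lemma eq_ler (x y : R) : x = y -> x <= y.
Proof. by move=> ->. Qed.

Implicit Types (s t : R) (j n : nat).

(* Weights of size about 2 ^- j concentrated at frequencies of size about 2 ^ j.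
   Vanishing at both ends of [0, 2 ^ j] makes the sine series [sine_bump j]
   decay like 2 ^- j / |sin (t / 2)|, by summation by parts. *)
Definition weight j n : R := (n * (2 ^ j - n))%:R / 8 ^+ j.

Definition sine_bump j t : R := \sum_(n < 2 ^ j) weight j n * sin (n%:R * t).

Lemma sin_mulrn_le n t : `|sin (n%:R * t)| <= n%:R * `|sin t|.
Proof.
elim: n => [|n IH]; first by rewrite !mul0r sin0 normr0.
rewrite -[n.+1]addn1 natrD !mulrDl !mul1r sinD.
apply: le_trans (ler_normD _ _) _; rewrite !normrM.
have c1 x : `|cos x : R| <= 1 by rewrite ler_norml cos_geN1 cos_le1.
apply: lerD.
- by rewrite -[leRHS]mulr1; apply: ler_pM.
- by rewrite -[leRHS]mul1r; apply: ler_pM.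
Qed.

Lemma exp2_gt0 j : 0 < 2 ^+ j :> R.
Proof. by rewrite exprn_gt0. Qed.

Lemma exp8E j : 8 ^+ j = 2 ^+ j * 4 ^+ j :> R.
Proof. by rewrite -exprMn; congr (_ ^+ _); ring. Qed.

Lemma exp4E j : 4 ^+ j = 2 ^+ j * 2 ^+ j :> R.
Proof. by rewrite -exprMn; congr (_ ^+ _); ring. Qed.

Lemma weight_ge0 j n : 0 <= weight j n.
Proof. by rewrite divr_ge0 ?ler0n ?exprn_ge0. Qed.

Lemma weight_le j n : weight j n <= n%:R / 4 ^+ j.
Proof.
rewrite /weight natrM exp8E -mulrA; apply: ler_wpM2l; first exact: ler0n.
rewrite invfM mulrA -[leRHS]mul1r; apply: ler_wpM2r; first by rewrite invr_ge0 exprn_ge0.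
by rewrite ler_pdivrMr ?exp2_gt0// mul1r -natrX ler_nat leq_subr.
Qed.

Lemma weight_le2 j n : weight j n <= (2 ^+ j)^-1.
Proof.
have [h|h] := leqP n (2 ^ j); last first.
  have -> : weight j n = 0 by rewrite /weight (eqP (ltnW h : (2 ^ j - n == 0)%N)) muln0 mul0r.
  by rewrite invr_ge0 exprn_ge0.
apply: le_trans (weight_le _ _) _.
rewrite exp4E ler_pdivrMr ?mulr_gt0 ?exp2_gt0// mulrA mulVf ?gt_eqF ?exp2_gt0// mul1r.
by rewrite -natrX ler_nat.
Qed.

Lemma weight0 j : weight j 0 = 0.
Proof. by rewrite /weight mul0n mul0r. Qed.

Lemma weight_out j n : (2 ^ j <= n)%N -> weight j n = 0.
Proof. by move=> h; rewrite /weight (eqP (h : (2 ^ j - n == 0)%N)) muln0 mul0r. Qed.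

(** Small angles: there are 2^j terms, each weight is at most 2^-j, and |sin (n t)| <= 2 n |sin
    (t/2)| with n < 2^j. *)
Lemma bump_le j t : `|sine_bump j t| <= 2 ^+ j * `|sin (t / 2)| * 2.
Proof.
apply: le_trans (ler_norm_sum _ _ _) _.
apply: (@le_trans _ _ (\sum_(n < 2 ^ j) (2 * `|sin (t / 2)|))).
  apply: ler_sum => n _; rewrite normrM (ger0_norm (weight_ge0 _ _)).
  have -> : n%:R * t = (n * 2)%:R * (t / 2) by rewrite natrM; field.
  apply: (@le_trans _ _ ((2 ^+ j)^-1 * ((n * 2)%:R * `|sin (t / 2)|))).
    by apply: ler_pM => //; [exact: weight_ge0|exact: weight_le2|exact: sin_mulrn_le].
  rewrite natrM mulrA; apply: ler_wpM2r => //.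
  rewrite mulrA -[leRHS]mul1r; apply: ler_wpM2r => //.
  by rewrite mulrC ler_pdivrMr ?exp2_gt0// mul1r -natrX ler_nat ltnW.
by rewrite sumr_const card_ord -[leLHS]mulr_natl natrX; apply: eq_ler; ring.
Qed.

(** Large angles: multiplication by 2 sin (t/2) turns the sines into differences of cosines. After
    summation by parts the boundary term is at most 2^-j, and so is the sum of the fewer than 2^j
    increments of the weights, each at most 4^-j. *)
Lemma bump_le_inv j t : `|sine_bump j t| * `|sin (t / 2)| <= (2 ^+ j)^-1.
Proof.
have E : sine_bump j t * sin (t / 2) * 2 =
   \sum_(n < 2 ^ j) weight j n * (cos (n%:R * t - t / 2) - cos (n%:R * t + t / 2)).
  rewrite /sine_bump -mulrA mulr_suml; apply: eq_bigr => n _.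
  by rewrite cosB cosD; ring.
pose c (n : nat) : R := cos (n%:R * t - t / 2).
have cS n : cos (n%:R * t + t / 2) = c n.+1.
  by rewrite /c -[n.+1]addn1 natrD; congr cos; field.
have abel N : \sum_(n < N.+1) weight j n * (c n - c n.+1) =
   - weight j N * c N.+1 + \sum_(n < N) (weight j n.+1 - weight j n) * c n.+1.
  elim: N => [|N IH]; first by rewrite big_ord1 big_ord0 weight0; ring.
  by rewrite big_ord_recr IH /= [in RHS]big_ord_recr /=; ring.
have c1 n : `|c n| <= 1 by rewrite ler_norml cos_geN1 cos_le1.
have dw n : (n.+1 < 2 ^ j)%N -> `|weight j n.+1 - weight j n| <= (4 ^+ j)^-1.
  move=> h; rewrite /weight -mulrBl normrM normfV (ger0_norm (exprn_ge0 _ _))//.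
  rewrite ler_pdivrMr ?exprn_gt0// exp8E mulrCA mulVf ?expf_neq0// mulr1.
  rewrite !natrM !natrB; [|exact: ltnW (ltnW h)|exact: ltnW h].
  rewrite natrX -[n.+1]addn1 natrD.
  have n0 : 0 <= n%:R :> R by exact: ler0n.
  have n1 : n%:R + 1 <= 2 ^+ j :> R by rewrite natr1 -natrX ler_nat ltnW.
  rewrite ler_norml; apply/andP; split; nra.
have [N hN] : exists N, (2 ^ j = N.+1)%N by exists (2 ^ j).-1; rewrite prednK// expn_gt0.
have : `|sine_bump j t * sin (t / 2) * 2| <= 2 * (2 ^+ j)^-1.
  rewrite E; under eq_bigr do rewrite cS.
  rewrite hN abel; apply: le_trans (ler_normD _ _) _.
  rewrite mulr_natl mulr2n; apply: lerD.
    rewrite normrM normrN (ger0_norm (weight_ge0 _ _)) -[leRHS]mulr1.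
    by apply: ler_pM => //; [exact: weight_ge0|exact: weight_le2].
  apply: le_trans (ler_norm_sum _ _ _) _.
  apply: (@le_trans _ _ (\sum_(n < N) (4 ^+ j)^-1)).
    apply: ler_sum => n _; rewrite normrM -[leRHS]mulr1; apply: ler_pM => //.
    by apply: dw; rewrite hN ltnS.
  rewrite sumr_const card_ord -[leLHS]mulr_natr exp4E invfM -mulrA -[leRHS]mulr1.
  apply: ler_wpM2l; first by rewrite invr_ge0 exprn_ge0.
  by rewrite mulrC ler_pdivrMr ?exp2_gt0// mul1r -natrX ler_nat hN.
by rewrite !normrM (ger0_norm (_ : 0 <= 2))// [2 * _]mulrC ler_pM2r.
Qed.

(** The two bounds cross where 4^j u = 1. The induction carries an explicit geometric sum on each
    side of the crossing, 4^J u / 3 before it and 8/3 - (4/3) / (4^J u) after it. *)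
Lemma sum_min_le (u : R) (B : nat -> R) J : 0 < u ->
  (forall j, B j <= 4 ^+ j * u) -> (forall j, B j <= (4 ^+ j * u)^-1) ->
  \sum_(j < J) B j <= 8 / 3.
Proof.
move=> u0 h1 h2.
have p4 j : 0 < 4 ^+ j * u by rewrite mulr_gt0// exprn_gt0.
suff : (4 ^+ J * u <= 1 -> \sum_(j < J) B j <= 4 ^+ J * u / 3) /\
       (1 < 4 ^+ J * u -> \sum_(j < J) B j <= 8 / 3 - 4 / 3 / (4 ^+ J * u)).
  move=> [H1 H2]; case: (leP (4 ^+ J * u) 1) => h.
  - by have := H1 h; lra.
  - have := H2 h; have : 0 <= 4 / 3 / (4 ^+ J * u) by rewrite divr_ge0// ltW.
    lra.
elim: J => [|J [IH1 IH2]].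
  rewrite big_ord0; split => h; first by rewrite divr_ge0// ltW.
  rewrite subr_ge0 ler_pdivrMr//; nra.
rewrite big_ord_recr /= exprS -mulrA; set x := 4 ^+ J * u.
have x0 : 0 < x by exact: p4.
have B1 := h1 J; have B2 := h2 J; rewrite -/x in B1 B2 IH1 IH2.
split => h; first by have := IH1 _; lra.
have e : 4 / 3 / (4 * x) = 3^-1 * x^-1 by field; rewrite gt_eqF.
rewrite e; case: (leP x 1) => hx.
- have := IH1 hx; have : x^-1 <= 4 by rewrite -[leRHS]invrK lef_pV2 ?posrE ?invr_gt0//; lra.
  lra.
- have := IH2 hx; lra.
Qed.

Lemma sum_bump_sqr J t : \sum_(j < J) sine_bump j t ^+ 2 <= 16 / 3.
Proof.
pose s := `|sin (t / 2)|.
have s0 : 0 <= s by exact: normr_ge0.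
have [s00|sn0] := eqVneq s 0.
  rewrite big1 ?divr_ge0// => j _; have := bump_le j t; rewrite -/s s00 mulr0 mul0r.
  by rewrite normr_le0 => /eqP ->; rewrite expr0n.
have sp : 0 < s by rewrite lt_def sn0.
have H : \sum_(j < J) (sine_bump j t ^+ 2 / 2) <= 8 / 3.
  (* Halving balances the two estimates: half the square is at most both 4^j u and 1 / (4^j u), with
     u = 2 s^2. *)
  apply: (@sum_min_le (2 * s ^+ 2) (fun j => sine_bump j t ^+ 2 / 2)) => [|j|j].
  - by rewrite mulr_gt0// exprn_gt0.
  - have := bump_le j t; rewrite -/s => h.
    have : `|sine_bump j t| ^+ 2 <= (2 ^+ j * s * 2) ^+ 2 by rewrite lerXn2r// nnegrE ?mulr_ge0// ?exprn_ge0.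
    rewrite real_normK ?num_real// exp4E; nra.
  - have := bump_le_inv j t; rewrite -/s => h.
    have : (`|sine_bump j t| * s) ^+ 2 <= ((2 ^+ j)^-1) ^+ 2.
      by rewrite lerXn2r// nnegrE ?mulr_ge0// invr_ge0 exprn_ge0.
    rewrite exprMn real_normK ?num_real// exprVn -exprM mulnC exprM -[2 ^+ 2]/(2 * 2) => h'.
    have -> : (4 ^+ j * (2 * s ^+ 2))^-1 = (4 ^+ j)^-1 / s ^+ 2 / 2.
      by field; rewrite gt_eqF// expf_neq0.
    rewrite ler_pM2r ?invr_gt0// ler_pdivlMr ?exprn_gt0//.
    by have -> : 4 = 2 * 2 :> R by ring.
have : \sum_(j < J) sine_bump j t ^+ 2 = 2 * \sum_(j < J) (sine_bump j t ^+ 2 / 2).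
  by rewrite mulr_sumr; apply: eq_bigr => j _; field.
by move=> ->; lra.
Qed.

Lemma sum_bump_bump J s t : `|\sum_(j < J) sine_bump j s * sine_bump j t| <= 16 / 3.
Proof.
apply: le_trans (ler_norm_sum _ _ _) _.
apply: (@le_trans _ _ (\sum_(j < J) (sine_bump j s ^+ 2 + sine_bump j t ^+ 2) / 2)).
  apply: ler_sum => j _; rewrite normrM.
  rewrite -(real_normK (num_real (sine_bump j s))) -(real_normK (num_real (sine_bump j t))).
  have := sqr_ge0 (`|sine_bump j s| - `|sine_bump j t|); nra.
rewrite -mulr_suml big_split /=.
have := sum_bump_sqr J s; have := sum_bump_sqr J t; lra.
Qed.

(** Fourier weight of the kernel. With M the larger of a and b, it is comparable to a b / M^4 as
    soon as 2^J exceeds 4 M; the scales 2^j of the order of M dominate. *)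
Definition kweight J (a b : nat) : R := \sum_(j < J) weight j a * weight j b.

Lemma kweight_ge0 J a b : 0 <= kweight J a b.
Proof. by apply: sumr_ge0 => j _; rewrite mulr_ge0 ?weight_ge0. Qed.

(** Only the scales with M < 2^j contribute, since the weight of the larger index vanishes at the
    others; there the product of weights is at most a b / 16^j, a geometric series. *)
Lemma kweight_upper J a b M : (a <= M)%N -> (b <= M)%N -> (a == M) || (b == M) -> (0 < M)%N ->
  kweight J a b * M%:R ^+ 4 <= 16 / 15 * (a%:R * b%:R).
Proof.
move=> aM bM abM M0.
pose F j : R := if (M < 2 ^ j)%N then (16 ^+ j)^-1 else 0.
have M4 : 0 < M%:R ^+ 4 :> R by rewrite exprn_gt0// ltr0n.
(* The partial sums are bounded with the tail 16^-J subtracted, so that the induction on [J]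
   closes. *)
have hF : (2 ^ J <= M)%N && (\sum_(j < J) F j == 0) ||
   (M < 2 ^ J)%N && (\sum_(j < J) F j <= 16 / 15 * ((M%:R ^+ 4)^-1 - (16 ^+ J)^-1)).
  elim: J => [|J /orP[/andP[h1 /eqP h2]|/andP[h1 h2]]].
  - by rewrite big_ord0 expn0 M0 eqxx.
  - rewrite big_ord_recr /= h2 /F ltnNge h1 /= addr0 eqxx andbT.
    case: (leqP (2 ^ J.+1) M) => //= h.
    rewrite mulr_ge0// subr_ge0 lef_pV2 ?posrE ?exprn_gt0 ?ltr0n//.
    have -> : 16 ^+ J.+1 = (2 ^ J.+1)%:R ^+ 4 :> R.
      by rewrite natrX -exprM mulnC exprM; congr (_ ^+ _); ring.
    by rewrite lerXn2r ?nnegrE ?ler0n// ler_nat ltnW.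
  - apply/orP; right; rewrite (leq_trans h1) ?leq_exp2l//= big_ord_recr /= {2}/F h1.
    rewrite [16 ^+ J.+1]exprS invfM; lra.
have sF : (\sum_(j < J) F j) * M%:R ^+ 4 <= 16 / 15.
  case/orP: hF => /andP[_]; first by move=> /eqP ->; rewrite mul0r.
  move=> h; apply: (@le_trans _ _ (16 / 15 * (M%:R ^+ 4)^-1 * M%:R ^+ 4)).
    apply: ler_wpM2r; first exact: ltW.
    apply: le_trans h _; apply: ler_wpM2l => //; rewrite gerBl invr_ge0 exprn_ge0//.
  by rewrite -mulrA mulVf ?gt_eqF// mulr1.
have hK : kweight J a b <= \sum_(j < J) F j * (a%:R * b%:R).
  apply: ler_sum => j _; rewrite /F; case: ltnP => h.
    apply: (@le_trans _ _ (a%:R / 4 ^+ j * (b%:R / 4 ^+ j))).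
      by apply: ler_pM; rewrite ?weight_ge0 ?weight_le.
    have -> : 16 ^+ j = 4 ^+ j * 4 ^+ j :> R by rewrite -exprMn; congr (_ ^+ _); ring.
    by apply: eq_ler; field; rewrite expf_neq0.
  rewrite mul0r; case/orP: abM => /eqP e.
  - by rewrite (@weight_out j a) ?mul0r// e.
  - by rewrite (@weight_out j b) ?mulr0// e.
apply: (@le_trans _ _ ((\sum_(j < J) F j) * (a%:R * b%:R) * M%:R ^+ 4)).
  by apply: ler_wpM2r; [exact: ltW|rewrite mulr_suml].
by rewrite mulrAC; apply: ler_wpM2r => //; rewrite mulr_ge0 ?ler0n.
Qed.

(** One scale suffices: for 2^j <= 4 M < 2^(j+1) both indices stay below half of 2^j, and each
    weight is at least n / (32 M^2); 1024 = 32 * 32. *)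
Lemma kweight_lower J a b M : (a <= M)%N -> (b <= M)%N -> (0 < M)%N -> (4 * M < 2 ^ J)%N ->
  a%:R * b%:R / (1024 * M%:R ^+ 4) <= kweight J a b.
Proof.
move=> aM bM M0 hJ.
have M4 : (0 < 4 * M)%N by rewrite muln_gt0.
have /andP[h1 h2] := trunc_log_bounds (isT : 1 < 2)%N M4.
set j := trunc_log 2 (4 * M) in h1 h2.
have jJ : (j < J)%N by rewrite -(ltn_exp2l _ _ (isT : 1 < 2)%N) (leq_ltn_trans h1).
rewrite /kweight (bigD1 (Ordinal jJ)) //=.
have : 0 <= \sum_(i < J | i != Ordinal jJ) weight i a * weight i b.
  by apply: sumr_ge0 => i _; rewrite mulr_ge0 ?weight_ge0.
have h3 : (2 * M <= 2 ^ j)%N by move: h2; rewrite expnS; lia.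
have Mp : 0 < M%:R :> R by rewrite ltr0n.
have wl n : (n <= M)%N -> n%:R / (32 * M%:R ^+ 2) <= weight j n.
  move=> nM; rewrite /weight natrM -mulrA; apply: ler_wpM2l; first exact: ler0n.
  rewrite natrB; last by lia.
  have h1' : 2 ^+ j <= 4 * M%:R :> R by rewrite -natrX -natrM ler_nat.
  have h3' : 2 * M%:R <= 2 ^+ j :> R by rewrite -natrX -natrM ler_nat.
  have nM' : n%:R <= M%:R :> R by rewrite ler_nat.
  rewrite natrX exp8E exp4E; set x : R := 2 ^+ j in h1' h3' *.
  have x0 : 0 < x by exact: exp2_gt0.
  apply: (@le_trans _ _ (x / 2 / (x * (x * x)))); last first.
    by apply: ler_wpM2r; [rewrite invr_ge0 !mulr_ge0// ltW|lra].
  have -> : x / 2 / (x * (x * x)) = (2 * (x * x))^-1 by field; rewrite gt_eqF.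
  rewrite lef_pV2 ?posrE ?mulr_gt0 ?exprn_gt0//; nra.
have : a%:R / (32 * M%:R ^+ 2) * (b%:R / (32 * M%:R ^+ 2)) <= weight j a * weight j b.
  by apply: ler_pM; rewrite ?wl// divr_ge0 ?ler0n ?mulr_ge0 ?exprn_ge0 ?ler0n.
have -> : a%:R / (32 * M%:R ^+ 2) * (b%:R / (32 * M%:R ^+ 2)) = a%:R * b%:R / (1024 * M%:R ^+ 4) :> R.
  by field; rewrite gt_eqF.
lra.
Qed.

End Kernel.

(** * The bilinear estimate for the multiplier *)

Section Core.
Variable R : realType.
Implicit Types (s t : R) (j n : nat) (a b : int).

Definition nzint n : seq int := [seq Posz m.+1 | m <- iota 0 n] ++ [seq Negz m | m <- iota 0 n].

Lemma mem_nzint n a : (a \in nzint n) = (a != 0) && (`|a| <= n)%N.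
Proof.
rewrite mem_cat; case: a => m.
- have -> : (Posz m \in [seq Negz m | m <- iota 0 n]) = false.
    by apply/negbTE/negP => /mapP[i _].
  rewrite orbF; case: m => [|m].
    by rewrite eqxx; apply/negbTE/negP => /mapP[i _].
  rewrite /=; apply/mapP/idP => [[m0]|h].
    by rewrite mem_iota => /andP[_ h] [->].
  by exists m => //; rewrite mem_iota.
- have -> : (Negz m \in [seq Posz m.+1 | m <- iota 0 n]) = false.
    by apply/negbTE/negP => /mapP[i _].
  rewrite /=; apply/mapP/idP => [[m0]|h].
    by rewrite mem_iota => /andP[_ h] [->].
  by exists m => //; rewrite mem_iota.
Qed.

Lemma uniq_nzint n : uniq (nzint n).
Proof.
rewrite cat_uniq !map_inj_uniq ?iota_uniq ?andbT /=; last 2 first.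
- by move=> i j [].
- by move=> i j [].
by apply/hasPn => _ /mapP[i _ ->]; apply/negP => /mapP[i' _].
Qed.

Lemma sum_nzint n (F : int -> R) :
  \sum_(a <- nzint n) F a = \sum_(m < n) (F (Posz m.+1) + F (- Posz m.+1)).
Proof.
rewrite /nzint big_cat /= !big_map -big_split /= -{1}[n]subn0 -/(index_iota 0 n) big_mkord.
by apply: eq_bigr => m _; rewrite NegzE.
Qed.

Lemma bump_widen J j t : (j < J)%N ->
  \sum_(m < 2 ^ J) weight R j m.+1 * sin (m.+1%:R * t) = sine_bump j t.
Proof.
move=> jJ; pose F m := weight R j m * sin (m%:R * t).
have hF m : (2 ^ j <= m)%N -> F m = 0 by move=> h; rewrite /F weight_out// mul0r.
have le : (2 ^ j <= (2 ^ J).+1)%N by rewrite ltnW// ltnS leq_exp2l// ltnW.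
have : \sum_(m < (2 ^ J).+1) F m = sine_bump j t.
  rewrite /sine_bump (big_ord_widen _ F le) [RHS]big_mkcond /=; apply: eq_bigr => m _.
  by case: ltnP => // /hF.
by rewrite big_ord_recl {1}/F /= weight0 mul0r add0r.
Qed.

Definition sg a : R := (Num.sg a)%:~R.
Definition kap J a b : R := kweight R J `|a| `|b|.

(** For fixed absolute values, the four sign choices of (a, b) weighted by sign a * sign b leave - 4
    sin (m s) sin (l t). *)
Lemma sum_kernel J s t :
  \sum_(a <- nzint (2 ^ J)) \sum_(b <- nzint (2 ^ J))
     kap J a b * (sg a * sg b) * cos (a%:~R * s + b%:~R * t)
  = - 4 * \sum_(j < J) sine_bump j s * sine_bump j t.
Proof.
have -> : \sum_(j < J) sine_bump j s * sine_bump j t = \sum_(m < 2 ^ J) \sum_(l < 2 ^ J)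
    kweight R J m.+1 l.+1 * (sin (m.+1%:R * s) * sin (l.+1%:R * t)).
  transitivity (\sum_(j < J) \sum_(m < 2 ^ J) \sum_(l < 2 ^ J)
     (weight R j m.+1 * weight R j l.+1) * (sin (m.+1%:R * s) * sin (l.+1%:R * t))).
    apply: eq_bigr => j _; rewrite -!(bump_widen _ (ltn_ord j)) mulr_suml.
    apply: eq_bigr => m _; rewrite mulr_sumr; apply: eq_bigr => l _; ring.
  rewrite exchange_big; apply: eq_bigr => m _ /=.
  rewrite exchange_big; apply: eq_bigr => l _ /=.
  by rewrite /kweight mulr_suml.
rewrite sum_nzint mulr_sumr; apply: eq_bigr => m _.
rewrite !sum_nzint -big_split mulr_sumr; apply: eq_bigr => l _ /=.
rewrite /kap !abszN !absz_nat /sg !sgrN !mulrNz.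
have h (i : nat) : Num.sg (Posz i.+1) = 1 by rewrite gtr0_sg.
rewrite !h !mulNr !cosD !cosN !sinN /=; ring.
Qed.

Lemma sum_kernel_le J s t :
  `|\sum_(a <- nzint (2 ^ J)) \sum_(b <- nzint (2 ^ J))
     kap J a b * (sg a * sg b) * cos (a%:~R * s + b%:~R * t)| <= 64 / 3.
Proof.
rewrite sum_kernel normrM normrN (ger0_norm (_ : 0 <= 4))//.
by have := sum_bump_bump J s t; lra.
Qed.

Lemma kap_ge0 J a b : 0 <= kap J a b.
Proof. exact: kweight_ge0. Qed.

Lemma sgM a : sg a * a%:~R = `|a%:~R| :> R.
Proof. by rewrite /sg -intrM -normrEsg intr_norm. Qed.

(** These are the three weights that [cross_term] produces; from the upper bound a b / M^4 each is
    at most a multiple of 1 / M^2, and a^2 + b^2 <= 2 M^2 doubles 16/15. *)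
Lemma kap_upper J a b : a != 0 -> b != 0 ->
  [/\ kap J a b * (`|b%:~R| / `|a%:~R|) <= 32 / 15 / (a%:~R ^+ 2 + b%:~R ^+ 2),
      kap J a b * (`|a%:~R| / `|b%:~R|) <= 32 / 15 / (a%:~R ^+ 2 + b%:~R ^+ 2) &
      kap J a b <= 32 / 15 / (a%:~R ^+ 2 + b%:~R ^+ 2 : R)].
Proof.
move=> a0 b0; rewrite /kap.
have nE (c : int) : `|c%:~R| = (`|c|%N)%:R :> R by rewrite -intr_norm -abszE.
rewrite -(real_normK (num_real a%:~R)) -(real_normK (num_real b%:~R)) !nE.
have : (0 < `|b|)%N by rewrite absz_gt0.
have : (0 < `|a|)%N by rewrite absz_gt0.
move: `|a|%N `|b|%N => {nE a0 b0}m n m0 n0.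
have M0 : (0 < maxn m n)%N by rewrite leq_max m0.
have hM : (m == maxn m n) || (n == maxn m n).
  by case: (leqP m n) => h; rewrite ?eqxx ?orbT.
have := @kweight_upper R J m n (maxn m n) (leq_maxl _ _) (leq_maxr _ _) hM M0.
set k := kweight R J m n; have k0 : 0 <= k by exact: kweight_ge0.
have : (m%:R <= (maxn m n)%:R :> R) by rewrite ler_nat leq_maxl.
have : (n%:R <= (maxn m n)%:R :> R) by rewrite ler_nat leq_maxr.
have : 0 < (maxn m n)%:R :> R by rewrite ltr0n.
have : 0 < m%:R :> R by rewrite ltr0n.
have : 0 < n%:R :> R by rewrite ltr0n.
move: (maxn m n)%:R m%:R n%:R => M x y y0 x0 M0' yM xM h.
have q0 : 0 < x ^+ 2 + y ^+ 2 by rewrite addr_gt0 ?exprn_gt0.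
have M2 : 0 < M ^+ 2 by rewrite exprn_gt0.
have x2 : x ^+ 2 <= M ^+ 2 by rewrite lerXn2r// nnegrE ltW.
have y2 : y ^+ 2 <= M ^+ 2 by rewrite lerXn2r// nnegrE ltW.
have q2 : x ^+ 2 + y ^+ 2 <= 2 * M ^+ 2 by lra.
have xy : x * y <= M ^+ 2 by rewrite expr2; apply: ler_pM => //; exact: ltW.
have M4 : M ^+ 4 = M ^+ 2 * M ^+ 2 by rewrite -exprD.
have H1 : k * M ^+ 2 <= 16 / 15.
  have : k * M ^+ 2 * M ^+ 2 <= 16 / 15 * M ^+ 2.
    by rewrite -mulrA -M4; apply: le_trans h _; apply: ler_wpM2l.
  by rewrite ler_pM2r.
have HD (z : R) : 0 <= z -> k * z * M ^+ 2 <= 16 / 15 -> k * z <= 32 / 15 / (x ^+ 2 + y ^+ 2).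
  move=> z0 hz; rewrite ler_pdivlMr//.
  apply: (@le_trans _ _ (k * z * (2 * M ^+ 2))); last by lra.
  by apply: ler_wpM2l => //; rewrite mulr_ge0.
split.
- apply: HD; first by rewrite divr_ge0// ltW.
  have : k * (y / x) * M ^+ 2 * M ^+ 2 <= 16 / 15 * M ^+ 2.
    have -> : k * (y / x) * M ^+ 2 * M ^+ 2 = (k * M ^+ 4) * (y / x) by rewrite M4; ring.
    apply: (@le_trans _ _ (16 / 15 * (x * y) * (y / x))).
      by apply: ler_wpM2r => //; rewrite divr_ge0// ltW.
    have -> : 16 / 15 * (x * y) * (y / x) = 16 / 15 * y ^+ 2 by field; rewrite gt_eqF.
    by apply: ler_wpM2l.
  by rewrite ler_pM2r.
- apply: HD; first by rewrite divr_ge0// ltW.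
  have : k * (x / y) * M ^+ 2 * M ^+ 2 <= 16 / 15 * M ^+ 2.
    have -> : k * (x / y) * M ^+ 2 * M ^+ 2 = (k * M ^+ 4) * (x / y) by rewrite M4; ring.
    apply: (@le_trans _ _ (16 / 15 * (x * y) * (x / y))).
      by apply: ler_wpM2r => //; rewrite divr_ge0// ltW.
    have -> : 16 / 15 * (x * y) * (x / y) = 16 / 15 * x ^+ 2 by field; rewrite gt_eqF.
    by apply: ler_wpM2l.
  by rewrite ler_pM2r.
- by have := HD 1 ler01; rewrite mulr1; apply.
Qed.

(** The last hypothesis says that |a| and |b| are both comparable to M, so |a b| / M^2 >= 1/2 and
    the square of this ratio turns 1024 into 4096. *)
Lemma kap_lower J a b M : (`|a| <= M)%N -> (`|b| <= M)%N -> (0 < M)%N -> (4 * M < 2 ^ J)%N ->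
  (M ^ 2 <= 2 * (`|a| * `|b|))%N -> 4096^-1 <= kap J a b * `|a%:~R * b%:~R|.
Proof.
move=> aM bM M0 hJ hab; have := @kweight_lower R J _ _ M aM bM M0 hJ.
have nE (c : int) : `|c%:~R| = (`|c|%N)%:R :> R by rewrite -intr_norm -abszE.
rewrite normrM !nE -/(kap J a b).
have hab' : M%:R ^+ 2 <= 2 * (`|a|%:R * `|b|%:R) :> R by rewrite -natrX -!natrM ler_nat.
have Mp : 0 < M%:R ^+ 2 :> R by rewrite exprn_gt0// ltr0n.
set p : R := _%:R * _%:R in hab' *.
have p0 : 0 <= p by rewrite mulr_ge0// ler0n.
have -> : M%:R ^+ 4 = M%:R ^+ 2 * M%:R ^+ 2 :> R by rewrite -exprD.
set m := M%:R ^+ 2 in hab' Mp *.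
move=> h; apply: (@le_trans _ _ (p / (1024 * (m * m)) * p)); last exact: ler_wpM2r.
have -> : p / (1024 * (m * m)) * p = (p / m) * (p / m) / 1024 by field; rewrite gt_eqF.
have : 2^-1 <= p / m by rewrite ler_pdivlMr//; lra.
nra.
Qed.

(** These are the cross terms in a x * b x = (a x - e) (b x - f) + e b x + a x f - e f. Young's
    inequality puts half of the main term k |a b| x^2 on one side and the squares of the errors on
    the other, at the price of the weights k |b| / |a| and k |a| / |b|. *)
Lemma cross_term (k D a b x e f s : R) : 0 < `|a| -> 0 < `|b| -> 0 <= k -> `|s| <= 1 ->
  k * (`|b| / `|a|) <= D -> k * (`|a| / `|b|) <= D -> k <= D ->
  k * s * (e * (b * x) + (a * x) * f - e * f) <=
  2^-1 * (k * `|a * b| * x ^+ 2) + 2 * D * (e ^+ 2 + f ^+ 2).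
Proof.
move=> a0 b0 k0 s1 h1 h2 h3; rewrite normrM; move: a0 b0 h1 h2.
have e2 : e ^+ 2 = `|e| ^+ 2 by rewrite real_normK ?num_real.
have f2 : f ^+ 2 = `|f| ^+ 2 by rewrite real_normK ?num_real.
have x2 : x ^+ 2 = `|x| ^+ 2 by rewrite real_normK ?num_real.
have : s * (e * (b * x) + (a * x) * f - e * f) <=
   `|e| * (`|b| * `|x|) + `|a| * `|x| * `|f| + `|e| * `|f|.
  apply: le_trans (ler_norm _) _; rewrite normrM -[leRHS]mul1r.
  apply: ler_pM => //; apply: le_trans (ler_normB _ _) _; rewrite !normrM lerD2r.
  by apply: le_trans (ler_normD _ _) _; rewrite !normrM.
rewrite e2 f2 x2.
have := normr_ge0 e; have := normr_ge0 f; have := normr_ge0 x.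
move: `|a| `|b| `|e| `|f| `|x| => A B E F X X0 F0 E0 hs A0 B0 h1 h2.
apply: (@le_trans _ _ (k * (E * (B * X) + A * X * F + E * F))).
  by rewrite -mulrA; apply: ler_wpM2l.
have t1 : k * (E * (B * X)) <= 4^-1 * (k * (A * B) * X ^+ 2) + D * E ^+ 2.
  apply: (@le_trans _ _ (4^-1 * (k * (A * B) * X ^+ 2) + k * (B / A) * E ^+ 2)); last first.
    by rewrite lerD2l; apply: ler_wpM2r => //; exact: sqr_ge0.
  rewrite -subr_ge0.
  have -> : 4^-1 * (k * (A * B) * X ^+ 2) + k * (B / A) * E ^+ 2 - k * (E * (B * X)) =
      k * (B / A) * (2^-1 * A * X - E) ^+ 2 by field; rewrite gt_eqF.
  by apply: mulr_ge0; [apply: mulr_ge0 => //; apply: divr_ge0; exact: ltW|exact: sqr_ge0].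
have t2 : k * (A * X * F) <= 4^-1 * (k * (A * B) * X ^+ 2) + D * F ^+ 2.
  apply: (@le_trans _ _ (4^-1 * (k * (A * B) * X ^+ 2) + k * (A / B) * F ^+ 2)); last first.
    by rewrite lerD2l; apply: ler_wpM2r => //; exact: sqr_ge0.
  rewrite -subr_ge0.
  have -> : 4^-1 * (k * (A * B) * X ^+ 2) + k * (A / B) * F ^+ 2 - k * (A * X * F) =
      k * (A / B) * (2^-1 * B * X - F) ^+ 2 by field; rewrite gt_eqF.
  by apply: mulr_ge0; [apply: mulr_ge0 => //; apply: divr_ge0; exact: ltW|exact: sqr_ge0].
have t3 : k * (E * F) <= D * (E ^+ 2 + F ^+ 2).
  apply: ler_pM => //; first by rewrite mulr_ge0.
  by have := sqr_ge0 (E - F); have := sqr_ge0 (E + F); nra.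
rewrite !mulrDr in t3 *; lra.
Qed.

(* The Bourgain-Brezis estimate: weighting the product of the equations for a * mu
   and b * mu by [kap] turns the product of the two source terms into an integral
   against the bounded kernel of [sum_kernel_le]. *)
Lemma core_estimate (T : finType) J (ga gb th1 th2 : T -> R)
   (mc ms eac eas ebc ebs : int -> int -> R) :
  let N := (2 ^ J)%N in
  let ph a b x := a%:~R * th1 x + b%:~R * th2 x in
  (forall a b, a \in nzint N -> b \in nzint N ->
    [/\ a%:~R * mc a b = eac a b + \sum_x ga x * cos (ph a b x),
        a%:~R * ms a b = eas a b + \sum_x ga x * sin (ph a b x),
        b%:~R * mc a b = ebc a b + \sum_x gb x * cos (ph a b x) &
        b%:~R * ms a b = ebs a b + \sum_x gb x * sin (ph a b x)]) ->
  \sum_(a <- nzint N) \sum_(b <- nzint N) kap J a b * `|a%:~R * b%:~R| * (mc a b ^+ 2 + ms a b ^+ 2) <=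
  128 / 3 * (\sum_x `|ga x|) * (\sum_x `|gb x|) +
  128 / 15 * \sum_(a <- nzint N) \sum_(b <- nzint N)
     (eac a b ^+ 2 + eas a b ^+ 2 + ebc a b ^+ 2 + ebs a b ^+ 2) / (a%:~R ^+ 2 + b%:~R ^+ 2).
Proof.
move=> N ph h.
pose S F : R := \sum_(a <- nzint N) \sum_(b <- nzint N) F a b.
pose Ga_c a b := \sum_x ga x * cos (ph a b x).
pose Ga_s a b := \sum_x ga x * sin (ph a b x).
pose Gb_c a b := \sum_x gb x * cos (ph a b x).
pose Gb_s a b := \sum_x gb x * sin (ph a b x).
pose Q a b := kap J a b * `|a%:~R * b%:~R| * (mc a b ^+ 2 + ms a b ^+ 2).
pose E a b := (eac a b ^+ 2 + eas a b ^+ 2 + ebc a b ^+ 2 + ebs a b ^+ 2) / (a%:~R ^+ 2 + b%:~R ^+ 2).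
pose Gm a b := kap J a b * (sg a * sg b) * (Ga_c a b * Gb_c a b + Ga_s a b * Gb_s a b).
have hterm a b : a \in nzint N -> b \in nzint N ->
    Q a b <= Gm a b + 2^-1 * Q a b + 64 / 15 * E a b.
  move=> aN bN; have [h1 h2 h3 h4] := h a b aN bN.
  have := aN; rewrite mem_nzint => /andP[a0 _]; have := bN; rewrite mem_nzint => /andP[b0 _].
  have [u1 u2 u3] := kap_upper J a0 b0.
  have a0' : 0 < `|a%:~R : R| by rewrite normr_gt0 intr_eq0.
  have b0' : 0 < `|b%:~R : R| by rewrite normr_gt0 intr_eq0.
  have sab : `|sg a * sg b| <= 1.
    have hs c : `|sg c| <= 1 by rewrite /sg -intr_norm normr_sg; case: (_ != 0); rewrite ?lexx ?ler01.
    by rewrite normrM -[leRHS]mulr1; apply: ler_pM.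
  have ct x e f := @cross_term (kap J a b) _ a%:~R b%:~R x e f _ a0' b0' (kap_ge0 J a b) sab u1 u2 u3.
  have tc := ct (mc a b) (eac a b) (ebc a b).
  have ts := ct (ms a b) (eas a b) (ebs a b).
  (* The sign weights of the kernel turn a b into |a b|, which makes the quadratic form
     nonnegative. *)
  have eQ : Q a b = kap J a b * (sg a * sg b) * (a%:~R * mc a b * (b%:~R * mc a b) + a%:~R * ms a b * (b%:~R * ms a b)).
    by rewrite /Q normrM -!sgM; ring.
  have eE : 64 / 15 * E a b = 2 * (32 / 15 / (a%:~R ^+ 2 + b%:~R ^+ 2)) * (eac a b ^+ 2 + ebc a b ^+ 2)
     + 2 * (32 / 15 / (a%:~R ^+ 2 + b%:~R ^+ 2)) * (eas a b ^+ 2 + ebs a b ^+ 2).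
    by rewrite /E; ring.
  have eg : Gm a b = Q a b
     - kap J a b * (sg a * sg b) * (eac a b * (b%:~R * mc a b) + a%:~R * mc a b * ebc a b - eac a b * ebc a b)
     - kap J a b * (sg a * sg b) * (eas a b * (b%:~R * ms a b) + a%:~R * ms a b * ebs a b - eas a b * ebs a b).
    rewrite eQ h1 h2 h3 h4 /Gm -/(Ga_c a b) -/(Ga_s a b) -/(Gb_c a b) -/(Gb_s a b); ring.
  rewrite eg eE; rewrite /Q mulrDr; rewrite /Q mulrDr in eg; lra.
have hsum : S Q <= S Gm + 2^-1 * S Q + 64 / 15 * S E.
  rewrite /S !mulr_sumr -!big_split /= big_seq [leRHS]big_seq; apply: ler_sum => a aN.
  rewrite !mulr_sumr -!big_split /= big_seq [leRHS]big_seq; apply: ler_sum => b bN.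
  exact: hterm.
(* Products of cosines and sines recombine into cosines of differences, so the sum is the double sum
   of [ga x * gb y] against the bounded kernel at the difference of the two points. *)
have hG : S Gm <= 64 / 3 * ((\sum_x `|ga x|) * (\sum_x `|gb x|)).
  have -> : S Gm = \sum_x \sum_y (ga x * gb y) *
     (\sum_(a <- nzint N) \sum_(b <- nzint N) kap J a b * (sg a * sg b) *
        cos (a%:~R * (th1 x - th1 y) + b%:~R * (th2 x - th2 y))).
    have e a b : Gm a b = \sum_x \sum_y (ga x * gb y) * (kap J a b * (sg a * sg b) *
        cos (a%:~R * (th1 x - th1 y) + b%:~R * (th2 x - th2 y))).
      rewrite /Gm.
      have -> : Ga_c a b * Gb_c a b + Ga_s a b * Gb_s a b =
          \sum_x \sum_y (ga x * gb y) * cos (a%:~R * (th1 x - th1 y) + b%:~R * (th2 x - th2 y)).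
        rewrite /Ga_c /Gb_c /Ga_s /Gb_s !mulr_suml -big_split /=; apply: eq_bigr => x _.
        rewrite !mulr_sumr -big_split /=; apply: eq_bigr => y _.
        have -> : a%:~R * (th1 x - th1 y) + b%:~R * (th2 x - th2 y) = ph a b x - ph a b y.
          by rewrite /ph; ring.
        by rewrite cosB; ring.
      rewrite mulr_sumr; apply: eq_bigr => x _; rewrite mulr_sumr; apply: eq_bigr => y _; ring.
    rewrite /S; under eq_bigr do under eq_bigr do rewrite e.
    under eq_bigr do rewrite exchange_big /=.
    rewrite exchange_big /=; apply: eq_bigr => x _.
    under eq_bigr do rewrite exchange_big /=.
    rewrite exchange_big /=; apply: eq_bigr => y _.
    by rewrite mulr_sumr; apply: eq_bigr => a _; rewrite mulr_sumr.
  rewrite mulr_suml mulr_sumr; apply: ler_sum => x _; rewrite !mulr_sumr; apply: ler_sum => y _.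
  apply: le_trans (ler_norm _) _; rewrite !normrM mulrC; apply: ler_wpM2r.
    by rewrite mulr_ge0.
  exact: sum_kernel_le.
have : S Q <= 128 / 3 * ((\sum_x `|ga x|) * (\sum_x `|gb x|)) + 128 / 15 * S E by lra.
by rewrite mulrA.
Qed.

End Core.

(** * Minimisation in finite dimension *)

Section Minimise.
Variable R : realType.

Lemma expr_taylor (p : nat) (a b : R) : exists2 C : R, 0 <= C & forall t, `|t| <= 1 ->
  `|(a + t * b) ^+ p - a ^+ p - t * (p%:R * a ^+ p.-1 * b)| <= C * t ^+ 2.
Proof.
elim: p => [|p [C C0 hC]].
  by exists 0 => // t _; rewrite !expr0 subrr !mul0r mulr0 subr0 normr0.
exists (`|p%:R * a ^+ p.-1 * b ^+ 2| + (`|a| + `|b|) * C) => [|t t1].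
  by rewrite addr_ge0// mulr_ge0// addr_ge0.
set r := (a + t * b) ^+ p - a ^+ p - t * (p%:R * a ^+ p.-1 * b) in hC *.
have -> : (a + t * b) ^+ p.+1 - a ^+ p.+1 - t * (p.+1%:R * a ^+ p.+1.-1 * b) =
   p%:R * a ^+ p.-1 * b ^+ 2 * t ^+ 2 + (a + t * b) * ((a + t * b) ^+ p - a ^+ p - t * (p%:R * a ^+ p.-1 * b)).
  rewrite (exprS _ p) (exprS a p) -natr1 /=; case: p {hC r} => [|p] /=; first by rewrite !expr0; ring.
  by rewrite (exprS a p); ring.
apply: le_trans (ler_normD _ _) _; rewrite [leRHS]mulrDl; apply: lerD.
  by rewrite normrM (ger0_norm (sqr_ge0 _)).
rewrite normrM -[leRHS]mulrA; apply: ler_pM => //; last exact: hC.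
apply: le_trans (ler_normD _ _) _; rewrite lerD2l normrM -[leRHS]mul1r.
exact: ler_wpM2r.
Qed.

Lemma linear_coef_eq0 (B C : R) : (forall t, `|t| <= 1 -> 0 <= t * B + t ^+ 2 * C) -> B = 0.
Proof.
move=> h; apply/eqP; rewrite -normr_eq0; apply/negPn/negP => B0.
have Bp : 0 < `|B| by rewrite lt_def B0 /=.
pose e := Num.min 1 (`|B| / (2 * (`|C| + 1))).
have C1 : 0 < `|C| + 1 by have := normr_ge0 C; lra.
have e0 : 0 < e by rewrite lt_min ltr01 divr_gt0// mulr_gt0.
have e1 : e <= 1 by rewrite ge_min lexx.
have e2 : e * (2 * (`|C| + 1)) <= `|B|.
  by rewrite -ler_pdivlMr ?mulr_gt0// ge_min lexx orbT.
have := h (- Num.sg B * e); rewrite normrM normrN normr_sg (gtr0_norm e0).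
have Bn : B != 0 by rewrite -normr_eq0.
rewrite Bn mul1r => /(_ e1).
have -> : - Num.sg B * e * B = - (e * `|B|) by rewrite normrEsg; ring.
have -> : (- Num.sg B * e) ^+ 2 = e ^+ 2.
  by rewrite exprMn sqrrN sqr_sg Bn mul1r.
have := ler_norm C; nra.
Qed.

Lemma sum_pair (I J : finType) (F : I * J -> R) :
  \sum_p F p = \sum_i \sum_j F (i, j).
Proof. by rewrite pair_bigA; apply: eq_bigr => -[]. Qed.

Lemma continuous_sumr (X : topologicalType) (I : Type) (s : seq I) (F : I -> X -> R) :
  (forall i, continuous (F i)) -> continuous (fun x => \sum_(i <- s) F i x).
Proof.
move=> hF; elim: s => [|i s IH] x.
  rewrite (_ : (fun x => _) = (fun=> 0)); first exact: cvg_cst.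
  by apply/funext => y; rewrite big_nil.
rewrite (_ : (fun x => _) = (F i \+ (fun x => \sum_(j <- s) F j x))).
  by apply: continuousD; [exact: hF|exact: IH].
by apply/funext => y; rewrite big_cons.
Qed.

(** [w] parametrises an affine space of fields, [q] lists the square roots of the energies of the
    modes and [l] the penalised values. Coercivity gives a minimiser on a large cube by compactness,
    and outside the cube the functional exceeds its value at 0. *)
Lemma euler_lagrange (m : nat) (I S T : finType) (q0 : S -> R) (q1 : S -> I -> R)
    (l0 : T -> R) (l1 : T -> I -> R) (c : R) : 0 <= c -> (0 < m)%N ->
  let q w s := q0 s + \sum_i q1 s i * w i in
  let l w x := l0 x + \sum_i l1 x i * w i in
  (forall w : I -> R, \sum_i w i ^+ 2 <= \sum_s q w s ^+ 2) ->
  exists w : I -> R, forall i,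
    \sum_s q w s * q1 s i + c * \sum_x l w x ^+ (2 * m).-1 * l1 x i = 0.
Proof.
move=> c0 m0 q l coer.
pose E w := \sum_s q w s ^+ 2 / 2 + \sum_x c / (2 * m)%:R * l w x ^+ (2 * m).
have m2 : 0 < (2 * m)%:R :> R by rewrite ltr0n muln_gt0.
have Elow w : \sum_i w i ^+ 2 / 2 <= E w.
  rewrite -mulr_suml; apply: (@le_trans _ _ (\sum_s q w s ^+ 2 / 2)).
    by rewrite -mulr_suml; apply: ler_wpM2r => //; exact: coer.
  rewrite lerDl; apply: sumr_ge0 => x _; apply: mulr_ge0; first by rewrite divr_ge0// ltW.
  by rewrite exprM exprn_ge0// sqr_ge0.
pose vw (v : 'rV[R]_#|I|) (i : I) : R := v ord0 (enum_rank i).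
(* Outside the cube some coordinate gives energy more than B^2 / 2, which is at least the energy at
   0. *)
pose B := 2 * E (fun=> 0) + 1.
have E00 : 0 <= E (fun=> 0) by apply: le_trans (Elow _); apply: sumr_ge0 => i _; rewrite expr0n mul0r.
have B0 : 0 <= B by rewrite /B; lra.
pose A := [set v : 'rV[R]_#|I| | forall i, `[- B, B]%classic (v ord0 i)].
have cA : compact A.
  by apply: (@rV_compact R _ (fun=> `[- B, B]%classic)) => i; exact: segment_compact.
have A0 : A !=set0 by exists 0 => i /=; rewrite mxE in_itv /=; apply/andP; split; lra.
have caff (f0 : R) (f1 : I -> R) : continuous (fun v => f0 + \sum_i f1 i * vw v i).
  have cv i : continuous (fun v : 'rV[R]_#|I| => f1 i * vw v i).
    by move=> v; apply: (@continuousM _ _ (fun=> f1 i)); [exact: cst_continuous|exact: coord_continuous].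
  move=> v; apply: (@continuousD _ _ _ (fun=> f0) (fun v => \sum_i f1 i * vw v i)); first exact: cst_continuous.
  exact: continuous_sumr.
have cX n (f : 'rV[R]_#|I| -> R) : continuous f -> continuous (fun v => f v ^+ n).
  by move=> cf v; apply: (@continuous_comp _ _ _ f (fun x => x ^+ n)); [exact: cf|exact: exprn_continuous].
have cE : continuous (fun v => E (vw v)).
  move=> v; apply: continuousD; apply: continuous_sumr => s {}v.
  - by apply: (@continuousM _ _ (fun v => q (vw v) s ^+ 2) (fun=> 2^-1)); [apply: cX; exact: caff|exact: cst_continuous].
  - by apply: (@continuousM _ _ (fun=> c / (2 * m)%:R) (fun v => l (vw v) s ^+ (2 * m))); [exact: cst_continuous|apply: cX; exact: caff].
have [v vA vmin] := EVT_min_rV A0 cA (@continuous_subspaceT _ _ A _ cE).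
have gmin w : E (vw v) <= E w.
  pose u : 'rV[R]_#|I| := \row_i w (enum_val i).
  have uw : vw u = w by apply/funext => i; rewrite /vw mxE enum_rankK.
  have [uA|uA] := pselect (A u); first by rewrite -uw; apply: vmin; rewrite inE.
  apply: (@le_trans _ _ (E (fun=> 0))).
    have -> : (fun=> 0) = vw 0 by apply/funext => i; rewrite /vw mxE.
    by apply: vmin; rewrite inE => i /=; rewrite mxE in_itv /=; apply/andP; split; lra.
  move/existsNP : uA => [i /negP]; rewrite in_itv /= -ler_norml -ltNge mxE => hi.
  apply: le_trans (Elow w); rewrite (bigD1 (enum_val i))//=.
  have : 0 <= \sum_(j | j != enum_val i) w j ^+ 2 / 2 by apply: sumr_ge0 => j _; rewrite divr_ge0 ?sqr_ge0.
  have : B ^+ 2 <= w (enum_val i) ^+ 2.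
    by rewrite -(real_normK (num_real (w _))) lerXn2r ?nnegrE// ltW.
  by rewrite /B; nra.
exists (vw v) => i; set w := vw v in gmin *.
pose dlt t j := w j + t * (j == i)%:R.
have qd t s : q (dlt t) s = q w s + t * q1 s i.
  rewrite /q /dlt -addrA; congr (_ + _).
  under eq_bigr do rewrite mulrDr.
  rewrite big_split /=; congr (_ + _).
  by rewrite (bigD1 i) //= eqxx big1 ?addr0 => [|j /negbTE ->]; rewrite ?mulr1 ?mulr0 // mulrC.
have ld t x : l (dlt t) x = l w x + t * l1 x i.
  rewrite /l /dlt -addrA; congr (_ + _).
  under eq_bigr do rewrite mulrDr.
  rewrite big_split /=; congr (_ + _).
  by rewrite (bigD1 i) //= eqxx big1 ?addr0 => [|j /negbTE ->]; rewrite ?mulr1 ?mulr0 // mulrC.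
have /choice[Cx hCx] : forall x, exists C : R, 0 <= C /\ forall t, `|t| <= 1 ->
  `|(l w x + t * l1 x i) ^+ (2 * m) - l w x ^+ (2 * m) - t * ((2 * m)%:R * l w x ^+ (2 * m).-1 * l1 x i)| <= C * t ^+ 2.
  by move=> x; have [C C0 hC] := expr_taylor (2 * m) (l w x) (l1 x i); exists C.
apply: (@linear_coef_eq0 _ (\sum_s q1 s i ^+ 2 / 2 + \sum_x c / (2 * m)%:R * Cx x)) => t t1.
have := gmin (dlt t); rewrite -subr_ge0 => /le_trans; apply.
rewrite /E; under [X in X + _ - _]eq_bigr do rewrite qd.
under [X in _ + X - _]eq_bigr do rewrite ld.
rewrite opprD addrACA -!sumrB !mulrDr addrACA; apply: lerD.
- rewrite !mulr_sumr -big_split /=; by apply: ler_sum => s _; apply: eq_ler; field.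
- rewrite !mulr_sumr -big_split /=; apply: ler_sum => x _.
  have [C0 /(_ t t1)] := hCx x; rewrite ler_norml => /andP[_ h].
  have -> : t * (c * (l w x ^+ (2 * m).-1 * l1 x i)) + t ^+ 2 * (c / (2 * m)%:R * Cx x) =
     c / (2 * m)%:R * (t * ((2 * m)%:R * l w x ^+ (2 * m).-1 * l1 x i) + Cx x * t ^+ 2).
    by move: m2; move: (2 * m)%:R (l w x ^+ (2 * m).-1) => M X M0; field; rewrite gt_eqF.
  rewrite -mulrBr; apply: ler_wpM2l; first by rewrite divr_ge0// ltW.
  by move: h; lra.
Qed.

Lemma sum_subset (K : eqType) (s t : seq K) (F : K -> R) : uniq s -> {subset s <= t} ->
  (forall k, 0 <= F k) -> \sum_(k <- s) F k <= \sum_(k <- t) F k.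
Proof.
move=> us st F0; elim: s t us st => [|x s IH] t /=.
  by move=> _ _; rewrite big_nil; apply: sumr_ge0.
move=> /andP[xs us] st.
have xt : x \in t by apply: st; rewrite inE eqxx.
rewrite big_cons (perm_big _ (perm_to_rem xt)) big_cons /= lerD2l; apply: IH => // y ys.
apply: rem_mem; first by apply: contraNneq xs => <-.
by apply: st; rewrite inE ys orbT.
Qed.

End Minimise.

(** * Euler-Lagrange equations for the Fourier modes *)

Section Modes.
Variable R : realType.
Local Notation freq := (@frequency R).
Local Notation freq2 := (@frequency_sqr R).

Definition trig (s : bool) (t : R) : R := if s then sin t else cos t.

(** In [z s b k], [s] selects the coefficient of the sine or of the cosine and [b] the component of
    the field. *)
Definition modes (K : seq (int * int)) (z : bool -> bool -> int * int -> R) (b : bool) (x : R * R) : R :=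
  \sum_(k <- K) \sum_s z s b k * trig s (phase k x).

Lemma sum_bool (F : bool -> R) : \sum_b F b = F false + F true.
Proof. by rewrite big_bool addrC. Qed.

Lemma freq2_ge1 k : k != 0 -> 1 <= freq2 k.
Proof.
move=> k0; have := freq2_neq0 R k0; have -> : freq2 k = (k.1 ^+ 2 + k.2 ^+ 2)%:~R.
  by rewrite /frequency_sqr /frequency intrD !rmorphXn.
rewrite intr_eq0 => h; rewrite -[1]/(1%:~R) ler_int.
have : 0 <= k.1 ^+ 2 + k.2 ^+ 2 by rewrite addr_ge0 ?sqr_ge0.
by rewrite le_eqVlt eq_sym (negbTE h) /= => h'; rewrite -gtz0_ge1.
Qed.

(* Euler-Lagrange equations for minimising the Dirichlet energy plus a (2m)-th power
   penalisation of the values at finitely many points, under div z = (cc, dd);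
   [mu] is the Lagrange multiplier. *)
Lemma modes_euler_lagrange (K : seq (int * int)) (cc dd : int * int -> R) (T : finType)
    (pts : T -> R * R) (c : R) (m : nat) :
  uniq K -> 0 \notin K -> 0 <= c -> (0 < m)%N ->
  exists (z : bool -> bool -> int * int -> R) (mu : bool -> int * int -> R),
  (forall k, k \in K -> \sum_b freq b k * z true b k = cc k /\ \sum_b freq b k * z false b k = - dd k) /\
  (forall k s b, k \in K -> freq2 k * z s b k +
     \sum_x c * modes K z b (pts x) ^+ (2 * m).-1 * trig s (phase k (pts x)) = freq b k * mu s k).
Proof.
move=> uK K0 c0 m0.
pose kk (i : 'I_(size K)) := nth 0 K i.
have kkK i : kk i \in K by rewrite mem_nth.
have kn0 k : k \in K -> freq2 k != 0.
  by move=> kK; apply: freq2_neq0; apply: contraNneq K0 => <-.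
have kge1 k : k \in K -> 1 <= freq2 k.
  by move=> kK; apply: freq2_ge1; apply: contraNneq K0 => <-.
pose rt k := Num.sqrt (freq2 k).
have rt2 k : rt k * rt k = freq2 k by rewrite -expr2 sqr_sqrtr// addr_ge0 ?sqr_ge0.
(* [z0] is the curl-free field with the prescribed divergence; every admissible field differs from
   it by a multiple of the vector [kp] perpendicular to k, mode by mode. *)
pose z0 (s b : bool) k : R := if s then freq b k * cc k / freq2 k else - (freq b k * dd k / freq2 k).
pose kp (b : bool) k := if b then freq false k else - freq true k.
pose I := ('I_(size K) * bool)%type.
pose q0 (t : I * bool) := rt (kk t.1.1) * z0 t.1.2 t.2 (kk t.1.1).
pose q1 (t : I * bool) (p : I) : R := if p == t.1 then rt (kk t.1.1) * kp t.2 (kk t.1.1) else 0.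
pose l0 (t : T * bool) := \sum_(p : I) z0 p.2 t.2 (kk p.1) * trig p.2 (phase (kk p.1) (pts t.1)).
pose l1 (t : T * bool) (p : I) := kp t.2 (kk p.1) * trig p.2 (phase (kk p.1) (pts t.1)).
have qE (w : I -> R) t : q0 t + \sum_p q1 t p * w p = rt (kk t.1.1) * (z0 t.1.2 t.2 (kk t.1.1) + kp t.2 (kk t.1.1) * w t.1).
  rewrite (bigD1 t.1) //= big1 => [|p /negbTE h]; last by rewrite /q1 h mul0r.
  by rewrite /q1 eqxx addr0 /q0 mulrDr mulrA.
(* [z0] is orthogonal to [kp], so the energy of a mode is |k|^2 (|z0|^2 + |k|^2 w^2), and |k|^2 is
   at least 1 on nonzero frequencies. *)
have coer (w : I -> R) : \sum_p w p ^+ 2 <= \sum_t (q0 t + \sum_p q1 t p * w p) ^+ 2.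
  rewrite (sum_pair (fun t => (q0 t + \sum_p q1 t p * w p) ^+ 2)).
  apply: ler_sum => p _; rewrite sum_bool !qE /=.
  have h1 := kge1 _ (kkK p.1); have hn := kn0 _ (kkK p.1).
  have rt22 k : rt k ^+ 2 = freq2 k by rewrite expr2 rt2.
  rewrite !exprMn rt22 -mulrDr.
  have -> : (z0 p.2 false (kk p.1) + - freq true (kk p.1) * w p) ^+ 2 + (z0 p.2 true (kk p.1) + freq false (kk p.1) * w p) ^+ 2
     = (z0 p.2 false (kk p.1) ^+ 2 + z0 p.2 true (kk p.1) ^+ 2) + freq2 (kk p.1) * w p ^+ 2.
    by move: hn; rewrite /z0 /frequency_sqr; case: (p.2) => hn; field; exact: hn.
  have w2 : 0 <= w p ^+ 2 by exact: sqr_ge0.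
  apply: (@le_trans _ _ (freq2 (kk p.1) * w p ^+ 2)); first by rewrite -[leLHS]mul1r; apply: ler_wpM2r.
  rewrite -[leLHS]mul1r; apply: ler_pM => //; first by rewrite mulr_ge0// (le_trans ler01).
  by rewrite lerDr addr_ge0 ?sqr_ge0.
have [w hw] := @euler_lagrange R m _ _ _ q0 q1 l0 l1 c c0 m0 coer.
pose W s k := \sum_(i < size K | kk i == k) w (i, s).
have WE i s : W s (kk i) = w (i, s).
  by rewrite /W (big_pred1 i) // => j; rewrite nth_uniq.
pose z (s b : bool) k := z0 s b k + kp b k * W s k.
have FE b x : modes K z b (pts x) = l0 (x, b) + \sum_p l1 (x, b) p * w p.
  rewrite /l0 /l1 -big_split /= /modes (big_nth 0) big_mkord.
  rewrite (sum_pair (fun p : I => z0 p.2 b (kk p.1) * trig p.2 (phase (kk p.1) (pts x)) +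
     kp b (kk p.1) * trig p.2 (phase (kk p.1) (pts x)) * w p)).
  apply: eq_bigr => i _; apply: eq_bigr => s _ /=.
  by rewrite /z -/(kk i) WE; ring.
pose lam (s b : bool) k := freq2 k * z s b k + \sum_x c * modes K z b (pts x) ^+ (2 * m).-1 * trig s (phase k (pts x)).
(* Stationarity says that the vector [lam] is orthogonal to [kp], hence parallel to k; the
   multiplier is the coefficient (k . lam) / |k|^2. *)
exists z, (fun s k => (freq false k * lam s false k + freq true k * lam s true k) / freq2 k); split.
  move=> k kK; have := kn0 k kK; rewrite !sum_bool /z /z0 /kp /frequency_sqr => hn.
  by split; field; exact: hn.
move=> k s b kK; rewrite -/(lam s b k).
have [i ik] : exists i, kk i = k.
  by exists (Ordinal (eq_ind_r is_true kK (index_mem k K))); rewrite /kk /= nth_index.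
have orth : kp false k * lam s false k + kp true k * lam s true k = 0.
  have := hw (i, s).
  rewrite (sum_pair (fun t => (q0 t + \sum_p q1 t p * w p) * q1 t (i, s))).
  rewrite (_ : \sum_i0 \sum_j _ = \sum_j (q0 (i, s, j) + \sum_p q1 (i, s, j) p * w p) * q1 (i, s, j) (i, s)); last first.
    rewrite (bigD1 (i, s)) //= -[RHS]addr0; congr (_ + _); apply: big1 => p /negbTE h.
    by rewrite big1// => b' _; rewrite /q1 /= eq_sym h mulr0.
  rewrite sum_bool !qE /q1 /= eqxx.
  rewrite (sum_pair (fun t => (l0 t + \sum_p l1 t p * w p) ^+ (2 * m).-1 * l1 t (i, s))).
  rewrite ik => <-.
  have zE b' : z s b' k = z0 s b' k + kp b' k * w (i, s) by rewrite /z -ik WE.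
  pose Sb (b' : bool) := \sum_x c * modes K z b' (pts x) ^+ (2 * m).-1 * trig s (phase k (pts x)).
  transitivity ((kp false k * (freq2 k * z s false k) + kp true k * (freq2 k * z s true k)) +
     (kp false k * Sb false + kp true k * Sb true)).
    have lamE b' : lam s b' k = freq2 k * z s b' k + Sb b' by [].
    by rewrite /kp !lamE; move: (Sb _) (Sb _) (z _ _ _) (z _ _ _) => u1 u2 u3 u4; ring.
  congr (_ + _); first by rewrite !zE /kp -!rt2; ring.
  rewrite /Sb !mulr_sumr -big_split /=; apply: eq_bigr => x _.
  by rewrite sum_bool /l1 /= ik !FE /kp; ring.
have hn := kn0 k kK.
rewrite /kp in orth; apply: (mulIf hn); rewrite [in RHS]mulrA divfK//.
rewrite /frequency_sqr; case: b.
- have -> : lam s true k * (freq false k ^+ 2 + freq true k ^+ 2) =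
    freq true k * (freq false k * lam s false k + freq true k * lam s true k)
    + freq false k * (- freq true k * lam s false k + freq false k * lam s true k) by ring.
  by rewrite orth mulr0 addr0.
- have -> : lam s false k * (freq false k ^+ 2 + freq true k ^+ 2) =
    freq false k * (freq false k * lam s false k + freq true k * lam s true k)
    - freq true k * (- freq true k * lam s false k + freq false k * lam s true k) by ring.
  by rewrite orth mulr0 subr0.
Qed.

(** [tau] is a change of variables on frequencies: a and b are linear forms of k = [tau a b] with
    coefficients [p] and [q], and the same combinations of the two component equations give
    equations for a mu and b mu, to which [core_estimate] applies. The constant 43 rounds up 128/3,
    and 103 rounds up 12 * 128/15, where 12 collects four error terms and the factor 3 of the
    comparison of squared lengths. *)
Lemma pair_estimate (K : seq (int * int)) (z : bool -> bool -> int * int -> R) (mu : bool -> int * int -> R)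
   (T : finType) (pts : T -> R * R) (g : bool -> T -> R) J
   (tau : int -> int -> int * int) (th1 th2 : T -> R) (p q : bool -> R) :
  (forall k s b, k \in K -> freq2 k * z s b k + \sum_x g b x * trig s (phase k (pts x)) = freq b k * mu s k) ->
  (forall a b x, phase (tau a b) (pts x) = a%:~R * th1 x + b%:~R * th2 x) ->
  (forall a b, a \in nzint (2 ^ J) -> b \in nzint (2 ^ J) -> tau a b \in K) ->
  (forall a b, a%:~R = \sum_c p c * freq c (tau a b)) ->
  (forall a b, b%:~R = \sum_c q c * freq c (tau a b)) ->
  (forall c, 0 <= p c <= 1) -> (forall c, 0 <= q c <= 1) ->
  (forall a b, freq2 (tau a b) <= 3 * (a%:~R ^+ 2 + b%:~R ^+ 2)) ->
  (forall a b a' b', tau a b = tau a' b' -> a = a' /\ b = b') ->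
  \sum_(a <- nzint (2 ^ J)) \sum_(b <- nzint (2 ^ J))
     kap R J a b * `|a%:~R * b%:~R| * \sum_s mu s (tau a b) ^+ 2 <=
  43 * (\sum_b \sum_x `|g b x|) ^+ 2 + 103 * \sum_(k <- K) freq2 k * \sum_s \sum_b z s b k ^+ 2.
Proof.
move=> hEL hph hK hp hq p01 q01 hf inj.
set G := \sum_b \sum_x `|g b x|.
pose gp (r : bool -> R) x := \sum_c r c * g c x.
pose ep (r : bool -> R) s a b := freq2 (tau a b) * \sum_c r c * z s c (tau a b).
have lin (r : bool -> R) s a b : a \in nzint (2 ^ J) -> b \in nzint (2 ^ J) ->
   (\sum_c r c * freq c (tau a b)) * mu s (tau a b) =
   ep r s a b + \sum_x gp r x * trig s (a%:~R * th1 x + b%:~R * th2 x).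
  move=> aN bN; rewrite mulr_suml /ep mulr_sumr /gp.
  have -> : \sum_x (\sum_c r c * g c x) * trig s (a%:~R * th1 x + b%:~R * th2 x) =
     \sum_c r c * \sum_x g c x * trig s (phase (tau a b) (pts x)).
    under eq_bigr do rewrite mulr_suml.
    rewrite exchange_big /=; apply: eq_bigr => c _; rewrite mulr_sumr; apply: eq_bigr => x _.
    by rewrite hph mulrA.
  rewrite -big_split /=; apply: eq_bigr => c _; rewrite -mulrA -hEL ?hK//; ring.
have h4 a b : a \in nzint (2 ^ J) -> b \in nzint (2 ^ J) ->
    [/\ a%:~R * mu false (tau a b) = ep p false a b + \sum_x gp p x * cos (a%:~R * th1 x + b%:~R * th2 x),
        a%:~R * mu true (tau a b) = ep p true a b + \sum_x gp p x * sin (a%:~R * th1 x + b%:~R * th2 x),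
        b%:~R * mu false (tau a b) = ep q false a b + \sum_x gp q x * cos (a%:~R * th1 x + b%:~R * th2 x) &
        b%:~R * mu true (tau a b) = ep q true a b + \sum_x gp q x * sin (a%:~R * th1 x + b%:~R * th2 x)].
  move=> aN bN.
  have hp' s : a%:~R * mu s (tau a b) = ep p s a b + \sum_x gp p x * trig s (a%:~R * th1 x + b%:~R * th2 x).
    by rewrite -lin// -hp.
  have hq' s : b%:~R * mu s (tau a b) = ep q s a b + \sum_x gp q x * trig s (a%:~R * th1 x + b%:~R * th2 x).
    by rewrite -lin// -hq.
  by split; [exact: (hp' false)|exact: (hp' true)|exact: (hq' false)|exact: (hq' true)].
have := @core_estimate R T J (gp p) (gp q) th1 th2 (fun a b => mu false (tau a b)) (fun a b => mu true (tau a b))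
  (ep p false) (ep p true) (ep q false) (ep q true) h4.
under eq_bigr do under eq_bigr do rewrite -[_ ^+ 2 + _ ^+ 2](sum_bool (fun s => mu s _ ^+ 2)).
move=> /le_trans; apply.
have G0 : 0 <= G by apply: sumr_ge0 => b _; apply: sumr_ge0.
have hG (r : bool -> R) : (forall c, 0 <= r c <= 1) -> \sum_x `|gp r x| <= G.
  move=> r01; rewrite /G exchange_big /=; apply: ler_sum => x _.
  apply: le_trans (ler_norm_sum _ _ _) _; apply: ler_sum => c _.
  have /andP[r0 r1] := r01 c; rewrite normrM (ger0_norm r0) -[leRHS]mul1r.
  exact: ler_wpM2r.
set X := \sum_(k <- K) _.
have hX : \sum_(a <- nzint (2 ^ J)) \sum_(b <- nzint (2 ^ J))
   (ep p false a b ^+ 2 + ep p true a b ^+ 2 + ep q false a b ^+ 2 + ep q true a b ^+ 2) / (a%:~R ^+ 2 + b%:~R ^+ 2) <= 12 * X.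
  pose Fx k := freq2 k * \sum_s \sum_b z s b k ^+ 2.
  have Fx0 k : 0 <= Fx k.
    rewrite mulr_ge0 ?addr_ge0 ?sqr_ge0//; apply: sumr_ge0 => s _; apply: sumr_ge0 => b _; exact: sqr_ge0.
  apply: (@le_trans _ _ (12 * \sum_(k <- [seq tau a b | a <- nzint (2 ^ J), b <- nzint (2 ^ J)]) Fx k)); last first.
    apply: ler_wpM2l => //; apply: sum_subset => //.
    - apply: allpairs_uniq; rewrite ?uniq_nzint// => -[a b] [a' b'] _ _ /= /inj[-> ->] //.
    - by move=> _ /allpairsP[[a b] /= [aN bN ->]]; exact: hK.
  rewrite big_allpairs_dep /= mulr_sumr big_seq [leRHS]big_seq; apply: ler_sum => a aN.
  rewrite mulr_sumr big_seq [leRHS]big_seq; apply: ler_sum => b bN.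
  have := aN; rewrite mem_nzint => /andP[a0 _].
  have q0 : 0 < a%:~R ^+ 2 + b%:~R ^+ 2 :> R.
    by rewrite ltr_pwDl ?sqr_ge0// lt_def sqr_ge0 andbT sqrf_eq0 intr_eq0.
  rewrite ler_pdivrMr//.
  have ep2 (r : bool -> R) s : (forall c, 0 <= r c <= 1) ->
      ep r s a b ^+ 2 <= freq2 (tau a b) ^+ 2 * (2 * \sum_c z s c (tau a b) ^+ 2).
    move=> r01; rewrite /ep exprMn; apply: ler_wpM2l; first exact: sqr_ge0.
    rewrite !sum_bool; have /andP[u0 u1] := r01 false; have /andP[v0 v1] := r01 true.
    move: (r false) (r true) (z s false _) (z s true _) u0 u1 v0 v1 => u v x y u0 u1 v0 v1.
    have h1 : (u * x) ^+ 2 <= x ^+ 2.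
      by rewrite exprMn -[leRHS]mul1r; apply: ler_wpM2r; [exact: sqr_ge0|rewrite expr_le1].
    have h2 : (v * y) ^+ 2 <= y ^+ 2.
      by rewrite exprMn -[leRHS]mul1r; apply: ler_wpM2r; [exact: sqr_ge0|rewrite expr_le1].
    have := sqr_ge0 (u * x - v * y); rewrite !sqrrB !sqrrD; lra.
  have := ep2 p false p01; have := ep2 p true p01; have := ep2 q false q01; have := ep2 q true q01.
  have := hf a b; rewrite /Fx !(sum_bool (fun s => \sum_b z s b _ ^+ 2)).
  have : 0 <= freq2 (tau a b) by rewrite addr_ge0 ?sqr_ge0.
  have : 0 <= \sum_c z false c (tau a b) ^+ 2 by apply: sumr_ge0 => c _; exact: sqr_ge0.
  have : 0 <= \sum_c z true c (tau a b) ^+ 2 by apply: sumr_ge0 => c _; exact: sqr_ge0.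
  move: (\sum_c _) (\sum_c _) (freq2 _) (_ + _) q0 => u v f s s0 u0 v0 f0 hfs e1 e2 e3 e4.
  apply: (@le_trans _ _ (4 * (f ^+ 2 * (u + v)))); first by rewrite mulrDr; lra.
  have : f * (u + v) * f <= f * (u + v) * (3 * s).
    by apply: ler_wpM2l => //; rewrite mulr_ge0// addr_ge0.
  by rewrite expr2; lra.
have hGG : (\sum_x `|gp p x|) * (\sum_x `|gp q x|) <= G ^+ 2.
  by rewrite expr2; apply: ler_pM; rewrite ?hG// sumr_ge0.
have X0 : 0 <= X.
  apply: sumr_ge0 => k _; rewrite mulr_ge0 ?addr_ge0 ?sqr_ge0//.
  by apply: sumr_ge0 => s _; apply: sumr_ge0 => b _; exact: sqr_ge0.
have G2 := sqr_ge0 G.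
rewrite -mulrA; lra.
Qed.

End Modes.

(** * Values on a grid and pairs of comparable frequencies *)

Section BourgainBrezis.
Variable R : realType.
Local Notation freq := (@frequency R).
Local Notation freq2 := (@frequency_sqr R).

Lemma sin_le_norm (t : R) : `|sin t| <= `|t|.
Proof.
wlog t0 : t / 0 <= t.
  move=> H; case: (leP 0 t) => [|/ltW]; first exact: H.
  by rewrite -oppr_ge0 => /H; rewrite sinN !normrN.
have cs : continuous (@sin R) by exact: continuous_sin.
have [->|tn] := eqVneq t 0; first by rewrite sin0.
have tp : 0 < t by rewrite lt_def tn.
have [c _] := @MVT R (@sin R) (@cos R) 0 t tp (fun x _ => is_derive_sin x) (@continuous_subspaceT _ _ _ _ cs).
rewrite sin0 !subr0 => ->; rewrite normrM -[leRHS]mul1r; apply: ler_wpM2r => //.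
by rewrite ler_norml cos_geN1 cos_le1.
Qed.

Lemma trig_lipschitz s (u v : R) : `|trig s u - trig s v| <= `|u - v|.
Proof.
have b1 (w : R) : `|cos w| <= 1 by rewrite ler_norml cos_geN1 cos_le1.
have b2 (w : R) : `|sin w| <= 1 by rewrite ler_norml sin_geN1 sin_le1.
have main (w1 w2 : R) : `|w2| <= 1 -> `|2 * sin ((u - v) / 2) * w2| <= `|u - v|.
  move=> h; rewrite !normrM (ger0_norm (_ : 0 <= 2))//.
  have := sin_le_norm ((u - v) / 2); rewrite normrM (ger0_norm (_ : 0 <= 2^-1)) ?invr_ge0// => h'.
  apply: (@le_trans _ _ (2 * (`|u - v| / 2) * 1)); last by lra.
  by apply: ler_pM => //; rewrite ?mulr_ge0//; apply: ler_wpM2l.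
have eu : u = (u + v) / 2 + (u - v) / 2 by field.
have ev : v = (u + v) / 2 - (u - v) / 2 by field.
case: s; rewrite /trig.
- have -> : sin u - sin v = 2 * sin ((u - v) / 2) * cos ((u + v) / 2).
    by rewrite [in sin u]eu [in sin v]ev sinD sinB; ring.
  exact: main.
- have -> : cos u - cos v = 2 * sin ((u - v) / 2) * - sin ((u + v) / 2).
    by rewrite [in cos u]eu [in cos v]ev cosD cosB; ring.
  by apply: main => //; rewrite normrN.
Qed.

Definition mode_poly (K : seq (int * int)) (z : bool -> bool -> int * int -> R) (b : bool) : tpoly R :=
  [seq ((z false b k -i* z true b k)%C, k) | k <- K].

Lemma modesE K z b x : modes K z b x = tev (mode_poly K z b) x.
Proof.
rewrite /modes /tev Re_sum /mode_poly big_map; apply: eq_bigr => k _.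
by rewrite sum_bool ReM /trig /=; ring.
Qed.

(** Euclidean division by [n] of the integer part of n x / (2 pi) gives the grid index and the
    number of periods. *)
Lemma grid_near (n : nat) (x : R) : (0 < n)%N ->
  exists (i : 'I_n) (q : int), `|x - (2 * pi * i%:R / n%:R + 2 * pi * q%:~R)| <= 2 * pi / n%:R.
Proof.
move=> n0; have np : 0 < n%:R :> R by rewrite ltr0n.
have p0 : 0 < pi :> R by exact: pi_gt0.
pose w := x * n%:R / (2 * pi).
have /andP[h1 h2] := floor_itv w; set f := Num.floor w in h1 h2.
have nz : n%:Z != 0 by rewrite eqz_nat -lt0n.
have fe := divz_eq f n.
have m0 : (0 <= (f %% n)%Z)%R by rewrite modz_ge0.
have mn : ((f %% n)%Z < n%:Z)%R by rewrite ltz_mod.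
have [i hi] : exists i : 'I_n, (i : nat)%:Z = (f %% n)%Z.
  case: (f %% n)%Z m0 mn => // j _ jn; have jn' : (j < n)%N by [].
  by exists (Ordinal jn').
exists i, (f %/ n)%Z.
have -> : 2 * pi * i%:R / n%:R + 2 * pi * (f %/ n)%Z%:~R = 2 * pi / n%:R * f%:~R :> R.
  rewrite [in RHS]fe -hi intrD intrM /=; field; by rewrite gt_eqF.
have -> : x = 2 * pi / n%:R * w.
  rewrite /w; move: (pi : R) p0 => P P0; field.
  by rewrite !gt_eqF.
have e0 : 0 <= 2 * pi / n%:R :> R by rewrite divr_ge0 ?mulr_ge0 ?(ltW p0) ?(ltW np).
rewrite -mulrBr normrM (ger0_norm e0) -[leRHS]mulr1.
apply: ler_wpM2l; first exact: e0.
by rewrite ler_norml; rewrite intrD in h2; apply/andP; split; lra.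
Qed.

(** Unit Dirichlet energy bounds |k| times each coefficient by one. The number of modes enters the
    constant harmlessly, since the grid is chosen after [K]. *)
Lemma modes_lipschitz K z b (x y : R * R) (h : R) :
  0 <= h -> `|x.1 - y.1| <= h -> `|x.2 - y.2| <= h ->
  \sum_(k <- K) freq2 k * \sum_s \sum_b z s b k ^+ 2 <= 1 ->
  `|modes K z b x - modes K z b y| <= 4 * (size K)%:R * h.
Proof.
move=> h0 h1 h2 hz.
have F0 k : 0 <= freq2 k * \sum_s \sum_b z s b k ^+ 2.
  rewrite mulr_ge0 ?addr_ge0 ?sqr_ge0//; apply: sumr_ge0 => s _; apply: sumr_ge0 => c _; exact: sqr_ge0.
have hk k s : k \in K -> `|z s b k * (trig s (phase k x) - trig s (phase k y))| <= 2 * h.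
  move=> kK; have hk1 : freq2 k * z s b k ^+ 2 <= 1.
    apply: le_trans hz; rewrite (perm_big _ (perm_to_rem kK)) big_cons /=.
    rewrite -[leLHS]addr0; apply: lerD; last by apply: sumr_ge0.
    apply: ler_wpM2l; first by rewrite addr_ge0 ?sqr_ge0.
    rewrite (bigD1 s)//= (bigD1 b)//= -addrA lerDl addr_ge0//; apply: sumr_ge0 => *; rewrite ?sqr_ge0//.
    by apply: sumr_ge0 => *; rewrite sqr_ge0.
  have : `|z s b k * (trig s (phase k x) - trig s (phase k y))| <= `|z s b k| * `|phase k x - phase k y|.
    by rewrite normrM; apply: ler_wpM2l => //; exact: trig_lipschitz.
  move=> /le_trans; apply; rewrite -normrM -(@ler_pXn2r _ 2)// ?nnegrE ?mulr_ge0//.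
  rewrite real_normK ?num_real//.
  have -> : phase k x - phase k y = freq false k * (x.1 - y.1) + freq true k * (x.2 - y.2).
    by rewrite /phase /frequency; ring.
  have d1 : (x.1 - y.1) ^+ 2 <= h ^+ 2 by rewrite -(real_normK (num_real (_ - _))) lerXn2r// nnegrE.
  have d2 : (x.2 - y.2) ^+ 2 <= h ^+ 2 by rewrite -(real_normK (num_real (_ - _))) lerXn2r// nnegrE.
  move: hk1; rewrite /frequency_sqr; move: (freq false k) (freq true k) (z s b k) (x.1 - y.1) (x.2 - y.2) d1 d2.
  move=> u v w d e d1 d2 hw.
  have cs : (u * d + v * e) ^+ 2 <= (u ^+ 2 + v ^+ 2) * (d ^+ 2 + e ^+ 2).
    by have := sqr_ge0 (u * e - v * d); nra.
  apply: (@le_trans _ _ (w ^+ 2 * ((u ^+ 2 + v ^+ 2) * (d ^+ 2 + e ^+ 2)))).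
    by rewrite exprMn; apply: ler_wpM2l => //; exact: sqr_ge0.
  apply: (@le_trans _ _ (1 * (d ^+ 2 + e ^+ 2))).
    by rewrite mulrA [w ^+ 2 * _]mulrC; apply: ler_wpM2r => //; rewrite addr_ge0 ?sqr_ge0.
  have := sqr_ge0 h; rewrite exprMn; lra.
rewrite /modes -sumrB; apply: le_trans (ler_norm_sum _ _ _) _.
apply: (@le_trans _ _ (\sum_(k <- K) (4 * h))).
  rewrite big_seq [leRHS]big_seq; apply: ler_sum => k kK.
  rewrite -sumrB sum_bool -!mulrBr; apply: le_trans (ler_normD _ _) _.
  have := hk k false kK; have := hk k true kK; lra.
by rewrite big_const_seq count_predT iter_addr addr0 -mulr_natr; apply: eq_ler; ring.
Qed.

(* The three pairs (k1, k2), (k1, k1 + k2), (k2, k1 + k2): in one of them the two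
   entries are comparable, which is where [kap] is bounded below. *)
Definition pair_a (t : nat) (k : int * int) : int := if t == 2%N then k.2 else k.1.
Definition pair_b (t : nat) (k : int * int) : int := if t == 0%N then k.2 else k.1 + k.2.
Definition pair_tau (t : nat) (a b : int) : int * int :=
  if t == 0%N then (a, b) else if t == 1%N then (a, b - a) else (b - a, a).

Lemma pair_tauK t k : (t < 3)%N -> pair_tau t (pair_a t k) (pair_b t k) = k.
Proof.
by case: k => k1 k2; rewrite /pair_tau /pair_a /pair_b; case: t => [|[|[|t]]] //= _; congr (_, _); ring.
Qed.

Lemma pair_abK t (a b : int) : (t < 3)%N -> pair_a t (pair_tau t a b) = a /\ pair_b t (pair_tau t a b) = b.
Proof.
by rewrite /pair_tau /pair_a /pair_b; case: t => [|[|[|t]]] //= _; split=> //; ring.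
Qed.

(** By the triangle inequality the two largest of |k1|, |k2|, |k1 + k2| differ at most by a factor
    two. *)
Lemma good_pair (k : int * int) : k != 0 -> exists2 t : nat, (t < 3)%N &
  let a := `|pair_a t k|%N in let b := `|pair_b t k|%N in
  (0 < maxn a b)%N && (maxn a b ^ 2 <= 2 * (a * b))%N.
Proof.
case: k => k1 k2; rewrite -pair_eqE /= => h.
have [x hx] : exists x, x = `|k1|%N by exists `|k1|%N.
have [y hy] : exists y, y = `|k2|%N by exists `|k2|%N.
have [w hw] : exists w, w = `|(k1 + k2)%R|%N by exists `|(k1 + k2)%R|%N.
have xyw : [/\ (w <= x + y)%N, (x <= w + y)%N, (y <= w + x)%N & (0 < x + y)%N].
  split; rewrite hx hy ?hw; lia.
have [h1 h2 h3 h4] := xyw.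
have key a b : (a <= 2 * b)%N -> (b <= 2 * a)%N -> (0 < a + b)%N ->
    (0 < maxn a b)%N && (maxn a b ^ 2 <= 2 * (a * b))%N.
  move=> ab ba ab0; apply/andP; split; first by lia.
  case: (leqP a b) => h'; rewrite expnS expn1; nia.
have [c1|c1] := boolP ((w <= x) && (w <= y))%N.
  exists 0%N => //=; rewrite /pair_a /pair_b /= -hx -hy; apply: key; lia.
have [c2|c2] := boolP ((y <= x) && (y <= w))%N.
  exists 1%N => //=; rewrite /pair_a /pair_b /= -hx -hw; apply: key; lia.
exists 2%N => //=; rewrite /pair_a /pair_b /= -hy -hw; apply: key; lia.
Qed.

(** Each mode is captured with weight at least 1/4096 by one of its three pairs. Pairs with a zero
    entry have weight zero, so the sums may run over nonzero integers only. *)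
Lemma mode_sum_le J M0 (K1 : seq (int * int)) (phi : int * int -> R) :
  uniq K1 -> 0 \notin K1 -> (forall k, k \in K1 -> (`|k.1| <= M0)%N /\ (`|k.2| <= M0)%N) ->
  (8 * M0 < 2 ^ J)%N -> (forall k, 0 <= phi k) ->
  \sum_(k <- K1) phi k <= 4096 * \sum_(t < 3) \sum_(a <- nzint (2 ^ J)) \sum_(b <- nzint (2 ^ J))
     kap R J a b * `|a%:~R * b%:~R| * phi (pair_tau t a b).
Proof.
move=> uK K0 hM hJ p0.
pose w t k := kap R J (pair_a t k) (pair_b t k) * `|(pair_a t k)%:~R * (pair_b t k)%:~R|.
have w0 t k : 0 <= w t k by rewrite mulr_ge0 ?kap_ge0.
have size_ab t k : k \in K1 -> (`|pair_a t k| <= 2 * M0)%N /\ (`|pair_b t k| <= 2 * M0)%N.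
  move=> /hM[h1 h2]; rewrite /pair_a /pair_b; split; case: ifP => _; case: k h1 h2 => k1 k2 /=; lia.
have step1 k : k \in K1 -> phi k <= 4096 * \sum_(t < 3) w t k * phi k.
  move=> kK; have kn : k != 0 by apply: contraNneq K0 => <-.
  have [t t3 /= /andP[m0 hm]] := good_pair kn.
  have [ha hb] := size_ab t k kK.
  have hm4 : (4 * maxn `|pair_a t k| `|pair_b t k| < 2 ^ J)%N.
    by apply: leq_ltn_trans hJ; rewrite -[8%N]/(4 * 2)%N -mulnA leq_mul2l /= geq_max ha hb.
  have hw := @kap_lower R J (pair_a t k) (pair_b t k) _ (leq_maxl _ _) (leq_maxr _ _) m0 hm4 hm. rewrite (bigD1 (Ordinal t3)) //= mulrDr.
  have : 0 <= \sum_(i < 3 | i != Ordinal t3) w i k * phi k by apply: sumr_ge0 => i _; rewrite mulr_ge0.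
  have : 4096^-1 * phi k <= w t k * phi k by apply: ler_wpM2r.
  by have := p0 k; lra.
apply: (@le_trans _ _ (\sum_(k <- K1) 4096 * \sum_(t < 3) w t k * phi k)).
  by rewrite big_seq [leRHS]big_seq; apply: ler_sum => k; exact: step1.
rewrite -mulr_sumr.
apply: ler_wpM2l; first exact: ler0n.
rewrite exchange_big /=.
apply: ler_sum => t _.
pose P k := (pair_a t k != 0) && (pair_b t k != 0).
pose Psi (ab : int * int) := kap R J ab.1 ab.2 * `|ab.1%:~R * ab.2%:~R| * phi (pair_tau t ab.1 ab.2).
have -> : \sum_(k <- K1) w t k * phi k = \sum_(ab <- [seq (pair_a t k, pair_b t k) | k <- K1 & P k]) Psi ab.
  rewrite big_map big_filter [RHS]big_mkcond /=; apply: eq_bigr => k _.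
  rewrite /Psi /= pair_tauK// -/(w t k); case: ifP => // /negbT.
  rewrite /P negb_and !negbK /w => /orP[/eqP->|/eqP->]; rewrite ?mul0r ?mulr0 normr0 mulr0 mul0r //.
apply: (@le_trans _ _ (\sum_(ab <- [seq (a, b) | a <- nzint (2 ^ J), b <- nzint (2 ^ J)]) Psi ab)); last first.
  by rewrite big_allpairs.
apply: sum_subset.
- rewrite map_inj_in_uniq ?filter_uniq// => k k' _ _ [e1 e2].
  by rewrite -(pair_tauK k (ltn_ord t)) -(pair_tauK k' (ltn_ord t)) e1 e2.
- move=> y /mapP[k]; rewrite mem_filter => /andP[/andP[a0 b0] kK] ->.
  have [ha hb] := size_ab t k kK.
  apply/allpairsP; exists (pair_a t k, pair_b t k); rewrite /= !mem_nzint a0 b0 /=.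
  by split => //; [apply: leq_trans ha _|apply: leq_trans hb _]; lia.
- by move=> ab; rewrite mulr_ge0// mulr_ge0 ?kap_ge0.
Qed.

End BourgainBrezis.

(** * The a priori bound and the solution for small data *)

Section BourgainBrezis2.
Variable R : realType.
Local Notation freq := (@frequency R).
Local Notation freq2 := (@frequency_sqr R).

(** 309 = 3 * 103: three pairs of linear forms, each contributing at most 103 times the right-hand
    side; 4096 comes from the lower bound for [kap]. *)
Definition bb_const : R := (4096 * 309)%:R.

Lemma sum_phase_bound (K : seq (int * int)) (z : bool -> bool -> int * int -> R) (mu : bool -> int * int -> R)
   (T : finType) (pts : T -> R * R) (g : bool -> T -> R) J M0 (K1 : seq (int * int)) :
  uniq K1 -> 0 \notin K1 -> (forall k, k \in K1 -> (`|k.1| <= M0)%N /\ (`|k.2| <= M0)%N) ->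
  (8 * M0 < 2 ^ J)%N ->
  (forall k s b, k \in K -> freq2 k * z s b k + \sum_x g b x * trig s (phase k (pts x)) = freq b k * mu s k) ->
  (forall k, k != 0 -> (`|k.1| <= 2 * 2 ^ J)%N -> (`|k.2| <= 2 * 2 ^ J)%N -> k \in K) ->
  \sum_(k <- K1) \sum_s mu s k ^+ 2 <= bb_const * ((\sum_b \sum_x `|g b x|) ^+ 2 +
     \sum_(k <- K) freq2 k * \sum_s \sum_b z s b k ^+ 2).
Proof.
move=> uK K0 hM hJ hEL hK.
set G := \sum_b \sum_x _; set X := \sum_(k <- K) _.
have X0 : 0 <= X.
  apply: sumr_ge0 => k _; rewrite mulr_ge0 ?addr_ge0 ?sqr_ge0//.
  by apply: sumr_ge0 => s _; apply: sumr_ge0 => b _; exact: sqr_ge0.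
have p0 k : 0 <= \sum_s mu s k ^+ 2 by apply: sumr_ge0 => s _; exact: sqr_ge0.
have inK t a b : (t < 3)%N -> a \in nzint (2 ^ J) -> b \in nzint (2 ^ J) -> pair_tau t a b \in K.
  move=> t3; rewrite !mem_nzint => /andP[a0 a1] /andP[b0 b1].
  apply: hK; rewrite /pair_tau; case: t t3 => [|[|[|]]] //= _;
    rewrite -?pair_eqE /= ?negb_and ?a0 ?b0 ?orbT //; lia.
have est t : (t < 3)%N -> \sum_(a <- nzint (2 ^ J)) \sum_(b <- nzint (2 ^ J))
     kap R J a b * `|a%:~R * b%:~R| * \sum_s mu s (pair_tau t a b) ^+ 2 <= 103 * (G ^+ 2 + X).
  move=> t3; apply: (@le_trans _ _ (43 * G ^+ 2 + 103 * X)); last by have := sqr_ge0 G; lra.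
  have inj a b a' b' : pair_tau t a b = pair_tau t a' b' -> a = a' /\ b = b'.
    have [h1 h2] := pair_abK a b t3; have [h3 h4] := pair_abK a' b' t3.
    by move=> e; split; [rewrite -[LHS]h1 e h3|rewrite -[LHS]h2 e h4].
  (* Angles dual to (a, b): k . x = a th1 + b th2 for k = [pair_tau t a b]. The functions [p] and
     [q] are the coefficients of a and b as linear forms in k. *)
  pose th1 x : R := if t == 0%N then (pts x).1 else if t == 1%N then (pts x).1 - (pts x).2 else (pts x).2 - (pts x).1.
  pose th2 x : R := if t == 0%N then (pts x).2 else if t == 1%N then (pts x).2 else (pts x).1.
  pose p c : R := if t == 2%N then (c == true)%:R else (c == false)%:R.
  pose q c : R := if t == 0%N then (c == true)%:R else 1.
  apply: (@pair_estimate R K z mu T pts g J (pair_tau t) th1 th2 p q) => //.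
  - by move=> a b x; rewrite /phase /pair_tau /th1 /th2; case: t t3 {inj p q th1 th2} => [|[|[|]]] //= _; rewrite ?intrB; ring.
  - by move=> a b; apply: inK.
  - by move=> a b; rewrite sum_bool /p /frequency /pair_tau; case: t t3 {inj p q th1 th2} => [|[|[|]]] //= _; rewrite ?intrB; ring.
  - by move=> a b; rewrite sum_bool /q /frequency /pair_tau; case: t t3 {inj p q th1 th2} => [|[|[|]]] //= _; rewrite ?intrB; ring.
  - by move=> c; rewrite /p; case: ifP => _; case: c; rewrite /= ?lexx ?ler01.
  - by move=> c; rewrite /q; case: ifP => _; case: c; rewrite /= ?lexx ?ler01.
  - move=> a b; rewrite /frequency_sqr /frequency /pair_tau; case: t t3 {inj p q th1 th2} => [|[|[|]]] //= _; rewrite ?intrB;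
    move: (a%:~R : R) (b%:~R : R) => u v; have := sqr_ge0 u; have := sqr_ge0 v; have := sqr_ge0 (u + v); nra.
apply: le_trans (mode_sum_le uK K0 hM hJ p0) _.
apply: (@le_trans _ _ (4096 * \sum_(t < 3) 103 * (G ^+ 2 + X))).
  by apply: ler_wpM2l; [exact: ler0n|apply: ler_sum => t _; exact: est].
rewrite sumr_const card_ord /bb_const natrM -[_ *+ 3]mulr_natr; apply: eq_ler.
by rewrite -[RHS]mulrA; congr (_ * _); move: (G ^+ 2 + X) => Z; ring.
Qed.

(** The estimate for [V] is quadratic in the total energy S = X + Y while the data [D] are small, so
    Cauchy-Schwarz gives S <= (2 + S) / 4, and the nonlinear bound closes without a continuity
    argument. *)
Lemma energy_arith (X Y G V D Cv S : R) : 0 < Cv -> 0 <= X -> 0 <= Y -> 0 <= G -> G <= 2 + Y ->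
  V <= Cv * (G ^+ 2 + X) -> D <= 1 / (16 * Cv) -> X + Y = S ->
  (forall t, 0 < t -> S <= (t * V + D / t) / 2) -> X <= 1 /\ Y <= 1.
Proof.
move=> C0 X0 Y0 G0 hG hV hD hS hcs; pose H := 2 + X + Y.
have H0 : 0 < H by rewrite /H; lra.
have hGH : G ^+ 2 + X <= H ^+ 2 by rewrite /H; nra.
(* The parameter that makes both terms of the Young inequality at most H / 4. *)
pose t0 := 1 / (4 * Cv * H); have t00 : 0 < t0 by rewrite divr_gt0 ?mulr_gt0.
have h1 : t0 * V <= H / 4.
  apply: (@le_trans _ _ (t0 * (Cv * H ^+ 2))).
    by apply: ler_wpM2l; [exact: ltW|apply: le_trans hV _; apply: ler_wpM2l => //; exact: ltW].
  by apply: eq_ler; rewrite /t0; field; rewrite !gt_eqF.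
have h2 : D / t0 <= H / 4.
  apply: (@le_trans _ _ (1 / (16 * Cv) / t0)).
    by apply: ler_wpM2r => //; rewrite invr_ge0 ltW.
  by apply: eq_ler; rewrite /t0; field; rewrite !gt_eqF.
have := hcs t0 t00; rewrite -hS => h3; rewrite /H in h1 h2; split; lra.
Qed.

Lemma cs_pair (I : Type) (s : seq I) (a b c d : I -> R) (t : R) : 0 < t ->
  \sum_(k <- s) (a k * c k - b k * d k) <=
  (t * (\sum_(k <- s) (a k ^+ 2 + b k ^+ 2)) + (\sum_(k <- s) (c k ^+ 2 + d k ^+ 2)) / t) / 2.
Proof.
move=> t0; rewrite mulr_sumr mulr_suml -big_split /= mulr_suml; apply: ler_sum => k _.
have ti : t * t^-1 = 1 by rewrite divff ?gt_eqF.
have i0 : 0 < t^-1 by rewrite invr_gt0.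
have h u v : u * v <= (t * u ^+ 2 + v ^+ 2 / t) / 2.
  have : 0 <= t^-1 * (t * u - v) ^+ 2 by rewrite mulr_ge0 ?sqr_ge0// ltW.
  have -> : t^-1 * (t * u - v) ^+ 2 = (t * t^-1) * (t * u ^+ 2) - 2 * (t * t^-1) * u * v + v ^+ 2 / t by ring.
  rewrite ti; lra.
have := h (a k) (c k); have := h (b k) (- d k); rewrite sqrrN !mulrDr !mulrDl; lra.
Qed.

(** Bounds the L^1 norm of the source term in the Euler-Lagrange equations by the penalty itself. *)
Lemma norm_odd_power (m : nat) (x : R) : (0 < m)%N -> `|x ^+ (2 * m).-1| <= 1 + x ^+ (2 * m).
Proof.
move=> m0; have e : (2 * m = (2 * m).-1.+1)%N by lia.
have x0 : 0 <= x ^+ (2 * m) by rewrite exprM exprn_ge0 ?sqr_ge0.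
rewrite normrX; case: (leP `|x| 1) => h.
  by apply: (@le_trans _ _ 1); [rewrite exprn_ile1|rewrite lerDl].
apply: (@le_trans _ _ (x ^+ (2 * m))); last by rewrite lerDr.
rewrite -[leRHS]ger0_norm// normrX [in leRHS]e exprS -[leLHS]mul1r; apply: ler_wpM2r; last exact: ltW.
by rewrite exprn_ge0.
Qed.

Lemma sum_eq_subset (I : eqType) (s t : seq I) (F : I -> R) : uniq s -> uniq t -> {subset s <= t} ->
  (forall k, k \notin s -> F k = 0) -> \sum_(k <- t) F k = \sum_(k <- s) F k.
Proof.
move=> us ut st h; rewrite (bigID (mem s)) /= [X in _ + X]big1 ?addr0; last by move=> k /h.
rewrite -big_filter; apply: perm_big; apply: uniq_perm => //; first exact: filter_uniq.
by move=> k; rewrite mem_filter; case: (boolP (k \in s)) => //= /st.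
Qed.

(* The exponent 2m is taken so large, compared with the number of grid points, that
   a bound on the mean of the 2m-th powers bounds the values on the grid. *)
Lemma bb_normalised : exists2 e : R, 0 < e & forall (K1 : seq (int * int)) (cc dd : int * int -> R),
  uniq K1 -> 0 \notin K1 -> (forall k, k \notin K1 -> cc k = 0 /\ dd k = 0) ->
  \sum_(k <- K1) (cc k ^+ 2 + dd k ^+ 2) <= e ->
  exists (K : seq (int * int)) (z : bool -> bool -> int * int -> R),
    [/\ uniq K /\ 0 \notin K, {subset K1 <= K},
      (forall k, k \in K -> \sum_b freq b k * z true b k = cc k /\ \sum_b freq b k * z false b k = - dd k),
      (forall b x, `|modes K z b x| <= 3) &
      \sum_(k <- K) freq2 k * \sum_s \sum_b z s b k ^+ 2 <= 1].
Proof.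
have Cp : 0 < bb_const by rewrite /bb_const ltr0n.
move: bb_const Cp (@sum_phase_bound) => Cv Cp spb.
(* The smallness threshold required by [energy_arith]. *)
exists (1 / (16 * Cv)); first by rewrite divr_gt0 ?mulr_gt0.
move=> K1 cc dd uK1 K10 hoff hsmall.
pose M0 := (\sum_(k <- K1) (`|k.1| + `|k.2|))%N.
have hM k : k \in K1 -> (`|k.1| <= M0)%N /\ (`|k.2| <= M0)%N.
  move=> kK; rewrite /M0 (perm_big _ (perm_to_rem kK)) big_cons /=; split; lia.
pose J := (8 * M0)%N; have hJ : (8 * M0 < 2 ^ J)%N by exact: ltn_expl.
(* The field may use more frequencies than the data: the bilinear estimate needs the equations at
   every [pair_tau t a b] with |a| and |b| up to 2^J, whose entries reach 2 * 2^J because of the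
   differences b - a. *)
pose ints := 0 :: nzint (2 * 2 ^ J).
have uints : uniq ints by rewrite /= uniq_nzint mem_nzint eqxx.
have mem_ints a : (a \in ints) = (`|a| <= 2 * 2 ^ J)%N.
  by rewrite inE mem_nzint; have [->|] := eqVneq a 0.
pose K : seq (int * int) := [seq k <- [seq (a, b) | a <- ints, b <- ints] | k != 0].
have uK : uniq K by rewrite filter_uniq// allpairs_uniq// => -[? ?] [? ?].
have K0 : 0 \notin K by rewrite mem_filter eqxx.
have memK k : k != 0 -> (`|k.1| <= 2 * 2 ^ J)%N -> (`|k.2| <= 2 * 2 ^ J)%N -> k \in K.
  move=> k0 h1 h2; rewrite mem_filter k0; apply/allpairsP; exists k.
  by rewrite !mem_ints; split=> //; case: k {k0 h1 h2}.
have K1K : {subset K1 <= K}.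
  have hb a : (a <= M0)%N -> (a <= 2 * 2 ^ J)%N.
    by move=> h; apply: leq_trans h _; move: (2 ^ J)%N hJ => w; clear; lia.
  by move=> k kK; have [/hb h1 /hb h2] := hM k kK; apply: memK => //; apply: contraNneq K10 => <-.
(* With more than 32 |K| grid points per period and pi <= 4, the field varies by at most 1 within
   one mesh. *)
have [n' hn'] : exists n', n' = (32 * size K)%N by eexists.
pose n := n'.+1.
pose pts (x : 'I_n * 'I_n) : R * R := (2 * pi * x.1%:R / n%:R, 2 * pi * x.2%:R / n%:R).
(* The penalty is a mean over the [m] grid points, so a penalty at most 1 gives F^(2m) <= m <= 4^m
   at each of them, whence |F| <= 2. *)
have [m hm] : exists m, m = #|{: 'I_n * 'I_n}| by eexists.
have m0 : (0 < m)%N by rewrite hm; apply/card_gt0P; exists (ord0, ord0).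
have m1 : (2 * m = (2 * m).-1.+1)%N by rewrite prednK// muln_gt0.
pose c : R := m%:R^-1.
have mp : 0 < m%:R :> R by rewrite ltr0n.
have c0 : 0 <= c by rewrite invr_ge0 ltW.
have [z [mu [hdiv hEL]]] := @modes_euler_lagrange R K cc dd _ pts c m uK K0 c0 m0.
exists K, z.
pose F b x := modes K z b (pts x).
pose X := \sum_(k <- K) freq2 k * \sum_s \sum_b z s b k ^+ 2.
pose Y := \sum_b \sum_x c * F b x ^+ (2 * m).
pose g b x := c * F b x ^+ (2 * m).-1.
pose G := \sum_b \sum_x `|g b x|.
have X0 : 0 <= X.
  apply: sumr_ge0 => k _; rewrite mulr_ge0 ?addr_ge0 ?sqr_ge0//.
  by apply: sumr_ge0 => s _; apply: sumr_ge0 => b _; exact: sqr_ge0.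
have F0 b x : 0 <= c * F b x ^+ (2 * m) by rewrite mulr_ge0// exprM exprn_ge0// sqr_ge0.
have Y0 : 0 <= Y by apply: sumr_ge0 => b _; apply: sumr_ge0.
have G0 : 0 <= G by apply: sumr_ge0 => b _; apply: sumr_ge0 => x _; exact: normr_ge0.
have hG : G <= 2 + Y.
  have h b : \sum_x `|g b x| <= 1 + \sum_x c * F b x ^+ (2 * m).
    have -> : 1 = \sum_(x : 'I_n * 'I_n) c.
      by rewrite sumr_const -hm -mulr_natr /c mulVf// gt_eqF.
    rewrite -big_split /=; apply: ler_sum => x _.
    rewrite /g normrM (ger0_norm c0) -[X in X + _]mulr1 -mulrDr; apply: ler_wpM2l => //.
    exact: norm_odd_power.
  by rewrite /G /Y !sum_bool; have := h false; have := h true; lra.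
(* Energy identity: the equations are tested with z itself, and the divergence constraint turns the
   multiplier term into the pairing of [mu] with the data. *)
have hS : X + Y = \sum_(k <- K) (mu true k * cc k - mu false k * dd k).
  have -> : Y = \sum_(k <- K) \sum_s \sum_b z s b k * \sum_x g b x * trig s (phase k (pts x)).
    have hY b : \sum_x c * F b x ^+ (2 * m) =
        \sum_(k <- K) \sum_s z s b k * \sum_x g b x * trig s (phase k (pts x)).
      transitivity (\sum_x \sum_(k <- K) \sum_s z s b k * (g b x * trig s (phase k (pts x)))).
        apply: eq_bigr => x _; rewrite m1 /= exprSr mulrA -/(g b x) /F /modes mulr_sumr; apply: eq_bigr => k _.
        by rewrite mulr_sumr; apply: eq_bigr => s _; ring.
      rewrite exchange_big /=; apply: eq_bigr => k _; rewrite exchange_big /=; apply: eq_bigr => s _.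
      by rewrite mulr_sumr.
    rewrite /Y (eq_bigr _ (fun b _ => hY b)) exchange_big /=; apply: eq_bigr => k _.
    by rewrite exchange_big.
  rewrite -big_split /= big_seq [RHS]big_seq; apply: eq_bigr => k kK.
  have [h1 h2] := hdiv k kK.
  have -> : mu true k * cc k - mu false k * dd k = \sum_s \sum_b z s b k * (freq b k * mu s k).
    by rewrite !sum_bool -h1 -[dd k]opprK -h2 !sum_bool; ring.
  rewrite mulr_sumr -big_split /=; apply: eq_bigr => s _; rewrite mulr_sumr -big_split /=.
  by apply: eq_bigr => b _; rewrite -(hEL k s b kK) /g; ring.
have hV : \sum_(k <- K1) \sum_s mu s k ^+ 2 <= Cv * (G ^+ 2 + X).
  exact: (@spb K z mu _ pts g J M0 K1 uK1 K10 hM hJ hEL memK).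
have hS1 : X + Y = \sum_(k <- K1) (mu true k * cc k - mu false k * dd k).
  rewrite hS; apply: sum_eq_subset => // k /hoff[-> ->]; ring.
have [hX hY] : X <= 1 /\ Y <= 1.
  apply: (energy_arith Cp X0 Y0 G0 hG hV hsmall hS1) => t t0.
  have := @cs_pair _ K1 (mu true) (mu false) cc dd t t0.
  have -> : \sum_(k <- K1) \sum_s mu s k ^+ 2 = \sum_(k <- K1) (mu true k ^+ 2 + mu false k ^+ 2).
    by apply: eq_bigr => k _; rewrite sum_bool addrC.
  by [].
have hgrid b x : `|F b x| <= 2.
  have h : F b x ^+ (2 * m) <= m%:R.
    have : c * F b x ^+ (2 * m) <= 1.
      apply: le_trans hY; rewrite /Y (bigD1 b)//= (bigD1 x)//= -addrA lerDl addr_ge0//.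
        by apply: sumr_ge0.
      by apply: sumr_ge0 => b' _; apply: sumr_ge0.
    by rewrite /c mulrC ler_pdivrMr// mul1r.
  rewrite -(@ler_pXn2r _ (2 * m))// ?nnegrE ?muln_gt0//.
  have h0 : 0 <= F b x ^+ (2 * m) by rewrite exprM exprn_ge0 ?sqr_ge0.
  rewrite -normrX (ger0_norm h0); apply: le_trans h _.
  rewrite exprM -natrX -natrX ler_nat ltnW//; exact: ltn_expl.
split=> // b x.
have n0 : (0 < n)%N by [].
have [i1 [q1 h1]] := @grid_near R n x.1 n0; have [i2 [q2 h2]] := @grid_near R n x.2 n0.
pose y : R * R := (2 * pi * i1%:R / n%:R + 2 * pi * q1%:~R, 2 * pi * i2%:R / n%:R + 2 * pi * q2%:~R).
have hh : 0 <= 2 * pi / n%:R :> R by rewrite divr_ge0// mulr_ge0// pi_ge0.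
have := @modes_lipschitz R K z b x y (2 * pi / n%:R) hh h1 h2 hX.
have -> : modes K z b y = F b (i1, i2).
  by rewrite /F !modesE /y (periodic2_int (@tev_periodic R _)).
have hn : 4 * (size K)%:R * (2 * pi / n%:R) <= 1 :> R.
  have p4 : pi <= 4 :> R by clear; have := @pihalf_lt2 R; lra.
  have np : 0 < n%:R :> R by rewrite ltr0n.
  have -> : n%:R = 32 * (size K)%:R + 1 :> R by rewrite /n hn' -addn1 natrD natrM.
  have u0 : 0 <= (size K)%:R :> R by exact: ler0n.
  move: ((size K)%:R : R) u0 (pi : R) p4 => u u0 w w4.
  have uw : u * w <= u * 4 by apply: ler_wpM2l.
  by clear -u0 uw; rewrite mulrA ler_pdivrMr ?mul1r; lra.
move=> hl; have := hgrid b (i1, i2); have := ler_normD (modes K z b x - F b (i1, i2)) (F b (i1, i2)).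
rewrite subrK; lra.
Qed.

End BourgainBrezis2.

(** * The divergence equation for trigonometric polynomials *)

Section TrigDivergence.
Variable R : realType.
Local Notation C := R[i].
Local Notation Re := (@complex.Re R).
Local Notation Im := (@complex.Im R).
Implicit Types (L : tpoly R).

Definition tder (b : bool) L : tpoly R := tmult (fun k => (0 +i* frequency R b k)%C) L.

(** The form N k1 + k2, with N larger than every |k2| in the list, vanishes only if k1 = 0 and then
    k2 = 0. *)
Lemma generic_form (S : seq (int * int)) : 0 \notin S ->
  exists v : int * int -> R, additive2 v /\ forall k, k \in S -> v k != 0.
Proof.
move=> S0; pose N := (\sum_(k <- S) `|k.2|).+1%N.
exists (fun k => (N%:Z * k.1 + k.2)%:~R); split.
  by move=> k k' /=; rewrite -intrD; congr (_%:~R); ring.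
move=> k kS; rewrite intr_eq0; apply/negP => /eqP e.
have h : (`|k.2| < N)%N by rewrite /N ltnS (perm_big _ (perm_to_rem kS)) big_cons leq_addr.
have k10 : k.1 = 0.
  apply/eqP; rewrite -absz_eq0; apply/negPn/negP; rewrite -lt0n => p.
  have : `|k.2|%N = (N * `|k.1|)%N.
    rewrite -[N in RHS]absz_nat -abszM -[RHS]abszN; congr (`|_|%N).
    by apply/eqP; rewrite -addr_eq0 addrC e.
  by move=> e'; move: h; rewrite e' ltnNge leq_pmulr.
have k20 : k.2 = 0 by move: e; rewrite k10 mulr0 add0r.
by case/negP: S0; have <- : k = 0 by case: (k) k10 k20 => a b /= -> ->.
Qed.

Lemma collect L : exists L', [/\ uniq (map snd L'), {subset map snd L' <= map snd L} & tval L' =1 tval L].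
Proof.
exists [seq (\sum_(t <- L | t.2 == k) t.1, k) | k <- undup (map snd L)].
have e : [seq i.2 | i <- [seq (\sum_(t <- L | t.2 == k) t.1, k) | k <- undup (map snd L)]] = undup (map snd L).
  by rewrite -map_comp map_id_in.
split; [by rewrite e undup_uniq|by rewrite e => k; rewrite mem_undup|move=> x].
rewrite /tval big_map /=.
transitivity (\sum_(k <- undup (map snd L)) \sum_(t <- L) if t.2 == k then t.1 * cexpi (phase t.2 x) else 0).
  apply: eq_bigr => k _; rewrite big_distrl big_mkcond /=; apply: eq_bigr => t _.
  by case: eqP => // ->.
rewrite exchange_big /= big_seq [RHS]big_seq; apply: eq_bigr => t tL.
rewrite (bigD1_seq t.2) ?undup_uniq ?mem_undup ?map_f//= eqxx big1 ?addr0// => k.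
by rewrite eq_sym => /negbTE ->.
Qed.

(** With all frequencies in an open half-plane the square of the complex sum has mean zero, so real
    and imaginary parts have the same L^2 norm; this is the factor 2. Orientation by a generic form
    and merging of repeated frequencies put [L] into this shape. *)
Lemma parseval_canonical L : 0 \notin map snd L -> exists L',
  [/\ uniq (map snd L'), 0 \notin map snd L', tev L' =1 tev L &
   (2 * pi) ^+ 2 * \sum_(t <- L') sqmod t.1 = 2 * Lp 2 (tev L)].
Proof.
move=> L0; have [v [av hv]] := generic_form L0.
pose G := map (orient v) L.
have Gpos k : k \in map snd G -> 0 < v k.
  move=> /mapP[_ /mapP[t tL ->] ->]; have := hv t.2 (map_f _ tL).
  rewrite /orient; case: (ltP (v t.2) 0) => h h0; first by change (0 < v (- t.2)); rewrite additive2_N// oppr_gt0.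
  by rewrite lt_def h0.
have [L' [uL' sL' eL']] := collect G; exists L'.
have L'0 : 0 \notin map snd L'.
  by apply/negP => /sL' /Gpos; rewrite additive2_0// ltxx.
have eL x : tev L' x = tev L x by rewrite /tev eL' -/(tev G x) tev_orient.
split=> //; rewrite -Iint_sqmod// /Lp -IintZ; last by apply: bmeas_powR => //; exact: tev_bmeas.
have h0 : Iint (fun x => Re (tval L' x ^+ 2)) = 0.
  by apply: (@Iint_tpow R v) => // k /sL'; exact: Gpos.
have bI : bmeas (fun x => Re (tval L' x ^+ 2)).
  rewrite (_ : (fun x => _) = tev (tpow L' 2)); first exact: tev_bmeas.
  by apply/funext => x; rewrite /tev tval_pow.
have bS : bmeas (fun x => sqmod (tval L' x)).
  rewrite (_ : (fun x => _) = (fun x => 2 * (tev L' x) ^+ 2 - Re (tval L' x ^+ 2))).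
    by apply: bmeasB => //; apply: bmeasZ; apply: bmeasX; exact: tev_bmeas.
  by apply/funext => x; rewrite /sqmod /tev expr2 ReM; ring.
rewrite -[LHS]addr0 -h0 -IintD//; apply: eq_Iint => x.
by rewrite powR_sqr -eL /sqmod /tev expr2 ReM; ring.
Qed.

Lemma Lp2_le_sqmod L : uniq (map snd L) -> Lp 2 (tev L) <= (2 * pi) ^+ 2 * \sum_(t <- L) sqmod t.1.
Proof.
move=> uL; rewrite -Iint_sqmod//; apply: Iint_le.
- by apply: bmeas_powR => //; exact: tev_bmeas.
- rewrite (_ : (fun x => _) = (fun x => tev L x ^+ 2 + tev (tmult (fun=> - 'i%C) L) x ^+ 2)).
    by apply: bmeasD; apply: bmeasX; exact: tev_bmeas.
  by apply/funext => x; rewrite -Im_tval.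
- by move=> x; rewrite powR_sqr /sqmod lerDl sqr_ge0.
Qed.

Lemma Lp_zero (r : R) : 0 < r -> Lp r (fun=> 0) = 0.
Proof.
move=> r0; rewrite /Lp (@eq_Iint _ _ (fun=> 0)) ?Iint_cst ?mul0r// => x.
by rewrite normr0 powR0// gt_eqF.
Qed.

Lemma tder_scale b (c : R) L x : tev (tder b (tmult (fun=> c%:C%C) L)) x = c * tev (tder b L) x.
Proof.
rewrite /tder tmult_comp -tev_scale tmult_comp; congr (tev _ x).
by apply: eq_tmult => k _; rewrite mulrC.
Qed.

Lemma tev_tder b L x : tev (tder b L) x =
  \sum_(t <- L) frequency R b t.2 * (- Im t.1 * cos (phase t.2 x) - Re t.1 * sin (phase t.2 x)).
Proof.
rewrite /tev tval_tmult Re_sum; apply: eq_bigr => t _.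
by rewrite !ReM !ImM /=; ring.
Qed.

Lemma Lp2_eq0 L : 0 \notin map snd L -> Lp 2 (tev L) = 0 -> forall x, tev L x = 0.
Proof.
move=> L0 hz x; have [L' [uL' L'0 eL' hpar]] := parseval_canonical L0.
have p0 : (2 * pi) ^+ 2 != 0 :> R by rewrite expf_neq0// mulf_neq0// gt_eqF// pi_gt0.
have Dz : \sum_(t <- L') sqmod t.1 = 0.
  by move/eqP: hpar; rewrite hz mulr0 mulf_eq0 (negbTE p0) => /eqP.
rewrite -eL' /tev /tval big_seq big1 ?Re0// => t tL.
have : sqmod t.1 = 0.
  apply/eqP; rewrite eq_le sqmod_ge0 andbT -Dz (perm_big _ (perm_to_rem tL)) big_cons lerDl.
  by apply: sumr_ge0 => *; exact: sqmod_ge0.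
rewrite /sqmod => /eqP; rewrite paddr_eq0 ?sqr_ge0// !sqrf_eq0 => /andP[/eqP h1 /eqP h2].
have -> : t.1 = 0 by apply: cplx_eq.
by rewrite mul0r.
Qed.

(** The normalised result only concerns small data. The data are scaled to the threshold size by s =
    sqrt (e / D), and the field is scaled back, which the linear constraint allows. *)
Theorem trig_divergence : exists2 K : R, 0 < K & forall L, 0 \notin map snd L ->
  exists Z : bool -> tpoly R,
  [/\ forall x, tev (tder false (Z false)) x + tev (tder true (Z true)) x = tev L x,
      forall b x, `|tev (Z b) x| <= K * Num.sqrt (Lp 2 (tev L)) &
      forall b c, Lp 2 (tev (tder c (Z b))) <= K ^+ 2 * Lp 2 (tev L)].
Proof.
have [e e0 hbb] := @bb_normalised R.
have p0 : 0 < pi :> R by exact: pi_gt0.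
(* The three summands dominate 1, the square of the sup bound 3 scaled back, and the gradient bound
   scaled back; [1 <= K] gives [K <= K ^+ 2], so one constant serves all. *)
pose K : R := 1 + 9 * (2 / e) + (2 * pi) ^+ 2 * (2 / e).
have ie : 0 < e^-1 by rewrite invr_gt0.
have K1 : 1 <= K by rewrite /K -addrA lerDl addr_ge0// mulr_ge0 ?sqr_ge0 ?divr_ge0// ltW.
have p4 : 2 <= (2 * pi) ^+ 2 :> R by have := @pihalf_ge1 R; nra.
exists K => [|L L0]; first exact: lt_le_trans K1.
have [L' [uL' L'0 eL' hpar]] := parseval_canonical L0.
set A := Lp 2 (tev L) in hpar *.
have A0 : 0 <= A by exact: Lp_ge0.
pose D := \sum_(t <- L') sqmod t.1.
have D0 : 0 <= D by apply: sumr_ge0 => t _; exact: sqmod_ge0.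
have DA : D <= A.
  have : 2 * D <= (2 * pi) ^+ 2 * D by apply: ler_wpM2r.
  by rewrite hpar; lra.
have [Dz|Dn] := eqVneq D 0.
  exists (fun=> [::]); split=> [x|b x|b c].
  - rewrite /tder /tmult /= tev_nil addr0 (Lp2_eq0 L0)// -/A.
    by move: hpar; rewrite -/D Dz mulr0 -/A => /eqP; rewrite eq_sym mulf_eq0 pnatr_eq0 => /eqP.
  - by rewrite tev_nil normr0 mulr_ge0 ?sqrtr_ge0// ltW// (lt_le_trans _ K1).
  - rewrite (@eq_Lp _ _ _ (fun=> 0)); last by move=> x; rewrite /tder /tmult /= tev_nil.
    by rewrite Lp_zero// mulr_ge0 ?sqr_ge0.
have Dp : 0 < D by rewrite lt_def Dn.
pose s := Num.sqrt (e / D).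
have s0 : 0 < s by rewrite sqrtr_gt0 divr_gt0.
have s2 : s ^+ 2 = e / D by rewrite sqr_sqrtr// ltW// divr_gt0.
pose w k := \sum_(t <- L' | t.2 == k) t.1.
have wE t : t \in L' -> w t.2 = t.1.
  move=> tL; rewrite /w (perm_big _ (perm_to_rem tL)) big_cons eqxx big_seq_cond big1; first exact: addr0.
  move=> u; rewrite (mem_rem_uniq _ (map_uniq uL')) inE => /andP[/andP[ut uL] /eqP e2].
  by case/eqP: ut; exact: (uniq_map_injl uL').
have wout k : k \notin map snd L' -> w k = 0.
  move=> kL; rewrite /w big_seq_cond big1// => t /andP[tL /eqP e2].
  by case/negP: kL; rewrite -e2 map_f.
have hoff k : k \notin map snd L' -> s * Re (w k) = 0 /\ - (s * Im (w k)) = 0.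
  by move=> /wout ->; rewrite !mulr0 oppr0.
have hsm : \sum_(k <- map snd L') ((s * Re (w k)) ^+ 2 + (- (s * Im (w k))) ^+ 2) <= e.
  rewrite big_map (eq_big_seq (fun t => s ^+ 2 * sqmod t.1)); last first.
    by move=> t tL; rewrite wE// /sqmod sqrrN !exprMn mulrDr.
  by rewrite -mulr_sumr -/D s2 divfK.
have [KK [z [[uK K0] sub hdiv hsup hX]]] := hbb _ _ _ uL' L'0 hoff hsm.
have si : s^-1 ^+ 2 = D / e by rewrite exprVn s2 invf_div.
exists (fun b => tmult (fun=> (s^-1)%:C%C) (mode_poly KK z b)).
split=> [x|b x|b c].
- rewrite !tder_scale -mulrDr -eL'.
  have -> : tev (tder false (mode_poly KK z false)) x + tev (tder true (mode_poly KK z true)) x =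
      s * tev L' x; last by rewrite mulKf// gt_eqF.
  rewrite !tev_tder /mode_poly !big_map /= -big_split /=.
  transitivity (\sum_(k <- KK) s * (Re (w k) * cos (phase k x) - Im (w k) * sin (phase k x))).
    rewrite big_seq [RHS]big_seq; apply: eq_bigr => k kK; have [h1 h2] := hdiv k kK.
    have -> : s * (Re (w k) * cos (phase k x) - Im (w k) * sin (phase k x)) =
      (s * Re (w k)) * cos (phase k x) + (- (s * Im (w k))) * sin (phase k x) by ring.
    by rewrite -h1 -[- (s * Im (w k))]opprK -h2 !sum_bool; ring.
  rewrite -mulr_sumr; congr (_ * _).
  rewrite (@sum_eq_subset _ _ (map snd L'))//.
    rewrite big_map /tev /tval Re_sum big_seq [RHS]big_seq; apply: eq_bigr => t tL.
    by rewrite wE// ReM.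
  by move=> k /wout ->; rewrite !mul0r subr0.
- rewrite tev_scale -modesE normrM gtr0_norm ?invr_gt0//.
  apply: (@le_trans _ _ (s^-1 * 3)); first by apply: ler_wpM2l => //; rewrite invr_ge0 ltW.
  rewrite -(@ler_pXn2r _ 2)// ?nnegrE ?mulr_ge0 ?invr_ge0 ?sqrtr_ge0 ?(ltW s0)//; last first.
    by apply: le_trans K1.
  rewrite !exprMn si sqr_sqrtr//.
  have h9 : 9 * (2 / e) <= K by rewrite /K; have : 0 <= (2 * pi) ^+ 2 * (2 / e) :> R; [rewrite mulr_ge0 ?sqr_ge0 ?divr_ge0// ltW|lra].
  have hK2 : K <= K ^+ 2 by rewrite expr2 ler_peMl// (le_trans ler01).
  apply: (@le_trans _ _ (9 * (2 / e) * A)); last by apply: ler_wpM2r => //; exact: le_trans hK2.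
  have : D / e <= A / e by apply: ler_wpM2r => //; exact: ltW.
  have : 0 <= A / e by rewrite mulr_ge0// ltW.
  have -> : 9 * (2 / e) * A = 18 * (A / e) by ring.
  have -> : D / e * 3 ^+ 2 = 9 * (D / e) by ring.
  by move: (D / e) (A / e) => u v; lra.
- rewrite (@eq_Lp _ _ _ (fun x => s^-1 * tev (tder c (mode_poly KK z b)) x)); last by move=> x; rewrite tder_scale.
  rewrite (LpZ _ (ler0n R 2) (tev_bmeas _)).
  rewrite powR_sqr si.
  have hE : Lp 2 (tev (tder c (mode_poly KK z b))) <= (2 * pi) ^+ 2.
    apply: le_trans (Lp2_le_sqmod _) _; first by rewrite tmult_keys -map_comp map_id_in.
    rewrite -[leRHS]mulr1; apply: ler_wpM2l; first exact: sqr_ge0.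
    apply: le_trans hX; rewrite /tder /tmult /mode_poly !big_map /=; apply: ler_sum => k _.
    rewrite sqmodM; apply: ler_pM; rewrite ?sqmod_ge0//.
      by rewrite /sqmod /= /frequency_sqr expr0n add0r; case: c; rewrite ?lerDl ?lerDr sqr_ge0.
    rewrite !sum_bool /sqmod /= sqrrN.
    by case: b; rewrite -?addrA; have := sqr_ge0 (z false false k); have := sqr_ge0 (z true false k);
      have := sqr_ge0 (z false true k); have := sqr_ge0 (z true true k); lra.
  apply: (@le_trans _ _ (D / e * (2 * pi) ^+ 2)); first by apply: ler_wpM2l => //; rewrite divr_ge0// ltW.
  have hK3 : (2 * pi) ^+ 2 * (2 / e) <= K by rewrite /K; have : 0 <= 9 * (2 / e) :> R; [rewrite mulr_ge0 ?divr_ge0// ltW|lra].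
  have hK2 : K <= K ^+ 2 by rewrite expr2 ler_peMl// (le_trans ler01).
  apply: (@le_trans _ _ ((2 * pi) ^+ 2 * (2 / e) * A)); last by apply: ler_wpM2r => //; exact: le_trans hK2.
  have h : D / e <= A / e by apply: ler_wpM2r => //; exact: ltW.
  have h' : 0 <= A / e by rewrite mulr_ge0// ltW.
  have -> : (2 * pi) ^+ 2 * (2 / e) * A = (2 * pi) ^+ 2 * (2 * (A / e)).
    by move: ((2 * pi : R) ^+ 2) => P; ring.
  by rewrite mulrC; apply: ler_wpM2l; [exact: sqr_ge0|lra].
Qed.

End TrigDivergence.

(** * Simultaneous L^oo and W^(1,q) bounds *)

Section Averages.
Variable R : realType.
Local Notation Re := (@complex.Re R).
Local Notation Im := (@complex.Im R).
Implicit Types (L : tpoly R).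

Lemma tev_cons t L x : tev (t :: L) x =
  Re t.1 * cos (phase t.2 x) - Im t.1 * sin (phase t.2 x) + tev L x.
Proof. by rewrite /tev tval_cons ReD ReM. Qed.

Lemma phase_axis (k : int * int) b (s : R) x :
  phase k (shift2 (axis2 b s) x) = frequency R b k * s + phase k x.
Proof. by rewrite /phase /shift2 /frequency; case: b => /=; ring. Qed.

Lemma tev_is_derive b L x (s : R) :
  is_derive s 1 (fun s => tev L (shift2 (axis2 b s) x)) (tev (tder b L) (shift2 (axis2 b s) x)).
Proof.
elim: L => [|t L IH].
  rewrite (_ : (fun s => _) = cst 0); last by apply/funext => u; rewrite tev_nil.
  by rewrite /tder /tmult /= tev_nil; exact: is_derive_cst.
rewrite (_ : (fun s => _) = (fun s => Re t.1 * cos (frequency R b t.2 * s + phase t.2 x)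
   - Im t.1 * sin (frequency R b t.2 * s + phase t.2 x) + tev L (shift2 (axis2 b s) x))); last first.
  by apply/funext => u; rewrite tev_cons phase_axis.
have -> : tev (tder b (t :: L)) (shift2 (axis2 b s) x) =
  (Re t.1 * (- sin (frequency R b t.2 * s + phase t.2 x) * frequency R b t.2)
   - Im t.1 * (cos (frequency R b t.2 * s + phase t.2 x) * frequency R b t.2)) + tev (tder b L) (shift2 (axis2 b s) x).
  by rewrite /tder /= tev_cons !ReM !ImM /= phase_axis; ring.
have hl : is_derive s 1 (fun s => frequency R b t.2 * s + phase t.2 x) (frequency R b t.2).
  have h1 : is_derive s 1 (fun s => frequency R b t.2 * s) (frequency R b t.2 * 1).
    exact: (@is_deriveZ _ _ _ id (frequency R b t.2) s 1 1 (is_derive_id s 1)).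
  have := is_deriveD h1 (is_derive_cst (phase t.2 x) s 1).
  by rewrite mulr1 addr0.
have hc := @is_derive1_comp _ (@cos R) _ s _ _ (is_derive_cos _) hl.
have hs := @is_derive1_comp _ (@sin R) _ s _ _ (is_derive_sin _) hl.
have h1 := @is_deriveZ _ _ _ _ (Re t.1) s 1 _ hc.
have h2 := @is_deriveZ _ _ _ _ (Im t.1) s 1 _ hs.
exact: (is_deriveD (is_deriveB h1 h2) IH).
Qed.

Lemma tev_lipschitz L : exists2 B : R, 0 <= B & forall (x y : R * R) (h : R),
  `|x.1 - y.1| <= h -> `|x.2 - y.2| <= h -> `|tev L x - tev L y| <= B * h.
Proof.
elim: L => [|t L [B B0 IH]].
  by exists 0 => // x y h _ _; rewrite !tev_nil subrr normr0 mul0r.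
exists ((`|Re t.1| + `|Im t.1|) * (`|frequency R false t.2| + `|frequency R true t.2|) + B) => [|x y h h1 h2].
  by rewrite addr_ge0// mulr_ge0// addr_ge0.
have hp : `|phase t.2 x - phase t.2 y| <= (`|frequency R false t.2| + `|frequency R true t.2|) * h.
  have -> : phase t.2 x - phase t.2 y = frequency R false t.2 * (x.1 - y.1) + frequency R true t.2 * (x.2 - y.2).
    by rewrite /phase /frequency; ring.
  apply: le_trans (ler_normD _ _) _; rewrite !normrM mulrDl.
  by apply: lerD; apply: ler_wpM2l.
have hc := trig_lipschitz false (phase t.2 x) (phase t.2 y).
have hs := trig_lipschitz true (phase t.2 x) (phase t.2 y).
rewrite !tev_cons.
have -> : forall a b c d e f : R, a - b + c - (d - e + f) = (a - d) + (e - b) + (c - f) by move=> *; ring.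
apply: le_trans (ler_normD _ _) _; rewrite [leRHS]mulrDl; apply: lerD; last exact: IH.
apply: le_trans (ler_normD _ _) _; rewrite -!mulrBr !normrM [X in _ <= X * h]mulrDl mulrDl -!mulrA.
apply: lerD; apply: ler_wpM2l => //; first exact: le_trans hc hp.
by rewrite distrC; exact: le_trans hs hp.
Qed.

Lemma powR_lipschitz (r B s t : R) : 1 <= r -> 0 <= s <= B -> 0 <= t <= B ->
  `|s `^ r - t `^ r| <= r * B `^ (r - 1) * `|s - t|.
Proof.
move=> r1; wlog st : s t / t <= s.
  move=> H hs ht; case: (leP t s) => [|/ltW] h; first exact: H.
  by rewrite distrC [`|s - t|]distrC; exact: H.
move=> /andP[s0 sB] /andP[t0 tB].
have r0 : 0 <= r by lra.
rewrite !ger0_norm ?subr_ge0//; last by apply: ge0_ler_powR.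
have := powR_tangent r1 s0 t0.
have h : s `^ (r - 1) <= B `^ (r - 1) by apply: ge0_ler_powR => //; rewrite ?nnegrE ?subr_ge0 ?(le_trans s0).
have : r * s `^ (r - 1) * (s - t) <= r * B `^ (r - 1) * (s - t).
  by apply: ler_wpM2r; [rewrite subr_ge0|apply: ler_wpM2l].
have -> : s - t = - (t - s) by ring.
by rewrite !mulrN; lra.
Qed.

Lemma tev_powR_lipschitz r L : 1 <= r -> exists2 B : R, 0 <= B & forall (x y : R * R) (h : R),
  `|x.1 - y.1| <= h -> `|x.2 - y.2| <= h -> `| `|tev L x| `^ r - `|tev L y| `^ r| <= B * h.
Proof.
move=> r1; have [B B0 hB] := tev_lipschitz L; have [M M0 hM] := bmeas_bound (tev_bmeas L).
have K0 : 0 <= r * M `^ (r - 1) by rewrite mulr_ge0 ?powR_ge0//; lra.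
exists (r * M `^ (r - 1) * B) => [|x y h h1 h2]; first by rewrite mulr_ge0.
apply: le_trans (@powR_lipschitz r M _ _ r1 _ _) _; rewrite ?normr_ge0 ?hM// -[leRHS]mulrA.
apply: ler_wpM2l => //; apply: le_trans (hB _ _ _ h1 h2).
exact: ler_dist_dist.
Qed.

Definition grid_mesh (N : nat) : R := 2 * pi / 2 ^+ N.
Definition grid_point N (i j : nat) : R * R := (grid_mesh N * i%:R, grid_mesh N * j%:R).
(* Mean over a square of side 2 ^ k grid steps; such means stay trigonometric
   polynomials and commute with derivatives. *)
Definition avg N k (G : R * R -> R) (x : R * R) : R :=
  \sum_(p : 'I_(2 ^ k) * 'I_(2 ^ k)) 4^-1 ^+ k * G (shift2 (grid_point N p.1 p.2) x).

Lemma mesh_gt0 N : 0 < grid_mesh N.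
Proof. by rewrite /grid_mesh divr_gt0 ?exprn_gt0// mulr_gt0// pi_gt0. Qed.

Lemma mesh_full N : 2 ^+ N * grid_mesh N = 2 * pi.
Proof. by rewrite /grid_mesh mulrC divfK// expf_neq0. Qed.

Lemma mesh_small (e : R) : 0 < e -> exists N0, forall N, (N0 <= N)%N -> grid_mesh N <= e.
Proof.
move=> e0; have p0 : 0 < 2 * pi :> R by rewrite mulr_gt0// pi_gt0.
exists (Num.bound (2 * pi / e)) => N hN.
rewrite /grid_mesh ler_pdivrMr ?exprn_gt0// [leRHS]mulrC -ler_pdivrMr//.
have /ltW h := archi_boundP (ltW (divr_gt0 p0 e0)); apply: le_trans h _.
by rewrite -natrX ler_nat (leq_trans hN)// ltnW// ltn_expl.
Qed.

Lemma gridptD N i j i' j' x :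
  shift2 (grid_point N i j) (shift2 (grid_point N i' j') x) = shift2 (grid_point N (i + i') (j + j')) x.
Proof. by rewrite /shift2 /grid_point /= !natrD; congr (_, _); ring. Qed.

Lemma avg_weights k : \sum_(p : 'I_(2 ^ k) * 'I_(2 ^ k)) 4^-1 ^+ k = 1 :> R.
Proof.
rewrite sumr_const card_prod !card_ord -[LHS]mulr_natr natrM natrX -exprMn -exprMn.
by rewrite (_ : 4^-1 * (2 * 2) = 1 :> R) ?expr1n//; lra.
Qed.

Lemma avg_le N k G H x : (forall y, G y <= H y) -> avg N k G x <= avg N k H x.
Proof. by move=> GH; apply: ler_sum => p _; apply: ler_wpM2l => //; rewrite exprn_ge0. Qed.

Lemma avg_cst N k c x : avg N k (fun=> c) x = c.
Proof. by rewrite /avg -mulr_suml avg_weights mul1r. Qed.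

Lemma avgD N k G H x : avg N k (fun y => G y + H y) x = avg N k G x + avg N k H x.
Proof. by rewrite /avg -big_split; apply: eq_bigr => p _; rewrite mulrDr. Qed.

Lemma avgZ N k c G x : avg N k (fun y => c * G y) x = c * avg N k G x.
Proof. by rewrite /avg mulr_sumr; apply: eq_bigr => p _; rewrite mulrCA. Qed.

Lemma eq_avg N k G H x : G =1 H -> avg N k G x = avg N k H x.
Proof. by move=> GH; apply: eq_bigr => p _; rewrite GH. Qed.

Lemma avg_shift N k G i j x : avg N k (fun y => G (shift2 (grid_point N i j) y)) x = avg N k G (shift2 (grid_point N i j) x).
Proof.
apply: eq_bigr => p _; congr (_ * G _).
by rewrite !gridptD addnC [(j + _)%N]addnC.
Qed.

Lemma avg_norm N k G x : `|avg N k G x| <= avg N k (fun y => `|G y|) x.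
Proof.
apply: le_trans (ler_norm_sum _ _ _) _; apply: ler_sum => p _.
by rewrite normrM ger0_norm// exprn_ge0.
Qed.

Lemma avg_jensen N k r G x : 1 <= r -> `|avg N k G x| `^ r <= avg N k (fun y => `|G y| `^ r) x.
Proof.
move=> r1; apply: (@powR_jensen R _ (index_enum ('I_(2 ^ k) * 'I_(2 ^ k))%type) (fun=> 4^-1 ^+ k) (fun p => G (shift2 (grid_point N p.1 p.2) x)) r) => //.
by rewrite avg_weights.
Qed.

Lemma avg0 N G x : avg N 0 G x = G x.
Proof.
rewrite /avg (big_pred1 (ord0, ord0)) => [|[[[|//] h1] [[|//] h2]]]; last first.
  by rewrite /= xpair_eqE -!val_eqE.
by rewrite expr0 mul1r /grid_point /shift2 /= !mulr0 !addr0; case: x.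
Qed.

Lemma sum_double n (f : nat -> R) : \sum_(i < 2 * n) f i = \sum_(i < n) f i + \sum_(i < n) f (n + i)%N.
Proof. by rewrite mul2n -addnn big_split_ord. Qed.

(** A square of double side is cut into four translates of the smaller one. *)
Lemma avgS N k G x : avg N k.+1 G x =
  4^-1 * \sum_(a : bool) \sum_(b : bool) avg N k G (shift2 (grid_point N (a * 2 ^ k) (b * 2 ^ k)) x).
Proof.
rewrite /avg !sum_bool !sum_pair /= expnS.
pose D i j := \sum_(i' < 2 ^ k) \sum_(j' < 2 ^ k) 4^-1 ^+ k * G (shift2 (grid_point N (i + i') (j + j')) x).
have hD (i j : nat) : \sum_(i' < 2 ^ k) \sum_(j' < 2 ^ k) 4^-1 ^+ k * G (shift2 (grid_point N i' j') (shift2 (grid_point N i j) x)) = D i j.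
  by apply: eq_bigr => i' _; apply: eq_bigr => j' _; rewrite gridptD addnC [(j' + _)%N]addnC.
rewrite !hD !mul0n !mul1n.
rewrite (@sum_double _ (fun i => \sum_(j < 2 * 2 ^ k) 4^-1 ^+ k.+1 * G (shift2 (grid_point N i j) x))).
have hrow i : \sum_(j < 2 * 2 ^ k) 4^-1 ^+ k.+1 * G (shift2 (grid_point N i j) x) =
   4^-1 * (\sum_(j < 2 ^ k) 4^-1 ^+ k * G (shift2 (grid_point N i j) x) +
           \sum_(j < 2 ^ k) 4^-1 ^+ k * G (shift2 (grid_point N i (2 ^ k + j)) x)).
  rewrite (@sum_double _ (fun j => 4^-1 ^+ k.+1 * G (shift2 (grid_point N i j) x))) mulrDr !mulr_sumr.
  by congr (_ + _); apply: eq_bigr => j _; rewrite exprS mulrA.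
under eq_bigr do rewrite hrow; under [X in _ + X]eq_bigr do rewrite hrow.
by rewrite -!mulr_sumr -mulrDr !big_split /= -/(D 0 0)%N -/(D 0 (2 ^ k))%N -/(D (2 ^ k) 0)%N -/(D (2 ^ k) (2 ^ k))%N.
Qed.

End Averages.

(** * Morrey's inequality for dyadic averages *)

Section Morrey.
Variable R : realType.
Local Notation C := R[i].
Local Notation Re := (@complex.Re R).
Implicit Types (L : tpoly R).
Local Notation mesh := (@grid_mesh R).
Local Notation gridpt := (@grid_point R).

Lemma tev_tmult_sum (I : Type) (W : seq I) (M : I -> int * int -> C) L x :
  tev (tmult (fun k => \sum_(p <- W) M p k) L) x = \sum_(p <- W) tev (tmult (M p) L) x.
Proof.
rewrite /tev -Re_sum; congr (Re _); rewrite tval_tmult.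
under [RHS]eq_bigr do rewrite tval_tmult.
rewrite exchange_big /=; apply: eq_bigr => t _.
by rewrite -mulrA mulr_suml; apply: eq_bigr => p _; rewrite mulrA.
Qed.

Definition tavg N k L : tpoly R :=
  tmult (fun kk => \sum_(p : 'I_(2 ^ k) * 'I_(2 ^ k)) (4^-1 ^+ k)%:C%C * cexpi (phase kk (gridpt N p.1 p.2))) L.

Lemma tev_tavg N k L x : tev (tavg N k L) x = avg N k (tev L) x.
Proof.
rewrite /tavg tev_tmult_sum; apply: eq_bigr => p _.
by rewrite tev_shift -tev_scale tmult_comp.
Qed.

Lemma tder_tavg N k b L x : tev (tder b (tavg N k L)) x = avg N k (tev (tder b L)) x.
Proof.
rewrite -tev_tavg /tder /tavg !tmult_comp; congr (tev _ x).
by apply: eq_tmult => kk _; rewrite mulrC.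
Qed.

Lemma bmeas_avg N k (G : R * R -> R) : bmeas G -> bmeas (avg N k G).
Proof.
move=> bG; apply: bmeas_sum => p; apply: bmeasZ; exact: (bmeas_shift _ bG).
Qed.

Lemma Iint_avg N k (G : R * R -> R) : bmeas G -> periodic2 G -> Iint (avg N k G) = Iint G.
Proof.
move=> bG pG; rewrite /avg Iint_sum; last by move=> p; apply: bmeasZ; exact: (bmeas_shift _ bG).
rewrite (eq_bigr (fun=> 4^-1 ^+ k * Iint G)); first by rewrite -mulr_suml avg_weights mul1r.
move=> p _; rewrite IintZ; last exact: (bmeas_shift _ bG).
by rewrite -[in RHS](Iint_shift (gridpt N p.1 p.2) bG pG).
Qed.

Lemma periodic2_comp (phi : R -> R) (G : R * R -> R) : periodic2 G -> periodic2 (fun x => phi (G x)).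
Proof. by move=> pG x y; have [h1 h2] := pG x y; rewrite h1 h2. Qed.

Lemma Lp_avg N k r (G : R * R -> R) : 1 <= r -> bmeas G -> periodic2 G -> Lp r (avg N k G) <= Lp r G.
Proof.
move=> r1 bG pG; have r0 : 0 <= r by lra.
have bH : bmeas (fun x => `|G x| `^ r) by exact: bmeas_powR.
rewrite /Lp -[leRHS](Iint_avg N k bH); last exact: (periodic2_comp (fun t => `|t| `^ r)).
apply: Iint_le; [apply: bmeas_powR => //; exact: bmeas_avg|exact: bmeas_avg|].
by move=> x; exact: avg_jensen.
Qed.

Lemma sum_cyclic n (f : nat -> R) a : (forall i, f (n + i)%N = f i) ->
  \sum_(i < n) f (i + a)%N = \sum_(i < n) f i.
Proof.
move=> hf; elim: a => [|a <-]; first by under eq_bigr do rewrite addn0.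
case: n hf => [|m] hf; first by rewrite !big_ord0.
rewrite big_ord_recr [RHS]big_ord_recl /= addrC; congr (_ + _).
  by rewrite addnS -addSn hf add0n.
by apply: eq_bigr => i _; rewrite addnS -addSn.
Qed.

Lemma periodic2_avg N k (G : R * R -> R) : periodic2 G -> periodic2 (avg N k G).
Proof.
move=> pG x y; split; apply: eq_bigr => p _; congr (_ * _).
  exact: (periodic2_shift (gridpt N p.1 p.2) pG x y).1.
exact: (periodic2_shift (gridpt N p.1 p.2) pG x y).2.
Qed.

Lemma avg_full_shift N (G : R * R -> R) a b x : periodic2 G ->
  avg N N G (shift2 (gridpt N a b) x) = avg N N G x.
Proof.
move=> pG; rewrite /avg !sum_pair /=.
have per i j : G (shift2 (gridpt N (2 ^ N + i) j) x) = G (shift2 (gridpt N i j) x) /\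
    G (shift2 (gridpt N i (2 ^ N + j)) x) = G (shift2 (gridpt N i j) x).
  have h m : mesh N * (2 ^ N + m)%N%:R = mesh N * m%:R + 2 * pi.
    by rewrite natrD mulrDr natrX addrC [X in _ + X]mulrC mesh_full.
  rewrite /shift2 /grid_point /= !h !addrA.
  by have [h1 h2] := pG (x.1 + mesh N * i%:R) (x.2 + mesh N * j%:R).
transitivity (\sum_(i < 2 ^ N) \sum_(j < 2 ^ N) 4^-1 ^+ N * G (shift2 (gridpt N (i + a) (j + b)) x)).
  by apply: eq_bigr => i _; apply: eq_bigr => j _; rewrite gridptD.
rewrite (@sum_cyclic _ (fun i => \sum_(j < 2 ^ N) 4^-1 ^+ N * G (shift2 (gridpt N i (j + b)) x))).
  apply: eq_bigr => i _; apply: (@sum_cyclic _ (fun j => 4^-1 ^+ N * G (shift2 (gridpt N i j) x))).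
  by move=> j; rewrite (per i j).2.
by move=> i; apply: eq_bigr => j _; rewrite (per i _).1.
Qed.

(** At full scale the average is a Riemann sum over one period. It is invariant under grid
    translations, so its values at two points differ by no more than the oscillation of the function
    over one mesh, and its mean is that of the function. *)
Lemma avg_full_le r L (e : R) : 1 <= r -> 0 < e -> exists N0, forall N, (N0 <= N)%N -> forall x,
  (2 * pi) ^+ 2 * avg N N (fun y => `|tev L y| `^ r) x <= Lp r (tev L) + e.
Proof.
move=> r1 e0; have r0 : 0 <= r by lra.
pose H y := `|tev L y| `^ r; rewrite -/H.
have bH : bmeas H by apply: bmeas_powR => //; exact: tev_bmeas.
have pH : periodic2 H by apply: (periodic2_comp (fun t => `|t| `^ r)); exact: tev_periodic.
have [B B0 hB] := tev_powR_lipschitz L r1.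
have P0 : 0 < (2 * pi) ^+ 2 :> R by rewrite exprn_gt0// mulr_gt0// pi_gt0.
pose d := e / ((2 * pi) ^+ 2 * (B + 1)).
have B1 : 0 < B + 1 by lra.
have d0 : 0 < d by rewrite divr_gt0// mulr_gt0.
have [N0 hN0] := mesh_small d0; exists N0 => N /hN0 hN x.
have osc x' : avg N N H x <= avg N N H x' + B * d.
  have n0 : (0 < 2 ^ N)%N by rewrite expn_gt0.
  have [i [q1 h1]] := grid_near (x'.1 - x.1) n0; have [j [q2 h2]] := grid_near (x'.2 - x.2) n0.
  have pA := periodic2_avg N N pH.
  have <- : avg N N H (shift2 (gridpt N i j) x) = avg N N H x by exact: avg_full_shift.
  pose y := shift2 (gridpt N i j) x.
  have <- : avg N N H (y.1 + 2 * pi * q1%:~R, y.2 + 2 * pi * q2%:~R) = avg N N H y.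
    by rewrite (periodic2_int pA); case: (y).
  rewrite -lerBlDl -(avg_cst N N (B * d) x') -/y.
  rewrite -sumrB; apply: ler_sum => p _; rewrite -mulrBr; apply: ler_wpM2l; first by rewrite exprn_ge0.
  apply: le_trans (ler_norm _) _; apply: hB.
    rewrite /shift2 /=; apply: le_trans hN; move: h1; rewrite /grid_mesh natrX distrC.
    congr (`|_| <= _); rewrite /y /shift2 /grid_point /grid_mesh /=; ring.
  rewrite /shift2 /=; apply: le_trans hN; move: h2; rewrite /grid_mesh natrX distrC.
  congr (`|_| <= _); rewrite /y /shift2 /grid_point /grid_mesh /=; ring.
have bA : bmeas (avg N N H) by exact: bmeas_avg.
have : Iint (fun=> avg N N H x) <= Iint (fun x' => avg N N H x' + B * d).
  by apply: Iint_le; [exact: bmeas_cst|exact: bmeasD bA (bmeas_cst _)|exact: osc].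
rewrite (IintD bA (bmeas_cst _)).
rewrite !Iint_cst Iint_avg// mulrC -/(Lp r (tev L)) => h.
apply: le_trans h _; rewrite lerD2l /d.
have -> : B * (e / ((2 * pi) ^+ 2 * (B + 1))) * (2 * pi) ^+ 2 = e * (B / (B + 1)).
  by move: ((2 * pi : R) ^+ 2) P0 => P P0; field; rewrite !gt_eqF.
by rewrite -[leRHS]mulr1; apply: ler_wpM2l; [exact: ltW|rewrite ler_pdivrMr// mul1r; lra].
Qed.

(** Up to a common factor both sides are sums of nonnegative terms, over a square and over a larger
    square that contains it. *)
Lemma avg_scale_le N k j (H : R * R -> R) x : (forall y, 0 <= H y) ->
  4 ^+ k * avg N k H x <= 4 ^+ (k + j) * avg N (k + j) H x.
Proof.
move=> H0; elim: j => [|j IH]; first by rewrite addn0.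
apply: le_trans IH _; rewrite addnS; move: (k + j)%N => m.
have A0 y : 0 <= avg N m H y.
  by apply: sumr_ge0 => p _; rewrite mulr_ge0 ?exprn_ge0.
rewrite avgS exprSr -mulrA; apply: ler_wpM2l; first by rewrite exprn_ge0.
rewrite mulrA divff// mul1r (bigD1 false)//= (bigD1 false)//= !mul0n.
have -> : shift2 (gridpt N 0 0) x = x by rewrite /shift2 /grid_point /= !mulr0 !addr0; case: (x).
rewrite -addrA lerDl addr_ge0//; first by apply: sumr_ge0.
by apply: sumr_ge0 => a _; apply: sumr_ge0.
Qed.

Lemma avg_powR_le r L (e : R) : 1 <= r -> 0 < e -> exists N0, forall N, (N0 <= N)%N -> forall k, (k <= N)%N ->
  forall x, (2 ^+ k * mesh N) ^+ 2 * avg N k (fun y => `|tev L y| `^ r) x <= Lp r (tev L) + e.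
Proof.
move=> r1 e0; have [N0 hN0] := avg_full_le L r1 e0; exists N0 => N /hN0 hN k kN x.
apply: le_trans (hN x); rewrite -(mesh_full R N).
move: (mesh N) => m.
have E (n : nat) : (2 ^+ n * m) ^+ 2 = m ^+ 2 * 4 ^+ n.
  by rewrite exprMn -exprM mulnC exprM [LHS]mulrC (_ : 2 ^+ 2 = 4 :> R)// expr2; lra.
rewrite !E; move: (m ^+ 2) (sqr_ge0 m) => u u0; rewrite -!mulrA; apply: ler_wpM2l; first exact: u0.
have := @avg_scale_le N k (N - k) (fun y => `|tev L y| `^ r) x (fun y => powR_ge0 _ _).
by rewrite subnKC.
Qed.

(** Mean value theorem; [eta] pays for the oscillation of the derivative over one mesh. *)
Lemma tev_step b L (eta : R) : 0 < eta -> exists N0, forall N, (N0 <= N)%N -> forall x,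
  `|tev L (shift2 (axis2 b (mesh N)) x) - tev L x| <= mesh N * (`|tev (tder b L) x| + eta).
Proof.
move=> eta0; have [B B0 hB] := tev_lipschitz (tder b L).
have B1 : 0 < B + 1 by lra.
have d0 : 0 < eta / (B + 1) by rewrite divr_gt0.
have [N0 hN0] := mesh_small d0; exists N0 => N /hN0 hN x.
have m0 := mesh_gt0 R N.
have cf : {within `[0, mesh N], continuous (fun s => tev L (shift2 (axis2 b s) x))}.
  apply: derivable_within_continuous => s _.
  by have := tev_is_derive b L x s => -[].
have [c] := MVT m0 (fun s _ => tev_is_derive b L x s) cf.
rewrite in_itv /= => /andP[c0 c1].
have -> : shift2 (axis2 b 0) x = x by rewrite /shift2; case: (b) => /=; rewrite !addr0; case: (x).
move=> ->; rewrite subr0 normrM [X in _ * X <= _](gtr0_norm m0) mulrC; apply: ler_wpM2l; first exact: ltW.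
rewrite -[X in `|X| <= _](subrK (tev (tder b L) x)) addrC.
apply: le_trans (ler_normD _ _) _.
rewrite lerD2l; apply: (@le_trans _ _ (B * mesh N)).
  by apply: hB; rewrite /shift2; case: (b) => /=; rewrite ?addr0 ?subrr ?normr0 ?(ltW m0)//
    addrAC subrr add0r ger0_norm ltW.
apply: (@le_trans _ _ (B * (eta / (B + 1)))); first by apply: ler_wpM2l.
have -> : B * (eta / (B + 1)) = eta * (B / (B + 1)) by ring.
by rewrite -[leRHS]mulr1; apply: ler_wpM2l; [exact: ltW|rewrite ler_pdivrMr// mul1r; lra].
Qed.

Lemma avg_axis_step b L N k (eta M : R) :
  (forall x, `|tev L (shift2 (axis2 b (mesh N)) x) - tev L x| <= mesh N * (`|tev (tder b L) x| + eta)) ->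
  (forall x, avg N k (fun y => `|tev (tder b L) y|) x <= M) ->
  forall i x, `|avg N k (tev L) (shift2 (axis2 b (mesh N * i%:R)) x) - avg N k (tev L) x| <=
    i%:R * mesh N * (M + eta).
Proof.
move=> hs hM i x; have m0 := mesh_gt0 R N.
elim: i => [|i IH].
  rewrite mulr0 mul0r mul0r; have -> : shift2 (axis2 b 0) x = x.
    by rewrite /shift2; case: (b) => /=; rewrite !addr0; case: (x).
  by rewrite subrr normr0.
set y := shift2 (axis2 b (mesh N * i%:R)) x in IH.
have ax z : shift2 (axis2 b (mesh N)) z = shift2 (if b then gridpt N 0 1 else gridpt N 1 0) z.
  by rewrite /shift2 /grid_point; case: (b) => /=; rewrite ?mulr1 ?mulr0.
have -> : shift2 (axis2 b (mesh N * i.+1%:R)) x = shift2 (axis2 b (mesh N)) y.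
  by rewrite /y /shift2 -natr1 mulrDr mulr1; case: (b) => /=; rewrite ?addr0 ?addrA.
have step : `|avg N k (tev L) (shift2 (axis2 b (mesh N)) y) - avg N k (tev L) y| <= mesh N * (M + eta).
  have -> : avg N k (tev L) (shift2 (axis2 b (mesh N)) y) = avg N k (fun z => tev L (shift2 (axis2 b (mesh N)) z)) y.
    transitivity (avg N k (fun z => tev L (shift2 (if b then gridpt N 0 1 else gridpt N 1 0) z)) y).
      by rewrite ax; case: (b); rewrite avg_shift.
    by apply: eq_avg => z; rewrite ax.
  have -> : avg N k (fun z => tev L (shift2 (axis2 b (mesh N)) z)) y - avg N k (tev L) y =
    avg N k (fun z => tev L (shift2 (axis2 b (mesh N)) z) + - 1 * tev L z) y.
    by rewrite avgD avgZ mulN1r.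
  apply: le_trans (avg_norm _ _ _ _) _.
  apply: (@le_trans _ _ (avg N k (fun z => mesh N * (`|tev (tder b L) z| + eta)) y)).
    by apply: avg_le => z; rewrite mulN1r; exact: hs.
  by rewrite avgZ avgD avg_cst; apply: ler_wpM2l; [exact: ltW|rewrite lerD2r].
rewrite -[X in `|X - _|](subrK (avg N k (tev L) y)) -addrA.
apply: le_trans (ler_normD _ _) _; rewrite -natr1.
by have := lerD step IH; move=> h; apply: le_trans h _; apply: eq_ler; ring.
Qed.

(** The four quarters of the larger square are translates of the smaller one by at most 2^k steps
    along each axis. *)
Lemma morrey_level L N k (eta M : R) : 0 <= M + eta ->
  (forall b x, `|tev L (shift2 (axis2 b (mesh N)) x) - tev L x| <= mesh N * (`|tev (tder b L) x| + eta)) ->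
  (forall b x, avg N k (fun y => `|tev (tder b L) y|) x <= M) ->
  forall x, `|avg N k.+1 (tev L) x - avg N k (tev L) x| <= 2 * (2 ^+ k * mesh N) * (M + eta).
Proof.
move=> Me hs hM x; have m0 := mesh_gt0 R N.
have h0 : 0 <= 2 ^+ k * mesh N * (M + eta).
  by apply: mulr_ge0 => //; apply: mulr_ge0; [exact: exprn_ge0|exact: ltW].
have one (b a : bool) y : `|avg N k (tev L) (shift2 (axis2 b (mesh N * (a * 2 ^ k)%:R)) y) - avg N k (tev L) y| <=
    2 ^+ k * mesh N * (M + eta).
  apply: le_trans (@avg_axis_step b L N k eta M (hs b) (hM b) _ _) _.
  by case: a; rewrite ?mul1n ?mul0n ?natrX// !mul0r.
have two (a b : bool) : `|avg N k (tev L) (shift2 (gridpt N (a * 2 ^ k) (b * 2 ^ k)) x) - avg N k (tev L) x| <=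
    2 * (2 ^+ k * mesh N) * (M + eta).
  have -> : shift2 (gridpt N (a * 2 ^ k) (b * 2 ^ k)) x =
      shift2 (axis2 true (mesh N * (b * 2 ^ k)%:R)) (shift2 (axis2 false (mesh N * (a * 2 ^ k)%:R)) x).
    by rewrite /shift2 /= !addr0.
  set y := shift2 (axis2 false _) x.
  rewrite -[X in `|X - _|](subrK (avg N k (tev L) y)) -addrA; apply: le_trans (ler_normD _ _) _.
  by apply: le_trans (lerD (one true b y) (one false a x)) _; apply: eq_ler; ring.
rewrite avgS.
have -> : avg N k (tev L) x = 4^-1 * \sum_(a : bool) \sum_(b : bool) avg N k (tev L) x.
  by rewrite !sum_bool; lra.
rewrite -mulrBr normrM ger0_norm// !sum_bool.
have := two false false; have := two false true; have := two true false; have := two true true.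
set A := avg N k _ x; set a := avg N k _ _; set b := avg N k _ _; set c := avg N k _ _; set d := avg N k _ _.
set B := 2 * _ * _; move=> h1 h2 h3 h4.
have : `|d + c + (b + a) - (A + A + (A + A))| <= B + B + B + B.
  rewrite (_ : _ - _ = (d - A) + (c - A) + (b - A) + (a - A)); last by ring.
  do 3![apply: le_trans (ler_normD _ _) _; apply: lerD => //].
lra.
Qed.

(** Telescoping over scales, from the single point k = 0 up to the given side. By Jensen the mean of
    the gradient over a square of side h is at most (E / h^2)^(1/q) up to the error [e], so the
    increments are of order h^(1 - 2/q) and form a growing geometric series because q > 2. *)
Lemma morrey (q : R) : 2 < q -> exists2 c : R, 0 < c & forall L (E e eta : R), 0 < e -> 0 < eta ->
  (forall b, Lp q (tev (tder b L)) <= E) ->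
  exists N0, forall N, (N0 <= N)%N -> forall k, (k <= N)%N -> forall x,
    `|avg N k (tev L) x - tev L x| <=
      c * (2 ^+ k * mesh N) `^ (1 - 2 / q) * (E + e) `^ q^-1 + 2 * (2 ^+ k * mesh N) * eta.
Proof.
move=> q2; have q0 : 0 < q by lra.
pose th := 1 - 2 / q.
have th0 : 0 < th by rewrite /th subr_gt0 ltr_pdivrMr// mul1r.
pose g : R := 2 `^ th.
have g1 : 1 < g.
  have := @gt0_ltr_powR _ _ th0 1 2; rewrite powR1 !nnegrE; apply => //.
  by rewrite ltr1n.
(* The solution of c g = c + 2, which is the recursion for the constant when the side doubles. *)
pose c := 2 / (g - 1).
have c0 : 0 < c by rewrite divr_gt0// subr_gt0.
exists c => // L E e eta e0 eta0 hE.
have q1 : 1 <= q by lra.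
have [N1 hN1] := avg_powR_le (tder false L) q1 e0; have [N2 hN2] := avg_powR_le (tder true L) q1 e0.
have [N3 hN3] := tev_step false L eta0; have [N4 hN4] := tev_step true L eta0.
exists (maxn (maxn N1 N2) (maxn N3 N4)) => N; rewrite !geq_max => /andP[/andP[l1 l2] /andP[l3 l4]] k.
have E0 : 0 <= E by apply: le_trans (hE false); exact: Lp_ge0.
have Ee : 0 < E + e by lra.
set D := (E + e) `^ q^-1.
have D0 : 0 <= D by exact: powR_ge0.
elim: k => [|k IH] kN x.
  have m0 := ltW (mesh_gt0 R N).
  rewrite avg0 subrr normr0 expr0 mul1r; apply: addr_ge0.
    by apply: mulr_ge0 => //; apply: mulr_ge0; [exact: ltW|exact: powR_ge0].
  by apply: mulr_ge0; [apply: mulr_ge0|exact: ltW].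
have h0 : 0 < 2 ^+ k * mesh N by apply: mulr_gt0; [exact: exprn_gt0|exact: mesh_gt0].
pose h := 2 ^+ k * mesh N; rewrite -/h in h0.
pose M := h `^ (- (2 / q)) * D.
have M0 : 0 <= M by rewrite mulr_ge0 ?powR_ge0.
have Mq : M `^ q = (h ^+ 2)^-1 * (E + e).
  rewrite /M powRM ?powR_ge0// -!powRrM mulVf ?gt_eqF// powRr1 ?ltW//; congr (_ * _).
  rewrite mulNr divfK ?gt_eqF// powRN; congr (_^-1).
  by rewrite powR_mulrn// ltW.
have hM b x' : avg N k (fun y => `|tev (tder b L) y|) x' <= M.
  have A0 : 0 <= avg N k (fun y => `|tev (tder b L) y|) x'.
    by apply: sumr_ge0 => p _; rewrite mulr_ge0 ?exprn_ge0.
  rewrite leNgt; apply/negP => lt.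
  have := @gt0_ltr_powR _ q q0 M (avg N k (fun y => `|tev (tder b L) y|) x').
  rewrite !nnegrE => /(_ M0 A0 lt); apply/negP; rewrite -leNgt Mq.
  rewrite -[X in X `^ q]ger0_norm//; apply: le_trans (avg_jensen _ _ _ _ q1) _.
  rewrite ler_pdivlMl ?exprn_gt0// (@eq_avg _ N k _ (fun y => `|tev (tder b L) y| `^ q)); last first.
    by move=> y; rewrite normr_id.
  have hEb := hE b; have kN' := ltnW kN.
  by case: b hEb {A0 lt} => hEb; [have := hN2 N l2 k kN' x'|have := hN1 N l1 k kN' x'] => h'; apply: le_trans h' _; rewrite lerD2r.
have hs b x' : `|tev L (shift2 (axis2 b (mesh N)) x') - tev L x'| <= mesh N * (`|tev (tder b L) x'| + eta).
  by case: b; [exact: hN4|exact: hN3].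
have Me : 0 <= M + eta by rewrite addr_ge0// ltW.
have := morrey_level Me hs hM x; rewrite -/h => hl.
have := IH (ltnW kN) x; rewrite -/h => hI.
have -> : avg N k.+1 (tev L) x - tev L x =
  (avg N k.+1 (tev L) x - avg N k (tev L) x) + (avg N k (tev L) x - tev L x) by ring.
apply: le_trans (ler_normD _ _) _; apply: le_trans (lerD hl hI) _.
have -> : 2 ^+ k.+1 * mesh N = 2 * h by rewrite /h exprS -mulrA.
rewrite powRM ?(ltW h0)// -/th -/g.
have hM' : h * M = h `^ th * D.
  rewrite /M mulrA; congr (_ * _); rewrite -[X in X * _](powRr1 (ltW h0)) -powRD ?(gt_eqF h0) ?implybT//.
have cg : c * g = c + 2 by rewrite /c; field; rewrite subr_eq0 gt_eqF.
apply: eq_ler.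
have -> : 2 * h * (M + eta) = 2 * (h * M) + 2 * h * eta by ring.
rewrite hM'; have -> : c * (g * h `^ th) * D = (c * g) * (h `^ th * D) by ring.
rewrite cg; ring.
Qed.

End Morrey.

(** * The corrected average of the bounded field *)

Section TrigSolution.
Variable R : realType.
Local Notation C := R[i].
Implicit Types (L : tpoly R).
Local Notation mesh := (@grid_mesh R).

Lemma eventually_bool (P : bool -> nat -> Prop) :
  (forall b, exists N0, forall N, (N0 <= N)%N -> P b N) ->
  exists N0, forall N, (N0 <= N)%N -> forall b, P b N.
Proof.
move=> h; have [N1 h1] := h false; have [N2 h2] := h true.
by exists (maxn N1 N2) => N; rewrite geq_max => /andP[l1 l2] [|]; [exact: h2|exact: h1].
Qed.

Lemma dyadic_scale (m h : R) n : 0 <= m -> m <= h -> h <= 2 ^+ n * m ->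
  exists k, [/\ (k <= n)%N, 2 ^+ k * m <= h & h <= 2 * (2 ^+ k * m)].
Proof.
move=> m0 mh; elim: n => [|n IH] hn.
  by exists 0%N; split => //; rewrite expr0 ?mul1r//; move: hn; rewrite expr0 mul1r; lra.
case: (leP h (2 ^+ n * m)) => [/IH[k [kn h1 h2]]|/ltW h1]; first by exists k; split => //; exact: leqW.
by exists n; split => //; rewrite mulrA -exprS.
Qed.

Lemma sqr_le_powR (s q t : R) : 0 < s -> 2 < q -> `|t| `^ 2 <= s ^+ 2 + s `^ (2 - q) * `|t| `^ q.
Proof.
move=> s0 q2; have [h|h] := leP `|t| s.
  rewrite -[leLHS]addr0; apply: lerD; last by rewrite mulr_ge0 ?powR_ge0.
  by rewrite powR_sqr -(real_normK (num_real _)) lerXn2r// nnegrE ltW.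
have g0 : 0 < `|t| by exact: lt_trans h.
rewrite -[leLHS]add0r; apply: lerD; first exact: sqr_ge0.
have e : `|t| `^ 2 = `|t| `^ (2 - q) * `|t| `^ q.
  by rewrite -powRD ?(gt_eqF g0) ?implybT// subrK.
rewrite e; apply: ler_wpM2r; first exact: powR_ge0.
rewrite -opprB !powRN lef_pV2 ?posrE ?powR_gt0//.
by apply: ge0_ler_powR; rewrite ?nnegrE ?subr_ge0 ?ltW.
Qed.

(** Stands in for Hölder's inequality on a space of finite measure, with [s] in the role of the L^q
    norm; it is obtained by splitting the values at the level [s]. *)
Lemma Lp2_le_Lpq (q : R) : 2 < q -> forall G : R * R -> R, bmeas G -> forall s, 0 < s ->
  Lp q G <= s `^ q -> Lp 2 G <= ((2 * pi) ^+ 2 + 1) * s ^+ 2.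
Proof.
move=> q2 G bG s s0 hs; have q0 : 0 <= q by lra.
have bq : bmeas (fun x => `|G x| `^ q) by exact: bmeas_powR.
apply: (@le_trans _ _ (Iint (fun x => s ^+ 2 + s `^ (2 - q) * `|G x| `^ q))).
  by apply: Iint_le => //; [exact: bmeas_powR|apply: bmeasD; [exact: bmeas_cst|exact: bmeasZ]|move=> x; exact: sqr_le_powR].
rewrite IintD; [|exact: bmeas_cst|exact: bmeasZ].
rewrite IintZ// Iint_cst -/(Lp q G).
have -> : ((2 * pi) ^+ 2 + 1) * s ^+ 2 = s ^+ 2 * (2 * pi) ^+ 2 + s ^+ 2.
  by move: ((2 * pi : R) ^+ 2) => P; ring.
rewrite lerD2l.
apply: (@le_trans _ _ (s `^ (2 - q) * s `^ q)); first by apply: ler_wpM2l => //; exact: powR_ge0.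
by rewrite -powRD ?(gt_eqF s0) ?implybT// subrK powR_mulrn// ltW.
Qed.

Definition grad_inv_laplacian (b : bool) L : tpoly R := tmult (fun k => (0 -i* (frequency R b k / frequency_sqr R k))%C) L.

Lemma tder_grad_inv_laplacian b c L : tder c (grad_inv_laplacian b L) = tmult (fun k => (riesz2 R b c k)%:C%C) L.
Proof.
rewrite /tder /grad_inv_laplacian tmult_comp; apply: eq_tmult => k _.
by apply: cplx_eq; rewrite ?ReM ?ImM /= /riesz2; ring.
Qed.

Lemma div_grad_inv_laplacian L x : 0 \notin map snd L ->
  tev (tder false (grad_inv_laplacian false L)) x + tev (tder true (grad_inv_laplacian true L)) x = tev L x.
Proof.
move=> L0; rewrite !tder_grad_inv_laplacian /tev -ReD -tval_multD.
rewrite (@eq_tmult _ _ (fun=> 1)); first by rewrite tval_scale mul1r.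
move=> k kL; have k0 : k != 0 by apply: contraNneq L0 => <-.
have := freq2_neq0 R k0; rewrite /riesz2 {1}/frequency_sqr => h.
by apply: cplx_eq => /=; rewrite ?addr0// -mulrDl -!expr2 divff.
Qed.

Lemma Lp_le_bound (q S : R) (G : R * R -> R) : 2 < q -> 0 <= S -> bmeas G ->
  (forall x, `|G x| <= S) -> Lp q G <= S `^ (q - 2) * Lp 2 G.
Proof.
move=> q2 S0 bG hG; rewrite /Lp -IintZ; last by apply: bmeas_powR.
apply: Iint_le; [by apply: bmeas_powR => //; lra|by apply: bmeasZ; apply: bmeas_powR|move=> x].
have [->|g0] := eqVneq `|G x| 0.
  by rewrite !powR0 ?mulr0// gt_eqF//; lra.
have gp : 0 < `|G x| by rewrite lt_def g0 /=.
have -> : `|G x| `^ q = `|G x| `^ (q - 2) * `|G x| `^ 2.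
  by rewrite -powRD ?g0 ?implybT// subrK.
apply: ler_wpM2r; first exact: powR_ge0.
by apply: ge0_ler_powR; rewrite ?nnegrE ?subr_ge0// ltW.
Qed.

(** Here a is the L^2 norm of the data and b the L^q norm, and h^(1 - 2/q) is proportional to a / b.
    The left side is what interpolation between the sup bound a / h and the L^2 bound a gives for
    the q-th power of the gradient of the averaged field: a multiple of b^q. *)
Lemma scale_identity (q a b c0 P : R) : 2 < q -> 0 < a -> 0 < b -> 0 < c0 -> 0 < P ->
  let h := P * (a / (c0 * b)) `^ (1 - 2 / q)^-1 in
  (a / h) `^ (q - 2) * a ^+ 2 = P `^ (2 - q) * c0 `^ q * b `^ q.
Proof.
move=> q2 a0 b0 c00 P0; set rho := a / _; move=> h.
have q0 : q != 0 by rewrite gt_eqF//; lra.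
have th0 : 1 - 2 / q != 0.
  rewrite gt_eqF// subr_gt0 ltr_pdivrMr; lra.
have r0 : 0 < rho by rewrite divr_gt0// mulr_gt0.
have h0 : 0 < h by rewrite mulr_gt0// powR_gt0.
have hE : h `^ (q - 2) = P `^ (q - 2) * rho `^ q.
  rewrite powRM ?powR_ge0 ?(ltW P0)// -powRrM; congr (_ * _ `^ _).
  by rewrite mulrC -[q - 2](_ : q * (1 - 2 / q) = q - 2) ?mulfK//; field.
rewrite -[a ^+ 2]powR_mulrn ?ltW// -[X in _ * X]/(a `^ 2).
rewrite powRM ?invr_ge0 ?ltW// -powR_inv1 ?ltW// -powRrM mulN1r powRN hE mulrAC -powRD ?(gt_eqF a0) ?implybT//.
rewrite subrK -opprB powRN.
rewrite /rho powRM ?invr_ge0 ?mulr_ge0 ?ltW// -(powR_inv1 (ltW (mulr_gt0 c00 b0))) -powRrM mulN1r powRN powRM ?ltW//.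
have := powR_gt0 q a0; have := powR_gt0 q b0; have := powR_gt0 q c00; have := powR_gt0 (2 - q) P0.
move: (a `^ q) (b `^ q) (c0 `^ q) (P `^ (2 - q)) => u v w z *.
by field; rewrite !gt_eqF.
Qed.

Lemma Lp_corrected r N k LZ LF (X Y : R) : 1 <= r -> Lp r (avg N k (tev LZ)) <= X -> Lp r (tev LF) <= Y ->
  Lp r (fun x => avg N k (tev LZ) x + (tev LF x + -1 * avg N k (tev LF) x)) <=
    2 `^ r * (X + 2 `^ r * (Y + Y)).
Proof.
move=> r1; have r0 : 0 <= r by lra.
move=> hX hY; have bz : bmeas (tev LZ) by exact: tev_bmeas.
have bm : bmeas (tev LF) by exact: tev_bmeas.
have ba1 : bmeas (avg N k (tev LZ)) by exact: bmeas_avg.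
have ba2 : bmeas (avg N k (tev LF)) by exact: bmeas_avg.
have ba3 : bmeas (fun x => -1 * avg N k (tev LF) x) by exact: bmeasZ.
have ba4 : bmeas (fun x => tev LF x + -1 * avg N k (tev LF) x) by exact: bmeasD.
apply: le_trans (LpD r0 ba1 ba4) _.
apply: ler_wpM2l; first exact: powR_ge0.
apply: lerD; first exact: hX.
apply: le_trans (LpD r0 bm ba3) _.
apply: ler_wpM2l; first exact: powR_ge0.
apply: lerD; first exact: hY.
rewrite LpZ// normrN normr1 powR1 mul1r; apply: le_trans hY.
by apply: Lp_avg; [exact: r1|exact: bm|exact: tev_periodic].
Qed.

(* Z solves the equation with ||Z||_oo <= C ||f||_2, F0 = grad Laplacian^-1 f with
   gradient bounded in L^q. The field A Z + F0 - A F0, with A the mean over squares of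
   side h, has both bounds when h balances the smoothing estimate for grad (A Z)
   against Morrey's estimate for F0 - A F0. *)
Lemma trig_solution_constants (q Kq : R) : 2 < q -> 0 <= Kq ->
  (forall b b' L, 0 \notin map snd L ->
     Lp q (tev (tmult (fun k => (riesz2 R b b' k)%:C%C) L)) <= Kq * Lp q (tev L)) ->
  exists Ks k1 k2 : R, [/\ 0 <= Ks, 0 <= k1, 0 <= k2 & forall L, 0 \notin map snd L ->
  0 < Lp 2 (tev L) -> exists F : bool -> tpoly R,
  [/\ forall x, tev (tder false (F false)) x + tev (tder true (F true)) x = tev L x,
      forall b x, `|tev (F b) x| <= Ks * Num.sqrt (Lp 2 (tev L)),
      forall b c, Lp 2 (tev (tder c (F b))) <= k1 * Lp 2 (tev L) &
      forall b c, Lp q (tev (tder c (F b))) <= k2 * Lp q (tev L)]].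
Proof.
move=> q2 Kq0 hKq.
have q0 : 0 < q by lra.
have q1 : 1 <= q by lra.
pose th : R := 1 - 2 / q.
have th0 : 0 < th by rewrite /th subr_gt0 ltr_pdivrMr// mul1r.
have [K2 K20 hZ] := @trig_divergence R.
have [M M0 hM] := morrey q2.
have [KR KR0 hKR] := @riesz2_bound R 1 isT.
have P0 : 0 < 2 * pi :> R by rewrite mulr_gt0// pi_gt0.
have [P hP] : exists P : R, P = 2 * pi by eexists.
rewrite -hP in P0.
(* The constant in the comparison a <= c0 b of the L^2 and L^q norms. *)
pose c0 := Num.sqrt (P ^+ 2 + 1).
have c02 : 1 <= P ^+ 2 + 1 by rewrite lerDr sqr_ge0.
have c00 : 0 < c0 by rewrite sqrtr_gt0; lra.
have c0E : c0 ^+ 2 = P ^+ 2 + 1 by rewrite sqr_sqrtr//; lra.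
clearbody c0.
pose Ks := K2 + 2 + M * (P `^ th / c0) * (Kq + 1) `^ q^-1.
pose KT := K2 ^+ 2 + 1.
pose Kt := (2 * Num.sqrt KT) `^ (q - 2) * K2 ^+ 2 * (P `^ (2 - q) * c0 `^ q).
have KT0 : 0 < KT by rewrite /KT; have := sqr_ge0 K2; lra.
have Ks0 : 0 <= Ks by rewrite /Ks !addr_ge0 ?(ltW K20)// !mulr_ge0 ?(ltW M0) ?powR_ge0 ?invr_ge0 ?(ltW c00).
have Kt0 : 0 <= Kt.
  by apply: mulr_ge0; apply: mulr_ge0; rewrite ?powR_ge0 ?sqr_ge0.
exists Ks, (2 `^ 2 * (K2 ^+ 2 + 2 `^ 2 * (KR + KR))), (2 `^ q * (Kt + 2 `^ q * (Kq + Kq))).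
split => //.
- by rewrite mulr_ge0 ?powR_ge0// addr_ge0 ?sqr_ge0// mulr_ge0 ?powR_ge0// addr_ge0.
- by rewrite mulr_ge0 ?powR_ge0// addr_ge0// mulr_ge0 ?powR_ge0// addr_ge0.
clear c02 Ks0 Kt0.
move=> L L0.
set A := Lp 2 (tev L); set B := Lp q (tev L).
have A0 : 0 <= A by exact: Lp_ge0.
have B0 : 0 <= B by exact: Lp_ge0.
move=> Ap.
have hol2 s : 0 < s -> B <= s `^ q -> A <= c0 ^+ 2 * s ^+ 2.
  by move=> s0 hs; rewrite c0E hP; exact: (Lp2_le_Lpq q2 (tev_bmeas L) s0 hs).
have [Z [Zdiv Zsup Z2]] := hZ L L0.
rewrite -/A in Zsup Z2.
pose F0 c := grad_inv_laplacian c L.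
have F0q b' c : Lp q (tev (tder c (F0 b'))) <= Kq * B by rewrite /F0 tder_grad_inv_laplacian; exact: hKq.
have F02 b' c : Lp 2 (tev (tder c (F0 b'))) <= KR * A.
  by rewrite /F0 tder_grad_inv_laplacian; have := hKR b' c L L0.
clear hZ hKq hKR; clearbody A B.
have [a aE] : exists a, Num.sqrt A = a by eexists.
rewrite aE in Zsup.
have a0 : 0 < a by rewrite -aE sqrtr_gt0.
have a2 : a ^+ 2 = A by rewrite -aE sqr_sqrtr.
have hol s : 0 < s -> B <= s `^ q -> a <= c0 * s.
  move=> s0 hs; rewrite -(@ler_pXn2r _ 2)// ?nnegrE ?mulr_ge0 ?(ltW a0) ?(ltW c00) ?(ltW s0)//.
  by rewrite a2 exprMn; exact: hol2.
clear hol2.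
have Bp : 0 < B.
  rewrite lt_def B0 andbT; apply/eqP => Bz.
  have s0 : 0 < a / (2 * c0) by rewrite divr_gt0 ?mulr_gt0.
  have := hol _ s0; rewrite Bz powR_ge0 => /(_ isT).
  have -> : c0 * (a / (2 * c0)) = a / 2 by field; rewrite gt_eqF.
  by lra.
have [b bE] : exists b, B `^ q^-1 = b by eexists.
have b0 : 0 < b by rewrite -bE powR_gt0.
have bq : b `^ q = B by rewrite -bE -powRrM mulVf ?gt_eqF// powRr1.
have ab : a <= c0 * b by apply: hol => //; rewrite bq.
pose rho := a / (c0 * b).
have rho0 : 0 < rho by rewrite divr_gt0 ?mulr_gt0.
have rho1 : rho <= 1 by rewrite ler_pdivrMr ?mul1r ?mulr_gt0.
(* Since [rho] is at most 1 by the comparison of norms, the side does not exceed the period. *)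
pose h := P * rho `^ th^-1.
have h0 : 0 < h by rewrite mulr_gt0 ?powR_gt0.
have hP1 : h <= P.
  rewrite -[leRHS]mulr1; apply: ler_wpM2l; first exact: ltW.
  have <- : 1 `^ th^-1 = 1 :> R by rewrite powR1.
  apply: ge0_ler_powR; rewrite ?nnegrE ?invr_ge0 ?(ltW th0) ?(ltW rho0) ?ler01 //.
have hth : h `^ th = P `^ th * rho.
  by rewrite powRM ?powR_ge0 ?(ltW P0)// -powRrM mulVf ?gt_eqF// powRr1 ?ltW.
(* With eta = a / P, the additive error 2 d eta in Morrey's inequality is at most 2 a, because d <=
   h <= P. *)
have eta0 : 0 < a / P by rewrite divr_gt0.
have [N1 hN1] := eventually_bool (fun b' => hM (F0 b') (Kq * B) B (a / P) Bp eta0 (F0q b')).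
have [N2 hN2] := eventually_bool (fun b' => eventually_bool (fun c =>
   avg_powR_le (tder c (Z b')) (ler1n _ 2) Ap)).
have [N3 hN3] := mesh_small h0.
pose N := maxn N1 (maxn N2 N3).
have /hN1{}hN1 : (N1 <= N)%N by rewrite leq_maxl.
have /hN2{}hN2 : (N2 <= N)%N by rewrite /N leq_max leq_maxl orbT.
have /hN3{}hN3 : (N3 <= N)%N by rewrite /N leq_max leq_maxr orbT.
have hPN : h <= 2 ^+ N * mesh N by rewrite mesh_full -hP.
(* The averages have dyadic sides; the one used lies between h / 2 and h. *)
have [k [kN hk1 hk2]] := dyadic_scale (ltW (mesh_gt0 R N)) hN3 hPN.
have {}hN1 b' x := hN1 b' k kN x.
have {}hN2 b' c x := hN2 b' c k kN x.
have hk0 : 0 < 2 ^+ k * mesh N by apply: mulr_gt0; [exact: exprn_gt0|exact: mesh_gt0].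
move: (2 ^+ k * mesh N) hk0 hk1 hk2 hN1 hN2 => d d0 dh hd hN1 hN2.
exists (fun b' => tavg N k (Z b') ++ F0 b' ++ tmult (fun=> (-1)%:C%C) (tavg N k (F0 b'))).
have tevF b' x : tev (tavg N k (Z b') ++ F0 b' ++ tmult (fun=> (-1)%:C%C) (tavg N k (F0 b'))) x =
   avg N k (tev (Z b')) x + (tev (F0 b') x - avg N k (tev (F0 b')) x).
  by rewrite !tev_cat tev_scale !tev_tavg mulN1r.
have tevG b' c x : tev (tder c (tavg N k (Z b') ++ F0 b' ++ tmult (fun=> (-1)%:C%C) (tavg N k (F0 b')))) x =
   avg N k (tev (tder c (Z b'))) x + (tev (tder c (F0 b')) x + -1 * avg N k (tev (tder c (F0 b'))) x).
  by rewrite /tder !tmult_cat !tev_cat -!/(tder _ _) tder_scale !tder_tavg.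
have bm c b' : bmeas (tev (tder c (F0 b'))) by exact: tev_bmeas.
have bz c b' : bmeas (tev (tder c (Z b'))) by exact: tev_bmeas.
have LpF r b' c X Y : 1 <= r -> Lp r (avg N k (tev (tder c (Z b')))) <= X -> Lp r (tev (tder c (F0 b'))) <= Y ->
  Lp r (tev (tder c (tavg N k (Z b') ++ F0 b' ++ tmult (fun=> (-1)%:C%C) (tavg N k (F0 b'))))) <=
    2 `^ r * (X + 2 `^ r * (Y + Y)).
  by move=> r1 hX hY; rewrite (eq_Lp r (tevG b' c)); exact: Lp_corrected.
split=> [x|b' x|b' c|b' c].
- rewrite !tevG.
  have hz : avg N k (tev (tder false (Z false))) x + avg N k (tev (tder true (Z true))) x = avg N k (tev L) x.
    by rewrite -avgD; exact: eq_avg.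
  have hf : avg N k (tev (tder false (F0 false))) x + avg N k (tev (tder true (F0 true))) x = avg N k (tev L) x.
    by rewrite -avgD; apply: eq_avg => y; exact: div_grad_inv_laplacian.
  have hd0 := div_grad_inv_laplacian x L0; rewrite -/(F0 false) -/(F0 true) in hd0.
  by rewrite -hd0 -[RHS](addrK (avg N k (tev L) x)) -{1}hz -hf; ring.
- rewrite tevF aE; apply: le_trans (ler_normD _ _) _.
  have -> : Ks * a = K2 * a + (2 * a + M * (P `^ th / c0) * (Kq + 1) `^ q^-1 * a) by rewrite /Ks; ring.
  apply: lerD.
    apply: le_trans (avg_norm _ _ _ _) _; rewrite -[leRHS](avg_cst N k _ x).
    by apply: avg_le => y; exact: Zsup.
  rewrite distrC [leRHS]addrC; apply: le_trans (hN1 b' x) _; rewrite -/th; apply: lerD.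
    have -> : (Kq * B + B) `^ q^-1 = (Kq + 1) `^ q^-1 * b.
      by rewrite -bE -powRM// ?addr_ge0// mulrDl mul1r.
    have hd' : d `^ th <= P `^ th * rho.
      by rewrite -hth; apply: ge0_ler_powR; rewrite ?nnegrE ?(ltW th0) ?(ltW d0) ?(ltW h0).
    apply: (@le_trans _ _ (M * (P `^ th * rho) * ((Kq + 1) `^ q^-1 * b))).
      by apply: ler_wpM2r; [rewrite mulr_ge0 ?powR_ge0 ?(ltW b0)|apply: ler_wpM2l; [exact: ltW|]].
    apply: eq_ler; rewrite /rho; move: (P `^ th) ((Kq + 1) `^ q^-1) => u v.
    by field; rewrite !gt_eqF.
  have : d * (a / P) <= P * (a / P) by apply: ler_wpM2r; [exact: ltW|exact: le_trans hP1].
  have -> : P * (a / P) = a by field; rewrite gt_eqF.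
  by rewrite -[2 * d * _]mulrA => h'; apply: ler_wpM2l.
- have hX : Lp 2 (avg N k (tev (tder c (Z b')))) <= K2 ^+ 2 * A.
    by apply: le_trans (Z2 b' c); apply: Lp_avg => //; [exact: ler1n|exact: tev_periodic].
  apply: le_trans (LpF _ _ _ _ _ (ler1n _ 2) hX (F02 b' c)) _.
  apply: eq_ler; move: (2 `^ 2) => w; ring.
- have hX2 : Lp 2 (avg N k (tev (tder c (Z b')))) <= K2 ^+ 2 * A.
    by apply: le_trans (Z2 b' c); apply: Lp_avg => //; [exact: ler1n|exact: tev_periodic].
  (* Sup bound of order a / h: the mean square of the gradient over a square of side d is at most KT
     A / d^2, and h <= 2 d. *)
  pose S := 2 * Num.sqrt KT * (a / h).
  have S0 : 0 <= S by rewrite !mulr_ge0 ?sqrtr_ge0 ?invr_ge0// ltW.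
  have hS x : `|avg N k (tev (tder c (Z b'))) x| <= S.
    rewrite -(@ler_pXn2r _ 2)// ?nnegrE// -powR_sqr.
    have := avg_jensen N k (tev (tder c (Z b'))) x (ler1n R 2); rewrite normr_id => /le_trans; apply.
    have h1 : d ^+ 2 * avg N k (fun y => `|tev (tder c (Z b')) y| `^ 2) x <= KT * A.
      by apply: le_trans (hN2 b' c x) _; rewrite mulrDl mul1r lerD2r; exact: Z2.
    have h2 : h ^+ 2 <= 4 * d ^+ 2.
      have -> : 4 * d ^+ 2 = (2 * d) ^+ 2 by ring.
      have d2 : 0 <= 2 * d by rewrite mulr_ge0// ltW.
      by rewrite ler_pXn2r ?nnegrE ?(ltW h0).
    rewrite /S !exprMn sqr_sqrtr ?(ltW KT0)// exprVn a2.
    have -> : 2 ^+ 2 * KT * (A / h ^+ 2) = 4 * (KT * A) / h ^+ 2 by field; rewrite gt_eqF.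
    rewrite ler_pdivlMr ?exprn_gt0//.
    have V0 : 0 <= avg N k (fun y => `|tev (tder c (Z b')) y| `^ 2) x.
      by apply: sumr_ge0 => p _; rewrite mulr_ge0 ?exprn_ge0 ?powR_ge0.
    move: V0 h1; set V := avg _ _ _ _ => V0 h1.
    apply: (@le_trans _ _ (V * (4 * d ^+ 2))); first exact: ler_wpM2l.
    by rewrite mulrCA; apply: ler_wpM2l => //; rewrite mulrC.
  have bz' : bmeas (avg N k (tev (tder c (Z b')))) by exact: bmeas_avg.
  have hX : Lp q (avg N k (tev (tder c (Z b')))) <= Kt * B.
    apply: le_trans (Lp_le_bound q2 S0 bz' hS) _.
    apply: (@le_trans _ _ (S `^ (q - 2) * (K2 ^+ 2 * A))); first by apply: ler_wpM2l => //; exact: powR_ge0.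
    have := scale_identity q2 a0 b0 c00 P0; rewrite /= -/rho -/th -/h bq => hid.
    have hd0 : 0 <= a / h by rewrite divr_ge0// ltW.
    have hd1 : 0 <= 2 * Num.sqrt KT by rewrite mulr_ge0 ?sqrtr_ge0.
    rewrite /S (powRM _ hd1 hd0) -a2.
    have -> : (2 * Num.sqrt KT) `^ (q - 2) * (a / h) `^ (q - 2) * (K2 ^+ 2 * a ^+ 2) =
      (2 * Num.sqrt KT) `^ (q - 2) * K2 ^+ 2 * ((a / h) `^ (q - 2) * a ^+ 2) by ring.
    by rewrite hid /Kt; apply: eq_ler; ring.
  apply: le_trans (LpF _ _ _ _ _ q1 hX (F0q b' c)) _.
  apply: eq_ler; move: (2 `^ q) => w; ring.
Qed.

Theorem trig_solution (q Kq : R) : 2 < q -> 0 <= Kq ->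
  (forall b b' L, 0 \notin map snd L ->
     Lp q (tev (tmult (fun k => (riesz2 R b b' k)%:C%C) L)) <= Kq * Lp q (tev L)) ->
  exists2 K : R, 0 < K & forall L, 0 \notin map snd L -> exists F : bool -> tpoly R,
  [/\ forall x, tev (tder false (F false)) x + tev (tder true (F true)) x = tev L x,
      forall b x, `|tev (F b) x| <= K * Num.sqrt (Lp 2 (tev L)),
      forall b c, Lp 2 (tev (tder c (F b))) <= K * Lp 2 (tev L) &
      forall b c, Lp q (tev (tder c (F b))) <= K * Lp q (tev L)].
Proof.
move=> q2 Kq0 hKq; have [Ks [k1 [k2 [Ks0 k10 k20 h]]]] := trig_solution_constants q2 Kq0 hKq.
have q0 : 0 < q by lra.
have K0 : 0 < Ks + k1 + k2 + 1 by lra.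
have Ks_le : Ks <= Ks + k1 + k2 + 1 by lra.
have k1_le : k1 <= Ks + k1 + k2 + 1 by lra.
have k2_le : k2 <= Ks + k1 + k2 + 1 by lra.
exists (Ks + k1 + k2 + 1) => // L L0.
have A0 : 0 <= Lp 2 (tev L) by exact: Lp_ge0.
have B0 : 0 <= Lp q (tev L) by exact: Lp_ge0.
have [Az|An] := eqVneq (Lp 2 (tev L)) 0.
  exists (fun=> [::]); split=> [x|b x|b c|b c].
  - by rewrite /tder /tmult /= tev_nil addr0 (Lp2_eq0 L0).
  - by rewrite tev_nil normr0 mulr_ge0 ?sqrtr_ge0// ltW.
  - rewrite (@eq_Lp _ _ _ (fun=> 0)); last by move=> x; rewrite /tder /tmult /= tev_nil.
    by rewrite Lp_zero// mulr_ge0// ltW.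
  - rewrite (@eq_Lp _ _ _ (fun=> 0)); last by move=> x; rewrite /tder /tmult /= tev_nil.
    by rewrite Lp_zero// mulr_ge0// ltW.
have Ap : 0 < Lp 2 (tev L).
  by rewrite lt_def An; exact: A0.
have [F [h1 h2 h3 h4]] := h L L0 Ap.
exists F; split; [exact: h1|move=> b x|move=> b c|move=> b c].
- by apply: le_trans (h2 b x) _; apply: ler_wpM2r; [exact: sqrtr_ge0|exact: Ks_le].
- by apply: le_trans (h3 b c) _; apply: ler_wpM2r; [exact: A0|exact: k1_le].
- by apply: le_trans (h4 b c) _; apply: ler_wpM2r; [exact: B0|exact: k2_le].
Qed.

End TrigSolution.

(** * Density of trigonometric polynomials *)

Section Density.
Variable R : realType.
Local Notation C := R[i].
Implicit Types (L : tpoly R) (f g : R * R -> R).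
Local Notation Pi := (@Pi R).
Local Notation leb2 := (@leb2 R).

Lemma ae_leb2S (P Q : R * R -> Prop) : (forall x, P x -> Q x) ->
  {ae leb2, forall x, P x} -> {ae leb2, forall x, Q x}.
Proof.
move=> PQ [N [mN N0 sub]]; exists N; split => // x nq; apply: sub => /= px.
by apply: nq; exact: PQ.
Qed.

Lemma Iint_dct (fn : nat -> R * R -> R) f (B : R) : (forall n, bmeas (fn n)) -> bmeas f ->
  (forall n x, `|fn n x| <= B) -> {ae leb2, forall x, Pi x -> fn n x @[n --> \oo] --> f x} ->
  Iint (fn n) @[n --> \oo] --> Iint f.
Proof.
move=> bfn bf hB hae.
have hcv : {ae leb2, forall x, Pi x -> (fn n x)%:E @[n --> \oo] --> (f x)%:E}.
  by apply: ae_leb2S hae => x hx /hx h; apply/fine_cvgP; split => //; exact: nearW.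
have hb : {ae leb2, forall x (n : nat), Pi x -> (`|(fn n x)%:E| <= B%:E)%E}.
  by apply: aeW => x n _; rewrite abse_EFin lee_fin.
have [_ _ h] := @dominated_convergence _ _ _ leb2 Pi (@measurable_Pi R) (fun n x => (fn n x)%:E) (EFin \o f) (fun=> B%:E)
  (fun n => measurable_int _ (bmeas_integrable (bfn n))) (measurable_int _ (bmeas_integrable bf))
  hcv (bmeas_integrable (bmeas_cst B)) hb.
by move: h; rewrite Iint_EFin// => /fine_cvg.
Qed.

Section Approximable.
Variable p : R.
Hypothesis p1 : 1 <= p.
Let p0 : 0 <= p.
Proof. by have := p1; lra. Qed.
Let pp : 0 < p.
Proof. by have := p1; lra. Qed.

Definition approx f := forall e, 0 < e -> exists L, Lp p (fun x => f x - tev L x) < e.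

Lemma approx_tev L : approx (tev L).
Proof.
move=> e e0; exists L; rewrite /Lp (@eq_Iint _ _ (fun=> 0)) ?Iint_cst ?mul0r// => x.
by rewrite subrr normr0 powR0// gt_eqF.
Qed.

Lemma approx_eq f g : f =1 g -> approx f -> approx g.
Proof. by move=> /funext ->. Qed.

Lemma approx_close f : bmeas f ->
  (forall e, 0 < e -> exists g, [/\ bmeas g, approx g & Lp p (fun x => f x - g x) < e]) -> approx f.
Proof.
move=> bf h e e0; pose c : R := 2 `^ p; have c0 : 0 < c by rewrite powR_gt0.
have e1 : 0 < e / (2 * c) by rewrite divr_gt0// mulr_gt0.
have [g [bg ag hg]] := h _ e1; have [L hL] := ag _ e1.
exists L; rewrite (@eq_Lp _ _ _ (fun x => (f x - g x) + (g x - tev L x))); last by move=> x; ring.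
have := LpD p0 (bmeasB bf bg) (bmeasB bg (tev_bmeas L)); rewrite -/c => h1.
apply: le_lt_trans h1 _.
move: (Lp p _) (Lp p _) hg hL => u v hu hv.
have -> : e = c * (e / (2 * c) + e / (2 * c)) by field; rewrite gt_eqF.
by rewrite ltr_pM2l//; lra.
Qed.

(** Approximability passes to bounded limits almost everywhere; this is what lets the approximable
    sets be closed under countable unions. *)
Lemma approx_dct (fn : nat -> R * R -> R) f (B : R) : (forall n, bmeas (fn n)) -> bmeas f ->
  (forall n x, `|fn n x| <= B) -> {ae leb2, forall x, Pi x -> fn n x @[n --> \oo] --> f x} ->
  (forall n, approx (fn n)) -> approx f.
Proof.
move=> bfn bf hB hae hap.
have [B' B'0 hB'] := bmeas_bound bf.
apply: approx_close => // e e0.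
have h : Iint (fun x => `|f x - fn n x| `^ p) @[n --> \oo] --> Iint (fun=> 0 : R).
  apply: (@Iint_dct _ _ ((B' + B) `^ p)).
  - by move=> n; apply: bmeas_powR => //; exact: bmeasB.
  - exact: bmeas_cst.
  - move=> n x; rewrite ger0_norm ?powR_ge0//; apply: ge0_ler_powR => //; rewrite ?nnegrE//.
      by rewrite addr_ge0 ?(ltW B'0)//; exact: le_trans (normr_ge0 _) (hB n x).
    by apply: le_trans (ler_normB _ _) _; apply: lerD.
  - apply: ae_leb2S hae => x hx /hx h.
    have h1 : `|f x - fn n x| @[n --> \oo] --> (0 : R).
      have : `|f x - fn n x| @[n --> \oo] --> `|f x - f x|.
        by apply: cvg_norm; apply: cvgB => //; exact: cvg_cst.
      by rewrite subrr normr0.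
    have h2 : \forall n \near \oo, `|f x - fn n x| < 1 by apply: (cvgr_lt 0).
    apply: squeeze_cvgr (cvg_cst 0) h1; apply: filterS h2 => n /ltW hn.
    rewrite powR_ge0 /=; have [->|n0] := eqVneq `|f x - fn n x| 0; first by rewrite powR0// gt_eqF.
    by apply: ge1r_powR; rewrite // hn andbT lt_def n0 normr_ge0.
rewrite Iint_cst mul0r in h.
have [n _ /(_ n (leqnn n)) hn] : \forall n \near \oo, Iint (fun x => `|f x - fn n x| `^ p) < e.
  exact: (cvgr_lt 0).
by exists (fn n); split; [exact: bfn|exact: hap|exact: hn].
Qed.

Definition istp f := exists L, tev L =1 f.

Lemma istp_approx f : istp f -> approx f.
Proof. by move=> [L hL]; apply: approx_eq hL _; exact: approx_tev. Qed.

Lemma istp_bmeas f : istp f -> bmeas f.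
Proof. by move=> [L /funext <-]; exact: tev_bmeas. Qed.

Lemma istpD f g : istp f -> istp g -> istp (fun x => f x + g x).
Proof. by move=> [L hL] [L' hL']; exists (L ++ L') => x; rewrite tev_cat hL hL'. Qed.

Lemma istpM f g : istp f -> istp g -> istp (fun x => f x * g x).
Proof.
move=> [L hL] [L' hL']; exists (tmult (fun=> (2^-1)%:C%C) (tprod L L' ++ tprod L (tconj L'))) => x.
rewrite tev_scale tev_cat -hL -hL' /tev !tval_prod tval_conj !ReM.
by case: (tval L' x) => a b /=; field.
Qed.

Lemma istp_cst c : istp (fun=> c).
Proof.
exists [:: (c%:C%C, 0)] => x; rewrite /tev tval_cons tval_nil addr0 ReM /phase /= !mul0r addr0 cos0; ring.
Qed.

Lemma istpX f n : istp f -> istp (fun x => f x ^+ n).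
Proof.
move=> hf; elim: n => [|n IH]; first exact: istp_cst.
by have [L hL] := istpM hf IH; exists L => x; rewrite hL exprS.
Qed.

Lemma istp_cos (b : bool) c : istp (fun x => cos ((if b then x.2 else x.1) - c)).
Proof.
exists [:: ((cos c -i* sin c)%C, if b then (0, 1) else (1, 0))] => x.
rewrite /tev tval_cons tval_nil addr0 ReM /phase /= cosB.
by case: b => /=; rewrite ?mul0r ?mul1r ?addr0 ?add0r; ring.
Qed.

Lemma approxD f g : bmeas f -> bmeas g -> approx f -> approx g -> approx (fun x => f x + g x).
Proof.
move=> bf bg af ag e e0; pose c : R := 2 `^ p; have c0 : 0 < c by rewrite powR_gt0.
have e1 : 0 < e / (2 * c) by rewrite divr_gt0// mulr_gt0.
have [L hL] := af _ e1; have [L' hL'] := ag _ e1.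
exists (L ++ L'); rewrite (@eq_Lp _ _ _ (fun x => (f x - tev L x) + (g x - tev L' x))); last first.
  by move=> x; rewrite tev_cat; ring.
have := LpD p0 (bmeasB bf (tev_bmeas L)) (bmeasB bg (tev_bmeas L')); rewrite -/c => h1.
apply: le_lt_trans h1 _.
move: (Lp p _) (Lp p _) hL hL' => u v hu hv.
have -> : e = c * (e / (2 * c) + e / (2 * c)) by field; rewrite gt_eqF.
by rewrite ltr_pM2l//; lra.
Qed.

Lemma Lp_mul_le f g (B : R) : bmeas f -> bmeas g -> (forall x, `|f x| <= B) ->
  Lp p (fun x => f x * g x) <= B `^ p * Lp p g.
Proof.
move=> bf bg hB; have B0 : 0 <= B by apply: le_trans (hB (0, 0)).
rewrite /Lp -IintZ; last exact: bmeas_powR.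
apply: Iint_le; [by apply: bmeas_powR => //; exact: bmeasM|by apply: bmeasZ; exact: bmeas_powR|move=> x].
rewrite normrM powRM//; apply: ler_wpM2r; first exact: powR_ge0.
by apply: ge0_ler_powR.
Qed.

Lemma approxM f g : bmeas f -> bmeas g -> approx f -> approx g -> approx (fun x => f x * g x).
Proof.
move=> bf bg af ag; have [B B0 hB] := bmeas_bound bf.
have c1 : 0 < (B + 1) `^ p by rewrite powR_gt0//; lra.
apply: approx_close; first exact: bmeasM.
move=> e e0; have e1 : 0 < e / (B + 1) `^ p by rewrite divr_gt0.
have [L hL] := ag _ e1.
exists (fun x => f x * tev L x); split.
- by apply: bmeasM => //; exact: tev_bmeas.
- have [B' B'0 hB'] := bmeas_bound (tev_bmeas L).
  have c2 : 0 < (B' + 1) `^ p by rewrite powR_gt0// addr_gt0.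
  apply: approx_close => [|e' e'0]; first by apply: bmeasM => //; exact: tev_bmeas.
  have e2 : 0 < e' / (B' + 1) `^ p by rewrite divr_gt0.
  have h x : `|tev L x| <= B' + 1 by rewrite (le_trans (hB' x))// lerDl.
  have [L' hL'] := af _ e2.
  have bL' := tev_bmeas L'; have bL := tev_bmeas L.
  exists (fun x => tev L' x * tev L x); split.
  + exact: bmeasM.
  + by apply: istp_approx; apply: istpM; [exists L'|exists L].
  rewrite (@eq_Lp _ _ _ (fun x => tev L x * (f x - tev L' x))); last by move=> x; ring.
  apply: le_lt_trans (Lp_mul_le bL (bmeasB bf bL') h) _.
  by rewrite mulrC -ltr_pdivlMr.
- rewrite (@eq_Lp _ _ _ (fun x => f x * (g x - tev L x))); last by move=> x; ring.
  have h x : `|f x| <= B + 1 by rewrite (le_trans (hB x))// lerDl.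
  apply: le_lt_trans (Lp_mul_le bf (bmeasB bg (tev_bmeas L)) h) _.
  by rewrite mulrC -ltr_pdivlMr.
Qed.

Lemma approx_eqPi f g : bmeas f -> bmeas g -> (forall x, Pi x -> f x = g x) -> approx f -> approx g.
Proof.
move=> bf bg fg af; have [B B0 hB] := bmeas_bound bf.
apply: (@approx_dct (fun=> f) g B) => //.
by apply: aeW => x /fg ->; exact: cvg_cst.
Qed.

(** Density is proved by measure theory: these sets form a sigma-algebra that contains the
    half-planes bounded by a line parallel to an axis, hence all measurable sets. *)
Definition approxset : set (set (R * R)) := [set E | measurable E /\ approx (\1_E)].

Lemma approxsetC E : approxset E -> approxset (~` E).
Proof.
move=> [mE aE]; split; first exact: measurableC.
have bE := bmeas_indic mE.
have h1 c : approx (fun=> c) by apply: istp_approx; exact: istp_cst.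
have aM := approxM (bmeas_cst (-1)) bE (h1 _) aE.
apply: approx_eq (approxD (bmeas_cst 1) (bmeasM (bmeas_cst (-1)) bE) (h1 _) aM) => x.
rewrite indicC /= indicE; move: (x \in E) => y; clear; case: y => /=; ring.
Qed.

Lemma approxsetI E F : approxset E -> approxset F -> approxset (E `&` F).
Proof.
move=> [mE aE] [mF aF]; split; first exact: measurableI.
by apply: approx_eq (approxM (bmeas_indic mE) (bmeas_indic mF) aE aF) => x; rewrite indicI.
Qed.

Lemma approxset0 : approxset set0.
Proof.
split; first exact: measurable0.
by apply: (@approx_eq (fun=> 0)); [move=> x; rewrite indic0|apply: istp_approx; exact: istp_cst].
Qed.

Lemma approxsetU E F : approxset E -> approxset F -> approxset (E `|` F).
Proof.
by move=> hE hF; rewrite -[_ `|` _]setCK setCU; apply: approxsetC; apply: approxsetI; exact: approxsetC.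
Qed.

Lemma approxset_sigma : sigma_algebra setT approxset.
Proof.
split; [exact: approxset0|by move=> E hE; rewrite setTD; exact: approxsetC|].
move=> A hA; have hU n : approxset (\big[setU/set0]_(i < n) A i).
  elim: n => [|n IH]; first by rewrite big_ord0; exact: approxset0.
  by rewrite big_ord_recr; apply: approxsetU; [exact: IH|exact: hA].
have mA n : measurable (A n) := (hA n).1.
have bU n : bmeas (\1_(\big[setU/set0]_(i < n) A i) : R * R -> R) := bmeas_indic (hU n).1.
have aU n := (hU n).2.
have mU : measurable (\bigcup_n A n) by apply: bigcup_measurable => n _; exact: mA.
split; first exact: mU.
apply: (approx_dct (B := 1) bU (bmeas_indic mU) _ _ aU); clear aU hU hA bU.
- by move=> n x; rewrite indicE; case: (_ \in _); rewrite ?normr1 ?normr0.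
- apply: aeW => x _; rewrite indicE.
  have [[n _ Anx]|nx] := pselect ((\bigcup_n A n) x).
    rewrite mem_set; last by exists n.
    apply: cvg_near_cst; exists n.+1 => //= m nm.
    by rewrite indicE mem_set// -bigcup_mkord; exists n.
  rewrite memNset//; apply: cvg_near_cst; apply: nearW => m.
  rewrite indicE memNset//; rewrite -bigcup_mkord => -[i _ Aix]; apply: nx; by exists i.
Qed.

(** Within one period the points x < a form an arc centred at (a - pi) / 2 of half-width (a + pi) /
    2, so that belonging to it amounts to a comparison of cosines. *)
Lemma cos_arc (a x : R) : - pi < a < pi -> - pi < x < pi -> x != a ->
  if x < a then cos ((a + pi) / 2) < cos (x - (a - pi) / 2)
  else cos (x - (a - pi) / 2) < cos ((a + pi) / 2).
Proof.
move=> /andP[a1 a2] /andP[x1 x2] xa; have pi0 := pi_gt0 R.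
set w := (a + pi) / 2; set t := x - _.
have w0 : w \in `[0, pi] by rewrite in_itv /= /w; apply/andP; split; lra.
case: (ltP x a) => h.
  have [t0|t0] := leP 0 t.
    by rewrite ltr_cos// ?in_itv /= ?t0 /=; rewrite /t /w; lra.
  have -> : cos t = cos (- t) by rewrite cosN.
  rewrite ltr_cos// ?in_itv /=; rewrite /t in t0 *; rewrite /w; first lra.
  by apply/andP; split; lra.
have {}h : a < x by rewrite lt_def xa h.
have [t0|t0] := leP t pi.
  rewrite ltr_cos// ?in_itv /=; first by rewrite /t /w; lra.
  by rewrite t0 andbT /t; lra.
have -> : cos t = cos (2 * pi - t).
  by rewrite [RHS]cosB (_ : 2 * pi = pi *+ 2) ?mulr_natl// cos2pi sin2pi; ring.
by rewrite ltr_cos// ?in_itv /=; [rewrite /t /w; lra|rewrite /t in t0 *; apply/andP; split; lra].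
Qed.

(** By Bernoulli's inequality the limit is decided by whether 2^n u^n tends to 0 or to infinity.
    These polynomials turn a trigonometric polynomial u into the indicator of the set where u <
    1/2. *)
Lemma bernoulli_step (u : R) : 0 <= u <= 1 -> u != 2^-1 ->
  (1 - u ^+ n) ^+ (2 ^ n) @[n --> \oo] --> ((u < 2^-1)%R%:R : R).
Proof.
move=> /andP[u0 u1] un.
have bern1 (s : R) N : 0 <= s <= 1 -> 1 - N%:R * s <= (1 - s) ^+ N.
  move=> /andP[s0 s1]; elim: N => [|N IH]; first by rewrite mul0r subr0 expr0.
  rewrite exprS; apply: (@le_trans _ _ ((1 - s) * (1 - N%:R * s))); last by apply: ler_wpM2l => //; lra.
  rewrite -natr1; have : 0 <= N%:R * s * s by rewrite !mulr_ge0.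
  by move: (N%:R : R) => M; nra.
have bern2 (s : R) N : 0 <= s <= 1 -> (1 - s) ^+ N * (1 + N%:R * s) <= 1.
  move=> /andP[s0 s1].
  have h : 1 + N%:R * s <= (1 + s) ^+ N.
    elim: N => [|N IH]; first by rewrite mul0r addr0 expr0.
    rewrite exprS; apply: (@le_trans _ _ ((1 + s) * (1 + N%:R * s))); last by apply: ler_wpM2l => //; lra.
    rewrite -natr1; have : 0 <= N%:R * s * s by rewrite !mulr_ge0.
    by move: (N%:R : R) => M; nra.
  apply: (@le_trans _ _ ((1 - s) ^+ N * (1 + s) ^+ N)); first by apply: ler_wpM2l => //; apply: exprn_ge0; lra.
  rewrite -exprMn; apply: exprn_ile1; first by apply: mulr_ge0; lra.
  nra.
have s01 n : 0 <= u ^+ n <= 1 by rewrite exprn_ge0//= exprn_ile1.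
have e2 n : (2 ^ n)%:R * u ^+ n = (2 * u) ^+ n by rewrite natrX exprMn.
have sq (l : R) (f g h : nat -> R) : (forall n, f n <= g n <= h n) ->
    f @ \oo --> l -> h @ \oo --> l -> g @ \oo --> l.
  by move=> fgh; apply: squeeze_cvgr; exact: nearW.
case: (ltgtP u 2^-1) un => // h _ /=.
  have hg : (2 * u) ^+ n @[n --> \oo] --> (0 : R).
    by apply: cvg_expr; rewrite ger0_norm; lra.
  have hl : (1 - (2 * u) ^+ n) @[n --> \oo] --> (1 : R).
    have := cvgB (cvg_cst (1 : R)) hg; rewrite subr0; exact.
  apply: (sq 1 (fun n => 1 - (2 * u) ^+ n) _ (fun=> 1)) => // [n|]; last exact: cvg_cst.
  by rewrite -e2 bern1//= exprn_ile1//; have := s01 n; lra.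
have hg : (2 * u)^-1 ^+ n @[n --> \oo] --> (0 : R).
  apply: cvg_expr; rewrite ger0_norm ?invr_ge0; last lra.
  by rewrite invf_lt1; lra.
apply: (sq 0 (fun=> 0) _ (fun n => (2 * u)^-1 ^+ n)) => // [n|]; last exact: cvg_cst.
have s0 := s01 n.
rewrite exprn_ge0 /=; last by lra.
have g0 : 0 < (2 * u) ^+ n by apply: exprn_gt0; lra.
rewrite exprVn -[leRHS]mul1r ler_pdivlMr// -e2.
apply: le_trans (bern2 _ (2 ^ n)%N s0); apply: ler_wpM2l; last by lra.
by apply: exprn_ge0; lra.
Qed.

Lemma ae_line (b : bool) (A : set R) : measurable A -> lebesgue_measure A = 0%E ->
  {ae leb2, forall x, ~ A (if b then x.2 else x.1)}.
Proof.
move=> mA A0; exists (rect2 b A setT); split.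
- exact: measurable_rect2.
- rewrite /rect2 /Defs.leb2; case: b; rewrite product_measure1E//.
    by rewrite [X in (_ * X)%E]A0 mule0.
  by rewrite [X in (X * _)%E]A0 mul0e.
- by move=> [x y] /=; case: b => /=; rewrite not_notE; tauto.
Qed.

Lemma approxset_strip (b : bool) (c : R) : approxset (rect2 b `]-oo, c[%classic setT).
Proof.
have mS (c' : R) : measurable (rect2 b `]-oo, c'[%classic setT : set (R * R)).
  by apply: measurable_rect2 => //; exact: measurable_itv.
split => //; have bS := bmeas_indic (mS c).
pose z (x : R * R) := if b then x.2 else x.1.
have hz x : Pi x -> - pi <= z x < pi.
  by case: x => x1 x2 [] /=; rewrite !in_itv /= /z; case: (b).
have memS x : (\1_(rect2 b `]-oo, c[%classic setT) : R * R -> R) x = (z x < c)%R%:R.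
  rewrite indicE /rect2 /z; case: (b) => /=; case: x => x1 x2; congr ((nat_of_bool _)%:R);
  by apply/idP/idP; rewrite inE /= in_itv /=; tauto.
have acst k : approx (fun=> k) by apply: istp_approx; exact: istp_cst.
have [c1|c1] := leP c (- pi).
  apply: (approx_eqPi (bmeas_cst 0) bS _ (acst 0)) => x /hz /andP[zx _].
  by rewrite memS ltNge (le_trans c1 zx).
have [c2|c2] := leP pi c.
  apply: (approx_eqPi (bmeas_cst 1) bS _ (acst 1)) => x /hz /andP[_ zx].
  by rewrite memS (lt_le_trans zx c2).
(* A trigonometric polynomial with values in [0, 1] that is below 1/2 exactly on the open arc before
   [c] and above 1/2 after it. *)
pose u (x : R * R) := 2^-1 + 4^-1 * (cos ((c + pi) / 2) + - 1 * cos (z x - (c - pi) / 2)).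
have tu : istp u.
  apply: istpD; first exact: istp_cst.
  apply: istpM; first exact: istp_cst.
  apply: istpD; first exact: istp_cst.
  by apply: istpM; [exact: istp_cst|exact: istp_cos].
have u01 x : 0 <= u x <= 1.
  rewrite /u; have := cos_geN1 ((c + pi) / 2); have := cos_le1 ((c + pi) / 2).
  have := cos_geN1 (z x - (c - pi) / 2); have := cos_le1 (z x - (c - pi) / 2).
  by move: (cos _) (cos _) => v w *; apply/andP; split; lra.
have tP n : istp (fun x => (1 + -1 * u x ^+ n) ^+ (2 ^ n)).
  apply: istpX; apply: istpD; first exact: istp_cst.
  by apply: istpM; [exact: istp_cst|exact: istpX].
apply: (approx_dct (B := 1) (fun n => istp_bmeas (tP n)) bS _ _ (fun n => istp_approx (tP n))).
- move=> n x; have /andP[h1 h2] := u01 x.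
  have h3 : 0 <= u x ^+ n <= 1 by rewrite exprn_ge0//= exprn_ile1.
  rewrite normrX; apply: exprn_ile1 => //; rewrite ler_norml; lra.
- have m2 : measurable ([set - pi] `|` [set c]) by apply: measurableU; exact: measurable_set1.
  have n2 : lebesgue_measure ([set - pi] `|` [set c]) = 0%E.
    by apply: countable_lebesgue_measure0; apply: finite_set_countable; exact: finite_set2.
  apply: ae_leb2S (ae_line b m2 n2) => x nx /hz /andP[z1 z2]; rewrite -/(z x) in nx.
  have zn : z x != c by apply/eqP => e; apply: nx; right.
  have zp : - pi < z x.
    by rewrite lt_def z1 andbT; apply/eqP => e; apply: nx; left.
  have hc : - pi < c < pi by rewrite c1 c2.
  have hzx : - pi < z x < pi by rewrite zp z2.
  have := cos_arc hc hzx zn; have hu : u x = 2^-1 + 4^-1 * (cos ((c + pi) / 2) + - 1 * cos (z x - (c - pi) / 2)) by [].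
  move: (cos _) (cos _) hu => v w hu hif.
  have hlt : (u x < 2^-1) = (z x < c).
    by move: hif; rewrite hu; case: (z x < c) => hif; apply/idP/idP => //; lra.
  rewrite memS -hlt; rewrite (_ : (fun n => _) = (fun n => (1 - u x ^+ n) ^+ (2 ^ n))); last first.
    by apply/funext => n; rewrite mulN1r.
  apply: bernoulli_step => //.
  by move: hif; rewrite hu; case: ifP => _ hif; apply/eqP; lra.
Qed.

Lemma approxset_measurable E : measurable E -> approxset E.
Proof.
have h1 b A : measurable A -> approxset (rect2 b A setT).
  move=> mA; have : (@RGenInftyO.G R).-sigma.-measurable A by rewrite -RGenInftyO.measurableE.
  apply: (@smallest_sub _ (sigma_algebra setT) _ [set A | approxset (rect2 b A setT)]).
    have [h0 hC hU] := approxset_sigma.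
    split => [|B hB|B hB] /=.
    - by rewrite /rect2; case: (b); rewrite ?setX0 ?set0X.
    - rewrite (_ : rect2 b (setT `\` B) setT = setT `\` rect2 b B setT); first exact: hC.
      by apply/seteqP; rewrite /rect2; case: (b); split=> -[x y] /=; tauto.
    - rewrite (_ : rect2 b (\bigcup_n B n) setT = \bigcup_n (rect2 b (B n) setT)); first exact: hU.
      apply/seteqP; rewrite /rect2; case: (b); split=> -[x y] /=.
      + by move=> [_ [n _ Bn]]; exists n.
      + by move=> [n _ [_ Bn]]; split => //; exists n.
      + by move=> [[n _ Bn] _]; exists n.
      + by move=> [n _ [Bn _]]; split => //; exists n.
  by move=> _ [x ->]; exact: approxset_strip.
rewrite measurable_prod_measurableType.
apply: (smallest_sub approxset_sigma) => _ [A mA [B mB <-]].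
rewrite (_ : A `*` B = rect2 false A setT `&` rect2 true B setT).
  by apply: approxsetI; exact: h1.
by apply/seteqP; split=> -[x y] /=; tauto.
Qed.

Lemma approx_sum (I : Type) (r : seq I) (F : I -> R * R -> R) : (forall i, bmeas (F i)) ->
  (forall i, approx (F i)) -> approx (fun x => \sum_(i <- r) F i x).
Proof.
move=> bF aF; elim: r => [|i r IH].
  apply: (@approx_eq (fun=> 0)); first by move=> x; rewrite big_nil.
  by apply: istp_approx; exact: istp_cst.
apply: (@approx_eq (fun x => F i x + \sum_(j <- r) F j x)); first by move=> x; rewrite big_cons.
by apply: approxD; [exact: bF|exact: bmeas_sum|exact: aF|exact: IH].
Qed.

(** The count is the integer part of [t], capped at [n], hence within 1 of [t] below the cap. *)
Lemma count_thresholds n (t : R) : 0 <= t ->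
  if t <= n%:R then t - 1 <= \sum_(j < n) ((j.+1%:R <= t)%R%:R : R) <= t
  else \sum_(j < n) ((j.+1%:R <= t)%R%:R : R) == n%:R.
Proof.
move=> t0; elim: n => [|n]; first by rewrite big_ord0; case: (leP t 0) => // h; lra.
rewrite big_ord_recr /= -natr1; case: (leP t n%:R) => h.
  have -> : t <= n%:R + 1 by rewrite (le_trans h)// lerDl.
  have -> : (n%:R + 1 <= t) = false by apply/negbTE; rewrite -ltNge (le_lt_trans h)// ltrDl.
  by rewrite addr0.
move=> /eqP ->; case: (leP t (n%:R + 1)) => h1.
  by case: (leP (n%:R + 1) t) => h2; rewrite /= ?mulr1n ?mulr0n; apply/andP; split; lra.
by rewrite ltW.
Qed.

Theorem bmeas_approx f : bmeas f -> approx f.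
Proof.
move=> bf; have [B B0 hB] := bmeas_bound bf.
(* The values of [f] are rescaled from [-B, B] to [0, n + 1] and rounded down, which gives simple
   functions within 2 B / (n + 1) of [f]. *)
pose t n x : R := n.+1%:R * ((f x + B) / (2 * B)).
pose E n j : set (R * R) := [set x | j.+1%:R <= t n x].
have mE n j : measurable (E n j).
  have bt : bmeas (t n).
    apply: bmeasZ; rewrite (_ : (fun x => _) = (fun x => (2 * B)^-1 * (f x + B))).
      by apply: bmeasZ; apply: bmeasD => //; exact: bmeas_cst.
    by apply/funext => x; rewrite mulrC.
  have := bt.1 measurableT `[j.+1%:R, +oo[%classic (measurable_itv _).
  rewrite setTI (_ : t n @^-1` _ = E n j)//.
  by apply/seteqP; split => x /=; rewrite in_itv /= andbT.
pose h n x : R := \sum_(j <- index_enum 'I_n.+1) \1_(E n j) x.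
have bh n : bmeas (h n) by apply: bmeas_sum => j; exact: bmeas_indic.
pose g n x := - B + 2 * B / n.+1%:R * h n x.
have bg n : bmeas (g n) by apply: bmeasD; [exact: bmeas_cst|exact: bmeasZ].
have np n : 0 < n.+1%:R :> R by rewrite ltr0n.
have hd n x : `|f x - g n x| <= 2 * B / n.+1%:R.
  have := hB x; rewrite ler_norml => /andP[f1 f2].
  have ht : 0 <= (f x + B) / (2 * B) <= 1.
    rewrite divr_ge0 ?mulr_ge0 ?(ltW B0)//=; last lra.
    by rewrite ler_pdivrMr ?mulr_gt0// mul1r; lra.
  have t0 : 0 <= t n x by rewrite mulr_ge0//; case/andP: ht.
  have tn : t n x <= n.+1%:R by rewrite -[leRHS]mulr1 ler_wpM2l//; case/andP: ht.
  have := count_thresholds n.+1 t0; rewrite tn.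
  have -> : \sum_(j < n.+1) (j.+1%:R <= t n x)%R%:R = h n x.
    apply: eq_bigr => j _; rewrite indicE; congr ((nat_of_bool _)%:R).
    by apply/idP/idP; rewrite inE.
  have -> : f x = - B + 2 * B / n.+1%:R * t n x by rewrite /t; field; rewrite !gt_eqF.
  move=> /andP[h1 h2]; rewrite /g.
  have -> : forall u v w z : R, (u + v * w) - (u + v * z) = v * (w - z) by move=> *; ring.
  have c0 : 0 <= 2 * B / n.+1%:R by rewrite divr_ge0// mulr_ge0// ltW.
  rewrite normrM (ger0_norm c0) -[leRHS]mulr1; apply: ler_wpM2l => //.
  by rewrite ler_norml; apply/andP; split; lra.
have ag n : approx (g n).
  apply: approxD; [exact: bmeas_cst|exact: bmeasZ|by apply: istp_approx; exact: istp_cst|].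
  apply: approxM; [exact: bmeas_cst|exact: bh|by apply: istp_approx; exact: istp_cst|].
  by apply: approx_sum => j; [exact: bmeas_indic|exact: (approxset_measurable (mE n j)).2].
apply: (approx_dct (B := 3 * B) bg bf _ _ ag).
- move=> n x; have -> : g n x = f x - (f x - g n x) by ring.
  apply: le_trans (ler_normB _ _) _; have := hd n x; have := hB x.
  have : 2 * B / n.+1%:R <= 2 * B.
    by rewrite ler_pdivrMr// -[leLHS]mulr1 ler_wpM2l ?mulr_ge0 ?(ltW B0)// ler1n.
  move: (2 * B / _) `|f x| `|f x - g n x| => u v w; clear; lra.
- apply: aeW => x _; apply/cvgrPdist_le => e e0.
  near=> n; apply: le_trans (hd n x) _.
  rewrite ler_pdivrMr// -ler_pdivrMl//.
  have : (2 * B) / e <= n%:R by near: n; exact: nbhs_infty_ger.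
  move=> h1; rewrite mulrC; apply: le_trans h1 _; by rewrite ler_nat.
Unshelve. all: by end_near.
Qed.

End Approximable.
End Density.

(** * Interpolation to real exponents *)

Section Marcinkiewicz.
Variable R : realType.
Local Notation C := R[i].
Implicit Types (L : tpoly R) (f g : R * R -> R).

Lemma le_powR (r a b : R) : 0 <= r -> 0 <= a -> a <= b -> a `^ r <= b `^ r.
Proof. by move=> r0 a0 ab; apply: ge0_ler_powR; rewrite ?nnegrE// (le_trans a0). Qed.

(** A value above [l0] is at most twice the largest dyadic level below it; smaller values are
    covered by the first term. *)
Lemma dyadic_layers (q y l0 : R) J : 0 < q -> 0 <= y -> 0 < l0 -> y <= 2 ^+ J * l0 ->
  y `^ q <= l0 `^ q + 2 `^ q * \sum_(j < J) (2 ^+ j * l0) `^ q * (2 ^+ j * l0 < y)%R%:R.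
Proof.
move=> q0 y0 l00; elim: J => [|J IH] hJ.
  rewrite big_ord0 mulr0 addr0; apply: ge0_ler_powR; rewrite ?nnegrE ?(ltW q0) ?(ltW l00)//.
  by move: hJ; rewrite expr0 mul1r.
have lJ : 0 < 2 ^+ J * l0 by rewrite mulr_gt0// exprn_gt0.
rewrite big_ord_recr /= mulrDr addrA; case: (ltP (2 ^+ J * l0) y) => h.
  rewrite mulr1 -powRM ?(ltW lJ)// -[leLHS]add0r; apply: lerD.
    rewrite addr_ge0 ?powR_ge0// mulr_ge0 ?powR_ge0//; apply: sumr_ge0 => j _.
    by rewrite mulr_ge0 ?powR_ge0.
  by apply: le_powR => //; [exact: ltW|rewrite mulrA -exprS].
by rewrite mulr0 mulr0 addr0; exact: IH.
Qed.

(** The sum of the geometric series of ratio 2^-a. *)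
Definition geo (a : R) := 2 `^ a / (2 `^ a - 1).

Lemma geo_gt1 a : 0 < a -> 1 < 2 `^ a :> R.
Proof.
move=> a0; have := @gt0_ltr_powR _ _ a0 1 2; rewrite powR1 !nnegrE; apply => //.
by rewrite ltr1n.
Qed.

Lemma geo_ge0 a : 0 < a -> 0 <= geo a.
Proof. by move=> /geo_gt1 h; rewrite divr_ge0 ?powR_ge0 ?subr_ge0 ?ltW. Qed.

Lemma geo_below (a t l0 : R) J : 0 < a -> 0 <= t -> 0 < l0 ->
  \sum_(j < J) (2 ^+ j * l0) `^ a * (2 ^+ j * l0 < t)%R%:R <= geo a * t `^ a.
Proof.
move=> a0 t0 l00; have g1 := geo_gt1 a0; have c0 := geo_ge0 a0.
(* The bound by the top level carries the induction; the bound by [t] follows at the last level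
   below [t]. *)
suff : \sum_(j < J) (2 ^+ j * l0) `^ a * (2 ^+ j * l0 < t)%R%:R <= (geo a - 1) * (2 ^+ J * l0) `^ a /\
   \sum_(j < J) (2 ^+ j * l0) `^ a * (2 ^+ j * l0 < t)%R%:R <= geo a * t `^ a by case.
have c1 : 0 <= geo a - 1.
  by rewrite subr_ge0 ler_pdivlMr ?subr_gt0// mul1r lerBlDr lerDl.
have cE : (geo a - 1) * 2 `^ a = geo a by rewrite /geo; field; rewrite subr_eq0 gt_eqF.
elim: J => [|J [IH1 IH2]]; first by rewrite big_ord0; split; rewrite mulr_ge0 ?powR_ge0.
have lJ : 0 < 2 ^+ J * l0 by rewrite mulr_gt0// exprn_gt0.
have lS : (2 ^+ J.+1 * l0) `^ a = 2 `^ a * (2 ^+ J * l0) `^ a.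
  by rewrite exprS -mulrA powRM// ltW.
rewrite !big_ord_recr /= lS mulrA cE.
case: (ltP (2 ^+ J * l0) t) => h; rewrite ?mulr1 ?mulr0 ?addr0.
  have h1 : \sum_(j < J) (2 ^+ j * l0) `^ a * (2 ^+ j * l0 < t)%R%:R + (2 ^+ J * l0) `^ a <= geo a * (2 ^+ J * l0) `^ a.
    by have := IH1; rewrite mulrBl mul1r lerBrDr.
  split => //; apply: le_trans h1 _; apply: ler_wpM2l => //.
  by apply: le_powR; exact: ltW.
split => //; apply: le_trans IH1 _; apply: ler_wpM2r; first exact: powR_ge0.
by rewrite lerBlDr lerDl.
Qed.

Lemma geo_above (a t l0 : R) J : 0 < a -> 0 < t -> 0 < l0 ->
  \sum_(j < J) (2 ^+ j * l0) `^ (- a) * (t <= 2 ^+ j * l0)%R%:R <= geo a * t `^ (- a).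
Proof.
move=> a0 t0 l00; have g1 := geo_gt1 a0; have c0 := geo_ge0 a0.
suff : \sum_(j < J) (2 ^+ j * l0) `^ (- a) * (t <= 2 ^+ j * l0)%R%:R <= geo a * l0 `^ (- a) /\
  \sum_(j < J) (2 ^+ j * l0) `^ (- a) * (t <= 2 ^+ j * l0)%R%:R <= geo a * t `^ (- a) by case.
elim: J l0 l00 => [|J IH] l0 l00; first by rewrite big_ord0; split; rewrite mulr_ge0 ?powR_ge0.
have l20 : 0 < 2 * l0 by rewrite mulr_gt0.
have [IH1 IH2] := IH _ l20.
have eS : \sum_(j < J) (2 ^+ j * (2 * l0)) `^ (- a) * (t <= 2 ^+ j * (2 * l0))%R%:R =
    \sum_(i < J) (2 ^+ lift ord0 i * l0) `^ (- a) * (t <= 2 ^+ lift ord0 i * l0)%R%:R.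
  by apply: eq_bigr => j _; rewrite lift0 exprSr !mulrA.
rewrite !big_ord_recl /= expr0 mul1r -eS.
have b1 : l0 `^ (- a) * (t <= l0)%R%:R + \sum_(j < J) (2 ^+ j * (2 * l0)) `^ (- a) * (t <= 2 ^+ j * (2 * l0))%R%:R <= geo a * l0 `^ (- a).
  have -> : geo a * l0 `^ (- a) = l0 `^ (- a) + geo a * (2 * l0) `^ (- a).
    rewrite powRM ?(ltW l00)// (powRN 2) /geo; move: (l0 `^ (- a)) => z; field.
    by rewrite subr_eq0 !gt_eqF// (lt_trans ltr01).
  by apply: lerD => //; case: (t <= l0); rewrite ?mulr1// mulr0 powR_ge0.
split => //; case: (leP t l0) => h; last by rewrite mulr0 add0r.
rewrite h in b1; apply: le_trans b1 _; apply: ler_wpM2l => //.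
rewrite !powRN lef_pV2 ?posrE ?powR_gt0//; by apply: le_powR => //; exact: ltW.
Qed.

(** If l < |y|, then |u| or |v| is at least l / 2; Chebyshev's inequality is used with exponent 2
    for u and p for v, pointwise. *)
Lemma split_level (q p y u v l : R) : 0 < l -> 2 < q -> q < p -> `|y| <= `|u| + `|v| ->
  l `^ q * (l < `|y|)%R%:R <= 4 * l `^ (q - 2) * `|u| `^ 2 + 2 `^ p * l `^ (q - p) * `|v| `^ p.
Proof.
move=> l0 q2 qp hy.
have r0 : 0 <= 4 * l `^ (q - 2) * `|u| `^ 2 + 2 `^ p * l `^ (q - p) * `|v| `^ p.
  by rewrite addr_ge0// !mulr_ge0 ?powR_ge0.
case: (ltP l `|y|) => h; last by rewrite mulr0.
rewrite mulr1; have [hu|hu] := leP (l / 2) `|u|.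
  rewrite -[leLHS]addr0; apply: lerD; last by rewrite !mulr_ge0 ?powR_ge0.
  have -> : l `^ q = l `^ (q - 2) * l ^+ 2.
    by rewrite -powR_mulrn ?ltW// -powRD ?subrK// (gt_eqF l0) implybT.
  rewrite -[leRHS]mulrA [leRHS]mulrCA; apply: ler_wpM2l; first exact: powR_ge0.
  rewrite powR_sqr -(real_normK (num_real u)).
  have := normr_ge0 u; move: `|u| hu => w hw w0; nra.
have hv : l / 2 <= `|v| by lra.
rewrite -[leLHS]add0r; apply: lerD; first by rewrite !mulr_ge0 ?powR_ge0.
have -> : l `^ q = l `^ (q - p) * l `^ p by rewrite -powRD ?subrK// (gt_eqF l0) implybT.
rewrite -[leRHS]mulrA [leRHS]mulrCA; apply: ler_wpM2l; first exact: powR_ge0.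
by rewrite -powRM//; apply: le_powR; lra.
Qed.

Lemma Iint_jensen (r : R) f : 1 <= r -> bmeas f ->
  `|Iint f / (2 * pi) ^+ 2| `^ r * (2 * pi) ^+ 2 <= Lp r f.
Proof.
move=> r1 bf; have r0 : 0 <= r by lra.
have P0 : 0 < (2 * pi) ^+ 2 :> R by rewrite exprn_gt0// mulr_gt0// pi_gt0.
set s := `|_|; have s0 : 0 <= s by exact: normr_ge0.
have bn := bmeas_norm bf; have bp := bmeas_powR r0 bf.
have b1 : bmeas (fun x => r * s `^ (r - 1) * (`|f x| - s)).
  by apply: bmeasZ; apply: bmeasB => //; exact: bmeas_cst.
have h : Iint (fun x => s `^ r + r * s `^ (r - 1) * (`|f x| - s)) <= Lp r f.
  apply: Iint_le => //; first by apply: bmeasD => //; exact: bmeas_cst.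
  by move=> x; exact: powR_tangent.
apply: le_trans h; rewrite IintD//; last exact: bmeas_cst.
rewrite Iint_cst lerDl IintZ; last by apply: bmeasB => //; exact: bmeas_cst.
rewrite IintB//; last exact: bmeas_cst.
rewrite Iint_cst; apply: mulr_ge0; first by rewrite mulr_ge0 ?powR_ge0.
have iP : 0 <= ((2 * pi) ^+ 2)^-1 :> R by rewrite invr_ge0 ltW.
rewrite subr_ge0 /s normrM (ger0_norm iP) divfK ?gt_eqF//.
have h1 : Iint f <= Iint (fun x => `|f x|) by apply: Iint_le => // x; exact: ler_norm.
have h2 : - Iint f <= Iint (fun x => `|f x|).
  by rewrite -IintN//; apply: Iint_le => //; [exact: bmeasN|move=> x; rewrite -normrN; exact: ler_norm].
by rewrite ler_norml h1 andbT lerNl.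
Qed.

Definition drop0 L : tpoly R := [seq t <- L | t.2 != 0].

Lemma drop0_keys L : 0 \notin map snd (drop0 L).
Proof. by apply/negP => /mapP[t]; rewrite mem_filter => /andP[/eqP h _] e; apply: h. Qed.

Lemma tev_drop0 L x : tev L x = tev (drop0 L) x + Iint (tev L) / (2 * pi) ^+ 2.
Proof.
have P0 : (2 * pi) ^+ 2 != 0 :> R by rewrite expf_neq0// mulf_neq0// gt_eqF// pi_gt0.
rewrite Iint_tev mulrC mulrA mulVf// mul1r /tev /tval Re_sum /drop0 big_filter (bigID (fun t => t.2 == 0)) /= addrC Re_sum.
congr (_ + _); apply: eq_bigr => t /eqP ->.
by rewrite ReM /phase /= !mul0r addr0 cos0 sin0; ring.
Qed.

Lemma tmult_drop0 M L x : M 0 = 0 -> tev (tmult M L) x = tev (tmult M (drop0 L)) x.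
Proof.
move=> M0; rewrite /tev !tval_tmult /drop0 big_filter (bigID (fun t => t.2 == 0)) /= big1 ?add0r//.
by move=> t /eqP ->; rewrite M0 !mul0r.
Qed.

Lemma Lp_center r f : 1 <= r -> bmeas f -> Lp r (fun x => f x - Iint f / (2 * pi) ^+ 2) <= 2 `^ r * 2 * Lp r f.
Proof.
move=> r1 bf; have r0 : 0 <= r by lra.
apply: le_trans (LpD r0 bf (bmeas_cst _)) _; rewrite -mulrA; apply: ler_wpM2l; first exact: powR_ge0.
rewrite [X in _ + X]Iint_cst normrN.
by have := Iint_jensen r1 bf; move: (Lp r _) (`|_| `^ r * _) => u v; lra.
Qed.

Lemma Lp_drop0 (r : R) L : 1 <= r -> Lp r (tev (drop0 L)) <= 2 `^ r * 2 * Lp r (tev L).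
Proof.
move=> r1; rewrite (@eq_Lp _ r _ (fun x => tev L x - Iint (tev L) / (2 * pi) ^+ 2)).
  exact: Lp_center r1 (tev_bmeas L).
by move=> x; rewrite [X in _ = X + _]tev_drop0 addrK.
Qed.

(** Truncating a function destroys its zero mean, so interpolation needs the endpoint bounds on all
    lists; a symbol vanishing at 0 ignores the mean. *)
Lemma multiplier_all (r K : R) M : 1 <= r -> 0 <= K -> M 0 = 0 ->
  (forall L, 0 \notin map snd L -> Lp r (tev (tmult M L)) <= K * Lp r (tev L)) ->
  forall L, Lp r (tev (tmult M L)) <= K * (2 `^ r * 2) * Lp r (tev L).
Proof.
move=> r1 K0 M0 h L; rewrite (@eq_Lp _ r _ (tev (tmult M (drop0 L)))); last by move=> x; exact: tmult_drop0.
apply: le_trans (h _ (drop0_keys L)) _; rewrite -[leRHS]mulrA; apply: ler_wpM2l => //.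
exact: Lp_drop0.
Qed.

Lemma approx_both (p : R) f : 2 < p -> bmeas f -> forall e, 0 < e ->
  exists L, Lp p (fun x => f x - tev L x) <= e /\ Lp 2 (fun x => f x - tev L x) <= e.
Proof.
move=> p2 bf e e0; have p1 : 1 <= p by lra.
have p0 : 0 < p by lra.
have P0 : 0 < (2 * pi) ^+ 2 + 1 :> R by have := sqr_ge0 (2 * pi : R); lra.
pose s := Num.sqrt (e / ((2 * pi) ^+ 2 + 1)).
have s0 : 0 < s by rewrite sqrtr_gt0 divr_gt0.
have m0 : 0 < Num.min e (s `^ p) by rewrite lt_min e0 powR_gt0.
have [L hL] := bmeas_approx p1 bf m0; exists L.
move: hL; rewrite lt_min => /andP[/ltW h1 /ltW h2]; split; first exact: h1.
apply: le_trans (Lp2_le_Lpq p2 (bmeasB bf (tev_bmeas L)) s0 h2) _.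
by rewrite sqr_sqrtr ?divr_ge0 ?(ltW e0) ?(ltW P0)// mulrC divfK// gt_eqF.
Qed.

(** The factor 2^q comes from [dyadic_layers]; 16 = 4 * 4 and 2^p * 2^p combine [split_level] with
    the replacement of truncations by trigonometric polynomials; the two geometric sums run over the
    levels below and above |f|. *)
Definition marc_const (q p K : R) := 2 `^ q * K * (16 * geo (q - 2) + 2 `^ p * 2 `^ p * geo (p - q)).
Definition marc_error (q p K : R) := 1 + 2 `^ q * K * (16 + 2 `^ p * 2 `^ p).

Section Interpolate.
Variables (q p K : R) (M : int * int -> C) (L : tpoly R).
Hypotheses (q2 : 2 < q) (qp : q < p) (K0 : 0 <= K).
Hypothesis hM2 : forall L, Lp 2 (tev (tmult M L)) <= K * Lp 2 (tev L).
Hypothesis hMp : forall L, Lp p (tev (tmult M L)) <= K * Lp p (tev L).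
Let f := tev L.
Let bf : bmeas f := tev_bmeas L.

Definition cutoff (l : R) x := f x * (`|f x| <= l)%R%:R.

Lemma bmeas_cutoff l : bmeas (cutoff l).
Proof.
have [mn _] := bmeas_norm bf.
have mE : measurable [set x | `|f x| <= l].
  have := mn measurableT `]-oo, l]%classic (measurable_itv _).
  rewrite setTI (_ : _ @^-1` _ = [set x | `|f x| <= l])//.
rewrite (_ : cutoff l = fun x => f x * \1_[set x | `|f x| <= l] x); first by apply: bmeasM; [exact: bf|exact: bmeas_indic].
apply/funext => x; rewrite /cutoff indicE; congr (_ * (nat_of_bool _)%:R).
by apply/idP/idP; rewrite inE.
Qed.

(** The sum over levels is taken under the integral: at a point x, the part above the cut is nonzero
    only for the levels below |f x|, whose powers sum geometrically. *)
Lemma sum_below (l0 : R) J : 0 < l0 ->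
  \sum_(j < J) (2 ^+ j * l0) `^ (q - 2) * Lp 2 (fun x => f x - cutoff (2 ^+ j * l0) x) <= geo (q - 2) * Lp q f.
Proof.
move=> l00; have qq : 0 < q - 2 by have := q2; lra.
have q0 : 0 <= q by have := q2; lra.
have bd j : bmeas (fun x => f x - cutoff (2 ^+ j * l0) x) by apply: bmeasB; [exact: bf|exact: bmeas_cutoff].
have bt j : bmeas (fun x => (2 ^+ j * l0) `^ (q - 2) * `|f x - cutoff (2 ^+ j * l0) x| `^ 2).
  by apply: bmeasZ; apply: bmeas_powR.
have bq := bmeas_powR q0 bf.
rewrite /Lp -IintZ// (eq_bigr (fun j : 'I_J => Iint (fun x => (2 ^+ j * l0) `^ (q - 2) * `|f x - cutoff (2 ^+ j * l0) x| `^ 2))); last first.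
  by move=> j _; rewrite IintZ//; apply: bmeas_powR.
rewrite -(Iint_sum _ (fun j : 'I_J => bt j)); apply: Iint_le; [by apply: bmeas_sum => j|exact: bmeasZ|move=> x].
apply: (@le_trans _ _ ((\sum_(j < J) (2 ^+ j * l0) `^ (q - 2) * (2 ^+ j * l0 < `|f x|)%R%:R) * `|f x| ^+ 2)).
  rewrite mulr_suml; apply: ler_sum => j _; rewrite -mulrA; apply: ler_wpM2l; first exact: powR_ge0.
  rewrite powR_sqr /cutoff real_normK ?num_real//.
  by case: (ltP _ `|f x|) => h; rewrite ?mulr0 ?mulr1 ?subr0 ?subrr ?mul1r ?mul0r// expr0n.
apply: (@le_trans _ _ (geo (q - 2) * `|f x| `^ (q - 2) * `|f x| ^+ 2)).
  by apply: ler_wpM2r; [exact: sqr_ge0|exact: geo_below].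
have [->|n0] := eqVneq `|f x| 0; first by rewrite expr0n mulr0 mulr_ge0 ?powR_ge0 ?geo_ge0.
by rewrite -mulrA -powR_mulrn// -powRD ?subrK// n0 implybT.
Qed.

Lemma sum_above (l0 : R) J : 0 < l0 ->
  \sum_(j < J) (2 ^+ j * l0) `^ (q - p) * Lp p (cutoff (2 ^+ j * l0)) <= geo (p - q) * Lp q f.
Proof.
move=> l00; have qq : 0 < p - q by have := qp; lra.
have q0 : 0 <= q by have := q2; lra.
have p0 : 0 < p by have := q2; have := qp; lra.
have bt j : bmeas (fun x => (2 ^+ j * l0) `^ (q - p) * `|cutoff (2 ^+ j * l0) x| `^ p).
  by apply: bmeasZ; apply: bmeas_powR; [exact: ltW|exact: bmeas_cutoff].
have bq := bmeas_powR q0 bf.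
rewrite /Lp -IintZ// (eq_bigr (fun j : 'I_J => Iint (fun x => (2 ^+ j * l0) `^ (q - p) * `|cutoff (2 ^+ j * l0) x| `^ p))); last first.
  by move=> j _; rewrite IintZ//; apply: bmeas_powR; [exact: ltW|exact: bmeas_cutoff].
rewrite -(Iint_sum _ (fun j : 'I_J => bt j)); apply: Iint_le; [by apply: bmeas_sum => j|exact: bmeasZ|move=> x].
have [f0|n0] := eqVneq `|f x| 0.
  rewrite big1; first by apply: mulr_ge0; [exact: geo_ge0|exact: powR_ge0].
  by move=> j _; rewrite /cutoff normrM f0 mul0r powR0 ?mulr0// gt_eqF.
have fp : 0 < `|f x| by rewrite lt_def n0 /=.
apply: (@le_trans _ _ ((\sum_(j < J) (2 ^+ j * l0) `^ (- (p - q)) * (`|f x| <= 2 ^+ j * l0)%R%:R) * `|f x| `^ p)).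
  rewrite mulr_suml; apply: ler_sum => j _; rewrite opprB -mulrA; apply: ler_wpM2l; first exact: powR_ge0.
  by rewrite /cutoff; case: (leP `|f x|) => h; rewrite ?mulr1 ?mulr0 ?mul1r ?mul0r// normr0 powR0// gt_eqF.
apply: (@le_trans _ _ (geo (p - q) * `|f x| `^ (- (p - q)) * `|f x| `^ p)).
  by apply: ler_wpM2r; [exact: powR_ge0|exact: geo_above].
by rewrite -mulrA opprB -powRD ?subrK// n0 implybT.
Qed.

Let p2 : 2 < p. Proof. by have := q2; have := qp; lra. Qed.
Let p0 : 0 <= p. Proof. by have := p2; lra. Qed.
Let q0 : 0 <= q. Proof. by have := q2; lra. Qed.

(** A truncation is not a trigonometric polynomial, so the multiplier is applied instead to a
    polynomial close to it in L^2 and L^p at once, and to the remainder of [L]. *)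
Lemma interpolate_level (l e : R) : 0 < l -> 0 < e -> exists L',
  Lp 2 (tev (tmult M (L ++ tmult (fun=> (-1)%:C%C) L'))) <= K * (4 * (Lp 2 (fun x => f x - cutoff l x) + e)) /\
  Lp p (tev (tmult M L')) <= K * (2 `^ p * (Lp p (cutoff l) + e)).
Proof.
move=> l0 e0; have bc := bmeas_cutoff l.
have [L' [h1 h2]] := approx_both p2 bc e0; exists L'; have bL' := tev_bmeas L'.
have bd := bmeasB bc bL'; split.
  apply: le_trans (hM2 _) _; apply: ler_wpM2l; first exact: K0.
  rewrite (@eq_Lp _ 2 _ (fun x => (f x - cutoff l x) + (cutoff l x - tev L' x))); last first.
    by move=> x; rewrite tev_cat tev_scale /f; ring.
  apply: le_trans (LpD (ler0n _ _) (bmeasB bf bc) bd) _.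
  rewrite powR_mulrn// (_ : 2 ^+ 2 = 4 :> R); last by rewrite expr2; lra.
  by apply: ler_wpM2l; [exact: ler0n|rewrite lerD2l; exact: h2].
apply: le_trans (hMp _) _; apply: ler_wpM2l; first exact: K0.
rewrite (@eq_Lp _ p _ (fun x => cutoff l x + -1 * (cutoff l x - tev L' x))); last by move=> x; ring.
apply: le_trans (LpD p0 bc (bmeasZ _ bd)) _; apply: ler_wpM2l; first exact: powR_ge0.
by rewrite LpZ// normrN1 powR1 mul1r lerD2l; exact: h1.
Qed.

Lemma interpolate_error (d : R) : 0 < d ->
  Lp q (tev (tmult M L)) <= marc_const q p K * Lp q f + marc_error q p K * d.
Proof.
move=> d0; pose P : R := (2 * pi) ^+ 2.
have P0 : 0 < P by rewrite exprn_gt0// mulr_gt0// pi_gt0.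
have qp0 : 0 < q by have := q2; lra.
(* The values below the lowest level contribute l0^q times the area of the torus, which is d. *)
pose l0 := (d / P) `^ q^-1; have l00 : 0 < l0 by rewrite powR_gt0// divr_gt0.
have l0q : l0 `^ q * P = d.
  by rewrite -powRrM mulVf ?gt_eqF// powRr1 ?divr_ge0 ?(ltW d0) ?(ltW P0)// divfK// gt_eqF.
have by_ := tev_bmeas (tmult M L); have [By By0 hBy] := bmeas_bound by_.
(* Levels above the sup of the transformed function are empty, so finitely many suffice. *)
have [J hJ] : exists J, By <= 2 ^+ J * l0.
  exists (Num.bound (By / l0)); rewrite -ler_pdivrMr//.
  have /ltW h := archi_boundP (ltW (divr_gt0 By0 l00)); apply: le_trans h _.
  by rewrite -natrX ler_nat ltnW// ltn_expl.
pose lam j := 2 ^+ j * l0 : R.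
have lam0 j : 0 < lam j by rewrite mulr_gt0// exprn_gt0.
(* The tolerance at level j: after weighting, each level costs at most d / (J + 1), and all of them
   together at most d. *)
pose e j := d / J.+1%:R / (lam j `^ (q - 2) + lam j `^ (q - p)).
have w0 j : 0 < lam j `^ (q - 2) + lam j `^ (q - p) by rewrite addr_gt0// powR_gt0.
have e0 j : 0 < e j by rewrite divr_gt0// divr_gt0.
have [L' hL'] := choice (fun j => interpolate_level (lam0 j) (e0 j)).
pose Q j := L ++ tmult (fun=> (-1)%:C%C) (L' j).
pose u j := tev (tmult M (Q j)); pose v j := tev (tmult M (L' j)).
have bu j : bmeas (u j) by exact: tev_bmeas.
have bv j : bmeas (v j) by exact: tev_bmeas.
have yE j x : tev (tmult M L) x = u j x + v j x.
  rewrite /u /v /Q tmult_cat tev_cat; have -> : tmult M (tmult (fun=> (-1)%:C%C) (L' j)) = tmult (fun=> (-1)%:C%C) (tmult M (L' j)).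
    by rewrite !tmult_comp; apply: eq_tmult => k _; rewrite mulrC.
  by rewrite tev_scale; ring.
pose S j x := 4 * lam j `^ (q - 2) * `|u j x| `^ 2 + 2 `^ p * lam j `^ (q - p) * `|v j x| `^ p.
have bS j : bmeas (S j) by apply: bmeasD; apply: bmeasZ; apply: bmeas_powR.
have IS j : Iint (S j) = 4 * lam j `^ (q - 2) * Lp 2 (u j) + 2 `^ p * lam j `^ (q - p) * Lp p (v j).
  by rewrite IintD ?IintZ//; try (by apply: bmeas_powR); apply: bmeasZ; apply: bmeas_powR.
have h1 : Lp q (tev (tmult M L)) <= d + 2 `^ q * \sum_(j < J) Iint (S j).
  rewrite -l0q -(Iint_cst (l0 `^ q)) -(Iint_sum _ (fun j : 'I_J => bS j)) -IintZ; last by apply: bmeas_sum => j.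
  have bT : bmeas (fun x => 2 `^ q * \sum_(j < J) S j x) by apply: bmeasZ; apply: bmeas_sum => j.
  rewrite -IintD//; last exact: bmeas_cst.
  apply: Iint_le; [exact: bmeas_powR|by apply: bmeasD => //; exact: bmeas_cst|move=> x].
  apply: le_trans (dyadic_layers qp0 (normr_ge0 _) l00 (le_trans (hBy x) hJ)) _.
  rewrite lerD2l; apply: ler_wpM2l; first exact: powR_ge0.
  apply: ler_sum => j _.
  have hyj : `|tev (tmult M L) x| <= `|u j x| + `|v j x| by rewrite (yE j x); exact: ler_normD.
  exact: (split_level (lam0 j) q2 qp hyj).
apply: le_trans h1 _; clear by_ By By0 hBy hJ bS bu bv yE.
have [kq kp] : 0 <= 2 `^ q * K /\ 0 <= 2 `^ p * 2 `^ p :> R by rewrite !mulr_ge0 ?powR_ge0 ?K0.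
pose a j := lam j `^ (q - 2) * Lp 2 (fun x => f x - cutoff (lam j) x).
pose b j := lam j `^ (q - p) * Lp p (cutoff (lam j)).
have hj j : Iint (S j) <= K * (16 * a j + 2 `^ p * 2 `^ p * b j) + K * (16 + 2 `^ p * 2 `^ p) * (d / J.+1%:R).
  have [g1 g2] := hL' j; rewrite -/(Q j) -/(u j) -/(v j) in g1 g2.
  have A0 : 0 <= lam j `^ (q - 2) by exact: powR_ge0.
  have B0 : 0 <= lam j `^ (q - p) by exact: powR_ge0.
  have E1 : lam j `^ (q - 2) * e j <= d / J.+1%:R.
    rewrite /e mulrCA -[leRHS]mulr1; apply: ler_wpM2l; first by rewrite divr_ge0// ltW.
    by rewrite ler_pdivrMr// mul1r lerDl.
  have E2 : lam j `^ (q - p) * e j <= d / J.+1%:R.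
    rewrite /e mulrCA -[leRHS]mulr1; apply: ler_wpM2l; first by rewrite divr_ge0// ltW.
    by rewrite ler_pdivrMr// mul1r lerDr.
  have := IS j; rewrite /a /b; clear IS; move: (Iint (S j)) (Lp 2 (u j)) (Lp p (v j)) g1 g2 E1 E2.
  move: (Lp 2 _) (Lp p _) (lam j `^ (q - 2)) A0 (lam j `^ (q - p)) B0 (e j) (d / J.+1%:R) (2 `^ p) (powR_ge0 (2 : R) p).
  move=> m n A A0 B B0 ej dj tp tp0 I U V g1 g2 E1 E2 ->.
  have t1 : 4 * A * U <= 4 * A * (K * (4 * (m + ej))) by apply: ler_wpM2l => //; rewrite mulr_ge0.
  have t2 : tp * B * V <= tp * B * (K * (tp * (n + ej))) by apply: ler_wpM2l => //; rewrite mulr_ge0.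
  apply: le_trans (lerD t1 t2) _.
  have -> : 4 * A * (K * (4 * (m + ej))) + tp * B * (K * (tp * (n + ej))) =
    K * (16 * (A * m) + tp * tp * (B * n)) + K * (16 * (A * ej) + tp * tp * (B * ej)) by ring.
  rewrite lerD2l -[leRHS]mulrA; apply: ler_wpM2l; first exact: K0.
  rewrite [leRHS]mulrDl; apply: lerD; apply: ler_wpM2l => //; exact: mulr_ge0.
have hs : \sum_(j < J) Iint (S j) <= K * (16 * (geo (q - 2) * Lp q f) + 2 `^ p * 2 `^ p * (geo (p - q) * Lp q f)) + K * (16 + 2 `^ p * 2 `^ p) * d.
  apply: (@le_trans _ _ (\sum_(j < J) (K * (16 * a j + 2 `^ p * 2 `^ p * b j) + K * (16 + 2 `^ p * 2 `^ p) * (d / J.+1%:R)))).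
    by apply: ler_sum => j _; exact: hj.
  rewrite big_split /=; apply: lerD.
    rewrite -mulr_sumr; apply: ler_wpM2l; first exact: K0.
    rewrite big_split; apply: lerD; rewrite -mulr_sumr.
      by apply: ler_wpM2l; [exact: ler0n|exact: sum_below].
    by apply: ler_wpM2l; [exact: kp|exact: sum_above].
  rewrite -mulr_sumr sumr_const card_ord -[_ *+ J]mulr_natr; apply: ler_wpM2l.
    by apply: mulr_ge0; [exact: K0|rewrite addr_ge0// ler0n].
  rewrite mulrAC ler_pdivrMr ?ltr0n//; apply: ler_wpM2l; first exact: ltW.
  by rewrite ler_nat.
clear hj hL' IS.
rewrite /marc_const /marc_error; move: (\sum_(j < J) Iint (S j)) (Lp q f) hs => X Y hs.
have hs' : 2 `^ q * X <= 2 `^ q * (K * (16 * (geo (q - 2) * Y) + 2 `^ p * 2 `^ p * (geo (p - q) * Y)) + K * (16 + 2 `^ p * 2 `^ p) * d).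
  by apply: ler_wpM2l; [exact: powR_ge0|exact: hs].
move: (2 `^ q * X) hs' => X'; move: (2 `^ q) (2 `^ p) (geo _) (geo _) => t1 t2 t4 t3 hs'.
apply: (@le_trans _ _ (d + t1 * (K * (16 * (t3 * Y) + t2 * t2 * (t4 * Y)) + K * (16 + t2 * t2) * d))).
  by rewrite lerD2l.
by apply: eq_ler; ring.
Qed.

Lemma interpolate : Lp q (tev (tmult M L)) <= marc_const q p K * Lp q f.
Proof.
have kq : 0 < marc_error q p K.
  have h1 : 0 <= 2 `^ p * 2 `^ p :> R by rewrite mulr_ge0 ?powR_ge0.
  have : 0 <= 2 `^ q * K * (16 + 2 `^ p * 2 `^ p).
    by apply: mulr_ge0; [apply: mulr_ge0; [exact: powR_ge0|exact: K0]|rewrite addr_ge0// ler0n].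
  rewrite /marc_error; move: (_ * _) => z; lra.
rewrite leNgt; apply/negP; rewrite -subr_gt0.
have := interpolate_error; move: (Lp q _) (_ * Lp q f) => X Y hXY XY.
have d0 : 0 < (X - Y) / (2 * marc_error q p K) by rewrite divr_gt0// mulr_gt0.
have := hXY _ d0; move: (marc_error q p K) kq => E E0.
have -> : E * ((X - Y) / (2 * E)) = (X - Y) / 2 by field; rewrite gt_eqF.
lra.
Qed.

End Interpolate.
(** Interpolation between 2 and an even integer above q. *)
Theorem riesz2_bound_real (q : R) : 2 < q -> exists2 K : R, 0 <= K &
  forall b b' L, 0 \notin map snd L ->
  Lp q (tev (tmult (fun k => (riesz2 R b b' k)%:C%C) L)) <= K * Lp q (tev L).
Proof.
move=> q2; pose m := (Num.bound q).+1.
have [qm m0] : q < (2 * m)%:R /\ (0 < m)%N.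
  split => //; have h := archi_boundP (ltW (lt_trans (ltr0n R 2) q2)).
  by apply: lt_le_trans h _; rewrite ler_nat /m; lia.
have [K2 K20 h2] := @riesz2_bound R 1 isT; have [Kp Kp0 hp] := @riesz2_bound R m m0.
move: (2 * m)%N qm hp => p qp hp.
have p1 : 1 <= p%:R :> R by lra.
have M0 b b' : (riesz2 R b b' 0)%:C%C = 0 :> C.
  by rewrite /riesz2 /frequency; case: b; rewrite /= !mul0r.
have a2 b b' := multiplier_all (ler1n R 2) K20 (M0 b b') (h2 b b').
have ap b b' := multiplier_all p1 Kp0 (M0 b b') (hp b b').
pose K := K2 * (2 `^ 2 * 2) + Kp * (2 `^ p%:R * 2).
have k2 : 0 <= K2 * (2 `^ 2 * 2) by rewrite !mulr_ge0 ?powR_ge0.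
have kp : 0 <= Kp * (2 `^ p%:R * 2) by rewrite !mulr_ge0 ?powR_ge0.
have K0 : 0 <= K by exact: addr_ge0.
exists (marc_const q p%:R K).
  have g1 : 0 <= geo (q - 2) by apply: geo_ge0; lra.
  have g2 : 0 <= geo (p%:R - q) by apply: geo_ge0; lra.
  rewrite /marc_const; apply: mulr_ge0; first by rewrite mulr_ge0 ?powR_ge0.
  move: (geo _) g1 (geo _) g2 => u u0 v v0.
  by rewrite addr_ge0 ?mulr_ge0 ?powR_ge0.
move=> b b' L _; apply: interpolate => // L1.
- apply: le_trans (a2 b b' L1) _; apply: ler_wpM2r; first exact: Lp_ge0.
  by rewrite /K lerDl.
- apply: le_trans (ap b b' L1) _; apply: ler_wpM2r; first exact: Lp_ge0.
  by rewrite /K lerDr.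
Qed.

End Marcinkiewicz.

(** * Weak derivatives *)

Section TestFunctions.
Variable R : realType.
Implicit Types (L : tpoly R) (f g phi : R * R -> R).

(** The plane carries the product sigma-algebra, so openness is related to it by hand: U is the
    union of the rational squares that it contains, which are countably many. *)
Lemma open_measurable2 (U : set (R * R)) : open U -> measurable U.
Proof.
move=> oU.
pose box (t : rat * rat * rat) : set (R * R) :=
  `](ratr t.1.1 - ratr t.2), (ratr t.1.1 + ratr t.2)[%classic `*` `](ratr t.1.2 - ratr t.2), (ratr t.1.2 + ratr t.2)[%classic.
pose G t := if `[< box t `<=` U >] then box t else set0.
have -> : U = \bigcup_t G t.
  apply/seteqP; split => [[x y] Uxy|x [t _]]; last first.
    by rewrite /G; case: ifPn => // /asboolP; apply.
  have /nbhs_ballP[e /= e0 sub] : nbhs (x, y) U by apply: open_nbhs_nbhs.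
  have e4 : 0 < e / 4 by rewrite divr_gt0.
  have [a] : exists q, ratr q \in `]x - e / 4, x + e / 4[ by apply: rat_in_itvoo; lra.
  rewrite in_itv /= => /andP[a1 a2].
  have [b] : exists q, ratr q \in `]y - e / 4, y + e / 4[ by apply: rat_in_itvoo; lra.
  rewrite in_itv /= => /andP[b1 b2].
  have [r] : exists q : rat, ratr q \in `](e / 4), (e / 2)[ by apply: rat_in_itvoo; lra.
  rewrite in_itv /= => /andP[r1 r2].
  exists (a, b, r) => //; rewrite /G; case: ifPn => [_|/asboolP nb].
    by rewrite /box /= !in_itv /=; split; apply/andP; split; lra.
  exfalso; apply: nb => -[u v]; rewrite /box /= !in_itv /= => -[/andP[u1 u2] /andP[v1 v2]].
  by apply: sub; split; rewrite /ball /= ltr_norml; apply/andP; split; lra.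
apply: countable_bigcupT_measurable => // t; rewrite /G; case: ifP => _; last exact: measurable0.
by apply: measurableX; exact: measurable_itv.
Qed.

Lemma continuous_measurable2 f : continuous f -> measurable_fun setT f.
Proof.
move=> cf; apply: (measurability (@RGenOInfty.G R)) => [|/= _ [_] [r] -> <-].
  exact: RGenOInfty.measurableE.
rewrite setTI; apply: open_measurable2.
by apply: open_comp => // x _; exact: cf.
Qed.

Lemma continuous_periodic_bmeas f : continuous f -> periodic2 f -> bmeas f.
Proof.
move=> cf pf; split; first exact: continuous_measurable2.
have cK : compact (`[0, 2 * pi] `*` `[0, 2 * pi] : set (R * R)).
  by apply: compact_setX; exact: segment_compact.
have : bounded_set (f @` (`[0, 2 * pi] `*` `[0, 2 * pi])).
  by apply: compact_bounded; apply: continuous_compact => //; exact: continuous_subspaceT.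
move=> [M [_ hM]]; exists (M + 1) => x.
have [m /andP[m1 m2]] := mod2pi x.1; have [n /andP[n1 n2]] := mod2pi x.2.
have -> : f x = f (x.1 + 2 * pi * m%:~R, x.2 + 2 * pi * n%:~R).
  by rewrite periodic2_int//; case: x {m1 m2 n1 n2}.
apply: (hM (M + 1)); first by rewrite ltrDl.
exists (x.1 + 2 * pi * m%:~R, x.2 + 2 * pi * n%:~R) => //.
by split; rewrite /= in_itv /= ?m1 ?n1 /= ltW.
Qed.

Lemma edir_axis b (s : R) (x : R * R) : shift2 (axis2 b s) x = s *: edir R b + x.
Proof.
apply: injective_projections; rewrite /shift2 /axis2 /edir /e1 /e2; case: b => /=;
  rewrite /GRing.scale /= ?mulr0 ?mulr1 addrC //.
Qed.

Lemma derive_axis phi b (x : R * R) (s : R) : derivable phi (shift2 (axis2 b s) x) (edir R b) ->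
  is_derive s 1 (fun s => phi (shift2 (axis2 b s) x)) ('D_(edir R b) phi (shift2 (axis2 b s) x)).
Proof.
move=> dphi.
have e : (fun h : R => h^-1 *: (((fun s => phi (shift2 (axis2 b s) x)) \o shift s) (h *: 1) - phi (shift2 (axis2 b s) x))) =
   (fun h : R => h^-1 *: ((phi \o shift (shift2 (axis2 b s) x)) (h *: edir R b) - phi (shift2 (axis2 b s) x))).
  apply/funext => h; congr (_ *: (phi _ - _)).
  by rewrite /shift /= !edir_axis [h *: (1 : R)]mulr1 scalerDl addrA.
by apply: DeriveDef; rewrite /derivable /derive e.
Qed.

Lemma derive_periodic phi b : periodic2 phi -> periodic2 ('D_(edir R b) phi).
Proof.
move=> pphi x y; rewrite /derive.
have h (c : R * R) : (forall z, phi (z + c) = phi z) -> forall z,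
   (fun h : R => h^-1 *: ((phi \o shift (z + c)) (h *: edir R b) - phi (z + c))) =
   (fun h : R => h^-1 *: ((phi \o shift z) (h *: edir R b) - phi z)).
  by move=> hc z; apply/funext => h; rewrite /= hc addrA hc.
have h1 (z : R * R) : phi (z + (2 * pi, 0)) = phi z.
  by case: z => u v; rewrite -(pphi u v).1; congr phi; congr (_, _); rewrite /= addr0.
have h2 (z : R * R) : phi (z + (0, 2 * pi)) = phi z.
  by case: z => u v; rewrite -(pphi u v).2; congr phi; congr (_, _); rewrite /= addr0.
split.
- have := h _ h1 (x, y); have -> : (x, y) + (2 * pi, 0) = (x + 2 * pi, y) by congr (_, _); rewrite /= addr0.
  by move=> ->.
- have := h _ h2 (x, y); have -> : (x, y) + (0, 2 * pi) = (x, y + 2 * pi) by congr (_, _); rewrite /= addr0.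
  by move=> ->.
Qed.

Lemma test_fun_bmeas phi : test_fun phi -> bmeas phi.
Proof. by move=> [sm pphi]; apply: continuous_periodic_bmeas => //; exact: (sm [::]).1. Qed.

Lemma test_fun_derive_bmeas phi b : test_fun phi -> bmeas ('D_(edir R b) phi).
Proof.
move=> [sm pphi]; apply: continuous_periodic_bmeas; first exact: (sm [:: b]).1.
exact: derive_periodic.
Qed.

(** The difference quotients of the periodic product have mean zero by translation invariance. The
    mean value theorem bounds them uniformly, and they converge to the derivative of the product,
    which therefore has mean zero. *)
Lemma trig_ibp b L phi : test_fun phi ->
  Iint (fun x => tev L x * 'D_(edir R b) phi x) = - Iint (fun x => tev (tder b L) x * phi x).
Proof.
move=> tphi; have bp := test_fun_bmeas tphi; have bd := test_fun_derive_bmeas b tphi.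
have bL := tev_bmeas L; have bdL := tev_bmeas (tder b L).
pose u x := tev L x * phi x; have bu : bmeas u by exact: bmeasM.
pose w x := tev (tder b L) x * phi x + tev L x * 'D_(edir R b) phi x.
have bw : bmeas w by apply: bmeasD; exact: bmeasM.
have pu : periodic2 u.
  by move=> x y; have [h1 h2] := tev_periodic L x y; have [h3 h4] := tphi.2 x y; rewrite /u h1 h2 h3 h4.
have du x (s : R) : is_derive s 1 (fun s => u (shift2 (axis2 b s) x)) (w (shift2 (axis2 b s) x)).
  have d1 := tev_is_derive b L x s.
  have d2 := @derive_axis phi b x s ((tphi.1 [::]).2 b _).
  have := @is_deriveM _ _ _ _ _ _ _ _ d1 d2; rewrite /GRing.scale /= => d3.
  by apply: (is_derive_eq d3); rewrite /w; ring.
pose v n x := n.+1%:R * (u (shift2 (axis2 b (n.+1%:R^-1)) x) - u x).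
have bv n : bmeas (v n) by apply: bmeasZ; apply: bmeasB => //; exact: bmeas_shift.
have Iv n : Iint (v n) = 0.
  rewrite IintZ; last by apply: bmeasB => //; exact: bmeas_shift.
  rewrite IintB//; last exact: bmeas_shift.
  by rewrite -[X in Iint X - _]/(u \o shift2 _) Iint_shift// subrr mulr0.
have [B B0 hB] := bmeas_bound bw.
have sh0 x : shift2 (axis2 b 0) x = x by rewrite /shift2; case: (b) => /=; rewrite !addr0; case: (x).
have hv n x : `|v n x| <= B.
  have n0 : 0 < n.+1%:R^-1 :> R by rewrite invr_gt0 ltr0n.
  have cf : {within `[0, n.+1%:R^-1], continuous (fun s => u (shift2 (axis2 b s) x))}.
    by apply: derivable_within_continuous => s _; have [] := du x s.
  have [c _] := MVT n0 (fun s _ => du x s) cf.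
  by rewrite sh0 /v => ->; rewrite subr0 mulrCA divff ?mulr1.
have cv x : v n x @[n --> \oo] --> w x.
  have [d1 d2] := du x 0.
  have h : (fun h : R => h^-1 *: (((fun s => u (shift2 (axis2 b s) x)) \o shift 0) (h *: 1) - u (shift2 (axis2 b 0) x))) h @[h --> 0^'] --> w (shift2 (axis2 b 0) x).
    by rewrite -d2.
  have := (cvgr_dnbhsP _ _ _).1 h (fun n => n.+1%:R^-1).
  have hn : (forall n : nat, (n.+1%:R^-1 : R) != 0) by move=> n; rewrite invr_eq0 pnatr_eq0.
  move=> /(_ (conj hn (@cvg_harmonic R))).
  rewrite (_ : (fun n : nat => _) = v ^~ x); first by rewrite sh0.
  by apply/funext => n; rewrite /v invrK /= [_ *: (1 : R)]mulr1 addr0 sh0.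
have := @Iint_dct R v w B bv bw hv (aeW _ (fun x _ => cv x)).
rewrite (_ : (fun n => Iint (v n)) = fun=> 0); last by apply/funext.
move=> /(cvg_unique _ (cvg_cst 0)) h.
have : Iint w = 0 by rewrite -h.
by rewrite IintD; [|exact: bmeasM|exact: bmeasM] => /eqP; rewrite addrC addr_eq0 => /eqP.
Qed.

End TestFunctions.

(** * Summation of series *)

Section Series.
Variable R : realType.
Implicit Types (f g : R * R -> R) (r : R).
Local Notation Pi := (@Pi R).
Local Notation leb2 := (@leb2 R).
Let mPi : measurable Pi := @measurable_Pi R.

(** Counterpart of [Lp] for functions that need not be bounded; the value may be infinite. *)
Definition Lpint r f : \bar R := (\int[leb2]_(x in Pi) (`|f x| `^ r)%:E)%E.

Lemma Lpint_ge0 r f : (0 <= Lpint r f)%E.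
Proof. by apply: integral_ge0 => x _; rewrite lee_fin powR_ge0. Qed.

Lemma Lpint_Lp r f : 0 <= r -> bmeas f -> Lpint r f = (Lp r f)%:E.
Proof. by move=> r0 bf; rewrite /Lpint Iint_EFin//; exact: bmeas_powR. Qed.

Lemma measurable_Lpint r f : measurable_fun Pi f -> measurable_fun Pi (fun x => (`|f x| `^ r)%:E).
Proof.
move=> mf; apply: measurableT_comp => //.
by apply: (measurableT_comp (measurable_powR r)); apply: measurableT_comp => //; exact: normr_measurable.
Qed.

Lemma Lpint_le r f g : 0 <= r -> measurable_fun Pi f -> measurable_fun Pi g ->
  (forall x, Pi x -> `|f x| <= `|g x|) -> (Lpint r f <= Lpint r g)%E.
Proof.
move=> r0 mf mg h; apply: ge0_le_integral.
- exact: mPi.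
- by move=> x _; rewrite lee_fin powR_ge0.
- exact: measurable_Lpint.
- exact: measurable_Lpint.
- by move=> x px; rewrite lee_fin; apply: le_powR => //; exact: h.
Qed.

Lemma Lpint_eq0 r f : 0 < r -> measurable_fun Pi f -> Lpint r f = 0%E -> {ae leb2, forall x, Pi x -> f x = 0}.
Proof.
move=> r0 mf h.
have : (\int[leb2]_(x in Pi) `|(`|f x| `^ r)%:E| = 0)%E.
  rewrite -[RHS]h; apply: eq_integral => x _; by rewrite gee0_abs// lee_fin powR_ge0.
move=> /(ae_eq_integral_abs leb2 mPi (measurable_Lpint r mf)).
apply: ae_leb2S => x hx px; have := hx px => -[] /eqP.
by move=> /eqP /powR_eq0_eq0 /normr0_eq0.
Qed.

Lemma eq_Lpint r f g : measurable_fun Pi f -> measurable_fun Pi g ->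
  {ae leb2, forall x, Pi x -> f x = g x} -> Lpint r f = Lpint r g.
Proof.
move=> mf mg h; apply: ae_eq_integral; [exact: mPi|exact: measurable_Lpint|exact: measurable_Lpint|].
by apply: ae_leb2S h => x hx px; rewrite hx.
Qed.

Lemma powR_cvg r (u : nat -> R) (l : R) : 1 <= r -> u n @[n --> \oo] --> l ->
  `|u n| `^ r @[n --> \oo] --> `|l| `^ r.
Proof.
move=> r1 ul; have un : `|u n| @[n --> \oo] --> `|l| by exact: cvg_norm.
have B0 : 0 <= `|l| + 1 by rewrite addr_ge0.
have C0 : 0 <= r * (`|l| + 1) `^ (r - 1) by rewrite mulr_ge0 ?powR_ge0//; lra.
have hb : \forall n \near \oo, `|u n| < `|l| + 1 by apply: (cvgr_lt `|l|) => //; rewrite ltrDl.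
apply/cvgrPdist_le => e e0.
have e1 : 0 < e / (r * (`|l| + 1) `^ (r - 1) + 1) by rewrite divr_gt0// ltr_wpDl.
have hd : \forall n \near \oo, `| `|l| - `|u n| | <= e / (r * (`|l| + 1) `^ (r - 1) + 1).
  by move/cvgrPdist_le : un; apply.
near=> n.
have h1 : 0 <= `|l| <= `|l| + 1 by rewrite normr_ge0 /= lerDl.
have h2 : 0 <= `|u n| <= `|l| + 1 by rewrite normr_ge0 /= ltW//; near: n.
apply: le_trans (powR_lipschitz r1 h1 h2) _.
have h3 : `| `|l| - `|u n| | <= e / (r * (`|l| + 1) `^ (r - 1) + 1) by near: n.
apply: le_trans (ler_wpM2l C0 h3) _.
move: (r * _ `^ _) C0 => c C0; rewrite mulrA ler_pdivrMr ?ltr_wpDl//.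
by rewrite mulrC ler_pM2l// lerDl.
Unshelve. all: by end_near.
Qed.

Lemma Lpint_fatou r (u : nat -> R * R -> R) f (c : R) : 1 <= r -> (forall n, measurable_fun Pi (u n)) ->
  measurable_fun Pi f -> {ae leb2, forall x, Pi x -> u n x @[n --> \oo] --> f x} ->
  (forall n, (Lpint r (u n) <= c%:E)%E) -> (Lpint r f <= c%:E)%E.
Proof.
move=> r1 mu mf hae hc.
have mv n : measurable_fun Pi (fun x => (`|u n x| `^ r)%:E) := measurable_Lpint r (mu n).
have h := fatou leb2 mPi mv (fun n x _ => powR_ge0 `|u n x| r).
have mi : measurable_fun Pi (fun x => limn_einf (fun n => (`|u n x| `^ r)%:E)).
  have m0 n : measurable_fun Pi (fun x => - (`|u n x| `^ r)%:E)%E.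
    by apply: measurableT_comp; [exact: oppe_measurable|exact: mv].
  have m1 := measurable_fun_limn_esup m0.
  rewrite (_ : (fun x => _) = \- (fun x => limn_esup (fun n => - (`|u n x| `^ r)%:E)%E))%E.
    by apply: measurableT_comp.
  by apply/funext => x; rewrite -limn_einfN; congr limn_einf; apply/funext => n /=; rewrite opprK.
have e : Lpint r f = (\int[leb2]_(x in Pi) limn_einf (fun n => (`|u n x| `^ r)%:E))%E.
  apply: ae_eq_integral; [exact: mPi|exact: measurable_Lpint|exact: mi|].
  apply: ae_leb2S hae => x hx px; have /(powR_cvg r1) h1 := hx px.
  apply/esym/(cvg_limn_einf_sup _).1; apply/fine_cvgP; split => //; exact: nearW.
rewrite e; apply: le_trans h _; rewrite limn_einf_lim; apply: lime_le; first exact: is_cvg_einfs.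
apply: nearW => n; apply: le_trans (hc n); apply: ereal_inf_lbound; exists n => //=.
Qed.

Section SummableSeries.
Variables (g : nat -> R * R -> R) (N : R).
Hypothesis bg : forall n, bmeas (g n).
Hypothesis hg : forall n, Lp 2 (g n) <= (4^-1 ^+ n) `^ 2 * N.

Let S n x := \sum_(0 <= i < n) g i x.
Let H x := (\sum_(0 <= i <oo) (`|g i x|)%:E)%E.
(* The value 0 is taken wherever the series does not converge absolutely. *)
Definition series_limit x := if H x \is a fin_num then limn (fun n => S n x) else 0.

Lemma partial_sum_bmeas n : bmeas (S n).
Proof. exact: bmeas_sum. Qed.

Lemma term_norm_ge0 i x : (0 <= (`|g i x|)%:E)%E.
Proof. by rewrite lee_fin. Qed.

Lemma abs_series_measurable : measurable_fun setT H.
Proof.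
apply: (@ge0_emeasurable_sum _ _ R setT (fun i x => (`|g i x|)%:E) xpredT) => [i x _ _|i _]; first exact: term_norm_ge0.
by apply: measurableT_comp => //; have [] := bmeas_norm (bg i).
Qed.

(** From |g| <= t + g^2 / t with t = 2^-n: the square integral is at most t^4 N, so each term is
    integrable with integral at most t times a constant. *)
Lemma abs_series_integral_lty : (\int[leb2]_(x in Pi) H x < +oo)%E.
Proof.
have N0 : 0 <= N.
  by have := le_trans (Lp_ge0 2 (g 0%N)) (hg 0); rewrite expr0 powR1 mul1r.
have P0 : 0 <= (2 * pi) ^+ 2 :> R by exact: sqr_ge0.
rewrite integral_nneseries; [|exact: mPi| |by move=> *; exact: term_norm_ge0]; last first.
  move=> n; apply: measurable_funTS; apply: measurableT_comp => //; by have [] := bmeas_norm (bg n).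
have hn n : (\int[leb2]_(x in Pi) (`|g n x|)%:E <= (2^-1 ^+ n * ((2 * pi) ^+ 2 + N))%:E)%E.
  rewrite (Iint_EFin (bmeas_norm (bg n))) lee_fin.
  pose t : R := 2^-1 ^+ n; have t0 : 0 < t by rewrite exprn_gt0.
  have tg : Lp 2 (g n) <= t ^+ 4 * N.
    apply: le_trans (hg n) _; rewrite powR_mulrn ?exprn_ge0// /t.
    by rewrite -!exprM (_ : 4^-1 = 2^-1 ^+ 2 :> R) -?exprM ?mulnA//; [rewrite (_ : (2 * n * 2 = n * 4)%N)//; lia|field].
  have b2 := bmeasZ t^-1 (bmeas_powR (ler0n R 2) (bg n)).
  have h : Iint (fun x => `|g n x|) <= Iint (fun x => t + t^-1 * `|g n x| `^ 2).
    apply: Iint_le; [exact: bmeas_norm|by apply: bmeasD => //; exact: bmeas_cst|move=> x].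
    rewrite powR_sqr -(real_normK (num_real (g n x))); move: `|_| (normr_ge0 (g n x)) => y y0.
    rewrite -(ler_pM2l t0) mulrDr mulVKf ?gt_eqF//; nra.
  apply: le_trans h _; rewrite IintD//; last exact: bmeas_cst.
  rewrite Iint_cst IintZ; last by apply: bmeas_powR.
  rewrite -/(Lp 2 (g n)) -/t [leRHS]mulrDr lerD2l.
  apply: (@le_trans _ _ (t^-1 * (t ^+ 4 * N))).
    by apply: ler_wpM2l => //; rewrite invr_ge0 ltW.
  have t1 : t <= 1 by rewrite exprn_ile1// ?invr_ge0 ?invf_le1 ?ler1n//.
  have -> : t^-1 * (t ^+ 4 * N) = t ^+ 3 * N by field; rewrite gt_eqF.
  by apply: ler_wpM2r => //; rewrite exprS -[leRHS]mulr1; apply: ler_wpM2l; [exact: ltW|rewrite exprn_ile1// ltW].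
apply: (@le_lt_trans _ _ (2 * ((2 * pi) ^+ 2 + N))%:E); last exact: ltry.
apply: lime_le.
  by apply: is_cvg_nneseries => n _ _; apply: integral_ge0 => x _; exact: term_norm_ge0.
apply: nearW => n; apply: (@le_trans _ _ (\sum_(0 <= i < n) 2^-1 ^+ i * ((2 * pi) ^+ 2 + N))%:E).
  by rewrite -sumEFin; apply: lee_sum => i _.
rewrite lee_fin -mulr_suml; apply: ler_wpM2r; first exact: addr_ge0.
elim: n => [|n]; first by rewrite big_nil.
rewrite big_nat_recl// expr0; under eq_bigr do rewrite exprS.
by rewrite -mulr_sumr; move: (\sum_(_ <= _ < _) _) => u; lra.
Qed.

Lemma abs_series_fin_set : measurable [set x | H x \is a fin_num].
Proof. by have := emeasurable_fin_num measurableT abs_series_measurable; rewrite setTI. Qed.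

Lemma abs_series_integrable : leb2.-integrable Pi H.
Proof.
apply/integrableP; split; first exact: measurable_funTS abs_series_measurable.
rewrite (_ : (\int[leb2]_(x in Pi) `|H x| = \int[leb2]_(x in Pi) H x)%E).
  exact: abs_series_integral_lty.
by apply: eq_integral => x _; rewrite gee0_abs//; apply: nneseries_ge0 => i _ _; exact: term_norm_ge0.
Qed.

Lemma abs_series_fin_num : {ae leb2, forall x, Pi x -> H x \is a fin_num}.
Proof.
have h := @integrable_ae _ _ _ leb2 Pi mPi H abs_series_integrable.
exact: h.
Qed.

Lemma partial_sum_le_abs_series n x : (`|(S n x)%:E| <= H x)%E.
Proof.
apply: (@le_trans _ _ (\sum_(0 <= i < n) (`|g i x|)%:E)%E).
  by rewrite sumEFin lee_fin; exact: ler_norm_sum.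
by apply: nneseries_lim_ge => i _ _; exact: term_norm_ge0.
Qed.

Lemma series_limit_cvg : {ae leb2, forall x, Pi x -> S n x @[n --> \oo] --> series_limit x}.
Proof.
apply: ae_leb2S abs_series_fin_num => x hx /hx fx; rewrite /series_limit fx.
apply: normed_cvg; apply: nondecreasing_is_cvgn.
  move=> m n mn; exact: (nondecreasing_series (fun i _ _ => normr_ge0 (g i x))).
exists (fine (H x)) => _ [n _ <-]; rewrite -lee_fin fineK// /series /= -sumEFin.
by apply: nneseries_lim_ge => i _ _; exact: term_norm_ge0.
Qed.

Lemma series_limit_measurable : measurable_fun setT series_limit.
Proof.
apply: (@measurable_fun_cvg _ _ _ setT (fun n x => S n x * \1_[set x | H x \is a fin_num] x)).
  by move=> n; have [] := bmeasM (partial_sum_bmeas n) (bmeas_indic abs_series_fin_set).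
move=> x _; rewrite /series_limit indicE; case: ifPn => fx; last first.
  by rewrite memNset; [under eq_fun do rewrite mulr0; exact: cvg_cst|exact/negP].
have -> : x \in [set x | H x \is a fin_num] by rewrite inE.
rewrite (_ : (fun n => _) = S ^~ x); last by apply/funext => n; rewrite mulr1.
apply: normed_cvg; apply: nondecreasing_is_cvgn.
  move=> m n mn; exact: (nondecreasing_series (fun i _ _ => normr_ge0 (g i x))).
exists (fine (H x)) => _ [n _ <-]; rewrite -lee_fin fineK// /series /= -sumEFin.
by apply: nneseries_lim_ge => i _ _; exact: term_norm_ge0.
Qed.

(** The partial sums are dominated by the integrable sum of absolute values, and [psi] is
    bounded. *)
Lemma series_limit_weak psi : bmeas psi -> exists2 l : R,
  Iint (fun x => S n x * psi x) @[n --> \oo] --> l &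
  (\int[leb2]_(x in Pi) (series_limit x * psi x)%:E = l%:E)%E.
Proof.
move=> bp; have [B B0 hB] := bmeas_bound bp.
have bSp n : bmeas (fun x => S n x * psi x) by exact: bmeasM (partial_sum_bmeas n) bp.
have [|||||hint _ h] := @dominated_convergence _ _ _ leb2 Pi mPi (fun n x => (S n x * psi x)%:E)
  (fun x => (series_limit x * psi x)%:E) (fun x => B%:E * H x)%E.
- by move=> n; apply: measurable_funTS; apply: measurableT_comp => //; have [] := bSp n.
- apply: measurable_funTS; apply: measurableT_comp => //; apply: measurable_funM => //.
    exact: series_limit_measurable.
  by have [] := bp.
- apply: ae_leb2S series_limit_cvg => x hx /hx h; apply/fine_cvgP; split; first exact: nearW.
  by apply: cvgM => //; exact: cvg_cst.
- exact: (@integrableZl _ _ _ leb2 Pi mPi B H abs_series_integrable).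
- apply: aeW => x n _; rewrite EFinM abseM muleC; apply: lee_pmul => //.
  + by rewrite abse_EFin lee_fin.
  + exact: partial_sum_le_abs_series.
have hfin : (\int[leb2]_(x in Pi) (series_limit x * psi x)%:E)%E \is a fin_num.
  by apply: integrable_fin_num; [exact: mPi|exact: hint].
move: h; rewrite -(fineK hfin); under eq_fun do rewrite (Iint_EFin (bSp _)).
by move=> /fine_cvgP[_ h]; exists (fine (\int[leb2]_(x in Pi) (series_limit x * psi x)%:E)%E).
Qed.

(** Jensen with the weights 2^-(i+1), for which the decay 4^-i leaves room: 2^(i+1) 4^-i <= 2,
    whence the factor 2^r. The bound is uniform in the number of terms and passes to the limit by
    Fatou. *)
Lemma series_limit_Lpint r M : 1 <= r -> (forall n, Lp r (g n) <= (4^-1 ^+ n) `^ r * M) ->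
  (Lpint r series_limit <= (2 `^ r * M)%:E)%E.
Proof.
move=> r1 hM; have r0 : 0 <= r by lra.
have M0 : 0 <= M.
  by have := le_trans (Lp_ge0 r (g 0%N)) (hM 0); rewrite expr0 powR1 mul1r.
apply: (Lpint_fatou r1 _ _ series_limit_cvg) => [n||n].
- by apply: measurable_funTS; have [] := partial_sum_bmeas n.
- exact: measurable_funTS series_limit_measurable.
rewrite Lpint_Lp//; last exact: partial_sum_bmeas.
rewrite lee_fin.
pose w i : R := 2^-1 ^+ i.+1.
have w0 i : 0 < w i by rewrite exprn_gt0.
have sw : \sum_(0 <= i < n) w i <= 1.
  elim: n => [|n]; first by rewrite big_nil.
  rewrite big_nat_recl// /w expr1; under eq_bigr do rewrite exprS.
  by rewrite -mulr_sumr; move: (\sum_(_ <= _ < _) _) => u; lra.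
have bw i : bmeas (fun x => w i * `|(w i)^-1 * g i x| `^ r).
  by apply: bmeasZ; apply: bmeas_powR => //; exact: bmeasZ.
apply: (@le_trans _ _ (Iint (fun x => \sum_(0 <= i < n) w i * `|(w i)^-1 * g i x| `^ r))).
  apply: Iint_le; [exact: bmeas_powR r0 (partial_sum_bmeas n)|exact: bmeas_sum|move=> x].
  have -> : S n x = \sum_(0 <= i < n) w i * ((w i)^-1 * g i x).
    by apply: eq_bigr => i _; rewrite mulVKf// gt_eqF.
  by apply: powR_jensen => // i; exact: ltW.
rewrite Iint_sum//; apply: (@le_trans _ _ (\sum_(0 <= i < n) w i * (2 `^ r * M))); last first.
  by rewrite -mulr_suml -[leRHS]mul1r; apply: ler_wpM2r => //; rewrite mulr_ge0 ?powR_ge0.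
apply: ler_sum => i _; rewrite IintZ; last by apply: bmeas_powR => //; exact: bmeasZ.
apply: ler_wpM2l; first exact: ltW.
rewrite -/(Lp r (fun x => (w i)^-1 * g i x)) LpZ//.
apply: le_trans (ler_wpM2l (powR_ge0 _ _) (hM i)) _.
rewrite mulrA; apply: ler_wpM2r => //.
have q0 : 0 <= 4^-1 ^+ i :> R by rewrite exprn_ge0.
rewrite -powRM//; apply: le_powR => //.
rewrite ger0_norm ?invr_ge0 ?(ltW (w0 i))// /w -exprVn invrK.
rewrite (_ : 4^-1 = 2^-1 * 2^-1 :> R); last by field.
have e : 2 ^+ i * 2^-1 ^+ i = 1 :> R by rewrite -exprMn mulfV// expr1n.
have l1 : 2^-1 ^+ i <= 1 :> R by rewrite exprn_ile1// ?invr_ge0 ?invf_le1 ?ler1n.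
rewrite exprMn exprS; move: (2 ^+ i) (2^-1 ^+ i) e l1 => u v e l1.
have -> : 2 * u * (v * v) = 2 * (u * v) * v by ring.
by rewrite e; lra.
Qed.

End SummableSeries.

Lemma series_limit_periodic (g : nat -> R * R -> R) : (forall n, periodic2 (g n)) -> periodic2 (series_limit g).
Proof.
move=> pg x y; split; rewrite /series_limit.
  have h n : g n (x + 2 * pi, y) = g n (x, y) by have [] := pg n x y.
  under eq_eseriesr do rewrite h.
  by congr (if _ then limn _ else _); apply/funext => n; apply: eq_bigr => i _; exact: h.
have h n : g n (x, y + 2 * pi) = g n (x, y) by have [] := pg n x y.
under eq_eseriesr do rewrite h.
by congr (if _ then limn _ else _); apply/funext => n; apply: eq_bigr => i _; exact: h.
Qed.

End Series.

(** * Passage to general data *)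

Section TrigDensity.
Variable R : realType.
Implicit Types (L : tpoly R) (f g h : R * R -> R) (r : R).
Local Notation Pi := (@Pi R).
Local Notation leb2 := (@leb2 R).
Local Notation P := ((2 * pi) ^+ 2 : R).
Let mPi : measurable Pi := @measurable_Pi R.

Lemma ae_leb2I (A B : R * R -> Prop) : {ae leb2, forall x, A x} -> {ae leb2, forall x, B x} ->
  {ae leb2, forall x, A x /\ B x}.
Proof.
move=> [N [mN N0 sN]] [M [mM M0 sM]]; exists (N `|` M); split.
- exact: measurableU.
- by rewrite -N0; apply: measureU0.
- move=> x /= /not_andP[h|h]; [left; exact: sN|right; exact: sM].
Qed.

Lemma integral_cst_Pi (c : R) : (\int[leb2]_(x in Pi) c%:E = (c * P)%:E)%E.
Proof. by rewrite integral_cst// EFinM; congr (_ * _)%E; exact: leb2_Pi. Qed.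

Lemma Lpint2_le_Lpintq (q s : R) f : 2 < q -> measurable_fun Pi f -> 0 < s ->
  (Lpint q f <= (s `^ q)%:E)%E -> (Lpint 2 f <= ((P + 1) * s ^+ 2)%:E)%E.
Proof.
move=> q2 mf s0 hs; have mq := measurable_Lpint q mf.
have nn x : (0 <= (`|f x| `^ q)%:E)%E by rewrite lee_fin powR_ge0.
have sn : (0 <= (s `^ (2 - q))%:E)%E by rewrite lee_fin powR_ge0.
have sm : measurable_fun Pi (fun x => (s `^ (2 - q))%:E * (`|f x| `^ q)%:E)%E.
  by apply: emeasurable_funM => //; exact: measurable_cst.
apply: (@le_trans _ _ (\int[leb2]_(x in Pi) ((s ^+ 2)%:E + (s `^ (2 - q))%:E * (`|f x| `^ q)%:E))%E).
  apply: ge0_le_integral => //.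
  - exact: measurable_Lpint.
  - by apply: emeasurable_funD => //; exact: measurable_cst.
  - by move=> x _; rewrite -EFinM -EFinD lee_fin; exact: sqr_le_powR.
rewrite ge0_integralD//; last 2 first.
- by move=> x _; rewrite lee_fin sqr_ge0.
- by move=> x _; apply: mule_ge0.
rewrite integral_cst_Pi ge0_integralZl//.
rewrite (_ : ((P + 1) * s ^+ 2)%:E = ((s ^+ 2 * P)%:E + (s ^+ 2)%:E)%E); last first.
  by rewrite -EFinD; congr (_%:E); move: P => z; ring.
apply: leeD2l; apply: (@le_trans _ _ ((s `^ (2 - q))%:E * (s `^ q)%:E)%E).
  exact: lee_wpmul2l.
by rewrite -EFinM -powRD ?subrK ?(gt_eqF s0) ?implybT// powR_mulrn// ltW.
Qed.

Lemma LpintD r f g (a b : R) : 0 <= r -> measurable_fun Pi f -> measurable_fun Pi g ->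
  (Lpint r f <= a%:E)%E -> (Lpint r g <= b%:E)%E -> (Lpint r (fun x => f x + g x)%R <= (2 `^ r * (a + b))%:E)%E.
Proof.
move=> r0 mf mg ha hb; have nf := measurable_Lpint r mf; have ng := measurable_Lpint r mg.
have n0 h x : (0 <= (`|h x| `^ r)%:E)%E by rewrite lee_fin powR_ge0.
have c0 : (0 <= (2 `^ r)%:E :> \bar R)%E by rewrite lee_fin powR_ge0.
have mD : measurable_fun Pi (fun x => (`|f x| `^ r)%:E + (`|g x| `^ r)%:E)%E by exact: emeasurable_funD.
apply: (@le_trans _ _ (\int[leb2]_(x in Pi) ((2 `^ r)%:E * ((`|f x| `^ r)%:E + (`|g x| `^ r)%:E)))%E).
  apply: ge0_le_integral => //.
  - by apply: (measurable_Lpint r); exact: measurable_funD.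
  - by apply: emeasurable_funM => //; exact: measurable_cst.
  - by move=> x _; rewrite -EFinD -EFinM lee_fin; exact: powR_normD.
rewrite ge0_integralZl//; last by move=> x _; apply: adde_ge0.
by rewrite EFinM EFinD; apply: lee_wpmul2l => //; rewrite ge0_integralD//; exact: leeD.
Qed.

Section Truncation.
Variable h : R * R -> R.
Hypothesis mh : measurable_fun setT h.

Definition truncation (n : nat) x := h x * \1_[set y | `|h y| <= n%:R] x.

Lemma truncation_bmeas n : bmeas (truncation n).
Proof.
have mn : measurable_fun setT (fun x => `|h x|).
  by apply: measurableT_comp => //; exact: normr_measurable.
have mE : measurable [set y | `|h y| <= n%:R].
  have := mn measurableT `]-oo, n%:R]%classic (measurable_itv _).
  by rewrite setTI.
split; first by apply: measurable_funM => //; exact: measurable_indic.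
exists n%:R => x; rewrite /truncation indicE; case: (boolP (x \in _)) => [|_].
  by rewrite inE /= mulr1.
by rewrite mulr0 normr0.
Qed.

Lemma truncation_id n x : `|h x| <= n%:R -> truncation n x = h x.
Proof. by move=> hn; rewrite /truncation indicE mem_set// mulr1. Qed.

Lemma truncation_eventually x : \forall n \near \oo, truncation n x = h x.
Proof. by near=> n; apply: truncation_id; near: n; exact: nbhs_infty_ger.
Unshelve. all: by end_near. Qed.

Lemma truncation_le n x : `|truncation n x| <= `|h x|.
Proof. by rewrite /truncation indicE; case: (_ \in _); rewrite ?mulr1// mulr0 normr0. Qed.

Lemma truncation_rest_le n x : `|h x - truncation n x| <= `|h x|.
Proof.
by rewrite /truncation indicE; case: (_ \in _); rewrite ?mulr1 ?mulr0 ?subrr ?subr0 ?normr0.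
Qed.

Lemma truncation_Lpint r : 0 < r -> (Lpint r h < +oo)%E ->
  forall e, 0 < e -> \forall n \near \oo, (Lpint r (fun x => h x - truncation n x)%R <= e%:E)%E.
Proof.
move=> r0 hr e e0; have mD n : measurable_fun setT (fun x => h x - truncation n x).
  by apply: measurable_funB => //; have [] := truncation_bmeas n.
have [|||||_ _ hcv] := @dominated_convergence _ _ _ leb2 Pi mPi (fun n x => (`|h x - truncation n x| `^ r)%:E)
  (fun=> 0%E) (fun x => (`|h x| `^ r)%:E).
- by move=> n; apply: (measurable_Lpint r); exact: measurable_funTS.
- exact: measurable_cst.
- apply: aeW => x _; apply: cvg_near_cst; apply: filterS (truncation_eventually x) => n ->.
  by rewrite subrr normr0 powR0// gt_eqF.
- apply/integrableP; split; first by apply: (measurable_Lpint r); exact: measurable_funTS.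
  by under eq_integral do rewrite gee0_abs ?lee_fin ?powR_ge0//.
- apply: aeW => x n _; rewrite gee0_abs ?lee_fin ?powR_ge0//.
  by apply: le_powR => //; [exact: ltW|exact: truncation_rest_le].
move: hcv; rewrite integral0 => /fine_cvgP[hf].
move=> /cvgrPdist_le /(_ _ e0) hd; near=> n.
have hn : Lpint r (fun x => h x - truncation n x) \is a fin_num by near: n; exact: hf.
rewrite -(fineK hn) lee_fin.
have : `|0 - fine (Lpint r (fun x => h x - truncation n x))| <= e by near: n; exact: hd.
by rewrite sub0r normrN => /(le_trans (ler_norm _)).
Unshelve. all: by end_near.
Qed.

Lemma truncation_mean : (Lpint 2 h < +oo)%E -> (\int[leb2]_(x in Pi) (h x)%:E = 0)%E ->
  Iint (truncation n) @[n --> \oo] --> (0 : R).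
Proof.
move=> h2 h0; have mH : measurable_fun Pi (fun x => 1 + (`|h x| `^ 2)%:E)%E.
  apply: emeasurable_funD; first exact: measurable_cst.
  by apply: (measurable_Lpint 2); exact: measurable_funTS.
have [|||||_ _ hcv] := @dominated_convergence _ _ _ leb2 Pi mPi (fun n x => (truncation n x)%:E)
  (fun x => (h x)%:E) (fun x => 1 + (`|h x| `^ 2)%:E)%E.
- by move=> n; apply: measurable_int (bmeas_integrable (truncation_bmeas n)).
- by apply: measurable_funTS; exact: measurableT_comp.
- by apply: aeW => x _; apply: cvg_near_cst; apply: filterS (truncation_eventually x) => n ->.
- apply/integrableP; split; first exact: mH.
  under eq_integral do rewrite gee0_abs ?adde_ge0 ?lee_fin ?powR_ge0//.
  rewrite ge0_integralD//; last first.
  + by apply: (measurable_Lpint 2); exact: measurable_funTS.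
  by rewrite integral_cst_Pi; apply: lte_add_pinfty => //; exact: ltry.
- apply: aeW => x n _; rewrite abse_EFin -EFinD lee_fin; apply: le_trans (truncation_le _ _) _.
  rewrite powR_sqr -(real_normK (num_real (h x))); move: `|_| => u; nra.
move: hcv; rewrite h0 => /fine_cvgP[_]; exact.
Qed.

End Truncation.

Lemma mean0_approx (q e : R) f : 2 < q -> bmeas f -> Iint f = 0 -> 0 < e -> exists2 L, 0 \notin map snd L &
  forall r, r \in [:: 2; q] -> Lp r (fun x => f x - tev L x) <= 2 `^ r * 2 * e.
Proof.
move=> q2 bf f0 e0; have [L [hq h2]] := approx_both q2 bf e0.
exists (drop0 L); first exact: drop0_keys.
move=> r hr; have [r1 hL] : 1 <= r /\ Lp r (fun x => f x - tev L x) <= e.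
  by move: hr; rewrite !inE => /orP[] /eqP ->; split; [lra|exact: h2|lra|exact: hq].
have bL := tev_bmeas L.
rewrite (@eq_Lp _ _ _ (fun x => (f x - tev L x) - Iint (fun x => f x - tev L x) / P)).
  apply: le_trans (Lp_center r1 (bmeasB bf bL)) _.
  by apply: ler_wpM2l => //; rewrite mulr_ge0 ?powR_ge0.
by move=> x; rewrite [in RHS]tev_drop0 IintB// f0 sub0r mulNr; ring.
Qed.

(** Truncation makes the function bounded but spoils its zero mean. The mean of the truncation tends
    to 0, and is subtracted before the approximation by sums without frequency 0. *)
Lemma trig_dense (q : R) h : 2 < q -> measurable_fun setT h ->
  (Lpint 2 h < +oo)%E -> (Lpint q h < +oo)%E -> (\int[leb2]_(x in Pi) (h x)%:E = 0)%E ->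
  forall e, 0 < e -> exists2 L, 0 \notin map snd L &
  forall r, r \in [:: 2; q] -> (Lpint r (fun x => h x - tev L x)%R <= e%:E)%E.
Proof.
move=> q2 mh h2 hq h0 e e0.
have P0 : 0 < P by rewrite exprn_gt0// mulr_gt0// pi_gt0.
have P00 : P != 0 by rewrite gt_eqF.
(* Nested factors 2^r of the triangle inequality: truncation error, mean of the truncation, and
   approximation error, the last with its own factor 2^r * 2 from recentring. *)
pose A r : R := 2 `^ r * (1 + 2 `^ r * (1 + 2 `^ r * 2)).
have A0 r : 0 < A r.
  have := powR_gt0 r (ltr0n R 2); rewrite /A; move: (2 `^ r) => t t0.
  by rewrite mulr_gt0// addr_gt0// mulr_gt0// addr_gt0// mulr_gt0.
pose d := e / (A 2 + A q); have d0 : 0 < d by rewrite divr_gt0// addr_gt0.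
have hd r : r \in [:: 2; q] -> A r * d <= e.
  move=> hr; rewrite /d mulrA ler_pdivrMr ?addr_gt0// mulrC ler_pM2l//.
  by move: hr; rewrite !inE => /orP[] /eqP ->; rewrite ?lerDl ?lerDr ltW.
have hm r : 1 <= r -> \forall n \near \oo, `|Iint (truncation h n) / P| `^ r * P <= d.
  move=> r1.
  have c1 : Iint (truncation h n) / P @[n --> \oo] --> (0 : R).
    by have := cvgM (truncation_mean mh h2 h0) (cvg_cst (P^-1)); rewrite mul0r; exact.
  have c2 := powR_cvg r1 c1; rewrite normr0 powR0 in c2; last by rewrite gt_eqF//; lra.
  have d1 : 0 < d / P by rewrite divr_gt0.
  by apply: filterS (cvgr_le 0 c2 _ d1) => n; rewrite ler_pdivlMr.
have hNI r : r \in [:: 2; q] -> 1 <= r /\ (Lpint r h < +oo)%E.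
  by rewrite !inE => /orP[] /eqP ->; split; [lra|exact: h2|lra|exact: hq].
have hn r : r \in [:: 2; q] -> \forall n \near \oo,
    (Lpint r (fun x => h x - truncation h n x)%R <= d%:E)%E /\ `|Iint (truncation h n) / P| `^ r * P <= d.
  move=> hr; have [r1 hr'] := hNI r hr; apply: filterI; last exact: hm.
  exact: (truncation_Lpint mh (lt_le_trans ltr01 r1) hr' d0).
have [n hn2 hnq] : exists2 n, (Lpint 2 (fun x => h x - truncation h n x)%R <= d%:E)%E /\ `|Iint (truncation h n) / P| `^ 2 * P <= d
    & (Lpint q (fun x => h x - truncation h n x)%R <= d%:E)%E /\ `|Iint (truncation h n) / P| `^ q * P <= d.
  have m2 : 2 \in [:: 2; q] by rewrite inE eqxx.
  have mq : q \in [:: 2; q] by rewrite !inE eqxx orbT.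
  have [n _ /(_ n (leqnn n)) [h1 h3]] := filterI (hn 2 m2) (hn q mq); by exists n.
have {}hn r : r \in [:: 2; q] ->
    (Lpint r (fun x => h x - truncation h n x)%R <= d%:E)%E /\ `|Iint (truncation h n) / P| `^ r * P <= d.
  by rewrite !inE => /orP[] /eqP ->.
clear hn2 hnq.
have bt := truncation_bmeas mh n.
pose m := Iint (truncation h n) / P.
pose k x := truncation h n x - m.
have bk : bmeas k by apply: bmeasB => //; exact: bmeas_cst.
have k0 : Iint k = 0.
  rewrite IintB//; last exact: bmeas_cst.
  by rewrite Iint_cst /m divfK// subrr.
have [L L0 hL] := mean0_approx q2 bk k0 d0.
exists L => // r hr; have [r1 _] := hNI r hr; have r0 : 0 <= r by lra.
have [hn1 hn2] := hn r hr; have bL := tev_bmeas L.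
apply: (@le_trans _ _ (A r * d)%:E); last by rewrite lee_fin; exact: hd.
have -> : (fun x => h x - tev L x) = (fun x => (h x - truncation h n x) + (m + (k x - tev L x))).
  by apply/funext => x; rewrite /k; ring.
have -> : A r * d = 2 `^ r * (d + 2 `^ r * (d + 2 `^ r * 2 * d)) by rewrite /A; ring.
have mT : measurable_fun Pi (truncation h n) by apply: measurable_funTS; have [] := bt.
have mk : measurable_fun Pi (fun x => k x - tev L x) by apply: measurable_funTS; have [] := bmeasB bk bL.
apply: LpintD; [exact: r0| | |exact: hn1|].
- by apply: measurable_funB; [exact: measurable_funTS|exact: mT].
- by apply: measurable_funD; [exact: measurable_cst|exact: mk].
apply: LpintD; [exact: r0|exact: measurable_cst|exact: mk| |].
- rewrite Lpint_Lp//; last exact: bmeas_cst.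
  by rewrite lee_fin [leLHS]Iint_cst.
- rewrite Lpint_Lp//; last exact: bmeasB.
  by rewrite lee_fin; exact: hL.
Qed.

(** Errors are measured relative to both norms of [h], so that constants stay homogeneous. Starting
    from the empty polynomial makes the error at n = 0 exactly [h]. *)
Lemma trig_sequence (q N2 Nq : R) h : 2 < q -> measurable_fun setT h ->
  (\int[leb2]_(x in Pi) (h x)%:E = 0)%E -> Lpint 2 h = N2%:E -> Lpint q h = Nq%:E ->
  exists M : nat -> tpoly R, [/\ M 0%N = [::], forall n, 0 \notin map snd (M n),
   forall n, (Lpint 2 (fun x => h x - tev (M n) x)%R <= ((4^-1 ^+ n) `^ 2 * N2)%:E)%E &
   forall n, (Lpint q (fun x => h x - tev (M n) x)%R <= ((4^-1 ^+ n) `^ q * Nq)%:E)%E].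
Proof.
move=> q2 mh h0 e2 eq; have mhP : measurable_fun Pi h by exact: measurable_funTS.
have n2 : 0 <= N2 by rewrite -lee_fin -e2; exact: Lpint_ge0.
have nq : 0 <= Nq by rewrite -lee_fin -eq; exact: Lpint_ge0.
have hnil r : Lpint r (fun x => h x - tev [::] x)%R = Lpint r h.
  by congr (Lpint r _); apply/funext => x; rewrite tev_nil subr0.
(* If [h] vanishes almost everywhere, the relative tolerances are zero and density says nothing; the
   empty polynomial is exact. *)
have [hz|hnz] := pselect {ae leb2, forall x, Pi x -> h x = 0}.
  have m0 : measurable_fun Pi (fun=> 0 : R) by exact: measurable_cst.
  have z r : 0 < r -> Lpint r h = 0%E.
    move=> r0; rewrite (eq_Lpint r mhP m0 hz) /Lpint normr0 powR0 ?gt_eqF//; exact: integral0.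
  exists (fun=> [::]); split => // n; rewrite hnil.
  - by rewrite z// lee_fin mulr_ge0 ?powR_ge0.
  - by rewrite z ?lee_fin ?mulr_ge0 ?powR_ge0//; lra.
have {}n2 : 0 < N2.
  rewrite lt_def n2 andbT; apply/eqP => z; apply: hnz; apply: (@Lpint_eq0 _ 2) => //; by rewrite e2 z.
have {}nq : 0 < Nq.
  rewrite lt_def nq andbT; apply/eqP => z; apply: hnz; apply: (@Lpint_eq0 _ q) => //; [lra|by rewrite eq z].
have p4 n r : 0 < (4^-1 ^+ n) `^ r :> R by rewrite powR_gt0 ?exprn_gt0 ?invr_gt0.
have hx n : exists L, [/\ 0 \notin map snd L, (Lpint 2 (fun x => h x - tev L x)%R <= ((4^-1 ^+ n) `^ 2 * N2)%:E)%E &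
   (Lpint q (fun x => h x - tev L x)%R <= ((4^-1 ^+ n) `^ q * Nq)%:E)%E].
  have m0 : 0 < Num.min ((4^-1 ^+ n) `^ 2 * N2) ((4^-1 ^+ n) `^ q * Nq) by rewrite lt_min !mulr_gt0.
  have h2 : (Lpint 2 h < +oo)%E by rewrite e2 ltry.
  have hq : (Lpint q h < +oo)%E by rewrite eq ltry.
  have [L L0 hL] := trig_dense q2 mh h2 hq h0 m0; exists L; split => //.
  - by apply: le_trans (hL 2 _) _; rewrite ?inE ?eqxx// lee_fin ge_min lexx.
  - by apply: le_trans (hL q _) _; rewrite ?inE ?eqxx ?orbT// lee_fin ge_min lexx orbT.
have [M hM] := choice hx.
exists (fun n => if n is n'.+1 then M n'.+1 else [::]); split => //.
- by case=> // n; have [] := hM n.+1.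
- by case=> [|n]; [rewrite hnil e2 expr0 powR1 mul1r|have [] := hM n.+1].
- by case=> [|n]; [rewrite hnil eq expr0 powR1 mul1r|have [] := hM n.+1].
Qed.

Lemma trig_series (q N2 Nq : R) h : 2 < q -> measurable_fun setT h ->
  (\int[leb2]_(x in Pi) (h x)%:E = 0)%E -> Lpint 2 h = N2%:E -> Lpint q h = Nq%:E ->
  exists L : nat -> tpoly R, [/\ forall n, 0 \notin map snd (L n),
   forall n, Lp 2 (tev (L n)) <= (4^-1 ^+ n) `^ 2 * (2 `^ 2 * 2 * N2),
   forall n, Lp q (tev (L n)) <= (4^-1 ^+ n) `^ q * (2 `^ q * 2 * Nq) &
   {ae leb2, forall x, Pi x -> \sum_(0 <= i < n) tev (L i) x @[n --> \oo] --> h x}].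
Proof.
move=> q2 mh h0 e2 eq; have [M [M0 Mk hM2 hMq]] := trig_sequence q2 mh h0 e2 eq.
have mhP : measurable_fun Pi h by exact: measurable_funTS.
pose L n := M n.+1 ++ tmult (fun=> (-1)%:C%C) (M n).
have eL n x : tev (L n) x = tev (M n.+1) x - tev (M n) x by rewrite tev_cat tev_scale mulN1r.
have mM n : measurable_fun Pi (fun x => h x - tev (M n) x).
  by apply: measurable_funB => //; apply: measurable_funTS; have [] := tev_bmeas (M n).
have bd r N : 0 <= r -> 0 <= N -> (forall n, (Lpint r (fun x => h x - tev (M n) x)%R <= ((4^-1 ^+ n) `^ r * N)%:E)%E) ->
    forall n, Lp r (tev (L n)) <= (4^-1 ^+ n) `^ r * (2 `^ r * 2 * N).
  move=> r0 N0 hr n; rewrite -lee_fin -Lpint_Lp//; last exact: tev_bmeas.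
  have -> : tev (L n) = fun x => (h x - tev (M n) x) + - (h x - tev (M n.+1) x).
    by apply/funext => x; rewrite eL; ring.
  have mN : measurable_fun Pi (fun x => - (h x - tev (M n.+1) x)) by exact: measurableT_comp.
  have hN : (Lpint r (fun x => - (h x - tev (M n.+1) x))%R <= ((4^-1 ^+ n) `^ r * N)%:E)%E.
    have -> : Lpint r (fun x => - (h x - tev (M n.+1) x)) = Lpint r (fun x => h x - tev (M n.+1) x).
      by apply: eq_integral => x _; rewrite normrN.
    apply: le_trans (hr n.+1) _; rewrite lee_fin; apply: ler_wpM2r => //; apply: le_powR => //.
    have p4 : 0 <= 4^-1 ^+ n :> R by rewrite exprn_ge0.
    by rewrite exprS; lra.
  apply: le_trans (LpintD r0 (mM n) mN (hr n) hN) _; rewrite lee_fin.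
  by move: (_ `^ r) (2 `^ r) => u v; lra.
have n2 : 0 <= N2 by rewrite -lee_fin -e2; exact: Lpint_ge0.
have nq : 0 <= Nq by rewrite -lee_fin -eq; exact: Lpint_ge0.
have b2 := bd 2 N2 (ler0n _ _) n2 hM2.
have q0 : 0 <= q by lra.
have bq := bd q Nq q0 nq hMq.
exists L; split => //.
- move=> n; rewrite map_cat mem_cat negb_or Mk /= -map_comp.
  by rewrite (_ : map _ _ = map snd (M n)) ?Mk//; apply: eq_map.
have bL n : bmeas (tev (L n)) by exact: tev_bmeas.
have hcv := series_limit_cvg bL b2; have mG := series_limit_measurable bL.
pose G := series_limit (fun n => tev (L n)).
have tele n x : \sum_(0 <= i < n) tev (L i) x = tev (M n) x.
  by under eq_bigr do rewrite eL; rewrite telescope_sumr// M0 tev_nil subr0.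
have mGP : measurable_fun Pi G by exact: measurable_funTS.
have mhG : measurable_fun Pi (fun x => h x - G x) by exact: measurable_funB.
(* Fatou along the sequence shifted by [m] bounds the square distance from [h] to the sum of the
   series by a quantity that tends to 0 with growing [m]; so the two agree almost everywhere. *)
have hG m : (Lpint 2 (fun x => h x - G x)%R <= (4^-1 ^+ m * N2)%:E)%E.
  apply: (@Lpint_fatou _ 2 (fun n x => h x - tev (M (n + m)%N) x)) => //; first lra.
    apply: ae_leb2S hcv => x hx /hx c; apply: cvgB; first exact: cvg_cst.
    rewrite (_ : (fun n => _) = (fun n => \sum_(0 <= i < n + m) tev (L i) x)); last by apply/funext => n; rewrite tele.
    by rewrite (cvg_shiftn m (fun n => \sum_(0 <= i < n) tev (L i) x)).
  move=> n; apply: le_trans (hM2 _) _; rewrite lee_fin; apply: ler_wpM2r => //.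
  have p4 k : 0 <= (4^-1 : R) ^+ k <= 1.
    by rewrite exprn_ge0//= exprn_ile1// ?invr_ge0 ?invf_le1 ?ler1n.
  have /andP[u0 u1] := p4 n; have /andP[v0 v1] := p4 m.
  rewrite powR_mulrn ?exprn_ge0// exprD; move: (_ ^+ n) (_ ^+ m) u0 u1 v0 v1 => u v u0 u1 v0 v1.
  have : u * v <= v by nra.
  have : 0 <= u * v by exact: mulr_ge0.
  by move: (u * v) => w; nra.
have z : Lpint 2 (fun x => h x - G x) = 0%E.
  apply/le_anti; rewrite Lpint_ge0 andbT.
  have c : 4^-1 ^+ m * N2 @[m --> \oo] --> (0 : R).
    have p4 : `|4^-1| < 1 :> R by rewrite ger0_norm ?invr_ge0// invf_lt1// ltr1n.
    by have := cvgM (cvg_expr p4) (cvg_cst N2); rewrite mul0r; exact.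
  have hfin : Lpint 2 (fun x => h x - G x) \is a fin_num.
    by rewrite ge0_fin_numE ?Lpint_ge0//; apply: le_lt_trans (hG 0%N) _; exact: ltry.
  move: hG; rewrite -(fineK hfin) => hG; rewrite lee_fin.
  rewrite -(cvg_lim (@Rhausdorff R) c); apply: limr_ge; first exact: cvgP c.
  by apply: nearW => m; have := hG m; rewrite lee_fin.
have hae := Lpint_eq0 (ltr0n R 2) mhG z.
have : {ae leb2, forall x, (Pi x -> h x - G x = 0) /\ (Pi x -> \sum_(0 <= i < n) tev (L i) x @[n --> \oo] --> G x)}.
  exact: ae_leb2I.
apply: ae_leb2S => x [h1 h2] px; have /eqP := h1 px; rewrite subr_eq0 => /eqP ->; exact: h2.
Qed.

End TrigDensity.

(** * Summing the solutions and collecting constants *)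

Section Assembly.
Variable R : realType.
Implicit Types (L : tpoly R) (f g h : R * R -> R) (r : R).
Local Notation Pi := (@Pi R).
Local Notation leb2 := (@leb2 R).
Local Notation P := ((2 * pi) ^+ 2 : R).
Let mPi : measurable Pi := @measurable_Pi R.

(** Integration by parts holds for each partial sum, and both sides pass to the limit against the
    bounded functions phi and its derivative. *)
Lemma weak_deriv_series b (T : nat -> tpoly R) (A B : R) :
  (forall n, Lp 2 (tev (T n)) <= (4^-1 ^+ n) `^ 2 * A) ->
  (forall n, Lp 2 (tev (tder b (T n))) <= (4^-1 ^+ n) `^ 2 * B) ->
  weak_deriv b (series_limit (fun n => tev (T n))) (series_limit (fun n => tev (tder b (T n)))).
Proof.
move=> hA hB phi tphi; have bp := test_fun_bmeas tphi; have bd := test_fun_derive_bmeas b tphi.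
have bT n : bmeas (tev (T n)) := tev_bmeas (T n).
have bD n : bmeas (tev (tder b (T n))) := tev_bmeas (tder b (T n)).
have [u hu ->] := series_limit_weak bT hA bd.
have [v hv ->] := series_limit_weak bD hB bp.
have e n : Iint (fun x => (\sum_(0 <= i < n) tev (T i) x) * 'D_(edir R b) phi x) =
    - Iint (fun x => (\sum_(0 <= i < n) tev (tder b (T i)) x) * phi x).
  under [in LHS]eq_Iint do rewrite mulr_suml.
  under [in RHS]eq_Iint do rewrite mulr_suml.
  rewrite !Iint_sum; [|by move=> i; exact: bmeasM|by move=> i; exact: bmeasM].
  by rewrite -sumrN; apply: eq_bigr => i _; rewrite trig_ibp.
have hu' : Iint (fun x => (\sum_(0 <= i < n) tev (T i) x) * 'D_(edir R b) phi x) @[n --> \oo] --> - v.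
  by under eq_fun do rewrite e; exact: cvgN.
by rewrite -EFinN; congr (_%:E); exact: cvg_unique hu hu'.
Qed.

Lemma sum_quarter n : \sum_(0 <= i < n) (4^-1 : R) ^+ i <= 2.
Proof.
elim: n => [|n]; first by rewrite big_nil.
rewrite big_nat_recl// expr0; under eq_bigr do rewrite exprS.
by rewrite -mulr_sumr; move: (\sum_(_ <= _ < _) _) => u; lra.
Qed.

Lemma series_limit_bound (g : nat -> R * R -> R) (A a : R) : (forall n, bmeas (g n)) ->
  (forall n, Lp 2 (g n) <= (4^-1 ^+ n) `^ 2 * A) -> 0 <= a -> (forall n x, `|g n x| <= 4^-1 ^+ n * a) ->
  {ae leb2, forall x, Pi x -> `|series_limit g x| <= 2 * a}.
Proof.
move=> bg hg a0 ha; apply: ae_leb2S (series_limit_cvg bg hg) => x hx px.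
have c : `|\sum_(0 <= i < n) g i x| @[n --> \oo] --> `|series_limit g x| by apply: cvg_norm; exact: hx.
rewrite -(cvg_lim (@Rhausdorff R) c); apply: limr_le; first exact: cvgP c.
apply: nearW => n; apply: le_trans (ler_norm_sum _ _ _) _.
apply: (@le_trans _ _ (\sum_(0 <= i < n) 4^-1 ^+ i * a)); first by apply: ler_sum => i _; exact: ha.
by rewrite -mulr_suml; apply: ler_wpM2r => //; exact: sum_quarter.
Qed.

Lemma Lp_bound r g (a : R) : 0 <= r -> bmeas g -> (forall x, `|g x| <= a) -> Lp r g <= a `^ r * P.
Proof.
move=> r0 bg ha; rewrite -(Iint_cst (a `^ r)); apply: Iint_le; [exact: bmeas_powR|exact: bmeas_cst|].
by move=> x; apply: le_powR.
Qed.

Lemma sqrt_le_norm2 (a b : R) : Num.sqrt (a ^+ 2 + b ^+ 2) <= `|a| + `|b|.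
Proof.
rewrite -[leRHS]ger0_norm ?addr_ge0// -sqrtr_sqr; apply: ler_wsqrtr.
rewrite -(real_normK (num_real a)) -(real_normK (num_real b)).
by have := normr_ge0 a; have := normr_ge0 b; move: `|a| `|b| => u v; nra.
Qed.

Lemma sqrt_le_norm4 (a b c d : R) :
  Num.sqrt (a ^+ 2 + b ^+ 2 + c ^+ 2 + d ^+ 2) <= (`|a| + `|b|) + (`|c| + `|d|).
Proof.
apply: le_trans (lerD (sqrt_le_norm2 a b) (sqrt_le_norm2 c d)).
have h (x y : R) : 0 <= x -> 0 <= y -> Num.sqrt (x + y) <= Num.sqrt x + Num.sqrt y.
  move=> x0 y0; rewrite -[leRHS]ger0_norm ?addr_ge0 ?sqrtr_ge0// -sqrtr_sqr; apply: ler_wsqrtr.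
  rewrite sqrrD !sqr_sqrtr//; have : 0 <= Num.sqrt x * Num.sqrt y by rewrite mulr_ge0 ?sqrtr_ge0.
  by move: (Num.sqrt x * _) => u; lra.
by rewrite -(addrA (a ^+ 2 + _)); apply: h; rewrite addr_ge0 ?sqr_ge0.
Qed.

Lemma measurable_sqrt f : measurable_fun Pi f -> (forall x, 0 <= f x) ->
  measurable_fun Pi (fun x => Num.sqrt (f x)).
Proof.
move=> mf f0; rewrite (_ : (fun x => _) = (fun x => f x `^ 2^-1)).
  by apply: (measurableT_comp (measurable_powR _)).
by apply/funext => x; rewrite powR12_sqrt.
Qed.

Lemma Lpint_norm r f : Lpint r (fun x => `|f x|) = Lpint r f.
Proof. by apply: eq_integral => x _; rewrite normr_id. Qed.

Lemma Lpint_add r f g (a b : R) : 0 <= r -> measurable_fun Pi f -> measurable_fun Pi g ->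
  (Lpint r f <= a%:E)%E -> (Lpint r g <= b%:E)%E -> (Lpint r (fun x => `|f x| + `|g x|)%R <= (2 `^ r * (a + b))%:E)%E.
Proof.
move=> r0 mf mg ha hb; apply: LpintD; rewrite ?Lpint_norm//.
- by apply: measurableT_comp => //; exact: normr_measurable.
- by apply: measurableT_comp => //; exact: normr_measurable.
Qed.

Lemma powR_ge_self (x r : R) : 1 <= x -> 1 <= r -> x <= x `^ r.
Proof. by move=> x1 r1; rewrite -[leLHS]powRr1 ?ler_powR//; exact: le_trans x1. Qed.

(** 24 = 2 * 2 * 6: at most two nested uses of the inequality with factor 2^p, and six scalar
    functions, with 6 <= 6^p. *)
Lemma W1pnorm_root_le (p t w : R) : 1 <= p -> 0 <= t -> 0 <= w ->
  w <= 2 `^ p * (t `^ p + t `^ p) + 2 `^ p * (2 `^ p * (t `^ p + t `^ p) + 2 `^ p * (t `^ p + t `^ p)) ->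
  w `^ p^-1 <= 24 * t.
Proof.
move=> p1 t0 w0 huv; have p0 : 0 <= p by lra.
have pp : 0 < p by lra.
have hle : w <= (24 * t) `^ p.
  apply: (le_trans huv).
  have -> : 24 * t = 2 * (2 * (6 * t)) by ring.
  rewrite !powRM ?mulr_ge0//.
  have h2 : 1 <= 2 `^ p :> R by apply: le_trans (powR_ge_self _ p1); rewrite ler1n.
  have h6 : 6 <= 6 `^ p :> R by apply: powR_ge_self => //; rewrite ler1n.
  move: (2 `^ p) (6 `^ p) (t `^ p) (powR_ge0 t p) h2 h6 => x y z z0 h2 h6.
  apply: (@le_trans _ _ (x * (x * (6 * z)))); last first.
    by rewrite ler_wpM2l ?ler_wpM2l ?ler_wpM2r//; lra.
  have : x * z <= x * (x * z).
    by rewrite ler_wpM2l//; [lra|rewrite -[leLHS]mul1r ler_wpM2r].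
  nra.
have t24 : 0 <= 24 * t by rewrite mulr_ge0.
apply: (@le_trans _ _ (((24 * t) `^ p) `^ p^-1)).
  by apply: le_powR => //; rewrite invr_ge0.
by rewrite -powRrM mulfV ?gt_eqF// powRr1.
Qed.

Lemma W1pnorm_le (p t : R) F1 F2 G11 G12 G21 G22 : 1 <= p -> 0 <= t ->
  (forall X, List.In X [:: F1; F2; G11; G12; G21; G22] -> measurable_fun Pi X /\ (Lpint p X <= (t `^ p)%:E)%E) ->
  W1pnorm p F1 F2 G11 G12 G21 G22 <= 24 * t.
Proof.
move=> p1 t0 hX; have p0 : 0 <= p by lra.
have pp : 0 < p by lra.
have [mF1 nF1] : measurable_fun Pi F1 /\ (Lpint p F1 <= (t `^ p)%:E)%E by apply: hX; left.
have [mF2 nF2] : measurable_fun Pi F2 /\ (Lpint p F2 <= (t `^ p)%:E)%E by apply: hX; do 1 right; left.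
have [m11 n11] : measurable_fun Pi G11 /\ (Lpint p G11 <= (t `^ p)%:E)%E by apply: hX; do 2 right; left.
have [m12 n12] : measurable_fun Pi G12 /\ (Lpint p G12 <= (t `^ p)%:E)%E by apply: hX; do 3 right; left.
have [m21 n21] : measurable_fun Pi G21 /\ (Lpint p G21 <= (t `^ p)%:E)%E by apply: hX; do 4 right; left.
have [m22 n22] : measurable_fun Pi G22 /\ (Lpint p G22 <= (t `^ p)%:E)%E by apply: hX; do 5 right; left.
have mn f : measurable_fun Pi f -> measurable_fun Pi (fun x => `|f x|).
  by move=> mf; apply: measurableT_comp => //; exact: normr_measurable.
have ms f : measurable_fun Pi f -> measurable_fun Pi (fun x => f x ^+ 2).
  by move=> mf; exact: measurable_funX.
have key f (B : R) : (Lpint p f <= B%:E)%E -> Lpnorm p f `^ p <= B.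
  move=> hB; rewrite /Lpnorm -/(Lpint p f).
  have hf : Lpint p f \is a fin_num by rewrite ge0_fin_numE ?Lpint_ge0//; apply: le_lt_trans hB _; exact: ltry.
  have f0 : 0 <= fine (Lpint p f) by apply: fine_ge0; exact: Lpint_ge0.
  by rewrite -powRrM mulVf ?gt_eqF// powRr1// -lee_fin fineK.
have mD f g : measurable_fun Pi f -> measurable_fun Pi g -> measurable_fun Pi (fun x => `|f x| + `|g x|).
  by move=> mf mg; apply: measurable_funD; exact: mn.
have hv : (Lpint p (vnorm F1 F2) <= (2 `^ p * (t `^ p + t `^ p))%:E)%E.
  apply: le_trans (Lpint_add p0 mF1 mF2 nF1 nF2); apply: Lpint_le => //; last 2 first.
  - exact (mD _ _ mF1 mF2).
  - move=> x _; rewrite ger0_norm ?sqrtr_ge0// ger0_norm ?addr_ge0//; exact: sqrt_le_norm2.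
  - apply: measurable_sqrt; first by apply: measurable_funD; exact: ms.
    by move=> x; rewrite addr_ge0 ?sqr_ge0.
have hm : (Lpint p (mnorm G11 G12 G21 G22) <=
    (2 `^ p * (2 `^ p * (t `^ p + t `^ p) + 2 `^ p * (t `^ p + t `^ p)))%:E)%E.
  have h1 := Lpint_add p0 m11 m12 n11 n12; have h2 := Lpint_add p0 m21 m22 n21 n22.
  apply: le_trans (Lpint_add p0 (mD _ _ m11 m12) (mD _ _ m21 m22) h1 h2); apply: Lpint_le => //; last 2 first.
  - exact (mD _ _ (mD _ _ m11 m12) (mD _ _ m21 m22)).
  - move=> x _; rewrite ger0_norm ?sqrtr_ge0// ger0_norm ?addr_ge0//.
    rewrite !(ger0_norm (addr_ge0 (normr_ge0 _) (normr_ge0 _))); exact: sqrt_le_norm4.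
  - apply: measurable_sqrt; last by move=> x; rewrite !addr_ge0 ?sqr_ge0.
    apply: measurable_funD; last exact: ms.
    by apply: measurable_funD; [apply: measurable_funD; exact: ms|exact: ms].
rewrite /W1pnorm; apply: W1pnorm_root_le p1 t0 _ (lerD (key _ _ hv) (key _ _ hm)).
by rewrite addr_ge0 ?powR_ge0.
Qed.

(** A factor at least 1 is at most its own r-th power, so constants move inside the power and the
    same constant serves r = 2 and r = q; likewise for the gradient below. *)
Lemma powR_field_le (r a p t : R) : 1 <= r -> 0 <= a -> 0 <= p -> 2 * a * (p + 1) <= t ->
  2 `^ r * (a `^ r * p) <= t `^ r.
Proof.
move=> r1 a0 p0 ht; have r0 : 0 <= r by lra.
apply: (@le_trans _ _ ((2 * a * (p + 1)) `^ r)); last by apply: le_powR => //; rewrite !mulr_ge0 ?addr_ge0.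
rewrite !powRM ?mulr_ge0 ?addr_ge0// [leLHS]mulrA; apply: ler_wpM2l; first by rewrite mulr_ge0 ?powR_ge0.
have : p + 1 <= (p + 1) `^ r by apply: powR_ge_self => //; lra.
by move: (_ `^ _) => u; lra.
Qed.

Lemma powR_gradient_le (r K m t : R) : 1 <= r -> 0 <= K -> 0 <= m -> 4 * (2 * K + 1) * m <= t ->
  2 `^ r * (K * (2 `^ r * 2 * m `^ r)) <= t `^ r.
Proof.
move=> r1 K0 m0 ht; have r0 : 0 <= r by lra.
have K1 : 0 <= 2 * K + 1 by lra.
apply: (@le_trans _ _ ((4 * (2 * K + 1) * m) `^ r)); last by apply: le_powR => //; rewrite !mulr_ge0.
have -> : 4 * (2 * K + 1) * m = 2 * (2 * ((2 * K + 1) * m)) by ring.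
rewrite !powRM ?mulr_ge0//; apply: ler_wpM2l; first exact: powR_ge0.
have -> : K * (2 `^ r * 2 * m `^ r) = 2 `^ r * (2 * K * m `^ r) by ring.
apply: ler_wpM2l; first exact: powR_ge0.
apply: ler_wpM2r; first exact: powR_ge0.
have : 2 * K + 1 <= (2 * K + 1) `^ r by apply: powR_ge_self => //; lra.
by move: (_ `^ _) => u; lra.
Qed.

Lemma Lpint_Lpnorm r f : 0 < r -> (Lpint r f < +oo)%E -> Lpint r f = (Lpnorm r f `^ r)%:E.
Proof.
move=> r0 hr; have hf : Lpint r f \is a fin_num by rewrite ge0_fin_numE ?Lpint_ge0.
have f0 : 0 <= fine (Lpint r f) by apply: fine_ge0; exact: Lpint_ge0.
by rewrite /Lpnorm -/(Lpint r f) -powRrM mulVf ?gt_eqF// powRr1// fineK.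
Qed.

Lemma Lpnorm2_le_Lpnorm (q : R) f : 2 < q -> measurable_fun Pi f -> (Lpint 2 f < +oo)%E -> (Lpint q f < +oo)%E ->
  Lpnorm 2 f <= (P + 1) * Lpnorm q f.
Proof.
move=> q2 mf f2 fq; have q0 : 0 < q by lra.
have P0 : 0 < P + 1 by rewrite ltr_wpDl ?sqr_ge0.
(* The slack [e] keeps the level [s] positive even when the L^q norm is zero. *)
apply/ler_addgt0Pr => e e0; pose s := Lpnorm q f + e / (P + 1).
have s0 : 0 < s by rewrite ltr_wpDl ?powR_ge0// divr_gt0.
have hs : (Lpint q f <= (s `^ q)%:E)%E.
  rewrite Lpint_Lpnorm// lee_fin; apply: le_powR; [exact: ltW|exact: powR_ge0|].
  by rewrite lerDl divr_ge0 ?ltW.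
have := Lpint2_le_Lpintq q2 mf s0 hs; rewrite Lpint_Lpnorm// lee_fin.
have -> : (P + 1) * Lpnorm q f + e = (P + 1) * s.
  by rewrite /s [RHS]mulrDr [X in _ = _ + X]mulrCA mulfV ?mulr1// gt_eqF.
have P1 : 1 <= P + 1 by rewrite lerDr sqr_ge0.
have n0 : 0 <= Lpnorm 2 f by exact: powR_ge0.
rewrite powR_mulrn//; clear hs; clearbody s; move: (Lpnorm 2 f) n0 (P + 1) P1 => n n0 p p1 h.
have p0 : 0 <= p by lra.
have ps0 : 0 <= p * s by apply: mulr_ge0 => //; exact: ltW.
rewrite -(@ler_pXn2r _ 2)//.
apply: (le_trans h); rewrite exprMn; apply: ler_wpM2r; first exact: sqr_ge0.
by rewrite expr2 -[leLHS]mulr1 ler_wpM2l.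
Qed.

(** Each term of the decomposition of the data is solved separately. The sup and gradient bounds
    inherit its geometric decay, so the fields and their derivatives can be summed, and the
    divergences add up to [h] almost everywhere. *)
Lemma assemble_series (q : R) h (n2 nq K : R) : 2 < q -> 0 <= n2 -> 0 <= nq -> 0 < K ->
  measurable_fun setT h -> (\int[leb2]_(x in Pi) (h x)%:E = 0)%E ->
  Lpint 2 h = (n2 `^ 2)%:E -> Lpint q h = (nq `^ q)%:E ->
  (forall L, 0 \notin map snd L -> exists F : bool -> tpoly R,
    [/\ forall x, tev (tder false (F false)) x + tev (tder true (F true)) x = tev L x,
        forall b x, `|tev (F b) x| <= K * Num.sqrt (Lp 2 (tev L)),
        forall b c, Lp 2 (tev (tder c (F b))) <= K * Lp 2 (tev L) &
        forall b c, Lp q (tev (tder c (F b))) <= K * Lp q (tev L)]) ->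
  exists (F : bool -> R * R -> R) (G : bool -> bool -> R * R -> R),
  [/\ forall b, periodic2 (F b) /\ measurable_fun setT (F b),
      forall b c, measurable_fun setT (G b c) /\ weak_deriv c (F b) (G b c),
      {ae leb2, forall x, Pi x -> G false false x + G true true x = h x},
      forall b, {ae leb2, forall x, Pi x -> `|F b x| <= 6 * K * n2} &
      (forall r b, 1 <= r -> (Lpint r (F b) <= (2 `^ r * ((3 * K * n2) `^ r * P))%:E)%E) /\
      (forall b c, (Lpint 2 (G b c) <= (2 `^ 2 * (K * (2 `^ 2 * 2 * n2 `^ 2)))%:E)%E /\
         (Lpint q (G b c) <= (2 `^ q * (K * (2 `^ q * 2 * nq `^ q)))%:E)%E)].
Proof.
move=> q2 n20 nq0 K0 mh h0 e2 eq hK; have q1 : 1 <= q by lra.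
have [L [Lk L2 Lq hL]] := trig_series q2 mh h0 e2 eq.
have [F hF] := choice (fun n => hK (L n) (Lk n)).
(* The n-th term has square norm at most 16^-n * 8 n2^2, and 8 <= 3^2; summing 4^-n <= 2 then gives
   6 K n2. *)
pose a := 3 * K * n2; have a0 : 0 <= a by apply: mulr_ge0 => //; apply: mulr_ge0 => //; exact: ltW.
have p4 n : 0 <= (4^-1 : R) ^+ n by rewrite exprn_ge0.
have sF b n x : `|tev (F n b) x| <= 4^-1 ^+ n * a.
  have [_ hs _ _] := hF n; apply: le_trans (hs b x) _.
  have -> : 4^-1 ^+ n * a = K * (4^-1 ^+ n * (3 * n2)) by rewrite /a; ring.
  apply: ler_wpM2l; first exact: ltW.
  have t0 : 0 <= 4^-1 ^+ n * (3 * n2) by rewrite !mulr_ge0.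
  rewrite -(ger0_norm t0) -sqrtr_sqr; apply: ler_wsqrtr; apply: le_trans (L2 n) _.
  rewrite !powR_mulrn//; move: (4^-1 ^+ n) (n2) => u v; have := sqr_ge0 (u * v); nra.
have bF b n : bmeas (tev (F n b)) := tev_bmeas (F n b).
have bG b c n : bmeas (tev (tder c (F n b))) := tev_bmeas (tder c (F n b)).
have hLF r b n : 1 <= r -> Lp r (tev (F n b)) <= (4^-1 ^+ n) `^ r * (a `^ r * P).
  move=> r1; have r0 : 0 <= r by lra.
  by apply: le_trans (Lp_bound r0 (bF b n) (sF b n)) _; rewrite powRM// mulrA.
have hG2 b c n : Lp 2 (tev (tder c (F n b))) <= (4^-1 ^+ n) `^ 2 * (K * (2 `^ 2 * 2 * n2 `^ 2)).
  have [_ _ hd _] := hF n; apply: le_trans (hd b c) _; rewrite [leRHS]mulrCA.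
  by apply: ler_wpM2l; [exact: ltW|exact: L2].
have hGq b c n : Lp q (tev (tder c (F n b))) <= (4^-1 ^+ n) `^ q * (K * (2 `^ q * 2 * nq `^ q)).
  have [_ _ _ hd] := hF n; apply: le_trans (hd b c) _; rewrite [leRHS]mulrCA.
  by apply: ler_wpM2l; [exact: ltW|exact: Lq].
have hF2 b n := hLF 2 b n (ler1n R 2).
exists (fun b => series_limit (fun n => tev (F n b))).
exists (fun b c => series_limit (fun n => tev (tder c (F n b)))).
split.
- move=> b; split; last exact: series_limit_measurable.
  by apply: series_limit_periodic => n; exact: tev_periodic.
- move=> b c; split; first exact: series_limit_measurable.
  exact: (weak_deriv_series (hF2 b) (hG2 b c)).
- have c1 := series_limit_cvg (bG false false) (hG2 false false).
  have c2 := series_limit_cvg (bG true true) (hG2 true true).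
  apply: ae_leb2S (ae_leb2I (ae_leb2I c1 c2) hL) => x [[h1 h2] h3] px.
  have hD : \sum_(0 <= i < n) tev (tder false (F i false)) x + \sum_(0 <= i < n) tev (tder true (F i true)) x @[n --> \oo]
      --> series_limit (fun n => tev (tder false (F n false))) x + series_limit (fun n => tev (tder true (F n true))) x.
    by apply: cvgD; [exact: h1|exact: h2].
  have := h3 px.
  rewrite (_ : (fun n => _) = (fun n => \sum_(0 <= i < n) tev (tder false (F i false)) x + \sum_(0 <= i < n) tev (tder true (F i true)) x)).
    by move=> hh; exact: cvg_unique hD hh.
  by apply/funext => n; rewrite -big_split; apply: eq_bigr => i _; have [<-] := hF i.
- move=> b; have := series_limit_bound (bF b) (hF2 b) a0 (sF b).
  apply: ae_leb2S => x hx px; rewrite (_ : 6 * K * n2 = 2 * a); first exact: hx.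
  by rewrite /a; ring.
split.
- by move=> r b r1; apply: (series_limit_Lpint (bF b) (hF2 b) r1) => n; exact: hLF.
- move=> b c; split.
    by apply: (series_limit_Lpint (bG b c) (hG2 b c)); [exact: ler1n|exact: hG2].
  by apply: (series_limit_Lpint (bG b c) (hG2 b c)); [exact: q1|exact: hGq].
Qed.

End Assembly.

Theorem theorem2p1 (R : realType) (q : R) (hq : 2 < q) :
  exists C : R, 0 < C /\
  forall f : R * R -> R,
    periodic2 f -> inLp 2 f -> inLp q f ->
    (\int[@leb2 R]_(x in @Pi R) (f x)%:E = 0)%E ->
    exists F1 F2 G11 G12 G21 G22 : R * R -> R,
      (* F = (F1, F2) is a function on the torus, with weak Jacobian
         G i j = d_j F_i *)
      periodic2 F1 /\ periodic2 F2 /\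
      weak_deriv false F1 G11 /\ weak_deriv true F1 G12 /\
      weak_deriv false F2 G21 /\ weak_deriv true F2 G22 /\
      (* F in H^1 and W^{1,q} *)
      (inLp 2 F1 /\ inLp q F1) /\ (inLp 2 F2 /\ inLp q F2) /\
      (inLp 2 G11 /\ inLp q G11) /\ (inLp 2 G12 /\ inLp q G12) /\
      (inLp 2 G21 /\ inLp q G21) /\ (inLp 2 G22 /\ inLp q G22) /\
      (* (1) div F = f *)
      {ae @leb2 R, forall x, @Pi R x -> G11 x + G22 x = f x} /\
      (* (2) F in L^oo and ||F||_oo <= C ||f||_2 *)
      {ae @leb2 R, forall x, @Pi R x -> vnorm F1 F2 x <= C * Lpnorm 2 f} /\
      (* (3) ||F||_{H^1} <= C ||f||_2 *)
      W1pnorm 2 F1 F2 G11 G12 G21 G22 <= C * Lpnorm 2 f /\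
      (* (4) ||F||_{W^{1,q}} <= C ||f||_q *)
      W1pnorm q F1 F2 G11 G12 G21 G22 <= C * Lpnorm q f.
Proof.
have [Kq Kq0 hKq] := riesz2_bound_real hq.
have [K K0 hK] := trig_solution hq Kq0 hKq.
have P0 : 0 <= (2 * pi) ^+ 2 :> R by exact: sqr_ge0.
have [p pE] : exists p, (2 * pi) ^+ 2 = p :> R by eexists.
rewrite pE in P0.
have q1 : 1 <= q by lra.
have q0 : 0 < q by lra.
(* [D1] serves the field and [D2] its gradient. The field is bounded by the L^2 norm even in the
   W^(1,q) estimate, and the extra factor p + 1 in [D] converts that norm into the L^q norm. *)
pose D1 := 6 * K * (p + 1); pose D2 := 4 * (2 * K + 1); pose D := D1 * (p + 1) + D2.
have D10 : 0 <= D1.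
  by apply: mulr_ge0; [apply: mulr_ge0 => //; exact: ltW|lra].
have D11 : D1 <= D1 * (p + 1) by rewrite -[leLHS]mulr1 ler_wpM2l//; lra.
have D20 : 0 <= D2 by rewrite /D2; lra.
have D1D : D1 * (p + 1) <= D by rewrite lerDl.
have D2D : D2 <= D by rewrite lerDr; lra.
have D0 : 0 <= D by lra.
(* 12 K = 6 K + 6 K covers the sup norm of the two components, and 24 D the Sobolev norms. *)
pose C := 12 * K + 24 * D.
have CK : 6 * K + 6 * K <= C by rewrite /C; lra.
have CD : 24 * D <= C by rewrite /C; lra.
exists C; split; first by rewrite /C; lra.
clearbody C.
move=> f pf [mf f2] [_ fq] f0.
(* [f] is measurable on the fundamental domain only; its extension by zero is measurable on the
   whole plane and has the same integrals. *)
pose h := f \_ @Pi R.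
have hf x : @Pi R x -> h x = f x by move=> px; rewrite /h patchE mem_set.
have mh : measurable_fun setT h by apply/(measurable_restrictT f (@measurable_Pi R)).
have h0 : (\int[@leb2 R]_(x in @Pi R) (h x)%:E = 0)%E.
  by rewrite -f0; apply: eq_integral => x; rewrite inE => /hf ->.
have hN r : Lpint r h = Lpint r f by apply: eq_integral => x; rewrite inE => /hf ->.
pose n2 := Lpnorm 2 f; pose nq := Lpnorm q f.
have n20 : 0 <= n2 by exact: powR_ge0.
have nq0 : 0 <= nq by exact: powR_ge0.
have e2 : Lpint 2 h = (n2 `^ 2)%:E := etrans (hN 2) (Lpint_Lpnorm (ltr0n R 2) f2).
have eq : Lpint q h = (nq `^ q)%:E := etrans (hN q) (Lpint_Lpnorm q0 fq).
have n2q : n2 <= (p + 1) * nq by rewrite -pE; exact (Lpnorm2_le_Lpnorm hq mf f2 fq).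
rewrite -/n2 -/nq; clearbody n2 nq; clear f2 fq hN f0.
have [F [G [hF hG hdiv hsup [nF nG]]]] := assemble_series hq n20 nq0 K0 mh h0 e2 eq hK.
rewrite pE in nF.
have a0 : 0 <= 3 * K * n2 by apply: mulr_ge0 => //; apply: mulr_ge0 => //; exact: ltW.
have F2 b : (Lpint 2 (F b) <= ((D * n2) `^ 2)%:E)%E.
  apply: le_trans (nF 2 b (ler1n R 2)) _; rewrite lee_fin; apply: powR_field_le => //; first exact: ler1n.
  have -> : 2 * (3 * K * n2) * (p + 1) = D1 * n2 by rewrite /D1; ring.
  by apply: ler_wpM2r => //; exact: le_trans D1D.
have Fq b : (Lpint q (F b) <= ((D * nq) `^ q)%:E)%E.
  apply: le_trans (nF q b q1) _; rewrite lee_fin; apply: powR_field_le => //.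
  have -> : 2 * (3 * K * n2) * (p + 1) = D1 * n2 by rewrite /D1; ring.
  apply: (@le_trans _ _ (D1 * (p + 1) * nq)); last by apply: ler_wpM2r.
  by rewrite -mulrA; apply: ler_wpM2l.
have G2 b c : (Lpint 2 (G b c) <= ((D * n2) `^ 2)%:E)%E.
  have [h2 _] := nG b c; apply: le_trans h2 _; rewrite lee_fin; apply: powR_gradient_le => //; [exact: ler1n|exact: ltW|].
  by apply: ler_wpM2r.
have Gq b c : (Lpint q (G b c) <= ((D * nq) `^ q)%:E)%E.
  have [_ h2] := nG b c; apply: le_trans h2 _; rewrite lee_fin; apply: powR_gradient_le => //; first exact: ltW.
  by apply: ler_wpM2r.
have mF b : measurable_fun (@Pi R) (F b) by apply: measurable_funTS; have [] := hF b.
have mG b c : measurable_fun (@Pi R) (G b c) by apply: measurable_funTS; have [] := hG b c.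
have inF b : inLp 2 (F b) /\ inLp q (F b).
  split; (split; first exact: mF); [apply: le_lt_trans (F2 b) _|apply: le_lt_trans (Fq b) _]; exact: ltry.
have inG b c : inLp 2 (G b c) /\ inLp q (G b c).
  split; (split; first exact: mG); [apply: le_lt_trans (G2 b c) _|apply: le_lt_trans (Gq b c) _]; exact: ltry.
have W2 : W1pnorm 2 (F false) (F true) (G false false) (G false true) (G true false) (G true true) <= 24 * (D * n2).
  apply: W1pnorm_le; [exact: ler1n|exact: mulr_ge0|].
  move=> X /= [<-|[<-|[<-|[<-|[<-|[<-|[]]]]]]].
  - exact (conj (mF _) (F2 _)).
  - exact (conj (mF _) (F2 _)).
  - exact (conj (mG _ _) (G2 _ _)).
  - exact (conj (mG _ _) (G2 _ _)).
  - exact (conj (mG _ _) (G2 _ _)).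
  - exact (conj (mG _ _) (G2 _ _)).
have Wq : W1pnorm q (F false) (F true) (G false false) (G false true) (G true false) (G true true) <= 24 * (D * nq).
  apply: W1pnorm_le; [exact: q1|exact: mulr_ge0|].
  move=> X /= [<-|[<-|[<-|[<-|[<-|[<-|[]]]]]]].
  - exact (conj (mF _) (Fq _)).
  - exact (conj (mF _) (Fq _)).
  - exact (conj (mG _ _) (Gq _ _)).
  - exact (conj (mG _ _) (Gq _ _)).
  - exact (conj (mG _ _) (Gq _ _)).
  - exact (conj (mG _ _) (Gq _ _)).
have ws b c := (hG b c).2.
exists (F false), (F true), (G false false), (G false true), (G true false), (G true true).
do 2 (split; first exact: (hF _).1).
do 4 (split; first exact: ws).
do 2 (split; first exact: inF).
do 4 (split; first exact: inG).
split; first by apply: ae_leb2S hdiv => x hx px; rewrite hx// hf.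
split.
  apply: ae_leb2S (ae_leb2I (hsup false) (hsup true)) => x [h1 h2] px.
  apply: le_trans (sqrt_le_norm2 _ _) _; apply: le_trans (lerD (h1 px) (h2 px)) _.
  by rewrite -mulrDl; apply: ler_wpM2r.
split.
- by apply: le_trans W2 _; rewrite mulrA; apply: ler_wpM2r.
- by apply: le_trans Wq _; rewrite mulrA; apply: ler_wpM2r.
Qed.
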